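(* For every $n \ge 1$, every $n$-component link has a diagram with exactly two odd-sided faces. Moreover, each of the two odd-sided faces can be specified to be a $1$-gon or a $3$-gon.
   Context: Links are tame. Link diagrams are regular planar diagrams with finitely many crossings, all of them transverse double points. The faces of a diagram are the complementary regions of its underlying curves in the plane (including the unbounded one), and the number of sides of a face is the number of edges on its boundary, where edges are the segments of the underlying curves between consecutive crossings. A face is odd-sided if its number of sides is odd, and it is an $m$-gon if it has $m$ sides. *)

(* Defs.v *)
From HB Require Import structures.
From mathcomp Require Import all_boot all_order all_algebra.
From mathcomp Require Import all_classical all_reals all_analysis.
Set Implicit Arguments.
Unset Strict Implicit.
Unset Printing Implicit Defensive.
Import Order.TTheory GRing.Theory Num.Theory.
Import numFieldNormedType.Exports.
Local Open Scope classical_set_scope.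
Local Open Scope ring_scope.

(* The projection of space along which diagrams are taken is [fst]; the last
   coordinate is the height. *)
Definition plane (R : realType) : normedModType R := (R * R)%type.
Definition space3 (R : realType) : normedModType R := (plane R * R)%type.

(* A family of [n] closed curves is given by 1-periodic maps
   [c : 'I_n -> R -> T], so that the disjoint union of [n] circles is
   represented by the pairs (i, s) with 0 <= s < 1. *)
Definition circles (R : realType) (n : nat) : set ('I_n * R) :=
  [set x | 0 <= x.2 < 1].

Definition closed_curves (R : realType) (T : topologicalType) (n : nat)
    (c : 'I_n -> R -> T) : Prop :=
  forall i, continuous (c i) /\ forall s, c i (s + 1) = c i s.

Definition trace (R : realType) (T : Type) (n : nat)
    (c : 'I_n -> R -> T) : set T :=
  [set p | exists i s, c i s = p].

(* The number [m] of pieces is the same for all pieces to have the same length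
   in the parameter; vertices may be repeated or have a flat angle. *)
Definition polygonal (R : realType) (V : lmodType R) (f : R -> V) : Prop :=
  exists2 m : nat, (0 < m)%N & forall (k : nat) (t : R), 0 <= t <= 1 ->
    f ((k%:R + t) / m%:R) =
      (1 - t) *: f (k%:R / m%:R) + t *: f (k.+1%:R / m%:R).

(* [x] and [y] are two distinct points of the circles with the same image. *)
Definition double_pair (R : realType) (T : Type) (n : nat)
    (c : 'I_n -> R -> T) (x y : 'I_n * R) : Prop :=
  [/\ circles x, circles y, x <> y & c x.1 x.2 = c y.1 y.2].

(* The circles being compact, a continuous injective parametrization is an
   embedding. *)
Definition link_parametrization (R : realType) (n : nat)
    (g : 'I_n -> R -> space3 R) : Prop :=
  closed_curves g /\ forall x y, ~ double_pair g x y.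

Definition homeomorphism (T : topologicalType) (f : T -> T) : Prop :=
  continuous f /\
  exists g : T -> T, [/\ continuous g, cancel f g & cancel g f].

Definition ambient_isotopic (R : realType) (L L' : set (space3 R)) : Prop :=
  exists H : R * space3 R -> space3 R,
    [/\ {within [set p | 0 <= p.1 <= 1], continuous H},
        forall t, 0 <= t <= 1 -> homeomorphism (fun x => H (t, x)),
        forall x, H (0, x) = x
      & [set H (1, x) | x in L] = L'].

Definition is_link (R : realType) (n : nat) (L : set (space3 R)) : Prop :=
  exists2 g : 'I_n -> R -> space3 R, link_parametrization g & L = trace g.

Definition tame (R : realType) (L : set (space3 R)) : Prop :=
  exists (n : nat) (g : 'I_n -> R -> space3 R),
    [/\ link_parametrization g, forall i, polygonal (g i)
      & ambient_isotopic (trace g) L].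

Definition transverse (R : realType) (n : nat) (c : 'I_n -> R -> plane R)
    (x y : 'I_n * R) : Prop :=
  exists u v : plane R,
    [/\ is_derive (x.2 : R) (1 : R) (c x.1) u,
        is_derive (y.2 : R) (1 : R) (c y.1) v
      & u.1 * v.2 - u.2 * v.1 != 0].

Definition crossing (R : realType) (n : nat) (c : 'I_n -> R -> plane R) :
    set (plane R) :=
  [set p | exists x y, double_pair c x y /\ c x.1 x.2 = p].

(* [upper] is only meaningful on the two preimages in [circles] of a crossing:
   it tells which one lies on the overpassing strand. *)
Record link_diagram (R : realType) (n : nat) := LinkDiagram {
  curves : 'I_n -> R -> plane R;
  upper : 'I_n * R -> bool;
  curves_closed : closed_curves curves;
  curves_polygonal : forall i, polygonal (curves i);
  crossings_finite : finite_set (crossing curves);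
  crossings_double : forall x y z,
    double_pair curves x y -> double_pair curves x z -> y = z;
  crossings_transverse : forall x y,
    double_pair curves x y -> transverse curves x y;
  upper_crossing : forall x y, double_pair curves x y -> upper x = ~~ upper y
}.

(* Lifting the curves by heights compatible with the crossing information
   gives a link, and [D] is a diagram of [L] when it is isotopic to [L]. *)
Definition diagram_of (R : realType) (n : nat) (D : link_diagram R n)
    (L : set (space3 R)) : Prop :=
  exists h : 'I_n -> R -> R,
    [/\ closed_curves h,
        forall x y, double_pair (curves D) x y -> upper D x ->
          h y.1 y.2 < h x.1 x.2
      & ambient_isotopic (trace (fun i s => (curves D i s, h i s))) L].

Definition face (R : realType) (n : nat) (D : link_diagram R n)
    (F : set (plane R)) : Prop :=
  exists2 p, ~ trace (curves D) p &
    F = connected_component (~` trace (curves D)) p.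

(* Edges are closed segments of the curves; a closed curve without crossings
   contains no edge. *)
Definition edge (R : realType) (n : nat) (D : link_diagram R n)
    (e : set (plane R)) : Prop :=
  exists (i : 'I_n) (a b : R),
    [/\ a < b,
        crossing (curves D) (curves D i a) /\
        crossing (curves D) (curves D i b),
        forall t, a < t < b -> ~ crossing (curves D) (curves D i t)
      & e = curves D i @` [set t | a <= t <= b]].

Definition boundary (T : topologicalType) (A : set T) : set T :=
  closure A `\` interior A.

(* No edge has the same face on both sides, as it is part of a closed curve
   of the diagram meeting the others transversally; so each edge on the
   boundary of a face counts once. *)
Definition sides (R : realType) (n : nat) (D : link_diagram R n)
    (F : set (plane R)) : set (set (plane R)) :=
  [set e | edge D e /\ e `<=` boundary F].

Definition gon (R : realType) (n : nat) (D : link_diagram R n) (m : nat)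
    (F : set (plane R)) : Prop :=
  face D F /\ (sides D F #= `I_m)%card.

Definition odd_sided_faces (R : realType) (n : nat) (D : link_diagram R n) :
    set (set (plane R)) :=
  [set F | exists2 m : nat, odd m & gon D m F].

(* Main.v *)
(* Take a polygon representing the link, whose projection to the coordinates
   (x, y) of the points ((x, z), y) has only double points, no two crossings or
   vertices having the same y. Call tokens a short edge around each overcrossing,
   and one more edge of each component. As the link passes over itself only on
   tokens, the heights z can be replaced by heights which decrease along the
   link, except on the tokens, which go above everything. Then project to (x, z)
   instead: each edge becomes horizontal and each vertex becomes a vertical
   segment.

   A face of such a rectilinear diagram has as many sides as it contains
   quadrants of crossings. Adding up along the rows, the parity of this number
   becomes a sum over the vertical segments, in which those without crossings
   contribute nothing. As successive edges have successive heights, only the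
   vertical segments next to tokens have crossings. Near both ends of every
   token, slide a vertex to the far right and an edge to the bottom, in nested
   positions: the contributions of these bends cancel in turn. Winding the first
   and the last bend once more adds two contributions, hence two odd-sided faces;
   these are rectangles with one or three crossings at their corners, according
   to the relative position of two parallel segments. *)

Require Import Defs.
From HB Require Import structures.
From mathcomp Require Import all_boot all_order all_algebra.
From mathcomp Require Import all_classical all_reals all_analysis.
From mathcomp Require Import ring lra zify.
Set Implicit Arguments.
Unset Strict Implicit.
Unset Printing Implicit Defensive.
Import Order.TTheory GRing.Theory Num.Theory.
Import numFieldNormedType.Exports.
Local Open Scope classical_set_scope.
Local Open Scope ring_scope.

(** The obstacle is that nothing is known about the projection far from the tokens, and the parity
    has to be computed nevertheless. Two facts make this possible. A block, that is the part of the
    link between two tokens, has crossed columns only among the seven first and the seven last ones.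
    And a shear of x by a piecewise linear function of y alone can put all these columns in the
    order of their numbers, whatever the projection was. So the rows joining neighbours among them
    are free, and the inner face of each bend is the outer face of the next one, which is what makes
    the contributions cancel. Fourteen edges per block keep the two ends of a block apart; the
    additional turns need no more than five positions.

    Every isotopy, apart from shears, is a straight-line motion of a polygon that stays embedded. It
    is cut into small steps; in a small step the displacement is a contraction along the polygon,
    extends to a contraction of space, and identity plus contraction is a homeomorphism.

    The two faces at an edge are told apart by the parity of the number of intersections of a ray
    with the diagram. *)

(** * Ambient isotopies *)

(* An alias of the product, on which completeness can be declared. *)
Definition cprod (K : numFieldType) (U V : completeNormedModType K) := (U * V)%type.

Section cprod.
Variables (K : numFieldType) (U V : completeNormedModType K).
HB.instance Definition _ := NormedModule.on (cprod U V).
HB.instance Definition _ := Pointed.on (cprod U V).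

Lemma cprod_complete (F : set_system (cprod U V)) :
  ProperFilter F -> cauchy F -> cvg F.
Proof.
move=> FF Fc.
have c1 : cauchy (fst @ F).
  move=> A entA; have [|[P Q]/= [FP FQ] PQ] := Fc [set p | A (p.1.1, p.2.1)].
    exists (A, setT); first by split => //=; exact: filterT.
    by move=> [[a b] [c d]] /= [Aab _]; exists ((a, c), (b, d)).
  exists (fst @` P, fst @` Q) => /=.
    by split; [apply: filterS FP => x Px /=; exists x | apply: filterS FQ => x Px /=; exists x].
  by move=> [_ _] [/= [x Px <-] [y Qy <-]]; exact: (PQ (x, y) (conj Px Qy)).
have c2 : cauchy (snd @ F).
  move=> A entA; have [|[P Q]/= [FP FQ] PQ] := Fc [set p | A (p.1.2, p.2.2)].
    exists (setT, A); first by split => //=; exact: filterT.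
    by move=> [[a b] [c d]] /= [_ Acd]; exists ((a, c), (b, d)).
  exists (snd @` P, snd @` Q) => /=.
    by split; [apply: filterS FP => x Px /=; exists x | apply: filterS FQ => x Px /=; exists x].
  by move=> [_ _] [/= [x Px <-] [y Qy <-]]; exact: (PQ (x, y) (conj Px Qy)).
have /cauchy_cvg/cvg_ex[a Fa] := c1; have /cauchy_cvg/cvg_ex[b Fb] := c2.
apply/cvg_ex; exists (a, b) => /= A [[P Q] /= [Pa Qb] PQA].
have FP := Fa _ Pa; have FQ := Fb _ Qb.
apply: (@filterS _ F _ _ _ _ (@filterI _ F _ _ _ FP FQ)) => -[x y] [/= Px Qy]; exact: PQA.
Qed.

HB.instance Definition _ := Uniform_isComplete.Build (cprod U V) cprod_complete.
End cprod.

Lemma continuous_pair (T U V : topologicalType) (f : T -> U) (g : T -> V) :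
  continuous f -> continuous g -> continuous (fun x => (f x, g x)).
Proof. by move=> fc gc x; exact: (cvg_pair (fc x) (gc x)). Qed.

Lemma continuous_compT (T U V : topologicalType) (f : T -> U) (g : U -> V) :
  continuous f -> continuous g -> continuous (fun x => g (f x)).
Proof. by move=> fc gc x; apply: cvg_comp (fc x) (gc _). Qed.

Lemma fst_continuous (T U : topologicalType) : continuous (@fst T U).
Proof. by move=> x; exact: cvg_fst. Qed.

Lemma snd_continuous (T U : topologicalType) : continuous (@snd T U).
Proof. by move=> x; exact: cvg_snd. Qed.

(** Connectedness of a segment in the form of an induction along it. It serves for isotopy types,
    for the faces along an edge, and for components of links. *)
Lemma segment_constant (R : realType) (a b : R) (P : R -> Prop) : a <= b ->
  (forall r, a <= r <= b -> exists2 e, 0 < e & forall r', a <= r' <= b -> `|r - r'| < e ->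
    P r <-> P r') ->
  P a -> P b.
Proof.
move=> ab loc Pa.
have /choice[e He] r : exists e : R, 0 < e /\ (a <= r <= b -> forall r', a <= r' <= b ->
    `|r - r'| < e -> P r <-> P r').
  have [hr|nr] := pselect (a <= r <= b); last by exists 1.
  by have [e e0 He] := loc r hr; exists e.
pose A := [set r : R | a <= r <= b /\ P r].
have oB (Q : set R) : open (\bigcup_(r in Q) ball r (e r)).
  by apply: bigcup_open => r _; apply: ball_open; case: (He r).
suff AE : A = `[a, b]%classic.
  have : A b by rewrite AE /= in_itv /= lexx ab.
  by case.
apply: segment_connected.
- by exists a; split => //; rewrite lexx.
- exists (\bigcup_(r in A) ball r (e r)); first exact: oB.
  apply/seteqP; split => r /=.
    move=> Ar; split; first by rewrite in_itv; case: Ar.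
    by exists r => //; apply: ballxx; case: (He r).
  rewrite in_itv /= => -[hr [u [hu uA] ur]]; split => //.
  by apply/((He u).2 hu r hr ur).
(* Closedness: a point where [P] fails has a ball on which it fails, so these balls together avoid
   [A]. *)
- exists (~` (\bigcup_(r in `[a, b]%classic `\` A) ball r (e r))).
    by apply: open_closedC; exact: oB.
  apply/seteqP; split => r /=.
    move=> Ar; split; first by rewrite in_itv; case: Ar.
    move=> [u [/= hu nA] ur]; apply: nA; rewrite in_itv /= in hu; split => //.
    by case: Ar => hr Pr; apply/((He u).2 hu r hr ur).
  rewrite in_itv /= => -[hr nr]; apply: contrapT => nA; apply: nr; exists r.
    by split => //=; rewrite in_itv.
  by apply: ballxx; case: (He r).
Qed.

Section isotopy.
Variable R : realType.
Local Notation sp := (space3 R).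

Lemma prod_norm_le (x y : R) (z : R) (e : R) :
  (`|((x, y), z) : sp| <= e) = [&& `|x| <= e, `|y| <= e & `|z| <= e].
Proof. by rewrite !prod_normE /= !ge_max andbA. Qed.

Lemma clamp_continuous : continuous (fun t : R => Num.max 0 (Num.min t 1)).
Proof.
move=> t; apply/cvgrPdist_le => e e0; near=> y.
have : `|t - y| <= e by near: y; exact: cvgr_dist_le.
apply: le_trans; rewrite /Num.max /Num.min.
have h10 : (0 < 1 :> R) by [].
by case: (ltP t 1) => ?; case: (ltP y 1) => ?; rewrite ?h10; try (case: (ltP 0 t) => ?); try (case: (ltP 0 y) => ?); rewrite ler_norml; apply/andP; have := ler_norm (t - y); have := ler_norm (y - t); rewrite [`|y - t|]distrC; split; lra.
Unshelve. all: by end_near. Qed.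

(** Clamping the time to [0, 1] extends an isotopy to all times; composing and reversing then take
    place in plain, not subspace, topology. *)
Lemma ambient_isotopicP (L L' : set sp) :
  ambient_isotopic L L' <->
  exists H : R * sp -> sp, [/\ continuous H,
    forall t, homeomorphism (fun x => H (t, x)),
    forall x, H (0, x) = x & [set H (1, x) | x in L] = L'].
Proof.
split=> [[H [Hc Hh H0 H1]]|[H [Hc Hh H0 H1]]]; last first.
  by exists H; split => //; exact: continuous_subspaceT.
pose c : R -> R := fun t => Num.max 0 (Num.min t 1).
have cP t : 0 <= c t <= 1.
  by rewrite /c le_max lexx /= ge_max ler01 ge_min lexx orbT.
exists (fun p => H (c p.1, p.2)); split => [|t|x|].
- move=> p; move/subspace_continuousP : Hc => Hc.
  move=> A /= /(Hc (c p.1, p.2) (cP _)) /= HA.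
  have : (fun q : R * sp => (c q.1, q.2)) @ p --> (c p.1, p.2).
    have cc : continuous (fun q : R * sp => c q.1).
      exact: (continuous_compT (@fst_continuous _ _) clamp_continuous).
    exact: (continuous_pair cc (@snd_continuous _ _)).
  move=> /(_ _ HA); apply: (@filterS _ (nbhs p)) => q /=; apply.
  exact: cP.
- exact: Hh (cP t).
- by rewrite /= /c min_l ?ler01// maxxx H0.
- by rewrite /= /c minxx max_r ?ler01.
Qed.

Lemma ambient_isotopic_refl (L : set sp) : ambient_isotopic L L.
Proof.
apply/ambient_isotopicP; exists snd; split => //.
- by move=> x; exact: cvg_snd.
- by move=> t; split=> [x|]; [exact: cvg_id | exists id; split => // x; exact: cvg_id].
- by rewrite /= image_id.
Qed.

Lemma ambient_isotopic_trans (L L' L'' : set sp) :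
  ambient_isotopic L L' -> ambient_isotopic L' L'' -> ambient_isotopic L L''.
Proof.
move=> /ambient_isotopicP[H [Hc Hh H0 H1]] /ambient_isotopicP[K [Kc Kh K0 K1]].
apply/ambient_isotopicP; exists (fun p => K (p.1, H p)); split.
- apply: (@continuous_compT _ _ _ (fun q : R * sp => (q.1, H q)) K _ Kc).
  exact: continuous_pair (@fst_continuous _ _) Hc.
- move=> t; have [hc [h' [h'c hK hK']]] := Hh t; have [kc [k' [k'c kK kK']]] := Kh t.
  split; first exact: (continuous_compT hc kc).
  exists (h' \o k'); split.
  + exact: continuous_compT k'c h'c.
  + by move=> x /=; rewrite kK hK.
  + by move=> x /=; rewrite hK' kK'.
- by move=> x /=; rewrite H0 K0.
- rewrite -K1 -H1; apply/seteqP; split => [_ [x Lx <-]|_ [_ [x Lx <-] <-]].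
    by exists (H (1, x)) => //; exists x.
  by exists x.
Qed.

Lemma ambient_isotopic_sym (L L' : set sp) :
  ambient_isotopic L L' -> ambient_isotopic L' L.
Proof.
move=> /ambient_isotopicP[H [Hc Hh H0 H1]].
have [kc [k [k'c kK kK']]] := Hh 1.
(* The motion is run backwards from its final position, hence the inverse [k] of the final
   homeomorphism. *)
apply/ambient_isotopicP; exists (fun p => H (1 - p.1, k p.2)); split.
- apply: (@continuous_compT _ _ _ (fun q : R * sp => (1 - q.1, k q.2)) H _ Hc).
  apply: continuous_pair; last exact: continuous_compT (@snd_continuous _ _) k'c.
  by move=> p; apply: cvgB; [exact: cvg_cst|exact: cvg_fst].
- move=> t; have [hc [h' [h'c hK hK']]] := Hh (1 - t); split.
    exact: continuous_compT k'c hc.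
  exists ((fun x => H (1, x)) \o h'); split.
  + exact: continuous_compT h'c kc.
  + by move=> x /=; rewrite hK kK'.
  + by move=> x /=; rewrite kK hK'.
- by move=> x /=; rewrite subr0 kK'.
- rewrite -H1; apply/seteqP; split => [_ [_ [x Lx <-] <-]|x Lx] /=.
    by rewrite subrr kK H0.
  by exists (H (1, x)); [exists x|rewrite subrr kK H0].
Qed.

Lemma lipschitz_continuous (k : R) (f : sp -> sp) :
  (forall x y, `|f x - f y| <= k * `|x - y|) -> continuous f.
Proof.
move=> fk x; apply/cvgrPdist_le => e e0.
near=> y; apply: (le_trans (fk x y)).
have k0 : 0 < `|k| + 1 by rewrite ltr_wpDl.
have : `|x - y| <= e / (`|k| + 1).
  by near: y; apply: cvgr_dist_le => //; apply: divr_gt0.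
rewrite ler_pdivlMr // => h; apply: le_trans h; rewrite mulrC ler_wpM2l //.
by rewrite (le_trans (ler_norm _)) // lerDl.
Unshelve. all: by end_near. Qed.

(** The displacement does not change along itself, so moving by [- t *: f x] undoes moving by
    [t *: f x]. *)
Lemma shear_isotopic (f : sp -> sp) (L : set sp) : continuous f ->
  (forall t x, f (x + t *: f x) = f x) ->
  ambient_isotopic L [set x + f x | x in L].
Proof.
move=> fc fE; apply/ambient_isotopicP; exists (fun p => p.2 + p.1 *: f p.2).
have ct t : continuous (fun x : sp => x + t *: f x).
  by move=> x; apply: cvgD; [exact: cvg_id|apply: cvgZr; exact: fc].
split.
- move=> p; apply: cvgD; first exact: cvg_snd.
  apply: cvgZ; first exact: cvg_fst.
  exact: (continuous_compT (@snd_continuous _ _) fc).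
- move=> t; split; first exact: ct.
  exists (fun x => x + (- t) *: f x); split; first exact: ct.
  + by move=> x /=; rewrite fE scaleNr addrK.
  + by move=> x /=; rewrite fE scaleNr subrK.
- by move=> x /=; rewrite scale0r addr0.
- by apply/seteqP; split => _ [x Lx <-]; exists x => //=; rewrite scale1r.
Qed.

(** The preimage of [y] is the fixed point of the contraction sending x to y - t f(x). Distances
    shrink at most by half, which makes the inverse 2-Lipschitz. *)
Lemma half_lipschitz_bij (f : sp -> sp) (t : R) : 0 <= t <= 1 ->
  (forall x y, `|f x - f y| <= 2^-1 * `|x - y|) ->
  homeomorphism (fun x => x + t *: f x).
Proof.
move=> /andP[t0 t1] fl.
have tl x y : `|t *: f x - t *: f y| <= 2^-1 * `|x - y|.
  rewrite -scalerBr normrZ ger0_norm //; apply: le_trans (fl _ _).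
  by rewrite ler_piMl.
have inv y : exists x, x + t *: f x = y.
  pose g := (fun x => y - t *: f x) : sp -> sp.
  have gs : set_fun setT setT g by [].
  pose X := cprod (cprod R R) R.
  pose m := isFun.Build X X setT setT g gs.
  pose G : {fun (setT : set X) >-> (setT : set X)} := HB.pack g m.
  have [||p _ gp] := @banach_fixed_point R X setT G _ closedT.
  - have h0 : 0 <= 2^-1 :> R by [].
    exists (NngNum h0); split => /=; first lra.
    move=> [a b] _ /=; rewrite /G /= /g /=.
    by rewrite opprB addrC addrA subrK [`|a - b|]distrC; exact: tl.
  - by exists 0.
  - have gp' : p = y - t *: f p by exact: gp.
    by exists p; apply/eqP; rewrite eq_sym -subr_eq -gp'.
pose h y := projT1 (cid (inv y)).
have hK y : h y + t *: f (h y) = y by rewrite /h; case: cid.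
have lo x y : `|x - y| <= 2 * `|(x + t *: f x) - (y + t *: f y)|.
  have -> : x + t *: f x - (y + t *: f y) = (x - y) - (t *: f y - t *: f x).
    by rewrite opprD opprB addrACA.
  have := lerB_dist (x - y) (t *: f y - t *: f x).
  have := tl y x; rewrite [`|y - x|]distrC; lra.
split.
  apply: (@lipschitz_continuous 2) => x y.
  rewrite (_ : _ - _ = (x - y) + (t *: f x - t *: f y)); last by rewrite opprD addrACA.
  have := ler_normD (x - y) (t *: f x - t *: f y); have := tl x y.
  have := normr_ge0 (x - y); lra.
exists h; split.
- by apply: (@lipschitz_continuous 2) => x y; have := lo (h x) (h y); rewrite !hK.
- move=> x; apply/eqP; rewrite -subr_eq0 -normr_le0.
  by have := lo (h (x + t *: f x)) x; rewrite hK subrr normr0 mulr0.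
- exact: hK.
Qed.

Lemma half_lipschitz_isotopic (f : sp -> sp) (L : set sp) :
  (forall x y, `|f x - f y| <= 2^-1 * `|x - y|) ->
  ambient_isotopic L [set x + f x | x in L].
Proof.
move=> fl; exists (fun p => p.2 + p.1 *: f p.2); split.
- apply: continuous_subspaceT.
  move=> p; apply: cvgD; first exact: cvg_snd.
  apply: cvgZ; first exact: cvg_fst.
  exact: (continuous_compT (@snd_continuous _ _) (lipschitz_continuous fl)).
- by move=> t t01; exact: half_lipschitz_bij.
- by move=> x /=; rewrite scale0r addr0.
- by apply/seteqP; split => _ [x Lx <-]; exists x => //=; rewrite scale1r.
Qed.

(** McShane extension: the infimum of the cones of slope [k] standing on the given values. *)
Lemma mcshane (I : Type) (p : I -> sp) (f : I -> R) (k : R) : 0 <= k ->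
  (forall i j, `|f i - f j| <= k * `|p i - p j|) ->
  exists F : sp -> R, (forall i, F (p i) = f i) /\
    forall x y, `|F x - F y| <= k * `|x - y|.
Proof.
move=> k0 fk; have [[i0]|nI] := pselect (inhabited I); last first.
  exists (fun _ => 0); split => [i|x y]; first by exfalso; apply: nI.
  by rewrite subrr normr0 mulr_ge0.
pose S x := [set f i + k * `|x - p i| | i in setT].
have Slb x : has_lbound (S x).
  exists (f i0 - k * `|x - p i0|) => _ [i _ <-].
  have := fk i0 i; rewrite ler_norml => /andP[_ h].
  have : k * `|p i0 - p i| <= k * (`|x - p i0| + `|x - p i|).
    rewrite ler_wpM2l // (_ : p i0 - p i = (x - p i) - (x - p i0)).
      by rewrite (le_trans (ler_normB _ _)) // addrC.
    by rewrite opprB [RHS]addrC addrA subrK.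
  by lra.
have Si x : has_inf (S x) by split => //; exists (f i0 + k * `|x - p i0|), i0.
have le1 x y : inf (S x) - inf (S y) <= k * `|x - y|.
  rewrite lerBlDr -lerBlDl; apply: lb_le_inf; first by case: (Si y).
  move=> _ [i _ <-]; rewrite lerBlDl.
  apply: le_trans (_ : f i + k * `|x - p i| <= _); first by apply: ge_inf => //; exists i.
  rewrite addrCA lerD2l -mulrDr ler_wpM2l //.
  by rewrite (_ : x - p i = (x - y) + (y - p i)) ?ler_normD // addrA subrK.
exists (fun x => inf (S x)); split => [i|x y].
  apply/eqP; rewrite eq_le; apply/andP; split.
    by rewrite -[leRHS]addr0 -[X in _ + X](mulr0 k) -(@normr0 _ sp) -(subrr (p i)); apply: ge_inf => //; exists i.
  apply: lb_le_inf; first by case: (Si (p i)).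
  move=> _ [j _ <-]; have := fk i j; rewrite ler_norml => /andP[_]; lra.
by rewrite ler_norml le1 andbT lerNl opprB distrC.
Qed.

(** The norm is a maximum over coordinates, so extending the displacement coordinate by coordinate
    keeps the constant 1/2 on the whole space. *)
Lemma displacement_isotopic (I : Type) (p q : I -> sp) :
  (forall i j, `|(q i - p i) - (q j - p j)| <= 2^-1 * `|p i - p j|) ->
  ambient_isotopic (range p) (range q).
Proof.
move=> pq0; have h0 : 0 <= 2^-1 :> R by [].
have pq i j : [&& `|(q i - p i).1.1 - (q j - p j).1.1| <= 2^-1 * `|p i - p j|,
   `|(q i - p i).1.2 - (q j - p j).1.2| <= 2^-1 * `|p i - p j| &
   `|(q i - p i).2 - (q j - p j).2| <= 2^-1 * `|p i - p j|].
  by move: (pq0 i j); case: (q i - p i) (q j - p j) => [[a b] c] [[a' b'] c'] /=; rewrite prod_norm_le.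
have [F1 [F1p F1l]] := mcshane h0 (fun i j => proj1 (andP (pq i j))).
have [F2 [F2p F2l]] := mcshane h0 (fun i j => proj1 (andP (proj2 (andP (pq i j))))).
have [F3 [F3p F3l]] := mcshane h0 (fun i j => proj2 (andP (proj2 (andP (pq i j))))).
pose F x : sp := ((F1 x, F2 x), F3 x).
have -> : range q = [set x + F x | x in range p].
  rewrite image_comp; apply: eq_imagel => i _ /=.
  rewrite /F F1p F2p F3p -[LHS](subrK (p i)) addrC; congr (_ + _).
by apply: half_lipschitz_isotopic => x y; rewrite prod_norm_le F1l F2l F3l.
Qed.

End isotopy.

(** * Closed polygons *)

Section cyclic_polygons.
Variable R : realType.
Local Notation sp := (space3 R).

Lemma displacement_isotopic_in (I : Type) (D : set I) (p q : I -> sp) :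
  (forall i j, D i -> D j ->
    `|(q i - p i) - (q j - p j)| <= 2^-1 * `|p i - p j|) ->
  ambient_isotopic (p @` D) (q @` D).
Proof.
move=> pq; pose J := {i | D i}.
have E (f : I -> sp) : f @` D = range (fun i : J => f (proj1_sig i)).
  apply/seteqP; split => [_ [i Di <-]|_ [[i Di] _ <-]]; last by exists i.
  by exists (exist _ i Di).
rewrite !E; apply: displacement_isotopic => -[i Di] [j Dj] /=; exact: pq.
Qed.

Lemma sp_eq (p q : sp) : p.1.1 = q.1.1 -> p.1.2 = q.1.2 -> p.2 = q.2 -> p = q.
Proof. by case: p q => [[a b] c] [[a' b'] c'] /= -> -> ->. Qed.

Ltac sp_simpl := apply: sp_eq; rewrite /= /GRing.scale /=.

Variables (W : finType) (s : W -> W).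
Implicit Types (v w : W -> sp) (j k : W) (a b : R).

(** Edge [k] goes from the vertex [k] to its successor; when [s] is a permutation, its cycles are
    the components of the link. *)
Definition pt v k a : sp := (1 - a) *: v k + a *: v (s k).

Definition polygon_trace v : set sp :=
  [set pt v x.1 x.2 | x in [set x : W * R | 0 <= x.2 <= 1]].

Definition embedded v := forall j k a b, 0 <= a <= 1 -> 0 <= b <= 1 ->
  pt v j a = pt v k b ->
  [\/ j = k /\ a = b, [/\ k = s j, a = 1 & b = 0] | [/\ j = s k, a = 0 & b = 1]].

Lemma pt_continuous v k : continuous (pt v k).
Proof.
move=> a; apply: cvgD; apply: cvgZr_tmp; last exact: cvg_id.
by apply: cvgB; [exact: cvg_cst|exact: cvg_id].
Qed.

Lemma pt_norm v k a (e : R) : 0 <= a <= 1 -> (forall k, `|v k| <= e) -> `|pt v k a| <= e.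
Proof.
move=> /andP[a0 a1] ve; apply: le_trans (ler_normD _ _) _.
rewrite !normrZ (ger0_norm a0) ger0_norm ?subr_ge0//.
have := ve k; have := ve (s k); move: `|v k| `|v (s k)| => x y hx hy.
have := ler_wpM2l a0 hx; have a1' : 0 <= 1 - a by lra.
have := ler_wpM2l a1' hy; lra.
Qed.

Lemma segment_min (f : R -> sp) : continuous f ->
  (forall a, 0 <= a <= 1 -> f a != 0) ->
  exists2 m, 0 < m & forall a, 0 <= a <= 1 -> m <= `|f a|.
Proof.
move=> fc f0; have [|||c] := @compact_EVT_min _ R (fun a => `|f a|) (`[0, 1]%classic).
- by exists 0; rewrite /= in_itv /= lexx ler01.
- exact: segment_compact.
- by apply: continuous_subspaceT => x; apply: cvg_norm; exact: fc.
rewrite inE /= in_itv /= => c01 cm; exists `|f c|; first by rewrite normr_gt0 f0.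
by move=> a a01; apply: cm; rewrite inE /= in_itv.
Qed.

Lemma square_min (f : R * R -> sp) : continuous f ->
  (forall a b, 0 <= a <= 1 -> 0 <= b <= 1 -> f (a, b) != 0) ->
  exists2 m, 0 < m & forall a b, 0 <= a <= 1 -> 0 <= b <= 1 -> m <= `|f (a, b)|.
Proof.
move=> fc f0; have [|||c] := @compact_EVT_min _ R (fun x => `|f x|)
  ((`[0, 1]%classic : set R) `*` (`[0, 1]%classic : set R)).
- by exists (0, 0); split; rewrite /= in_itv /= lexx ler01.
- by apply: compact_setX; exact: segment_compact.
- by apply: continuous_subspaceT => x; apply: cvg_norm; exact: fc.
rewrite inE /= !in_itv /= => -[c01 c02] cm; exists `|f c|.
  by rewrite normr_gt0; case: c c01 c02 {cm} => c d /= *; exact: f0.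
by move=> a b a01 b01; apply: cm; rewrite inE; split; rewrite /= in_itv.
Qed.

Section displacement.
Variable v : W -> sp.
Hypothesis ev : embedded v.

(** Here [w] is a displacement of the vertices, extended affinely to the edges: between points of
    the edges [j] and [k] its Lipschitz constant is proportional to its size. *)
Definition displacement_bound j k (C : R) := forall w (e : R), (forall k, `|w k| <= e) ->
  forall a b, 0 <= a <= 1 -> 0 <= b <= 1 ->
  `|pt w j a - pt w k b| <= C * e * `|pt v j a - pt v k b|.

Lemma displacement_boundC j k (C : R) :
  displacement_bound j k C -> displacement_bound k j C.
Proof. by move=> H w e we a b ha hb; rewrite distrC [X in _ * X]distrC; exact: H. Qed.

Lemma displacement_bound_same j : exists2 C, 0 <= C & displacement_bound j j C.
Proof.
pose m := `|v j - v (s j)|.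
have m0 : 0 < m.
  rewrite normr_gt0 subr_eq0; apply/eqP => E.
  have h3 : 0 <= (3%:R^-1 : R) <= 1 by lra.
  have h2 : 0 <= (2%:R^-1 : R) <= 1 by lra.
  have h : pt v j 3%:R^-1 = pt v j 2%:R^-1.
    by rewrite /pt -E -!scalerDl; congr (_ *: _); lra.
  by have [[_]|[_]|[_]] := ev h3 h2 h; lra.
exists (2 / m) => [|w e we a b ha hb]; first by rewrite divr_ge0 // ltW.
have E u : pt u j a - pt u j b = (b - a) *: (u j - u (s j)).
  by rewrite /pt; sp_simpl; ring.
rewrite !E !normrZ -/m.
have -> : 2 / m * e * (`|b - a| * m) = `|b - a| * (2 * e) by field; rewrite gt_eqF.
apply: ler_wpM2l => //; have := ler_normB (w j) (w (s j)); have := we j; have := we (s j); lra.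
Qed.

(** Two edges joining the same two vertices would share their midpoint. *)
Lemma no_two_cycle j k : j != k -> k = s j -> j = s k -> False.
Proof.
move=> jk kj jk'; have h2 : 0 <= (2%:R^-1 : R) <= 1 by lra.
have h : pt v j 2%:R^-1 = pt v k 2%:R^-1.
  by rewrite /pt -kj -jk'; sp_simpl; field.
have [[/eqP]|[_]|[_]] := ev h2 h2 h; try lra.
by rewrite (negbTE jk).
Qed.

(** The two edges do not overlap, so the distance of two points is at least proportional to the sum
    of their distances to the common vertex. The difference of their displacements is at most
    proportional to the same sum. *)
Lemma displacement_bound_next j : j != s j ->
  exists2 C, 0 <= C & displacement_bound j (s j) C.
Proof.
move=> jk; set k := s j in jk *.
pose u := v j - v k; pose u' := v (s k) - v k.
have E (x : W -> sp) a b : pt x j a - pt x k b = (1 - a) *: (x j - x k) - b *: (x (s k) - x k).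
  by rewrite /pt -/k; sp_simpl; ring.
have ne a b : 0 <= a <= 1 -> 0 <= b <= 1 -> (a == 0) || (b == 1) ->
    (1 - a) *: u - b *: u' != 0.
  move=> ha hb ab; rewrite -E subr_eq0; apply/eqP => /(ev ha hb) [[/eqP]|[_ a1 b0]|[jk' _ _]].
  - by rewrite (negbTE jk).
  - by move: ab; rewrite a1 b0 oner_eq0 eq_sym oner_eq0.
  - exact: (no_two_cycle jk erefl jk').
have [||m1 m10 h1] := @segment_min (fun b => u - b *: u').
- by move=> b; apply: cvgB; [exact: cvg_cst|apply: cvgZr_tmp; exact: cvg_id].
- by move=> b hb; have := ne 0 b; rewrite subr0 scale1r eqxx /= lexx ler01; apply.
have [||m2 m20 h2] := @segment_min (fun a => a *: u - u').
- by move=> b; apply: cvgB; [apply: cvgZr_tmp; exact: cvg_id|exact: cvg_cst].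
- move=> a ha; have := ne (1 - a) 1; rewrite subKr scale1r eqxx orbT lexx ler01; apply => //.
  lra.
pose m := Num.min m1 m2.
have m0 : 0 < m by rewrite lt_min m10.
(* Dividing by the larger of [x] and [y] reduces to the two families for which compactness gave the
   minima [m1] and [m2]. *)
have lb x y : 0 <= x <= 1 -> 0 <= y <= 1 -> m * (x + y) <= 2 * `|x *: u - y *: u'|.
  move=> /andP[x0 x1] /andP[y0 y1].
  have [xy|xy] := leP y x.
    have [x_0|xn0] := eqVneq x 0; first by (have -> : y = 0 by lra); rewrite x_0 addr0 mulr0 mulr_ge0.
    have xp : 0 < x by rewrite lt_neqAle eq_sym xn0.
    have -> : x *: u - y *: u' = x *: (u - (y / x) *: u').
      by rewrite [RHS]scalerBr scalerA mulrCA divff // mulr1.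
    rewrite normrZ ger0_norm //.
    have : m <= `|u - (y / x) *: u'|.
      by rewrite (le_trans _ (h1 _ _)) ?ge_min ?lexx// divr_ge0 //= ler_pdivrMr // mul1r.
    move=> hm; have := ler_wpM2l x0 hm; have := ler_wpM2l (ltW m0) xy; lra.
  have yp : 0 < y by lra.
  have -> : x *: u - y *: u' = y *: ((x / y) *: u - u').
    by rewrite [RHS]scalerBr scalerA mulrCA divff ?gt_eqF // mulr1.
  rewrite normrZ ger0_norm //.
  have : m <= `|(x / y) *: u - u'|.
    by rewrite (le_trans _ (h2 _ _)) ?ge_min ?lexx ?orbT // divr_ge0 //= ler_pdivrMr // mul1r ltW.
  move=> hm; have := ler_wpM2l y0 hm; have := ler_wpM2l (ltW m0) (ltW xy); lra.
exists (4 / m) => [|w e we a b ha hb]; first by rewrite divr_ge0 // ltW.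
rewrite !E -/u -/u'.
have e0 : 0 <= e by exact: le_trans (we j).
apply: le_trans (_ : 2 * e * ((1 - a) + b) <= _).
  apply: le_trans (ler_normB _ _) _; rewrite !normrZ.
  have -> : `|1 - a| = 1 - a by rewrite ger0_norm; lra.
  have -> : `|b| = b by rewrite ger0_norm; lra.
  have d2 (x y : W) : `|w x - w y| <= 2 * e.
    by have := ler_normB (w x) (w y); have := we x; have := we y; lra.
  have a1 : 0 <= 1 - a by lra.
  have b1 : 0 <= b by lra.
  by have := ler_wpM2l a1 (d2 j k); have := ler_wpM2l b1 (d2 (s k) k); lra.
have := lb (1 - a) b; move: `|_| => X /(_ _ hb) h.
have {h} : m * (1 - a + b) <= 2 * X by apply: h; lra.
move=> h; have -> : 4 / m * e * X = 2 * e * ((2 * X) / m) by field; rewrite gt_eqF.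
by apply: ler_wpM2l; [rewrite mulr_ge0 | rewrite ler_pdivlMr // mulrC].
Qed.

(** Non-adjacent edges have a positive distance by compactness, while displacements differ by at
    most twice their size. *)
Lemma displacement_bound_far j k : j != k -> k != s j -> j != s k ->
  exists2 C, 0 <= C & displacement_bound j k C.
Proof.
move=> jk kj jk'.
have [||m m0 hm] := @square_min (fun x => pt v j x.1 - pt v k x.2).
- move=> x; apply: cvgB.
    exact: (continuous_compT (@fst_continuous _ _) (@pt_continuous v j)).
  exact: (continuous_compT (@snd_continuous _ _) (@pt_continuous v k)).
- move=> a b ha hb /=; rewrite subr_eq0; apply/eqP => /(ev ha hb)[[/eqP]|[/eqP]|[/eqP]].
  + by rewrite (negbTE jk).
  + by rewrite (negbTE kj).
  + by rewrite (negbTE jk').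
exists (2 / m) => [|w e we a b ha hb]; first by rewrite divr_ge0 // ltW.
have e0 : 0 <= e by exact: le_trans (we j).
apply: le_trans (_ : 2 * e <= _).
  have := ler_normB (pt w j a) (pt w k b).
  have := pt_norm j ha we; have := pt_norm k hb we.
  by move: `|_| `|_| `|_| => x y z; lra.
have := hm _ _ ha hb => /= h.
have -> : 2 / m * e * `|pt v j a - pt v k b| = 2 * e * (`|pt v j a - pt v k b| / m).
  by field; rewrite gt_eqF.
by rewrite ler_peMr ?mulr_ge0 // ler_pdivlMr // mul1r.
Qed.

Lemma displacement_bound_all : exists2 C, 0 < C & forall j k, displacement_bound j k C.
Proof.
have H (x : W * W) : exists C : R, 0 <= C /\ displacement_bound x.1 x.2 C.
  case: x => j k /=.
  have [->|jk] := eqVneq j k.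
    by have [C ? ?] := displacement_bound_same k; exists C.
  have [kj|kj] := eqVneq k (s j).
    by rewrite kj in jk *; have [C ? ?] := displacement_bound_next jk; exists C.
  have [jk'|jk'] := eqVneq j (s k).
    rewrite jk' eq_sym in jk *; have [C C0 HC] := displacement_bound_next jk.
    by exists C; split; [exact: C0|exact: (displacement_boundC HC)].
  by have [C ? ?] := displacement_bound_far jk kj jk'; exists C.
have {H} /choice[C HC] := H.
exists (1 + \sum_x C x).
  by rewrite ltr_wpDr ?sumr_ge0 // => x _; case: (HC x).
move=> j k w e we a b ha hb; have [C0 Cb] := HC (j, k).
apply: le_trans (Cb _ _ we _ _ ha hb) _.
rewrite ler_wpM2r // ler_wpM2r //; first exact: le_trans (we j).
rewrite (bigD1 (j, k)) //= addrCA lerDl addr_ge0 // sumr_ge0 // => x _.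
by case: (HC x).
Qed.

Lemma small_perturbation : exists2 e, 0 < e & forall v',
  (forall k, `|v' k - v k| <= e) ->
  ambient_isotopic (polygon_trace v) (polygon_trace v').
Proof.
have [C C0 HC] := displacement_bound_all.
exists (2^-1 / C) => [|v' hv']; first by rewrite divr_gt0.
apply: displacement_isotopic_in => -[j a] [k b] /= ha hb.
have := HC j k (fun k => v' k - v k) _ hv' a b ha hb.
have -> : C * (2^-1 / C) = 2^-1 by field; rewrite gt_eqF.
apply: le_trans; rewrite le_eqVlt; apply/orP; left; apply/eqP; congr `|_|.
by rewrite /pt; sp_simpl; ring.
Qed.

End displacement.

Definition line_homotopy v v' (t : R) k : sp := (1 - t) *: v k + t *: v' k.

Lemma line_homotopy0 v v' : line_homotopy v v' 0 = v.
Proof. by apply/funext => k; rewrite /line_homotopy subr0 scale1r scale0r addr0. Qed.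

Lemma line_homotopy1 v v' : line_homotopy v v' 1 = v'.
Proof. by apply/funext => k; rewrite /line_homotopy subrr scale1r scale0r add0r. Qed.

(** By [small_perturbation] the isotopy type is locally constant in time, hence constant on
    [0, 1]. *)
Lemma polygon_isotopy v v' :
  (forall t, 0 <= t <= 1 -> embedded (line_homotopy v v' t)) ->
  ambient_isotopic (polygon_trace v) (polygon_trace v').
Proof.
move=> emb; set h := line_homotopy v v'.
have [M M0 HM] : exists2 M, 0 < M & forall k, `|v' k - v k| <= M.
  exists (1 + \sum_k `|v' k - v k|); first by rewrite ltr_wpDr ?sumr_ge0.
  by move=> k; rewrite (bigD1 k) //= addrCA lerDl addr_ge0 // sumr_ge0.
have : ambient_isotopic (polygon_trace v) (polygon_trace (h 1)); last by rewrite /h line_homotopy1.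
apply: (@segment_constant _ 0 1 (fun t => ambient_isotopic (polygon_trace v) (polygon_trace (h t)))) => //.
  move=> t ht; have [e e0 He] := small_perturbation (emb t ht).
  exists (e / M) => [|t' _ tt']; first by rewrite divr_gt0.
  have iso : ambient_isotopic (polygon_trace (h t)) (polygon_trace (h t')).
    apply: He => k.
    have -> : h t' k - line_homotopy v v' t k = (t' - t) *: (v' k - v k).
      by rewrite /h /line_homotopy; sp_simpl; ring.
    rewrite normrZ distrC; apply: le_trans (ler_wpM2l _ (HM k)) _ => //.
    by rewrite -ler_pdivlMr // ltW.
  split=> iso'; first exact: ambient_isotopic_trans iso' iso.
  exact: ambient_isotopic_trans iso' (ambient_isotopic_sym iso).
by rewrite /h line_homotopy0; exact: ambient_isotopic_refl.
Qed.

End cyclic_polygons.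

(** * Rectilinear diagrams *)

Module Grid.

Section between.
Variable R : realType.
Definition btw (a b c : R) := (a <= c <= b) || (b <= c <= a).
Definition sbtw (a b c : R) := (a < c < b) || (b < c < a).
Definition sh (d : bool) (u r : R) : R := if d then u + r else u - r.

Lemma btwC a b c : btw a b c = btw b a c.
Proof. by rewrite /btw orbC. Qed.
Lemma sbtwC a b c : sbtw a b c = sbtw b a c.
Proof. by rewrite /sbtw orbC. Qed.
Lemma sbtwW a b c : sbtw a b c -> btw a b c.
Proof. by rewrite /sbtw /btw => /orP[] /andP[/ltW-> /ltW->]; rewrite ?orbT. Qed.
Lemma btwE a b c : btw a b c -> [\/ c = a, c = b | sbtw a b c].
Proof.
rewrite /btw /sbtw => /orP[|] /andP[h1 h2].
  have [->|n1] := eqVneq c a; first by constructor 1.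
  have [->|n2] := eqVneq c b; first by constructor 2.
  by constructor 3; rewrite !lt_neqAle h1 h2 n2 (eq_sym a) n1.
have [->|n1] := eqVneq c a; first by constructor 1.
have [->|n2] := eqVneq c b; first by constructor 2.
by constructor 3; rewrite !lt_neqAle h1 h2 n1 (eq_sym b) n2 orbT.
Qed.
Lemma btwl a b : btw a b a.
Proof. by rewrite /btw lexx /= andbT le_total. Qed.
Lemma btwr a b : btw a b b.
Proof. by rewrite btwC btwl. Qed.

(** The inverse of one plus the sum of the inverses lies below every value, and exists also for an
    empty family. *)
Lemma fin_lower (I : finType) (f : I -> R) : (forall i, 0 < f i) ->
  exists2 r, 0 < r & forall i, r < f i.
Proof.
move=> f0; pose S := \sum_i (f i)^-1.
have S0 : 0 <= S by rewrite sumr_ge0 // => i _; rewrite invr_ge0 ltW.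
exists (1 + S)^-1 => [|i]; first by rewrite invr_gt0 ltr_wpDr.
rewrite -[f i]invrK ltf_pV2 ?posrE ?invr_gt0 //; last by rewrite ltr_wpDr.
rewrite /S (bigD1 i) //= addrCA ltrDl ltr_wpDr // sumr_ge0 // => j _.
by rewrite invr_ge0 ltW.
Qed.

End between.

Section components.
Variables (R : realType) (T : set (R * R)).
Definition comp_of (p : R * R) := connected_component (~` T) p.

Lemma comp_of_conn (A : set (R * R)) p q : connected A -> A `<=` ~` T -> A p -> A q ->
  comp_of p = comp_of q.
Proof.
move=> cA AT Ap Aq; apply: same_connected_component.
exact: (connected_component_max Ap AT cA).
Qed.

Lemma comp_of_hor a b c : (forall u, btw a b u -> ~ T (u, c)) -> comp_of (a, c) = comp_of (b, c).
Proof.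
wlog ab : a b / a <= b => [W h|h].
  have [ab|ab] := leP a b; first exact: W.
  by apply/esym/W => [|u]; [exact: ltW | rewrite btwC; exact: h].
apply: (@comp_of_conn [set (u, c) | u in `[a, b]%classic]).
- apply: connected_continuous_connected; first exact: segment_connected.
  apply: continuous_subspaceT.
  have h1 : continuous (fun u : R => u) by move=> u; exact: cvg_id.
  have h2 : continuous (fun _ : R => c) by move=> u; exact: cvg_cst.
  exact: (continuous_pair h1 h2).
- by move=> _ [u + <-]; rewrite /= in_itv /= => hu; apply: h; rewrite /btw hu.
- by exists a => //; rewrite /= in_itv /= lexx.
- by exists b => //; rewrite /= in_itv /= lexx ab.
Qed.

Lemma comp_of_ver a b c : (forall u, btw a b u -> ~ T (c, u)) -> comp_of (c, a) = comp_of (c, b).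
Proof.
wlog ab : a b / a <= b => [W h|h].
  have [ab|ab] := leP a b; first exact: W.
  by apply/esym/W => [|u]; [exact: ltW | rewrite btwC; exact: h].
apply: (@comp_of_conn [set (c, u) | u in `[a, b]%classic]).
- apply: connected_continuous_connected; first exact: segment_connected.
  apply: continuous_subspaceT.
  have h1 : continuous (fun u : R => u) by move=> u; exact: cvg_id.
  have h2 : continuous (fun _ : R => c) by move=> u; exact: cvg_cst.
  exact: (continuous_pair h2 h1).
- by move=> _ [u + <-]; rewrite /= in_itv /= => hu; apply: h; rewrite /btw hu.
- by exists a => //; rewrite /= in_itv /= lexx.
- by exists b => //; rewrite /= in_itv /= lexx ab.
Qed.

End components.

Section grid.
Variables (R : realType) (W : finType) (s t : W -> W) (x z : W -> R).
Hypotheses (sK : cancel s t) (tK : cancel t s).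
Hypotheses (xI : injective x) (zI : injective z) (sn : forall k, s k != k).

(** The polygon alternates: the vertical side [k] on the line [x k] joins the rows of [t k] and [k],
    then the horizontal side [k] on the row [z k] joins the columns of [k] and [s k]. As [x] and [z]
    are injective, no line contains two sides. *)
Definition onV k (p : R * R) := (p.1 == x k) && btw (z (t k)) (z k) p.2.
Definition onH k (p : R * R) := (p.2 == z k) && btw (x k) (x (s k)) p.1.
Definition grid_trace : set (R * R) := [set p | exists k, onV k p || onH k p].
Local Notation T := grid_trace.
Definition cross k l := sbtw (z (t k)) (z k) (z l) && sbtw (x l) (x (s l)) (x k).
Local Notation Fc := (comp_of T).

(** Within this radius the only grid lines met are those through [p] itself. *)
Definition small p (r : R) := [/\ 0 < r, forall k, x k != p.1 -> r < `|x k - p.1|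
  & forall k, z k != p.2 -> r < `|z k - p.2|].

Lemma small_x p r k : small p r -> `|x k - p.1| <= r -> x k = p.1.
Proof. by case=> _ h _; apply: contraTeq => /h; rewrite -ltNge. Qed.

Lemma small_z p r k : small p r -> `|z k - p.2| <= r -> z k = p.2.
Proof. by case=> _ _ h; apply: contraTeq => /h; rewrite -ltNge. Qed.

Lemma small_z3 p r k : small p r ->
  [\/ z k = p.2, z k < p.2 - r | p.2 + r < z k].
Proof.
move=> sp; have [/(small_z sp) E|] := leP `|z k - p.2| r; first by constructor 1.
by rewrite ltr_normr => /orP[] h; [constructor 3 | constructor 2]; lra.
Qed.

Lemma small_x3 p r k : small p r ->
  [\/ x k = p.1, x k < p.1 - r | p.1 + r < x k].
Proof.
move=> sp; have [/(small_x sp) E|] := leP `|x k - p.1| r; first by constructor 1.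
by rewrite ltr_normr => /orP[] h; [constructor 3 | constructor 2]; lra.
Qed.

Lemma small_ex p : exists r, small p r.
Proof.
have [|r1 r10 h1] := @fin_lower R W (fun k => if x k == p.1 then 1 else `|x k - p.1|).
  by move=> k; case: eqP => // /eqP; rewrite normr_gt0 subr_eq0.
have [|r2 r20 h2] := @fin_lower R W (fun k => if z k == p.2 then 1 else `|z k - p.2|).
  by move=> k; case: eqP => // /eqP; rewrite normr_gt0 subr_eq0.
exists (Num.min r1 r2); split=> [|k /negbTE kp|k /negbTE kp].
- by rewrite lt_min r10.
- by have := h1 k; rewrite kp; apply: le_lt_trans; rewrite ge_min lexx.
- by have := h2 k; rewrite kp; apply: le_lt_trans; rewrite ge_min lexx orbT.
Qed.

Definition rad p := projT1 (cid (small_ex p)).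
Lemma radP p : small p (rad p).
Proof. by rewrite /rad; case: cid. Qed.
Lemma rad_gt0 p : 0 < rad p. Proof. by case: (radP p). Qed.

Definition in_ray (d : bool) (a r b : R) := if d then a < b <= a + r else a - r <= b < a.
Definition in_quad p r (d e : bool) (q : R * R) := in_ray d p.1 r q.1 && in_ray e p.2 r q.2.

Lemma in_ray_neq d a r b : in_ray d a r b -> b != a /\ `|b - a| <= r.
Proof.
rewrite /in_ray ler_norml; case: d => /andP[h1 h2]; split.
- by rewrite gt_eqF.
- by apply/andP; split; lra.
- by rewrite lt_eqF.
- by apply/andP; split; lra.
Qed.

Lemma quad_free p r d e q : small p r -> in_quad p r d e q -> ~ T q.
Proof.
move=> sp /andP[/in_ray_neq[n1 h1] /in_ray_neq[n2 h2]] [k /orP[] /andP[/eqP E _]].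
  by move: n1; rewrite E in h1 *; rewrite (small_x sp h1) eqxx.
by move: n2; rewrite E in h2 *; rewrite (small_z sp h2) eqxx.
Qed.

Lemma in_ray_btw d a r b c u : in_ray d a r b -> in_ray d a r c -> btw b c u -> in_ray d a r u.
Proof.
rewrite /in_ray /btw; case: d => /andP[h1 h2] /andP[h3 h4] /orP[] /andP[h5 h6];
  by apply/andP; split; lra.
Qed.

Lemma quad_comp p r d e q q' : small p r -> in_quad p r d e q -> in_quad p r d e q' ->
  Fc q = Fc q'.
Proof.
case: q q' => [a b] [a' b'] sp /andP[/= h1 h2] /andP[/= h3 h4].
transitivity (Fc (a', b)).
  apply: comp_of_hor => u hu; apply: (quad_free sp (d := d) (e := e)).
  by rewrite /in_quad /= h2 andbT; exact: in_ray_btw hu.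
apply: comp_of_ver => u hu; apply: (quad_free sp (d := d) (e := e)).
by rewrite /in_quad /= h3 /=; exact: in_ray_btw hu.
Qed.

(** The face seen from [p] in the quadrant with the signs [d] and [e]; by [quadE] the radius does
    not matter. *)
Definition quad p (d e : bool) := Fc (sh d p.1 (rad p), sh e p.2 (rad p)).

Lemma sh_in_ray d a r : 0 < r -> in_ray d a r (sh d a r).
Proof. by rewrite /in_ray /sh; case: d => r0; rewrite lexx /= ?andbT; lra. Qed.

Lemma in_ray_sh d a r m : 0 < m -> m <= r -> in_ray d a r (sh d a m).
Proof. by rewrite /in_ray /sh; case: d => m0 mr; apply/andP; split; lra. Qed.

Lemma quadE p r d e q : small p r -> in_quad p r d e q -> Fc q = quad p d e.
Proof.
move=> sp hq; have r0 : 0 < r by case: sp.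
pose m := Num.min r (rad p).
have m0 : 0 < m by rewrite lt_min r0 rad_gt0.
transitivity (Fc (sh d p.1 m, sh e p.2 m)).
  apply: (quad_comp sp hq); rewrite /in_quad /=.
  by rewrite !in_ray_sh // ge_min lexx.
apply: (quad_comp (radP p) (d := d) (e := e)); rewrite /in_quad /=.
  by rewrite !in_ray_sh // ge_min lexx orbT.
by rewrite !sh_in_ray ?rad_gt0.
Qed.

(** The trace leaves [p] upwards or downwards. Testing one point is enough: by [wallV_all] and
    [wallV_none] the ray of length [rad p] is contained in the trace or disjoint from it. *)
Definition wallV p (e : bool) := T (p.1, sh e p.2 (rad p)).
Definition wallH p (d : bool) := T (sh d p.1 (rad p), p.2).

Definition gap (a r u : R) := [\/ u = a, u < a - r | a + r < u].

(** The ends of the interval are at [a] or beyond the radius, so an interval meeting a ray from [a]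
    contains all of it, and [a] as well. *)
Lemma ray_btw e a r b c u v : gap a r u -> gap a r v -> in_ray e a r b ->
  c = a \/ in_ray e a r c -> btw u v b -> btw u v c.
Proof.
have side w : gap a r w -> in_ray e a r b -> c = a \/ in_ray e a r c ->
    (w <= b -> w <= c) /\ (b <= w -> c <= w).
  by rewrite /in_ray => gw; case: e => /andP[h1 h2] [->|/andP[h3 h4]];
    case: gw => h; split => h5; lra.
move=> gu gv hb hc; have [u1 u2] := side u gu hb hc; have [v1 v2] := side v gv hb hc.
by rewrite /btw => /orP[] /andP[]; [move=> /u1 -> /v2 ->|move=> /v1 -> /u2 ->; rewrite orbT].
Qed.

Lemma wallV_ray p r e b : small p r -> in_ray e p.2 r b -> T (p.1, b) ->
  exists k, x k = p.1 /\ forall c, c = p.2 \/ in_ray e p.2 r c -> btw (z (t k)) (z k) c.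
Proof.
move=> sp hb [k]; rewrite /onV /onH /= => /orP[] /andP[/eqP E B].
  exists k; split=> [//|c hc].
  exact: ray_btw (small_z3 (t k) sp) (small_z3 k sp) hb hc B.
have [n1 h1] := in_ray_neq hb.
by rewrite E in n1 h1; rewrite (small_z sp h1) eqxx in n1.
Qed.

Lemma wallH_ray p r d b : small p r -> in_ray d p.1 r b -> T (b, p.2) ->
  exists k, z k = p.2 /\ forall c, c = p.1 \/ in_ray d p.1 r c -> btw (x k) (x (s k)) c.
Proof.
move=> sp hb [k]; rewrite /onV /onH /= => /orP[] /andP[/eqP E B]; last first.
  exists k; split=> [//|c hc].
  exact: ray_btw (small_x3 k sp) (small_x3 (s k) sp) hb hc B.
have [n1 h1] := in_ray_neq hb.
by rewrite E in n1 h1; rewrite (small_x sp h1) eqxx in n1.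
Qed.

Lemma neq_ray a r b : b != a -> `|b - a| <= r -> exists d, in_ray d a r b.
Proof.
rewrite ler_norml neq_lt => /orP[] h /andP[h1 h2]; [exists false|exists true];
  rewrite /in_ray; apply/andP; split; lra.
Qed.

Lemma onV_trace k a b : x k = a -> btw (z (t k)) (z k) b -> T (a, b).
Proof. by move=> E B; exists k; rewrite /onV /= E eqxx B. Qed.

Lemma onH_trace k a b : z k = b -> btw (x k) (x (s k)) a -> T (a, b).
Proof. by move=> E B; exists k; rewrite /onH /= E eqxx B orbT. Qed.

Lemma near_free p q : ~ T p -> `|q.1 - p.1| <= rad p -> `|q.2 - p.2| <= rad p -> ~ T q.
Proof.
case: p q => [p1 p2] [q1 q2] /= nT h1 h2 Tq; apply: nT.
have [E1|n1] := eqVneq q1 p1; have [E2|n2] := eqVneq q2 p2.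
- by rewrite -E1 -E2.
- have [e he] := neq_ray n2 h2; rewrite E1 in Tq.
  have [k [xk]] := @wallV_ray (p1, p2) _ _ _ (radP _) he Tq.
  by move=> /(_ p2 (or_introl erefl)); exact: onV_trace xk.
- have [d hd] := neq_ray n1 h1; rewrite E2 in Tq.
  have [k [zk]] := @wallH_ray (p1, p2) _ _ _ (radP _) hd Tq.
  by move=> /(_ p1 (or_introl erefl)); exact: onH_trace zk.
- have [d hd] := neq_ray n1 h1; have [e he] := neq_ray n2 h2.
  exfalso; apply: (quad_free (radP (p1, p2)) (d := d) (e := e)) Tq.
  by rewrite /in_quad hd he.
Qed.

Lemma ball_prodE (p q : R * R) e : ball p e q <-> `|q.1 - p.1| < e /\ `|q.2 - p.2| < e.
Proof.
rewrite -(distrC p.1) -(distrC p.2); split=> [[h1 h2]|[h1 h2]]; first by split; [exact: h1|exact: h2].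
by split.
Qed.

Lemma wallV_all p e b : wallV p e -> in_ray e p.2 (rad p) b -> T (p.1, b).
Proof.
move=> w hb; have [k [xk]] := wallV_ray (radP p) (sh_in_ray e p.2 (rad_gt0 p)) w.
by move=> /(_ b (or_intror hb)); exact: onV_trace.
Qed.

Lemma wallH_all p d b : wallH p d -> in_ray d p.1 (rad p) b -> T (b, p.2).
Proof.
move=> w hb; have [k [xk]] := wallH_ray (radP p) (sh_in_ray d p.1 (rad_gt0 p)) w.
by move=> /(_ b (or_intror hb)); exact: onH_trace.
Qed.

Lemma wallV_none p e b : ~ wallV p e -> in_ray e p.2 (rad p) b -> ~ T (p.1, b).
Proof.
move=> w hb Tb; apply: w; have [k [xk]] := wallV_ray (radP p) hb Tb.
move=> /(_ _ (or_intror (sh_in_ray e p.2 (rad_gt0 p)))); exact: onV_trace.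
Qed.

Lemma wallH_none p d b : ~ wallH p d -> in_ray d p.1 (rad p) b -> ~ T (b, p.2).
Proof.
move=> w hb Tb; apply: w; have [k [xk]] := wallH_ray (radP p) hb Tb.
move=> /(_ _ (or_intror (sh_in_ray d p.1 (rad_gt0 p)))); exact: onH_trace.
Qed.

Lemma rayV_comp p d e b : ~ wallV p e -> in_ray e p.2 (rad p) b ->
  Fc (p.1, b) = quad p d e.
Proof.
move=> w hb; rewrite -(@quadE p (rad p) d e (sh d p.1 (rad p), b)); last 2 first.
- exact: radP.
- by rewrite /in_quad hb sh_in_ray // rad_gt0.
apply: comp_of_hor => u hu; have [->|n] := eqVneq u p.1; first exact: wallV_none hb.
apply: (quad_free (radP p) (d := d) (e := e)); rewrite /in_quad /= hb andbT.
have := rad_gt0 p; move: hu n; rewrite /btw /sh /in_ray neq_lt.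
by case: (d) => /orP[] /andP[h1 h2] /orP[] h3 h4; apply/andP; split; lra.
Qed.

Lemma rayH_comp p d e b : ~ wallH p d -> in_ray d p.1 (rad p) b ->
  Fc (b, p.2) = quad p d e.
Proof.
move=> w hb; rewrite -(@quadE p (rad p) d e (b, sh e p.2 (rad p))); last 2 first.
- exact: radP.
- by rewrite /in_quad hb sh_in_ray // rad_gt0.
apply: comp_of_ver => u hu; have [->|n] := eqVneq u p.2; first exact: wallH_none hb.
apply: (quad_free (radP p) (d := d) (e := e)); rewrite /in_quad /= hb /=.
have := rad_gt0 p; move: hu n; rewrite /btw /sh /in_ray neq_lt.
by case: (e) => /orP[] /andP[h1 h2] /orP[] h3 h4; apply/andP; split; lra.
Qed.

Lemma quad_V p d d' e : ~ wallV p e -> quad p d e = quad p d' e.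
Proof.
move=> w; have h := sh_in_ray e p.2 (rad_gt0 p).
by rewrite -(rayV_comp d w h) -(rayV_comp d' w h).
Qed.

Lemma quad_H p d e e' : ~ wallH p d -> quad p d e = quad p d e'.
Proof.
move=> w; have h := sh_in_ray d p.1 (rad_gt0 p).
by rewrite -(rayH_comp e w h) -(rayH_comp e' w h).
Qed.

(* The faces adherent to a point of the trace are those of its quadrants. *)
Definition adherent p (F : set (R * R)) := exists d e, F = quad p d e.

(** A point of the face near [p] is in an open quadrant, or on a half-axis free of the trace, which
    then merges with the quadrants on both sides of it. *)
Lemma closure_adherent p q : T p -> ~ T q -> closure (Fc q) p <-> adherent p (Fc q).
Proof.
move=> Tp nTq; split=> [cl|[d [e E]]].
  have [q' [Fq' /ball_prodE[h1 h2]]] := cl _ (nbhsx_ballx p _ (rad_gt0 p)).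
  have nT' : ~ T q' by exact: connected_component_sub Fq'.
  have E : Fc q = Fc q' by exact: same_connected_component.
  rewrite E; case: q' h1 h2 nT' {E Fq'} => q1 q2 /= /ltW h1 /ltW h2 nT'.
  have [E1|n1] := eqVneq q1 p.1; have [E2|n2] := eqVneq q2 p.2.
  - by exfalso; apply: nT'; rewrite E1 E2; case: p Tp {cl h1 h2 E1 E2}.
  - have [e he] := neq_ray n2 h2; exists true, e; rewrite E1; apply: rayV_comp (he).
    by move=> w; apply: nT'; rewrite E1; exact: wallV_all he.
  - have [d hd] := neq_ray n1 h1; exists d, true; rewrite E2; apply: rayH_comp (hd).
    by move=> w; apply: nT'; rewrite E2; exact: wallH_all hd.
  - have [d hd] := neq_ray n1 h1; have [e he] := neq_ray n2 h2.
    by exists d, e; apply: (quadE (radP p)); rewrite /in_quad hd he.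
rewrite E => A /nbhs_ballP[r r0 rA].
pose m := Num.min (r / 2) (rad p).
have m0 : 0 < m by rewrite lt_min rad_gt0 divr_gt0.
have mr : m < r by rewrite gt_min ltr_pdivrMr // ltr_pMr // ltr1n.
have hq : in_quad p (rad p) d e (sh d p.1 m, sh e p.2 m).
  by rewrite /in_quad /= !in_ray_sh // ge_min lexx orbT.
exists (sh d p.1 m, sh e p.2 m); split; last first.
  apply: rA; apply/ball_prodE; rewrite /= /sh.
  have -> : `|(if d then p.1 + m else p.1 - m) - p.1| = m.
    by case: d {E hq}; [rewrite addrC addKr gtr0_norm|rewrite addrAC subrr add0r normrN gtr0_norm].
  have -> // : `|(if e then p.2 + m else p.2 - m) - p.2| = m.
  by case: e {E hq}; [rewrite addrC addKr gtr0_norm|rewrite addrAC subrr add0r normrN gtr0_norm].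
rewrite -(quadE (radP p) hq); apply: connected_component_refl.
exact: quad_free (radP p) hq.
Qed.

Lemma in_ray_near e a r b : in_ray e a r b -> b != sh e a r ->
  exists2 m, 0 < m & forall e' u, 0 < u <= m -> in_ray e a r (sh e' b u).
Proof.
rewrite /in_ray /sh neq_lt; case: e => /andP[h3 h4] /orP[] h5; try lra.
  exists (Num.min ((b - a) / 2) (a + r - b)) => [|e' u].
    by rewrite lt_min divr_gt0 ?subr_gt0.
  by rewrite le_min => /and3P[h6 h7 h8]; case: e'; apply/andP; split; lra.
exists (Num.min ((a - b) / 2) (b - (a - r))) => [|e' u].
  by rewrite lt_min divr_gt0 ?subr_gt0.
by rewrite le_min => /and3P[h6 h7 h8]; case: e'; apply/andP; split; lra.
Qed.

(** A sufficiently small quadrant at the new point is contained in a quadrant of [p]. *)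
Lemma quad_on_V p e b d e' : in_ray e p.2 (rad p) b -> b != sh e p.2 (rad p) ->
  quad (p.1, b) d e' = quad p d e.
Proof.
move=> hb nb; have [m m0 hm] := in_ray_near hb nb.
pose m' := Num.min m (Num.min (rad p) (rad (p.1, b))).
have m'0 : 0 < m' by rewrite !lt_min m0 !rad_gt0.
rewrite -(@quadE (p.1, b) (rad (p.1, b)) d e' (sh d p.1 m', sh e' b m')); last 2 first.
- exact: radP.
- by rewrite /in_quad /= !in_ray_sh // /m' !ge_min lexx !orbT.
apply: (quadE (radP p)); rewrite /in_quad /= in_ray_sh //=.
  by apply: hm; rewrite m'0 /m' ge_min lexx.
by rewrite /m' !ge_min lexx !orbT.
Qed.

Lemma quad_on_H p d b d' e : in_ray d p.1 (rad p) b -> b != sh d p.1 (rad p) ->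
  quad (b, p.2) d' e = quad p d e.
Proof.
move=> hb nb; have [m m0 hm] := in_ray_near hb nb.
pose m' := Num.min m (Num.min (rad p) (rad (b, p.2))).
have m'0 : 0 < m' by rewrite !lt_min m0 !rad_gt0.
rewrite -(@quadE (b, p.2) (rad (b, p.2)) d' e (sh d' b m', sh e p.2 m')); last 2 first.
- exact: radP.
- by rewrite /in_quad /= !in_ray_sh // /m' !ge_min lexx !orbT.
apply: (quadE (radP p)); rewrite /in_quad /= [X in _ && X]in_ray_sh ?andbT //=.
  by apply: hm; rewrite m'0 /m' ge_min lexx.
by rewrite /m' !ge_min lexx !orbT.
Qed.

End grid.

End Grid.
Export Grid.

(** * Telescoping sums, parity of intersections with rays, and faces around corners *)

Module Corner.

(** What leaves a point to the east reaches the next one from the west, so inner terms cancel. [X]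
    will list the crossings on a side with the ends [m] and [M]. *)
Lemma telescope (R : realType) (e w : R -> bool) (X : seq R) (m M : R) :
  path <%R m (rcons X M) ->
  (forall c c', c \in m :: X -> c' \in rcons X M -> c < c' ->
    (forall u, u \in X -> ~~ (c < u < c')) -> e c = w c') ->
  \big[addb/false]_(c <- X) (e c (+) w c) = e m (+) w M.
Proof.
elim: X m => [|c X IH] m.
  rewrite /= andbT big_nil => mM H.
  by rewrite (H m M) ?inE ?eqxx ?addbb.
rewrite rcons_cons /= => /andP[mc pX] H; rewrite big_cons (IH c) //.
  have -> : e m = w c; last by case: (e c) (w c) (w M) => [] [] [].
  apply: H; rewrite ?inE ?eqxx ?orbT // => u; rewrite inE => /orP[/eqP->|uX]; first by rewrite ltxx andbF.
  have := order_path_min lt_trans pX; rewrite all_rcons => /andP[_ /allP /(_ _ uX) cu].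
  by rewrite negb_and -!leNgt (ltW cu) orbT.
move=> a b ha hb ab hu; apply: H => //.
- by rewrite inE ha orbT.
- by rewrite inE hb orbT.
- move=> u; rewrite inE => /orP[/eqP->|]; last exact: hu.
  move: ha; rewrite inE => /orP[/eqP->|aX]; first by rewrite ltxx.
  have := order_path_min lt_trans pX; rewrite all_rcons => /andP[_ /allP /(_ _ aX) ca].
  by rewrite negb_and -!leNgt (ltW ca).
Qed.

Section grid.
Variables (R : realType) (W : finType) (s t : W -> W) (x z : W -> R).
Hypotheses (sK : cancel s t) (tK : cancel t s).
Hypotheses (xI : injective x) (zI : injective z) (sn : forall k, s k != k).
Local Notation T := (grid_trace s t x z).
Local Notation Fc := (comp_of T).
Local Notation rad := (rad x z).
Local Notation wallV := (wallV s t x z).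
Local Notation wallH := (wallH s t x z).
Local Notation quad := (quad s t x z).
Local Notation cross := (cross s t x z).
Implicit Types (p q : R * R) (k l : W) (d e : bool).

(** Parity of the number of vertical sides met by the ray going right from [p]; it will separate the
    two faces along a side. *)
Definition chi p := \big[addb/false]_(k : W)
  ((p.1 < x k) && ((p.2 < z k) (+) (p.2 < z (t k)))).

(** Summation by parts along the closed polygon turns the ray to the right into an upward one. The
    first form suits horizontal moves, this one vertical moves. *)
Lemma chiE p : chi p = \big[addb/false]_(k : W)
  ((p.2 < z k) && ((p.1 < x k) (+) (p.1 < x (s k)))).
Proof.
rewrite /chi; under eq_bigr do rewrite andb_addr; under [RHS]eq_bigr do rewrite andb_addr.
rewrite !big_split /=; congr (_ (+) _).
  by apply: eq_bigr => k _; rewrite andbC.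
rewrite (reindex_inj (can_inj sK)) /=.
by apply: eq_bigr => k _; rewrite sK andbC.
Qed.

Lemma chi_hor a a' b : (forall k, (a < x k) != (a' < x k) -> (b < z k) = (b < z (t k))) ->
  chi (a, b) = chi (a', b).
Proof.
move=> H; apply: eq_bigr => k _ /=; have := H k.
by case: (a < x k) (a' < x k) => [] [] //= ->; rewrite ?addbb.
Qed.

Lemma chi_ver a b b' : (forall k, (b < z k) != (b' < z k) -> (a < x k) = (a < x (s k))) ->
  chi (a, b) = chi (a, b').
Proof.
move=> H; rewrite !chiE; apply: eq_bigr => k _ /=; have := H k.
by case: (b < z k) (b' < z k) => [] [] //= ->; rewrite ?addbb.
Qed.

Lemma small_ltx p r k a : small x z p r -> x k != p.1 -> `|a - p.1| <= r ->
  (a < x k) = (p.1 < x k).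
Proof.
move=> sp n; rewrite ler_norml => /andP[h1 h2].
by case: (small_x3 k sp) n => [->|h3|h3] n; [rewrite eqxx in n| |]; apply/idP/idP => ?; lra.
Qed.

Lemma small_ltz p r k b : small x z p r -> z k != p.2 -> `|b - p.2| <= r ->
  (b < z k) = (p.2 < z k).
Proof.
move=> sp n; rewrite ler_norml => /andP[h1 h2].
by case: (small_z3 k sp) n => [->|h3|h3] n; [rewrite eqxx in n| |]; apply/idP/idP => ?; lra.
Qed.

Lemma nbtw_lt (a b c : R) : ~ btw a b c -> (c < a) = (c < b).
Proof.
move=> h; case: (ltP c a) => ca; case: (ltP c b) => cb //; exfalso; apply: h; rewrite /btw.
  by apply/orP; right; rewrite cb ltW.
by apply/orP; left; rewrite ca ltW.
Qed.

Lemma chi_near p q : ~ T p -> `|q.1 - p.1| <= rad p -> `|q.2 - p.2| <= rad p ->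
  chi q = chi p.
Proof.
case: p q => [p1 p2] [q1 q2] /= nT h1 h2; have sp := radP x z (p1, p2).
have r0 : 0 <= rad (p1, p2) by rewrite ltW // rad_gt0.
transitivity (chi (q1, p2)).
  apply: chi_ver => k; have [zk|zk] := eqVneq (z k) p2; last first.
    by rewrite (small_ltz sp (k := k) (b := q2)) // eqxx.
  move=> _; apply: nbtw_lt => B.
  apply: (@near_free _ _ _ _ _ _ _ (q1, p2) nT) => //=; first by rewrite subrr normr0.
  exact: onH_trace zk B.
apply: chi_hor => k; have [xk|xk] := eqVneq (x k) p1; last first.
  by rewrite (small_ltx sp (k := k) (a := q1)) // eqxx.
move=> _; apply/esym/nbtw_lt => B; apply: nT; exact: onV_trace xk B.
Qed.

(** The parity is locally constant off the trace: both level sets are open, so a connected set meets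
    only one of them. *)
Lemma chi_comp p q : ~ T p -> ~ T q -> Fc p = Fc q -> chi p = chi q.
Proof.
move=> nTp nTq E; apply/esym.
have oC b : open [set q | ~ T q /\ chi q = b].
  rewrite openE => u [nTu cu]; apply/nbhs_ballP; exists (rad u); first exact: rad_gt0.
  move=> v /ball_prodE[/ltW h1 /ltW h2]; split; first exact: near_free h1 h2.
  by rewrite -cu; exact: chi_near.
pose C := connected_component (~` T) p.
have H : connected C by exact: component_connected.
have subC v : C v -> ~ T v by exact: connected_component_sub.
have : [set q | C q /\ chi q = chi p] = C.
  apply: H.
  - by exists p; split => //; exact: connected_component_refl.
  - exists [set q | ~ T q /\ chi q = chi p]; first exact: oC.
    by apply/seteqP; split => v /= [Cv]; [split => //; split => //; exact: subC|case].
  - exists (~` [set q | ~ T q /\ chi q = ~~ chi p]); first exact/open_closedC/oC.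
    apply/seteqP; split => v /= [Cv cv]; split => //.
      by move=> [_]; rewrite cv; case: (chi p).
    apply: contrapT => ne; apply: cv; split; first exact: subC.
    by case: (chi v) (chi p) ne => [] [].
have Cq : C q by rewrite /C -/(Fc p) E; exact: connected_component_refl.
by move=> CE; move: Cq; rewrite -CE => -[].
Qed.

Lemma chi_flip_hor a a' b k0 : (forall k, k != k0 -> (a < x k) = (a' < x k)) ->
  (a < x k0) = ~~ (a' < x k0) -> (b < z k0) = ~~ (b < z (t k0)) -> chi (a, b) != chi (a', b).
Proof.
move=> H h1 h2; rewrite /chi [X in X != _](bigD1 k0) //= [X in _ != X](bigD1 k0) //= h1 h2.
rewrite (eq_bigr (fun k => (a' < x k) && ((b < z k) (+) (b < z (t k))))); last first.
  by move=> k kk; rewrite H.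
by case: (a' < x k0) (b < z (t k0)) (\big[_/_]_(_ | _) _) => [] [] [].
Qed.

Lemma chi_flip_ver a b b' k0 : (forall k, k != k0 -> (b < z k) = (b' < z k)) ->
  (b < z k0) = ~~ (b' < z k0) -> (a < x k0) = ~~ (a < x (s k0)) -> chi (a, b) != chi (a, b').
Proof.
move=> H h1 h2; rewrite !chiE [X in X != _](bigD1 k0) //= [X in _ != X](bigD1 k0) //= h1 h2.
rewrite (eq_bigr (fun k => (b' < z k) && ((a < x k) (+) (a < x (s k))))); last first.
  by move=> k kk; rewrite H.
by case: (b' < z k0) (a < x (s k0)) (\big[_/_]_(_ | _) _) => [] [] [].
Qed.

Lemma quad_point_free p d e : ~ T (sh d p.1 (rad p), sh e p.2 (rad p)).
Proof.
by apply: (quad_free (radP x z p) (d := d) (e := e)); rewrite /in_quad /= !sh_in_ray // rad_gt0.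
Qed.

Lemma sh_dist d (a r : R) : 0 < r -> `|sh d a r - a| = r.
Proof.
move=> r0; rewrite /sh; case: d; first by rewrite addrC addKr gtr0_norm.
by rewrite addrAC subrr add0r normrN gtr0_norm.
Qed.

Lemma btw_sh (a b c : R) e r : 0 < r -> btw a b (sh e c r) -> (a <> sh e c r) -> b <> sh e c r ->
  (sh e c r < b) = ~~ (sh e c r < a).
Proof.
move=> r0 /orP[] /andP[]; rewrite !le_eqVlt => /orP[/eqP->//|h1] /orP[/eqP->//|h2] _ _.
  by rewrite h2 -leNgt ltW.
by rewrite h2 ltNge ltW.
Qed.

(** Passing through the wall changes the parity, because by injectivity of [x] a single vertical
    side lies on this line. *)
Lemma wallV_quad p e : wallV p e -> quad p true e <> quad p false e.
Proof.
move=> w /(chi_comp (@quad_point_free _ _ _) (@quad_point_free _ _ _)); apply/eqP.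
have r0 := rad_gt0 x z p; have sp := radP x z p.
have [k [xk B]] := wallV_ray sp (sh_in_ray e p.2 r0) w.
have {}B := B _ (or_intror (sh_in_ray e p.2 r0)).
have nz l : z l <> sh e p.2 (rad p).
  move=> zl; have := sh_dist e p.2 r0; rewrite -zl => h.
  by have := small_z sp (eq_ind _ (fun u => u <= _) (lexx _) _ (esym h)) => h'; move: h; rewrite h' subrr normr0 => h; rewrite -h ltxx in r0.
apply: (@chi_flip_hor _ _ _ k).
- move=> l lk; have n : x l != p.1 by rewrite -xk; apply: contra lk => /eqP/xI ->.
  by rewrite !(small_ltx sp n) // sh_dist.
- by rewrite xk /sh; lra.
- exact: btw_sh r0 B (nz _) (nz _).
Qed.

Lemma wallH_quad p d : wallH p d -> quad p d true <> quad p d false.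
Proof.
move=> w /(chi_comp (@quad_point_free _ _ _) (@quad_point_free _ _ _)); apply/eqP.
have r0 := rad_gt0 x z p; have sp := radP x z p.
have [k [zk B]] := wallH_ray sp (sh_in_ray d p.1 r0) w.
have {}B := B _ (or_intror (sh_in_ray d p.1 r0)).
have nx l : x l <> sh d p.1 (rad p).
  move=> xl; have := sh_dist d p.1 r0; rewrite -xl => h.
  by have := small_x sp (eq_ind _ (fun u => u <= _) (lexx _) _ (esym h)) => h'; move: h; rewrite h' subrr normr0 => h; rewrite -h ltxx in r0.
apply: (@chi_flip_ver _ _ _ k).
- move=> l lk; have n : z l != p.2 by rewrite -zk; apply: contra lk => /eqP/zI ->.
  by rewrite !(small_ltz sp n) // sh_dist.
- by rewrite zk /sh; lra.
- by rewrite btwC in B; exact: btw_sh r0 B (nx _) (nx _).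
Qed.

Definition noncross p := forall k l, p = (x k, z l) -> ~~ cross k l.

Lemma sbtw_sh (a r u v : R) e : 0 < r -> gap a r u -> gap a r v -> sbtw u v a -> btw u v (sh e a r).
Proof.
move=> r0; rewrite /sbtw /btw /sh => gu gv /orP[] /andP[h1 h2]; apply/orP; [left|right].
  by case: gu => h3; case: gv => h4; case: e; apply/andP; split; lra.
by case: gu => h3; case: gv => h4; case: e; apply/andP; split; lra.
Qed.

Lemma sbtw_wallV k p e : x k = p.1 -> sbtw (z (t k)) (z k) p.2 -> wallV p e.
Proof.
move=> xk B; rewrite /Grid.wallV; apply: (onV_trace _ xk).
exact: sbtw_sh (rad_gt0 x z p) (small_z3 (t k) (radP x z p)) (small_z3 k (radP x z p)) B.
Qed.

Lemma sbtw_wallH k p d : z k = p.2 -> sbtw (x k) (x (s k)) p.1 -> wallH p d.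
Proof.
move=> zk B; rewrite /Grid.wallH; apply: (onH_trace _ zk).
exact: sbtw_sh (rad_gt0 x z p) (small_x3 k (radP x z p)) (small_x3 (s k) (radP x z p)) B.
Qed.

Lemma wallVP p e : wallV p e -> exists k, [/\ x k = p.1, btw (z (t k)) (z k) p.2 &
  btw (z (t k)) (z k) (sh e p.2 (rad p))].
Proof.
move=> w; have hr := sh_in_ray e p.2 (rad_gt0 x z p).
have [k [xk B]] := wallV_ray (radP x z p) hr w.
by exists k; split => //; apply: B; [left|right].
Qed.

Lemma wallHP p d : wallH p d -> exists k, [/\ z k = p.2, btw (x k) (x (s k)) p.1 &
  btw (x k) (x (s k)) (sh d p.1 (rad p))].
Proof.
move=> w; have hr := sh_in_ray d p.1 (rad_gt0 x z p).
have [k [xk B]] := wallH_ray (radP x z p) hr w.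
by exists k; split => //; apply: B; [left|right].
Qed.

Lemma tn k : t k != k.
Proof. by have := sn (t k); rewrite tK eq_sym. Qed.

(* The vertical side [k] has its ends on the rows [row k true] and [row k false];
   the other end of the row meeting it at the corner [(k, b)] is on the
   vertical side [nxt k b]. *)
Definition row k (b : bool) := if b then k else t k.
Definition nxt k (b : bool) := if b then s k else t k.
Definition corner k b := (x k, z (row k b)).
Definition dirV k b := z (row k b) < z (row k (~~ b)).
Definition dirH k b := x k < x (nxt k b).

Lemma sh_side (a b : R) d r : 0 < r -> r < `|b - a| -> btw a b (sh d a r) = (d == (a < b)).
Proof.
move=> r0; rewrite /btw /sh; case: (ltrgt0P (b - a)) => h hr; last by lra.
  have -> : a < b by lra.
  case: d; first by apply/orP; left; apply/andP; split; lra.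
  by apply/negbTE/negP => /orP[] /andP[h1 h2]; lra.
have -> : a < b = false by apply/negP => ?; lra.
case: d; last by apply/orP; right; apply/andP; split; lra.
by apply/negbTE/negP => /orP[] /andP[h1 h2]; lra.
Qed.

Lemma btw_row k b c : btw (z (t k)) (z k) c = btw (z (row k b)) (z (row k (~~ b))) c.
Proof. by case: b => //=; rewrite btwC. Qed.

Lemma corner_wallV k b e : wallV (corner k b) e <-> e = dirV k b.
Proof.
have sp := radP x z (corner k b); have r0 := rad_gt0 x z (corner k b).
have nz : z (row k (~~ b)) != (corner k b).2.
  by rewrite (inj_eq zI); case: (b); rewrite /= ?tn // eq_sym tn.
have hr : rad (corner k b) < `|z (row k (~~ b)) - z (row k b)| by case: sp => _ _; exact.
have E : btw (z (t k)) (z k) (sh e (corner k b).2 (rad (corner k b))) = (e == dirV k b).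
  by rewrite (btw_row k b) sh_side.
split=> [/wallVP[k' [/xI -> _]]|h]; first by rewrite E => /eqP.
by rewrite /Grid.wallV; apply: (@onV_trace _ _ _ _ _ _ k) => //; rewrite E h.
Qed.

Lemma corner_wallH k b d : wallH (corner k b) d <-> d = dirH k b.
Proof.
have sp := radP x z (corner k b); have r0 := rad_gt0 x z (corner k b).
have nx : x (nxt k b) != (corner k b).1.
  by rewrite (inj_eq xI); case: (b); rewrite /= ?sn // tn.
have hr : rad (corner k b) < `|x (nxt k b) - x k| by case: sp => _ + _; exact.
have E : btw (x (row k b)) (x (s (row k b))) (sh d (corner k b).1 (rad (corner k b))) = (d == dirH k b).
  have -> c : btw (x (row k b)) (x (s (row k b))) c = btw (x k) (x (nxt k b)) c.
    by case: (b) => //=; rewrite tK btwC.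
  by rewrite sh_side.
split=> [/wallHP[k' [/zI -> _]]|h]; first by rewrite E => /eqP.
by rewrite /Grid.wallH; apply: (@onH_trace _ _ _ _ _ _ (row k b)) => //; rewrite E h.
Qed.

(** Near such a point the trace is a piece of a straight line, or a corner with one arm in each
    direction. *)
Lemma noncross_walls p : T p -> noncross p ->
  [\/ (forall d, ~ wallH p d), (forall e, ~ wallV p e) |
   exists d e, ~ wallH p (~~ d) /\ ~ wallV p (~~ e)].
Proof.
have C k b : [\/ (forall d, ~ wallH (corner k b) d), (forall e, ~ wallV (corner k b) e) |
   exists d e, ~ wallH (corner k b) (~~ d) /\ ~ wallV (corner k b) (~~ e)].
  constructor 3; exists (dirH k b), (dirV k b); split.
    by move=> /corner_wallH; case: (dirH k b).
  by move=> /corner_wallV; case: (dirV k b).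
case: p => a c [k /orP[] /andP[/= /eqP E B]] nc.
  have [->|->|B'] := btwE B.
  - by rewrite E; exact: (C k false).
  - by rewrite E; exact: (C k true).
  constructor 1 => d /wallHP[l [/= zl B2 _]]; rewrite E in B2.
  have [/xI kl|/xI kl|B3] := btwE B2.
  - by move: B'; rewrite -zl kl /sbtw ltxx andbF.
  - by move: B'; rewrite -zl kl sK /sbtw ltxx andbF.
  - by have := nc k l; rewrite E zl => /(_ erefl)/negP; apply; rewrite /Grid.cross zl B' B3.
have [->|->|B'] := btwE B.
- by rewrite E; exact: (C k true).
- by have := C (s k) false; rewrite /corner /= sK E.
constructor 2 => e /wallVP[l [/= xl B2 _]]; rewrite E in B2.
have [/zI kl|/zI kl|B3] := btwE B2.
- by move: B'; rewrite -xl kl tK /sbtw ltxx andbF.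
- by move: B'; rewrite -xl kl /sbtw ltxx andbF.
- by have := nc l k; rewrite E xl => /(_ erefl)/negP; apply; rewrite /Grid.cross B3 xl B'.
Qed.

(** Quadrants merge across missing walls, so off crossings every face at [p] already occurs beside
    any given wall. *)
Lemma cover_V p e0 d e : T p -> noncross p -> wallV p e0 -> exists d', quad p d e = quad p d' e0.
Proof.
move=> Tp nc w; case: (noncross_walls Tp nc) => [nH|nV|[d1 [e1 [nH nV]]]].
- by exists d; exact: quad_H.
- by have := nV _ w.
- have -> : e0 = e1 by case: (e0) (e1) w nV => [] [] //.
  have [->|ne] := eqVneq e e1; first by exists d.
  have -> : e = ~~ e1 by case: (e) (e1) ne => [] [].
  by exists (~~ d1); rewrite (quad_V d (~~ d1)) //; exact: quad_H.
Qed.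

Lemma cover_H p d0 d e : T p -> noncross p -> wallH p d0 -> exists e', quad p d e = quad p d0 e'.
Proof.
move=> Tp nc w; case: (noncross_walls Tp nc) => [nH|nV|[d1 [e1 [nH nV]]]].
- by have := nH _ w.
- by exists e; exact: quad_V.
- have -> : d0 = d1 by case: (d0) (d1) w nH => [] [] //.
  have [->|ne] := eqVneq d d1; first by exists e.
  have -> : d = ~~ d1 by case: (d) (d1) ne => [] [].
  by exists (~~ e1); rewrite (quad_H e (~~ e1)) //; exact: quad_V.
Qed.

Local Notation adherent := (adherent s t x z).

(** A nearby point of the trace is on a wall of [p], and the two sides of this wall show all the
    faces at [p] by [cover_V] and [cover_H]. *)
Lemma adherent_near p q F : T p -> noncross p -> T q ->
  `|q.1 - p.1| < rad p -> `|q.2 - p.2| < rad p -> adherent q F <-> adherent p F.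
Proof.
case: q => [q1 q2] Tp nc Tq /= h1 h2.
have nsh d (a b : R) : `|b - a| < rad p -> b != sh d a (rad p).
  by move=> h; apply/eqP => E; move: h; rewrite E sh_dist ?ltxx // rad_gt0.
have [E1|n1] := eqVneq q1 p.1; have [E2|n2] := eqVneq q2 p.2.
- by rewrite E1 E2 -surjective_pairing.
- have [e0 he] := neq_ray n2 (ltW h2); rewrite E1 in Tq *.
  have w : wallV p e0 by apply: contrapT => w; exact: wallV_none he Tq.
  have Q d e : quad (p.1, q2) d e = quad p d e0 by apply: quad_on_V => //; exact: nsh.
  split=> [[d [e ->]]|[d [e ->]]]; first by exists d, e0.
  by have [d' ->] := cover_V d e Tp nc w; exists d', true.
- have [d0 hd] := neq_ray n1 (ltW h1); rewrite E2 in Tq *.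
  have w : wallH p d0 by apply: contrapT => w; exact: wallH_none hd Tq.
  have Q d e : quad (q1, p.2) d e = quad p d0 e by apply: quad_on_H => //; exact: nsh.
  split=> [[d [e ->]]|[d [e ->]]]; first by exists d0, e.
  by have [e' ->] := cover_H d e Tp nc w; exists true, e'.
- have [d hd] := neq_ray n1 (ltW h1); have [e he] := neq_ray n2 (ltW h2).
  exfalso; apply: (quad_free (radP x z p) (d := d) (e := e)) Tq.
  by rewrite /in_quad hd he.
Qed.

Lemma sbtw_mid (a b c c' u : R) : btw a b c -> btw a b c' -> c < u < c' -> sbtw a b u.
Proof.
rewrite /btw /sbtw => /orP[] /andP[h1 h2] /orP[] /andP[h3 h4] /andP[h5 h6];
  apply/orP; ((left; apply/andP; split; lra) || (right; apply/andP; split; lra)).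
Qed.

(** A path slightly beside the row could only be stopped by a vertical side reaching the row
    strictly between its ends, and such a side crosses the row. *)
Lemma row_step l c c' e : c < c' -> btw (x l) (x (s l)) c -> btw (x l) (x (s l)) c' ->
  (forall k, cross k l -> ~~ (c < x k < c')) ->
  quad (c, z l) true e = quad (c', z l) false e.
Proof.
move=> cc B B' nc.
pose m := Num.min ((c' - c) / 2) (Num.min (rad (c, z l)) (rad (c', z l))).
have m0 : 0 < m by rewrite !lt_min !rad_gt0 divr_gt0 // subr_gt0.
have mc : m <= (c' - c) / 2 by rewrite /m ge_min lexx.
have m1 : m <= rad (c, z l) by rewrite /m !ge_min lexx !orbT.
have m2 : m <= rad (c', z l) by rewrite /m !ge_min lexx !orbT.
rewrite -(@quadE _ _ _ _ _ _ (c, z l) (rad (c, z l)) true e (sh true c m, sh e (z l) m)); last 2 first.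
- exact: radP.
- by rewrite /in_quad !in_ray_sh.
rewrite -(@quadE _ _ _ _ _ _ (c', z l) (rad (c', z l)) false e (sh false c' m, sh e (z l) m)); last 2 first.
- exact: radP.
- by rewrite /in_quad !in_ray_sh.
apply: comp_of_hor => u hu.
have {hu} /andP[u1 u2] : c < u < c' by move: hu; rewrite /btw /sh => /orP[] /andP[h1 h2]; apply/andP; split; lra.
have hz := in_ray_sh e (z l) m0 m1; have [nz hz'] := in_ray_neq hz.
move=> [k /orP[] /andP[/= /eqP E Bk]]; last first.
  have := small_z (k := k) (radP x z (c, z l)); rewrite /= -E => /(_ hz') h.
  by rewrite E -h E eqxx in nz.
have Bz : btw (z (t k)) (z k) (z l).
  exact: ray_btw (small_z3 (t k) (radP x z (c, z l))) (small_z3 k (radP x z (c, z l))) hz (or_introl erefl) Bk.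
have Bx : sbtw (x l) (x (s l)) u by apply: sbtw_mid B B' _; rewrite u1 u2.
have nx1 : x l <> u by move=> h; move: Bx; rewrite h /sbtw ltxx andbF.
have nx2 : x (s l) <> u by move=> h; move: Bx; rewrite h /sbtw ltxx andbF.
have [/zI kl|/zI kl|Bz'] := btwE Bz.
- by apply: nx2; rewrite kl tK E.
- by apply: nx1; rewrite kl E.
by rewrite E in u1 u2 Bx; have := nc k; rewrite /Grid.cross Bz' Bx u1 u2 => /(_ isT).
Qed.

Lemma col_step k c c' d : c < c' -> btw (z (t k)) (z k) c -> btw (z (t k)) (z k) c' ->
  (forall l, cross k l -> ~~ (c < z l < c')) ->
  quad (x k, c) d true = quad (x k, c') d false.
Proof.
move=> cc B B' nc.
pose m := Num.min ((c' - c) / 2) (Num.min (rad (x k, c)) (rad (x k, c'))).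
have m0 : 0 < m by rewrite !lt_min !rad_gt0 divr_gt0 // subr_gt0.
have mc : m <= (c' - c) / 2 by rewrite /m ge_min lexx.
have m1 : m <= rad (x k, c) by rewrite /m !ge_min lexx !orbT.
have m2 : m <= rad (x k, c') by rewrite /m !ge_min lexx !orbT.
rewrite -(@quadE _ _ _ _ _ _ (x k, c) (rad (x k, c)) d true (sh d (x k) m, sh true c m)); last 2 first.
- exact: radP.
- by rewrite /in_quad !in_ray_sh.
rewrite -(@quadE _ _ _ _ _ _ (x k, c') (rad (x k, c')) d false (sh d (x k) m, sh false c' m)); last 2 first.
- exact: radP.
- by rewrite /in_quad !in_ray_sh.
apply: comp_of_ver => u hu.
have {hu} /andP[u1 u2] : c < u < c' by move: hu; rewrite /btw /sh => /orP[] /andP[h1 h2]; apply/andP; split; lra.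
have hx := in_ray_sh d (x k) m0 m1; have [nx hx'] := in_ray_neq hx.
move=> [l /orP[] /andP[/= /eqP E Bk]].
  have := small_x (k := l) (radP x z (x k, c)); rewrite /= -E => /(_ hx') h.
  by rewrite E -h E eqxx in nx.
have Bx : btw (x l) (x (s l)) (x k).
  exact: ray_btw (small_x3 l (radP x z (x k, c))) (small_x3 (s l) (radP x z (x k, c))) hx (or_introl erefl) Bk.
have Bz : sbtw (z (t k)) (z k) u by apply: sbtw_mid B B' _; rewrite u1 u2.
have nz1 : z k <> u by move=> h; move: Bz; rewrite h /sbtw ltxx andbF.
have nz2 : z (t k) <> u by move=> h; move: Bz; rewrite h /sbtw ltxx andbF.
have [/xI kl|/xI kl|Bx'] := btwE Bx.
- by apply: nz1; rewrite kl E.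
- by apply: nz2; rewrite kl sK E.
by rewrite E in u1 u2 Bz; have := nc l; rewrite /Grid.cross Bz Bx' u1 u2 => /(_ isT).
Qed.

End grid.

End Corner.
Export Corner.

(** * The parity of the number of sides *)

Module Strand.

Section grid.
Variables (R : realType) (W : finType) (s t : W -> W) (x z : W -> R).
Hypotheses (sK : cancel s t) (tK : cancel t s).
Hypotheses (xI : injective x) (zI : injective z) (sn : forall k, s k != k).
Local Notation T := (grid_trace s t x z).
Local Notation Fc := (comp_of T).
Local Notation rad := (rad x z).
Local Notation quad := (quad s t x z).
Local Notation cross := (cross s t x z).
Local Notation row := (row t).
Local Notation nxt := (nxt s t).
Local Notation corner := (corner t x z).
Local Notation dirV := (dirV t z).
Local Notation dirH := (dirH s t x).
Implicit Types (p q : R * R) (k l : W) (d e b : bool) (F : set (R * R)).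

(** How often, modulo 2, [F] occurs on the two sides of the strand leaving [p] horizontally in the
    direction [d]. *)
Definition sideH p d F := `[< quad p d true = F >] (+) `[< quad p d false = F >].
Definition sideV p e F := `[< quad p true e = F >] (+) `[< quad p false e = F >].

(** The faces beside a row do not change between consecutive crossings, so the sum telescopes to the
    two ends of the row. *)
Lemma sideH_row l F : \big[addb/false]_(k | cross k l)
    (sideH (x k, z l) true F (+) sideH (x k, z l) false F) =
  sideH (x l, z l) (x l < x (s l)) F (+) sideH (x (s l), z l) (x (s l) < x l) F.
Proof.
pose X := sort <=%R [seq x k | k <- enum W & cross k l].
have -> : \big[addb/false]_(k | cross k l)
    (sideH (x k, z l) true F (+) sideH (x k, z l) false F) =
  \big[addb/false]_(c <- X) (sideH (c, z l) true F (+) sideH (c, z l) false F).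
  rewrite (perm_big _ (permEl (perm_sort _ _))) /= big_map big_filter big_enum_cond.
  by apply: eq_bigl => k; rewrite inE.
have XE c : (c \in X) = [exists k, cross k l && (c == x k)].
  rewrite mem_sort; apply/mapP/existsP => [[k]|[k /andP[ck /eqP ->]]].
    by rewrite mem_filter => /andP[ck _] ->; exists k; rewrite ck eqxx.
  by exists k => //; rewrite mem_filter ck mem_enum.
have sX : sorted <%R X.
  rewrite sort_lt_sorted map_inj_uniq //; exact/filter_uniq/enum_uniq.
(* Both orientations of the row are treated through its left end [lo] and its right end [hi]. *)
have key lo hi : lo < hi -> (forall u, btw (x l) (x (s l)) u = (lo <= u <= hi)) ->
    (forall u, sbtw (x l) (x (s l)) u = (lo < u < hi)) ->
    \big[addb/false]_(c <- X) (sideH (c, z l) true F (+) sideH (c, z l) false F) =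
    sideH (lo, z l) true F (+) sideH (hi, z l) false F.
  move=> lh B SB; have BX u : u \in X -> lo < u < hi.
    by rewrite XE => /existsP[k /andP[/andP[_ ck] /eqP ->]]; rewrite -SB.
  apply: telescope.
    rewrite rcons_path; apply/andP; split.
      rewrite path_sortedE; last exact: lt_trans.
      by rewrite sX andbT; apply/allP => u /BX /andP[].
    by have := mem_last lo X; rewrite inE => /orP[/eqP->//|/BX/andP[]//].
  move=> c c' hc hc' cc hu.
  have Bc : btw (x l) (x (s l)) c.
    rewrite B; move: hc; rewrite inE => /orP[/eqP->|/BX/andP[/ltW-> /ltW->]//].
    by rewrite lexx ltW.
  have Bc' : btw (x l) (x (s l)) c'.
    rewrite B; move: hc'; rewrite mem_rcons inE => /orP[/eqP->|/BX/andP[/ltW-> /ltW->]//].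
    by rewrite lexx ltW.
  have nc k : cross k l -> ~~ (c < x k < c').
    by move=> ck; apply: hu; rewrite XE; apply/existsP; exists k; rewrite ck eqxx.
  by rewrite /sideH !(row_step tK zI (c' := c')).
have := sn l; rewrite -(inj_eq xI) neq_lt => /orP[] h.
  rewrite h (lt_gtF h) (key _ _ h) 1?addbC //= => u.
    by rewrite btwC /btw; apply/orP/idP => [[//|] /andP[]|->]; [lra|left].
  by rewrite sbtwC /sbtw; apply/orP/idP => [[//|] /andP[]|->]; [lra|left].
rewrite h (lt_gtF h) (key _ _ h) //= => u.
  by rewrite /btw; apply/orP/idP => [[//|] /andP[]|->]; [lra|left].
by rewrite /sbtw; apply/orP/idP => [[//|] /andP[]|->]; [lra|left].
Qed.

(** The face in the quadrant between the two arms of the corner; the three other quadrants merge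
    into one face, [cout]. Hence [omega] describes all of a corner modulo 2. *)
Definition cin k b := quad (corner k b) (dirH k b) (dirV k b).
Definition cout k b := quad (corner k b) (~~ dirH k b) (~~ dirV k b).
Definition omega k b F := `[< cin k b = F >] (+) `[< cout k b = F >].

Lemma quad_corner k b d e : quad (corner k b) d e =
  if (d == dirH k b) && (e == dirV k b) then cin k b else cout k b.
Proof.
have nV e' : e' != dirV k b -> ~ Grid.wallV s t x z (corner k b) e'.
  by move=> /eqP h /(corner_wallV tK xI zI sn).
have nH d' : d' != dirH k b -> ~ Grid.wallH s t x z (corner k b) d'.
  by move=> /eqP h /(corner_wallH tK xI zI sn).
have [->|hd] := eqVneq d; have [->|he] := eqVneq e => //=.
- rewrite (quad_V (dirH k b) (~~ dirH k b)); last exact: nV.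
  by congr quad; case: e (dirV k b) he => [] [].
- rewrite (quad_H (dirV k b) (~~ dirV k b)); last exact: nH.
  by congr quad; case: d (dirH k b) hd => [] [].
- by congr quad; [case: d (dirH k b) hd => [] []|case: e (dirV k b) he => [] []].
Qed.

Lemma sideH_corner k b F : sideH (corner k b) (dirH k b) F = omega k b F.
Proof.
by rewrite /sideH /omega !quad_corner eqxx /=; case: (dirV k b) => //=; rewrite addbC.
Qed.

Lemma sideV_corner k b F : sideV (corner k b) (dirV k b) F = omega k b F.
Proof.
by rewrite /sideV /omega !quad_corner eqxx !andbT; case: (dirH k b) => //=; rewrite addbC.
Qed.

Lemma sideH_row_corner l F : \big[addb/false]_(k | cross k l)
    (sideH (x k, z l) true F (+) sideH (x k, z l) false F) =
  omega l true F (+) omega (s l) false F.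
Proof.
rewrite sideH_row -!sideH_corner /Corner.corner /Corner.dirH /=; rewrite !sK //.
Qed.

Lemma free_row l F : (forall k, ~~ cross k l) -> omega l true F = omega (s l) false F.
Proof.
move=> nc; have := sideH_row_corner l F; rewrite big1 => [|k ck]; last by have := nc k; rewrite ck.
by case: (omega l true F) (omega (s l) false F) => [] [].
Qed.

Lemma free_col k F : (forall l, ~~ cross k l) -> omega k true F = omega k false F.
Proof.
move=> nc; rewrite -!sideV_corner.
have key c c' : c < c' -> btw (z (t k)) (z k) c -> btw (z (t k)) (z k) c' ->
    sideV (x k, c) true F = sideV (x k, c') false F.
  move=> cc B B'; have nc' l : cross k l -> ~~ (c < z l < c') by rewrite (negbTE (nc l)).
  by rewrite /sideV !(col_step sK xI _ cc B B' nc').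
have := tn tK sn k; rewrite -(inj_eq zI) neq_lt /Corner.corner /Corner.dirV /= => /orP[] h.
  by rewrite h (lt_gtF h) /=; apply/esym/key => //; [exact: btwl|exact: btwr].
by rewrite h (lt_gtF h) /=; apply/key => //; [exact: btwr|exact: btwl].
Qed.

(** This will be the number of sides of the face [F]; see [sides_card]. *)
Definition nquads F : nat := \sum_(k : W) \sum_(l | cross k l) \sum_(d : bool) \sum_(e : bool)
  `[< quad (x k, z l) d e = F >].

Lemma odd_sum (I : Type) (r : seq I) (P : pred I) (f : I -> nat) :
  odd (\sum_(i <- r | P i) f i) = \big[addb/false]_(i <- r | P i) odd (f i).
Proof. by apply: (big_morph odd oddD). Qed.

(** The four quadrants of a crossing are the two sides of its right strand and those of its left
    strand. Summing along rows leaves the corners at their ends, and reindexing along the link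
    regroups these corners by vertical sides. *)
Lemma odd_nquads F : odd (nquads F) =
  \big[addb/false]_(k : W) (omega k true F (+) omega k false F).
Proof.
rewrite /nquads odd_sum; under eq_bigr do rewrite odd_sum.
rewrite (exchange_big_dep predT) //= big_split /=.
rewrite [X in _ = _ (+) X](reindex_inj (can_inj sK)) -big_split /=.
apply: eq_bigr => l _; rewrite -sideH_row_corner; apply: eq_bigr => k _.
by rewrite !big_bool /= !oddD !oddb /sideH.
Qed.

Section cell.
Variables k1 k2 l1 l2 : W.
Hypotheses (x12 : x k1 < x k2) (z12 : z l1 < z l2).
Hypotheses (nox : forall k, ~~ (x k1 < x k < x k2)) (noz : forall l, ~~ (z l1 < z l < z l2)).
Hypothesis wV : forall v, z l1 <= v <= z l2 -> T (x k1, v) /\ T (x k2, v).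
Hypothesis wH : forall u, x k1 <= u <= x k2 -> T (u, z l1) /\ T (u, z l2).

(** A rectangle between neighbouring grid lines, all of whose four sides belong to the trace, is a
    whole face. *)
Definition cell : set (R * R) := [set p | x k1 < p.1 < x k2 /\ z l1 < p.2 < z l2].

Lemma cell_free p : cell p -> ~ T p.
Proof.
move=> [h1 h2] [k /orP[] /andP[/eqP E _]].
  by have := nox k; rewrite -E h1.
by have := noz k; rewrite -E h2.
Qed.

Lemma cell_comp p : cell p -> Fc p = cell.
Proof.
move=> cp; apply/seteqP; split=> [q Fq|[q1 q2] cq]; last first.
  suff -> : Fc p = Fc (q1, q2) by apply: connected_component_refl; exact: cell_free.
  case: p cp => p1 p2 [/= hp1 hp2]; case: cq => /= hq1 hq2.
  have mid (a b c d u : R) : a < c < b -> a < d < b -> btw c d u -> a < u < b.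
    by rewrite /btw => /andP[? ?] /andP[? ?] /orP[] /andP[? ?]; apply/andP; split; lra.
  transitivity (Fc (q1, p2)).
    by apply: comp_of_hor => u hu; apply: cell_free; split => //=; exact: mid hu.
  by apply: comp_of_ver => u hu; apply: cell_free; split => //=; exact: mid hu.
have cC : connected (Fc p) by exact: component_connected.
have nT : forall v, Fc p v -> ~ T v by exact: connected_component_sub.
suff : Fc p `&` cell = Fc p by move=> E; move: Fq; rewrite -E => -[].
apply: cC.
- by exists p; split => //; apply: connected_component_refl; exact: cell_free.
- exists cell => //.
  have -> : cell = (fst @^-1` `](x k1), (x k2)[%classic) `&` (snd @^-1` `](z l1), (z l2)[%classic).
    by apply/seteqP; split => v; rewrite /cell /= !in_itv.
  by apply: openI; apply: open_comp => //= ? _; [exact: cvg_fst|exact: cvg_snd].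
- exists ((fst @^-1` `[(x k1), (x k2)]%classic) `&` (snd @^-1` `[(z l1), (z l2)]%classic)).
    apply: closedI; apply: closed_comp; try exact: interval_closed.
      by move=> ? _; exact: cvg_fst.
    by move=> ? _; exact: cvg_snd.
  apply/seteqP; split => [[a b] [Fv [/=/andP[h1 h2] /andP[h3 h4]]]|[a b] [Fv]]; rewrite /= !in_itv /=.
    by split => //; rewrite !ltW.
  move=> [h1 h2]; split => //; have {}nT := nT _ Fv.
  split => /=.
    case/andP: (h1) => u1 u2; rewrite !lt_neqAle u1 u2 !andbT.
    apply/andP; split; apply/eqP => E; apply: nT; first by rewrite -E; case: (wV h2).
    by rewrite E; case: (wV h2).
  case/andP: (h2) => u1 u2; rewrite !lt_neqAle u1 u2 !andbT.
  apply/andP; split; apply/eqP => E; apply: nT; first by rewrite -E; case: (wH h1).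
  by rewrite E; case: (wH h1).
Qed.

Lemma quad_cell k l d e : (quad (x k, z l) d e = cell) <->
  k = (if d then k1 else k2) /\ l = (if e then l1 else l2).
Proof.
have X12 := x12; have Z12 := z12.
have sp := radP x z (x k, z l); have r0 := rad_gt0 x z (x k, z l).
split=> [E|[Ek El]]; last first.
  apply: cell_comp; split; rewrite /sh /=; move: (rad _) sp r0 => r sp r0.
    case: (small_x3 k1 sp) => /= h1; case: (small_x3 k2 sp) => /= h2;
      move: Ek h1 h2; case: (d) => -> /= h1 h2; apply/andP; split; lra.
  case: (small_z3 l1 sp) => /= h1; case: (small_z3 l2 sp) => /= h2;
    move: El h1 h2; case: (e) => -> /= h1 h2; apply/andP; split; lra.
have : cell (sh d (x k) (rad (x k, z l)), sh e (z l) (rad (x k, z l))).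
  by rewrite -E; apply: connected_component_refl; exact: quad_point_free.
case=> /= h1 h2; split.
  apply: xI; have := nox k; case: (small_x3 k1 sp) (small_x3 k2 sp) => /= h3 [] /= h4; move: h1 h3 h4; rewrite /sh;
    case: d {E} => /= /andP[h1 h1'] h3 h4 /negP h5; try lra; exfalso; try lra; apply: h5; apply/andP; split; lra.
apply: zI; have := noz l; case: (small_z3 l1 sp) (small_z3 l2 sp) => /= h3 [] /= h4; move: h2 h3 h4; rewrite /sh;
  case: e {E} => /= /andP[h1' h1''] h3 h4 /negP h5; try lra; exfalso; try lra; apply: h5; apply/andP; split; lra.
Qed.

(** Only the four corners can have a quadrant in the rectangle, and each has exactly one, which
    counts if the corner is a crossing. *)
Lemma nquads_cell : nquads cell =
  (cross k1 l1 + cross k1 l2 + (cross k2 l1 + cross k2 l2))%N.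
Proof.
have pick (a b : W) : (\sum_(k : W) \sum_(l | cross k l) ((k == a) && (l == b) : nat) = cross a b)%N.
  rewrite (bigD1 a) //= [X in (_ + X)%N]big1 ?addn0 => [|k /negbTE ka]; last first.
    by rewrite big1 // => l _; rewrite ka.
  have [c|c] := boolP (cross a b).
    rewrite (bigD1 b) //= !eqxx big1 ?addn0 // => l /andP[_ /negbTE ->].
    by rewrite andbF.
  rewrite big1 // => l cl; rewrite eqxx /=; case: eqP => // E.
  by rewrite E (negbTE c) in cl.
rewrite -!pick -!big_split /=; apply: eq_bigr => k _; rewrite -!big_split /=.
apply: eq_bigr => l _; rewrite !big_bool /=.
have E d e : `[< quad (x k, z l) d e = cell >] = (k == if d then k1 else k2) && (l == if e then l1 else l2).
  apply/asboolP/andP => [/quad_cell[-> ->]|[/eqP ? /eqP ?]]; first by rewrite !eqxx.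
  exact/quad_cell.
by rewrite !E.
Qed.

End cell.

End grid.

End Strand.
Export Strand.

Section steps.
Variables (R : realType) (W : finType) (s t : W -> W) (x z : W -> R).
Local Notation quad := (quad s t x z).
Local Notation rad := (rad x z).

(** In contrast to [row_step], the level [c] need not carry a side: it suffices that the columns in
    between miss it. *)
Lemma quad_hor a b c e : a < b -> (forall k, a < x k < b -> ~~ btw (z (t k)) (z k) c) ->
  quad (a, c) true e = quad (b, c) false e.
Proof.
move=> ab nc.
pose m := Num.min ((b - a) / 2) (Num.min (rad (a, c)) (rad (b, c))).
have m0 : 0 < m by rewrite !lt_min !rad_gt0 divr_gt0 // subr_gt0.
have mc : m <= (b - a) / 2 by rewrite /m ge_min lexx.
have m1 : m <= rad (a, c) by rewrite /m !ge_min lexx !orbT.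
have m2 : m <= rad (b, c) by rewrite /m !ge_min lexx !orbT.
rewrite -(@quadE _ _ _ _ _ _ (a, c) (rad (a, c)) true e (sh true a m, sh e c m)); last 2 first.
- exact: radP.
- by rewrite /in_quad !in_ray_sh.
rewrite -(@quadE _ _ _ _ _ _ (b, c) (rad (b, c)) false e (sh false b m, sh e c m)); last 2 first.
- exact: radP.
- by rewrite /in_quad !in_ray_sh.
apply: comp_of_hor => u hu.
have {hu} hu : a < u < b by move: hu; rewrite /btw /sh => /orP[] /andP[h1 h2]; apply/andP; split; lra.
have hz := in_ray_sh e c m0 m1; have [nz hz'] := in_ray_neq hz.
move=> [k /orP[] /andP[/= /eqP E Bk]]; last first.
  have := small_z (k := k) (radP x z (a, c)); rewrite /= -E => /(_ hz') h.
  by rewrite E -h E eqxx in nz.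
apply: (negP (nc k _)); first by rewrite -E.
exact: ray_btw (small_z3 (t k) (radP x z (a, c))) (small_z3 k (radP x z (a, c))) hz (or_introl erefl) Bk.
Qed.

Lemma quad_ver a b c d : a < b -> (forall l, a < z l < b -> ~~ btw (x l) (x (s l)) c) ->
  quad (c, a) d true = quad (c, b) d false.
Proof.
move=> ab nc.
pose m := Num.min ((b - a) / 2) (Num.min (rad (c, a)) (rad (c, b))).
have m0 : 0 < m by rewrite !lt_min !rad_gt0 divr_gt0 // subr_gt0.
have mc : m <= (b - a) / 2 by rewrite /m ge_min lexx.
have m1 : m <= rad (c, a) by rewrite /m !ge_min lexx !orbT.
have m2 : m <= rad (c, b) by rewrite /m !ge_min lexx !orbT.
rewrite -(@quadE _ _ _ _ _ _ (c, a) (rad (c, a)) d true (sh d c m, sh true a m)); last 2 first.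
- exact: radP.
- by rewrite /in_quad !in_ray_sh.
rewrite -(@quadE _ _ _ _ _ _ (c, b) (rad (c, b)) d false (sh d c m, sh false b m)); last 2 first.
- exact: radP.
- by rewrite /in_quad !in_ray_sh.
apply: comp_of_ver => u hu.
have {hu} hu : a < u < b by move: hu; rewrite /btw /sh => /orP[] /andP[h1 h2]; apply/andP; split; lra.
have hz := in_ray_sh d c m0 m1; have [nz hz'] := in_ray_neq hz.
move=> [k /orP[] /andP[/= /eqP E Bk]].
  have := small_x (k := k) (radP x z (c, a)); rewrite /= -E => /(_ hz') h.
  by rewrite E -h E eqxx in nz.
apply: (negP (nc k _)); first by rewrite -E.
exact: ray_btw (small_x3 k (radP x z (c, a))) (small_x3 (s k) (radP x z (c, a))) hz (or_introl erefl) Bk.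
Qed.

Lemma quad_off_V p d d' e : (forall k, x k != p.1) -> quad p d e = quad p d' e.
Proof.
move=> h; apply: quad_V => w.
have [k [xk _]] := wallV_ray (radP x z p) (sh_in_ray e p.2 (rad_gt0 x z p)) w.
by move: (h k); rewrite xk eqxx.
Qed.

End steps.

Lemma max0_continuous (R : realType) : continuous (fun t : R => Num.max 0 t).
Proof.
move=> t; apply/cvgrPdist_le => e e0; near=> y.
have : `|t - y| <= e by near: y; exact: cvgr_dist_le.
apply: le_trans; rewrite /Num.max.
by case: (ltP 0 t) => ?; case: (ltP 0 y) => ?; rewrite ler_norml; apply/andP;
  have := ler_norm (t - y); have := ler_norm (y - t); rewrite [`|y - t|]distrC; split; lra.
Unshelve. all: by end_near. Qed.

(** * Periodic parametrizations of the cycles of a permutation *)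

Section orbit.
Variables (E : finType) (S S' : E -> E).
Hypotheses (SK : cancel S S') (S'K : cancel S' S).

(** Integer iterates, the negative ones through the inverse [S'], so that curves can be parametrized
    by all reals. *)
Definition orb (e : E) (q : int) : E :=
  match q with Posz n => iter n S e | Negz n => iter n.+1 S' e end.

Lemma orbS e q : orb e (q + 1) = S (orb e q).
Proof.
case: q => [n|[|n]].
- by have -> : Posz n + 1 = Posz n.+1 by rewrite -addn1 PoszD.
- by have -> : Negz 0 + 1 = Posz 0 by []; rewrite /= S'K.
- have -> : Negz n.+1 + 1 = Negz n by rewrite !NegzE -[n.+2]addn1 PoszD opprD addrNK.
  by rewrite /= S'K.
Qed.

Lemma orbD e q (n : nat) : orb e (q + n%:Z) = iter n S (orb e q).
Proof.
elim: n => [|n IH]; first by rewrite addr0.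
by rewrite -addn1 PoszD addrA orbS IH addn1.
Qed.

Lemma iter_cancel n : cancel (iter n S) (iter n S').
Proof. by elim: n => // n IH x; rewrite iterSr /= SK IH. Qed.

Lemma orb_period e q (n : int) : orb e (q + n * (order S e)%:Z) = orb e q.
Proof.
have inj := can_inj SK.
have E1 p : orb e (p + (order S e)%:Z) = orb e p.
  rewrite addrC; case: p => n'; first by rewrite addrC orbD /= -iterD addnC iterD iter_order.
  have Sn k : iter k S (orb e (- k%:Z)) = e by rewrite -orbD addNr.
  rewrite NegzE; apply: (can_inj (iter_cancel n'.+1)); rewrite Sn -orbD addrNK.
  by rewrite /= iter_order.
have E2 k p : orb e (p + k%:Z * (order S e)%:Z) = orb e p.
  elim: k => [|k IH]; first by rewrite mul0r addr0.
  by rewrite -addn1 PoszD mulrDl mul1r addrA E1 IH.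
case: n => n; first exact: E2.
by rewrite NegzE mulNr -[LHS](E2 n.+1) subrK.
Qed.

Lemma orb_inj e q q' : 0 <= q < (order S e)%:Z -> 0 <= q' < (order S e)%:Z ->
  orb e q = orb e q' -> q = q'.
Proof.
case: q q' => [n|//] [n'|//] /andP[_ h] /andP[_ h'] /= nn; congr Posz.
by rewrite -(findex_iter h) -(findex_iter h') nn.
Qed.

Lemma orb_surj e y : fconnect S e y -> exists2 q, 0 <= q < (order S e)%:Z & orb e q = y.
Proof.
move=> h; exists (findex S e y)%:Z; last by rewrite /= iter_findex.
by rewrite /= ltz_nat findex_max.
Qed.

Lemma orb_fconnect e q : fconnect S e (orb e q).
Proof.
have inj := can_inj SK; case: q => n /=; first exact: fconnect_iter.
rewrite fconnect_sym //; have : iter n.+1 S (iter n.+1 S' e) = e.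
  elim: n.+1 => // k IH; by rewrite iterSr /= S'K.
by move=> {2}<-; exact: fconnect_iter.
Qed.

End orbit.

Section closed_polygon.
Variables (R : realType) (E : finType) (S S' : E -> E).
Hypotheses (SK : cancel S S') (S'K : cancel S' S).
Local Notation orb := (orb S S').

Definition seg (V : lmodType R) (u : E -> V) (e : E) (a : R) : V :=
  (1 - a) *: u e + a *: u (S e).

Variable e0 : E.
Local Notation m := (order S e0).

Let m0 : 0 < m%:R :> R. Proof. by rewrite ltr0n order_gt0. Qed.

(** At the parameter [s] the curve is on the edge leaving [node s], at the fraction [offset s] of
    it; a turn of [m] edges takes a parameter interval of length 1. *)
Definition node (s : R) : E := orb e0 (Num.floor (m%:R * s)).
Definition offset (s : R) : R := m%:R * s - (Num.floor (m%:R * s))%:~R.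

Lemma offset01 s : 0 <= offset s < 1.
Proof.
have := floor_itv (m%:R * s); rewrite /offset intrD => /andP[h1 h2].
by apply/andP; split; lra.
Qed.

Lemma node_at (q : int) (a : R) : 0 <= a < 1 ->
  node ((q%:~R + a) / m%:R) = orb e0 q /\ offset ((q%:~R + a) / m%:R) = a.
Proof.
move=> /andP[a0 a1]; have E1 : m%:R * ((q%:~R + a) / m%:R) = q%:~R + a.
  by rewrite mulrCA divff ?mulr1 // gt_eqF.
have F : Num.floor (q%:~R + a) = q.
  by apply: floor_def; rewrite intrD lerDl a0 ltrD2l.
by rewrite /node /offset E1 F addrAC subrr add0r.
Qed.

Lemma param_node s : s = ((Num.floor (m%:R * s))%:~R + offset s) / m%:R.
Proof. by rewrite /offset addrC subrK mulrC mulKf // gt_eqF. Qed.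

Lemma node_shift s : node (s + 1) = node s /\ offset (s + 1) = offset s.
Proof.
have -> : s + 1 = ((Num.floor (m%:R * s) + m%:Z)%:~R + offset s) / m%:R.
  rewrite {1}(param_node s) intrD (_ : m%:Z%:~R = m%:R) //.
  move: (_%:~R) (offset s) => F o; field; by rewrite gt_eqF.
have [-> ->] := node_at (Num.floor (m%:R * s) + m%:Z) (offset01 s); split => //.
by rewrite -[m%:Z]mul1r (orb_period SK S'K).
Qed.

Lemma node_inj s s' : 0 <= s < 1 -> 0 <= s' < 1 -> node s = node s' ->
  offset s = offset s' -> s = s'.
Proof.
move=> hs hs' ns os; rewrite (param_node s) (param_node s') os; congr ((_%:~R + _) / _).
have h (r : R) : 0 <= r < 1 -> 0 <= Num.floor (m%:R * r) < m%:Z.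
  move=> /andP[r0 r1]; rewrite floor_ge0 floor_lt_int; apply/andP; split.
    by rewrite mulr_ge0 // ltW.
  by rewrite -[ltRHS]mulr1 ltr_pM2l.
exact: orb_inj (h _ hs) (h _ hs') ns.
Qed.

Lemma node_ex e a : fconnect S e0 e -> 0 <= a < 1 ->
  exists2 s, 0 <= s < 1 & node s = e /\ offset s = a.
Proof.
move=> /orb_surj-/(_ S')[q /andP[q0 qm] <-] ha; have /andP[a0 a1] := ha.
exists ((q%:~R + a) / m%:R); last exact: node_at.
apply/andP; split; first by rewrite divr_ge0 ?addr_ge0 ?ler0z // ltW.
rewrite ltr_pdivrMr // mul1r.
have : (q + 1)%:~R <= m%:Z%:~R :> R by rewrite ler_int lezD1.
by rewrite intrD; move=> h; apply: lt_le_trans h; rewrite ltrD2l.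
Qed.

Lemma node_fconnect s : fconnect S e0 (node s).
Proof. exact: orb_fconnect. Qed.

Section curve.
Variables (V : normedModType R) (u : E -> V).

Definition polycurve s := seg u (node s) (offset s).

Lemma seg1 e : seg u e 1 = seg u (S e) 0.
Proof. by rewrite /seg subrr scale0r add0r scale1r subr0 scale1r scale0r addr0. Qed.

Lemma polycurve_at (q : int) (a : R) : 0 <= a <= 1 ->
  polycurve ((q%:~R + a) / m%:R) = seg u (orb e0 q) a.
Proof.
move=> /andP[a0]; rewrite le_eqVlt => /orP[/eqP->|a1].
  have -> : q%:~R + 1 = (q + 1)%:~R + 0 :> R by rewrite intrD addr0.
  rewrite /polycurve; have [|-> ->] := @node_at (q + 1) 0; first by rewrite lexx ltr01.
  by rewrite (orbS S'K) seg1.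
by rewrite /polycurve; have [|-> ->] := @node_at q a; first by rewrite a0.
Qed.

Lemma polycurve_period s : polycurve (s + 1) = polycurve s.
Proof. by rewrite /polycurve; have [-> ->] := node_shift s. Qed.

Lemma polycurve_polygonal : polygonal polycurve.
Proof.
exists m; first exact: order_gt0.
move=> k t t01; have P n : n%:R = n%:Z%:~R :> R by [].
rewrite P polycurve_at //.
rewrite -[k%:~R in RHS]addr0 -[k.+1%:R]addr0 (P k.+1) !polycurve_at ?lexx ?ler01 //.
rewrite -addn1 PoszD (orbS S'K) {2 3}/seg subr0 !scale1r !scale0r !addr0.
by [].
Qed.

Lemma polycurve_seg (q : int) (r : R) : q%:~R <= m%:R * r <= q%:~R + 1 ->
  polycurve r = seg u (orb e0 q) (m%:R * r - q%:~R).
Proof.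
move=> h; rewrite -polycurve_at; last by move: h => /andP[h1 h2]; apply/andP; split; lra.
by congr polycurve; rewrite addrC subrK mulrC mulKf // gt_eqF.
Qed.

(** Positive parts give a single formula valid on both sides of a vertex, from which continuity
    there is immediate. *)
Lemma polycurve_near (s : R) : let q := Num.floor (m%:R * s) in
  forall r : R, q%:~R - 1 < m%:R * r < q%:~R + 1 ->
  polycurve r = u (orb e0 q) + Num.max 0 (m%:R * r - q%:~R) *: (u (orb e0 (q + 1)) - u (orb e0 q))
    + Num.max 0 (q%:~R - m%:R * r) *: (u (orb e0 (q - 1)) - u (orb e0 q)).
Proof.
move=> q r /andP[h1 h2].
have [h|h] := leP (q%:~R) (m%:R * r).
  have -> : Num.max 0 (q%:~R - m%:R * r) = 0 by rewrite max_l // subr_le0.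
  have -> : Num.max 0 (m%:R * r - q%:~R) = m%:R * r - q%:~R by rewrite max_r // subr_ge0.
  rewrite (@polycurve_seg q) ?h ?(ltW h2) // scale0r addr0 /seg (orbS S'K).
  by rewrite scalerBl scale1r scalerBr addrAC addrA.
have -> : Num.max 0 (m%:R * r - q%:~R) = 0 by rewrite max_l // subr_le0 ltW.
have -> : Num.max 0 (q%:~R - m%:R * r) = q%:~R - m%:R * r by rewrite max_r // subr_ge0 ltW.
rewrite (@polycurve_seg (q - 1)) ?intrB; last by apply/andP; split; lra.
rewrite scale0r addr0 /seg -(orbS S'K) subrK.
have -> : 1 - (m%:R * r - (q%:~R - 1)) = q%:~R - m%:R * r by ring.
have -> : m%:R * r - (q%:~R - 1) = 1 - (q%:~R - m%:R * r) by ring.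
by move: (q%:~R - m%:R * r) => a; rewrite scalerBl scale1r scalerBr addrCA.
Qed.

Lemma polycurve_continuous : continuous polycurve.
Proof.
move=> s; set q := Num.floor (m%:R * s).
pose f r := u (orb e0 q) + Num.max 0 (m%:R * r - q%:~R) *: (u (orb e0 (q + 1)) - u (orb e0 q))
    + Num.max 0 (q%:~R - m%:R * r) *: (u (orb e0 (q - 1)) - u (orb e0 q)).
have /andP[s1 s2] := floor_itv (m%:R * s).
have mc : {for s, continuous (fun r : R => m%:R * r)} by apply: cvgMr; exact: cvg_id.
have maxc (g : R -> R) : {for s, continuous g} -> {for s, continuous (fun r => Num.max 0 (g r))}.
  move=> gc; apply: (@continuous_comp _ _ _ g (Num.max 0)) => //.
  exact: max0_continuous.
have fc : {for s, continuous f}.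
  apply: cvgD; first apply: cvgD; first exact: cvg_cst.
    by apply: cvgZr_tmp; apply: maxc; apply: cvgB => //; exact: cvg_cst.
  by apply: cvgZr_tmp; apply: maxc; apply: cvgB => //; exact: cvg_cst.
have near : \forall r \near s, q%:~R - 1 < m%:R * r < q%:~R + 1.
  have h1 : \forall r \near s, q%:~R - 1 < m%:R * r.
    by apply: (cvgr_gt _ mc); lra.
  have h2 : \forall r \near s, m%:R * r < q%:~R + 1.
    by apply: (cvgr_lt _ mc); move: s2; rewrite intrD.
  by near=> r; apply/andP; split; near: r.
have fs : f s = polycurve s.
  by rewrite (polycurve_near (s := s) (r := s)) //; rewrite intrD in s2; apply/andP; split; lra.
rewrite /continuous_at -fs; apply: cvg_trans fc.
apply: near_eq_cvg; near=> r; apply/esym/polycurve_near.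
by near: r.
Unshelve. all: by end_near. Qed.

Lemma affine_is_derive (A B : V) (s : R) : is_derive (s : R) (1 : R) (fun r : R => A + r *: B) B.
Proof.
have key : (fun h : R => h^-1 *: (((fun r : R => A + r *: B) \o shift s) (h *: 1) - (A + s *: B)))
    @ 0^' --> B.
  apply: (@cvg_trans _ (cst B @ (0:R)^')); last exact: cvg_cst.
  apply: near_eq_cvg; near=> h => /=.
  have h0 : h != 0 by near: h; exact: nbhs_dnbhs_neq.
  by rewrite opprD addrACA subrr add0r -scalerBl addrK [h *: 1]mulr1 scalerA mulVf // scale1r.
by apply: DeriveDef; [apply/cvg_ex; exists B|exact: cvg_lim key].
Unshelve. all: by end_near. Qed.

Lemma polycurve_derive s : 0 < offset s ->
  is_derive (s : R) (1 : R) polycurve (m%:R *: (u (S (node s)) - u (node s))).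
Proof.
set q := Num.floor (m%:R * s) => s0.
pose B := u (S (node s)) - u (node s); pose A := u (node s) - q%:~R *: B.
apply: (@near_eq_is_derive _ _ _ (fun r : R => A + r *: (m%:R *: B))); last exact: affine_is_derive.
have mc : {for s, continuous (fun r : R => m%:R * r)} by apply: cvgMr; exact: cvg_id.
have os : offset s = m%:R * s - q%:~R by [].
have /andP[_ s1] := offset01 s.
near=> r.
have hr : q%:~R <= m%:R * r <= q%:~R + 1.
  apply/andP; split; apply: ltW; near: r; [apply: (cvgr_gt _ mc)|apply: (cvgr_lt _ mc)]; lra.
rewrite (polycurve_seg hr) /seg -/(node s) /A /B scalerA [r * _]mulrC.
move: (m%:R * r) (u _) (u _) => y U U'.
rewrite -addrA -[- _ + _]addrC -scalerBl scalerBr [in RHS]scalerBl scale1r.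
by rewrite [RHS]addrAC addrA.
Unshelve. all: by end_near. Qed.

End curve.

End closed_polygon.

Section affine.
Variable R : realType.
Implicit Types a b c d : R.

Lemma affine_btw a c d : 0 <= a <= 1 -> btw c d ((1 - a) * c + a * d).
Proof.
move=> /andP[a0 a1]; have a1' : 0 <= 1 - a by lra.
rewrite /btw; have [cd|cd] := leP c d; apply/orP.
  left; apply/andP; have := ler_wpM2l a0 cd; have := ler_wpM2l a1' cd; split; lra.
right; apply/andP; have := ler_wpM2l a0 (ltW cd); have := ler_wpM2l a1' (ltW cd); split; lra.
Qed.

Lemma affine_inj a b c d : c != d -> (1 - a) * c + a * d = (1 - b) * c + b * d -> a = b.
Proof.
move=> cd h; have /eqP : (a - b) * (d - c) = 0 by lra.
by rewrite mulf_eq0 !subr_eq0 [d == c]eq_sym (negbTE cd) orbF => /eqP.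
Qed.

Lemma btw_affine c d v : btw c d v -> exists2 a, 0 <= a <= 1 & v = (1 - a) * c + a * d.
Proof.
have [->|cd] := eqVneq c d.
  by rewrite /btw => h; exists 0; [rewrite lexx ler01|move: h => /orP[] /andP[? ?]; lra].
have dc : d - c != 0 by rewrite subr_eq0 eq_sym.
move=> h; exists ((v - c) / (d - c)); last by field.
move: h; rewrite /btw => /orP[] /andP[h1 h2].
  have d0 : 0 < d - c by rewrite lt_neqAle eq_sym dc /=; lra.
  by rewrite divr_ge0 ?ler_pdivrMr ?(ltW d0) //= ?mul1r; lra.
have d0 : 0 < c - d by rewrite -opprB oppr_gt0 lt_neqAle dc /=; lra.
rewrite -[v - c]opprB -[d - c]opprB invrN mulrNN divr_ge0 ?ler_pdivrMr ?(ltW d0) //= ?mul1r; lra.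
Qed.

Lemma affine_sbtw a c d : sbtw c d ((1 - a) * c + a * d) -> 0 < a < 1.
Proof.
rewrite /sbtw => h; have [cd|cd|cd] := ltrgtP c d.
- have d0 : 0 < d - c by lra.
  rewrite -[ltLHS](mul0r (d - c)) -(ltr_pM2r d0) -[X in _ && X](ltr_pM2r d0).
  by move: h => /orP[] /andP[h1 h2]; apply/andP; split; lra.
- have d0 : 0 < c - d by lra.
  rewrite -[X in X && _](ltr_pM2r d0) -[X in _ && X](ltr_pM2r d0).
  by move: h => /orP[] /andP[h1 h2]; apply/andP; split; lra.
- by exfalso; rewrite cd in h; move: h => /orP[] /andP[h1 h2]; lra.
Qed.

End affine.

(** * The link diagram of a rectilinear polygon, and the count of the sides of its faces *)

Section diagram.
Variables (R : realType) (W : finType) (s t : W -> W) (x z : W -> R).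
Hypotheses (sK : cancel s t) (tK : cancel t s).
Hypotheses (xI : injective x) (zI : injective z) (sn : forall k, s k != k).
Local Notation T := (grid_trace s t x z).
Local Notation cross := (cross s t x z).

(** Corners in their order along the link: [(k, false)] and [(k, true)] are the start and the end of
    the vertical side [k], and the edge leaving [(k, true)] is the horizontal side [k]. *)
Definition gnext (e : W * bool) := if e.2 then (s e.1, false) else (e.1, true).
Definition gprev (e : W * bool) := if e.2 then (e.1, false) else (t e.1, true).
Lemma gnextK : cancel gnext gprev.
Proof. by move=> [k []]; rewrite /gnext /gprev /= ?sK. Qed.
Lemma gprevK : cancel gprev gnext.
Proof. by move=> [k []]; rewrite /gnext /gprev /= ?tK. Qed.

Definition gcorner (e : W * bool) : plane R := corner t x z e.1 e.2.

Variables (n : nat) (e0 : 'I_n -> W * bool).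
Hypothesis e0_surj : forall e, exists i, fconnect gnext (e0 i) e.
Hypothesis e0_inj : forall i j, fconnect gnext (e0 i) (e0 j) -> i = j.
Variable dep : W * bool -> R.
Definition gspace (e : W * bool) : space3 R := (gcorner e, dep e).
Hypothesis emb : embedded gnext gspace.

Definition gcurve (i : 'I_n) : R -> plane R := polycurve gnext gprev (e0 i) gcorner.
Definition gheight (i : 'I_n) : R -> R := polycurve gnext gprev (e0 i) dep.
Definition nd (X : 'I_n * R) := node gnext gprev (e0 X.1) X.2.
Definition off (X : 'I_n * R) := offset gnext (e0 X.1) X.2.

Lemma off01 X : 0 <= off X < 1. Proof. exact: offset01. Qed.
Lemma gcurveE X : gcurve X.1 X.2 = seg gnext gcorner (nd X) (off X).
Proof. by []. Qed.

Lemma segV k a : seg gnext gcorner (k, false) a = (x k, (1 - a) * z (t k) + a * z k).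
Proof.
by rewrite /seg /gcorner /= /corner /=; congr (_, _); rewrite /= /GRing.scale /=; ring.
Qed.

Lemma segH k a : seg gnext gcorner (k, true) a = ((1 - a) * x k + a * x (s k), z k).
Proof.
by rewrite /seg /gcorner /= /corner /=; congr (_, _); rewrite /= /GRing.scale /= ?sK; ring.
Qed.

Lemma zt k : z (t k) != z k. Proof. by rewrite (inj_eq zI) (tn tK sn). Qed.
Lemma xs k : x k != x (s k). Proof. by rewrite (inj_eq xI) eq_sym. Qed.

(** A common end of the two sides would be the far end of one of them, which half-open edges
    exclude; what remains is interior to both. *)
Lemma segVH k l a b : 0 <= a < 1 -> 0 <= b < 1 ->
  seg gnext gcorner (k, false) a = seg gnext gcorner (l, true) b ->
  [/\ cross k l, 0 < a < 1 & 0 < b < 1].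
Proof.
move=> /andP[a0 a1] /andP[b0 b1]; rewrite segV segH => -[E1 E2].
have Bz : btw (z (t k)) (z k) (z l) by rewrite -E2 affine_btw // a0 ltW.
have Bx : btw (x l) (x (s l)) (x k) by rewrite E1 affine_btw // b0 ltW.
have [/zI E|/zI E|Bz'] := btwE Bz.
- have : b = 1; last lra.
  by apply: (affine_inj (xs l)); rewrite -E1 E tK; ring.
- have : a = 1; last lra.
  by apply: (affine_inj (zt k)); rewrite E2 E; ring.
have [/xI E|/xI E|Bx'] := btwE Bx.
- by move: Bz'; rewrite E /sbtw ltxx andbF.
- by move: Bz'; rewrite E sK /sbtw ltxx andbF.
split; first by rewrite /Grid.cross Bz' Bx'.
  by apply: (@affine_sbtw _ _ (z (t k)) (z k)); rewrite E2.
by apply: (@affine_sbtw _ _ (x l) (x (s l))); rewrite -E1.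
Qed.

Lemma seg_cases e e' a b : 0 <= a < 1 -> 0 <= b < 1 ->
  seg gnext gcorner e a = seg gnext gcorner e' b ->
  (e = e' /\ a = b) \/ exists k l, [/\ cross k l, 0 < a < 1, 0 < b < 1,
    seg gnext gcorner e a = (x k, z l) &
    (e = (k, false) /\ e' = (l, true)) \/ (e = (l, true) /\ e' = (k, false))].
Proof.
case: e e' => [k []] [l []] ha hb E.
- left; move: E; rewrite !segH => -[E1 /zI E2]; subst l; split => //.
  exact: affine_inj (xs k) E1.
- right; exists l, k; have [h1 h2 h3] := segVH hb ha (esym E); split => //; last by right.
  by move: E; rewrite segV segH => -[-> _].
- right; exists k, l; have [h1 h2 h3] := segVH ha hb E; split => //; last by left.
  by move: E; rewrite segV segH => -[_ ->].
- left; move: E; rewrite !segV => -[/xI E2 E1]; subst l; split => //.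
  exact: affine_inj (zt k) E1.
Qed.

Lemma param_eq X Y : @circles R n X -> @circles R n Y -> nd X = nd Y -> off X = off Y -> X = Y.
Proof.
case: X Y => [i r] [j r'] /= hr hr' N O.
have ij : i = j.
  apply: e0_inj; have h1 := node_fconnect gnextK gprevK (e0 i) r.
  have h2 := node_fconnect gnextK gprevK (e0 j) r'.
  rewrite -/(nd (i, r)) N in h1; rewrite (fconnect_sym (can_inj gnextK)) in h2.
  exact: connect_trans h1 h2.
subst j; congr (_, _); exact: node_inj hr hr' N O.
Qed.

Lemma param_ex e a : 0 <= a < 1 -> exists X, [/\ @circles R n X, nd X = e & off X = a].
Proof.
move=> ha; have [i ie] := e0_surj e.
by have [r hr [N O]] := node_ex gprev ie ha; exists (i, r).
Qed.

Lemma double_pairP X Y : double_pair gcurve X Y -> exists k l,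
  [/\ cross k l, 0 < off X < 1, 0 < off Y < 1, gcurve X.1 X.2 = (x k, z l) &
    (nd X = (k, false) /\ nd Y = (l, true)) \/ (nd X = (l, true) /\ nd Y = (k, false))].
Proof.
move=> [cX cY XY E]; have := seg_cases (off01 X) (off01 Y) E => -[[N O]|[k [l [h1 h2 h3 h4 h5]]]].
  by exfalso; apply: XY; exact: param_eq.
by exists k, l.
Qed.

Lemma double_pairC X Y : double_pair gcurve X Y -> double_pair gcurve Y X.
Proof. by move=> [h1 h2 h3 h4]; split => //; exact: nesym. Qed.

Lemma cross_param k l : cross k l -> exists X Y, [/\ double_pair gcurve X Y,
  nd X = (k, false), nd Y = (l, true), gcurve X.1 X.2 = (x k, z l) & gcurve Y.1 Y.2 = (x k, z l)].
Proof.
move=> /andP[/[dup] Bz /sbtwW /btw_affine[a _ az] /[dup] Bx /sbtwW /btw_affine[b _ bx]].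
have /andP[a0 a1] : 0 < a < 1 by apply: (@affine_sbtw _ _ (z (t k)) (z k)); rewrite -az.
have /andP[b0 b1] : 0 < b < 1 by apply: (@affine_sbtw _ _ (x l) (x (s l))); rewrite -bx.
have [|X [cX NX OX]] := @param_ex (k, false) a; first by rewrite ltW.
have [|Y [cY NY OY]] := @param_ex (l, true) b; first by rewrite ltW.
have EX : gcurve X.1 X.2 = (x k, z l) by rewrite gcurveE NX OX segV -az.
have EY : gcurve Y.1 Y.2 = (x k, z l) by rewrite gcurveE NY OY segH -bx.
exists X, Y; split => //; split => //; last by rewrite EX EY.
by move=> XY; move: NX; rewrite XY NY.
Qed.

Lemma crossingP p : crossing gcurve p <-> exists k l, cross k l /\ p = (x k, z l).
Proof.
split=> [[X [Y [dXY <-]]]|[k [l [c ->]]]].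
  by have [k [l [c _ _ E _]]] := double_pairP dXY; exists k, l.
by have [X [Y [d _ _ E _]]] := cross_param c; exists X, Y.
Qed.

Lemma gcurve_closed : closed_curves gcurve.
Proof.
move=> i; split; first exact: (polycurve_continuous gprevK).
exact: (polycurve_period gnextK gprevK).
Qed.

Lemma gheight_closed : closed_curves gheight.
Proof.
move=> i; split; first exact: (polycurve_continuous gprevK).
exact: (polycurve_period gnextK gprevK).
Qed.

Lemma gcurve_polygonal i : polygonal (gcurve i).
Proof. exact: (polycurve_polygonal gprevK). Qed.

Lemma gcrossings_finite : finite_set (crossing gcurve).
Proof.
apply: (@sub_finite_set _ _ ((fun q : W * W => (x q.1, z q.2) : plane R) @` setT)).
  by move=> p /crossingP[k [l [_ ->]]]; exists (k, l).
apply: finite_image; exact: finite_finset.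
Qed.

Lemma gcrossings_double X Y Z : double_pair gcurve X Y -> double_pair gcurve X Z -> Y = Z.
Proof.
move=> dXY dXZ.
have [k [l [_ _ _ E h]]] := double_pairP dXY; have [k' [l' [_ _ _ E' h']]] := double_pairP dXZ.
have [kk ll] : k = k' /\ l = l' by move: E'; rewrite E => -[/xI -> /zI ->].
subst k' l'; have N : nd Y = nd Z.
  by case: h h' => -[-> ->] [] [] // [->] ->.
case: dXY dXZ => [_ cY _ EY] [_ cZ _ EZ].
apply: param_eq => //; move: EZ; rewrite EY !gcurveE N.
case: (nd Z) => [j []]; rewrite ?segH ?segV => -[].
  by move=> /(affine_inj (xs _)).
by move=> /(affine_inj (zt _)).
Qed.

Lemma gcrossings_transverse X Y : double_pair gcurve X Y -> transverse gcurve X Y.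
Proof.
move=> dXY; have [k [l [_ /andP[oX _] /andP[oY _] _ h]]] := double_pairP dXY.
have dX := polycurve_derive gprevK gcorner oX.
have dY := polycurve_derive gprevK gcorner oY.
have mX : (order gnext (e0 X.1))%:R != 0 :> R by rewrite pnatr_eq0 -lt0n order_gt0.
have mY : (order gnext (e0 Y.1))%:R != 0 :> R by rewrite pnatr_eq0 -lt0n order_gt0.
eexists; eexists; split; [exact: dX|exact: dY|].
have xz : z k - z (t k) != 0 by rewrite subr_eq0 eq_sym zt.
have xx : x (s l) - x l != 0 by rewrite subr_eq0 eq_sym xs.
rewrite -/(nd X) -/(nd Y).
case: h => -[-> ->]; rewrite /gcorner /= /corner /= /GRing.scale /= !subrr ?sK ?mulr0 ?mul0r ?subrr.
  by rewrite subr_eq0 eq_sym ?mulf_neq0.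
by rewrite subr0 !mulf_neq0.
Qed.

(** The crossing information is read off from the depths. They differ at a crossing, since equal
    depths would make the embedded polygon meet itself. *)
Definition gupper (X : 'I_n * R) : bool :=
  `[< exists Y, double_pair gcurve X Y /\ gheight Y.1 Y.2 < gheight X.1 X.2 >].

Lemma gupper_crossing X Y : double_pair gcurve X Y -> gupper X = ~~ gupper Y.
Proof.
move=> dXY; have dYX := double_pairC dXY.
have U P Q : double_pair gcurve P Q -> gupper P = (gheight Q.1 Q.2 < gheight P.1 P.2).
  move=> dPQ; apply/asboolP/idP => [[Q' [dPQ']]|h]; last by exists Q.
  by rewrite (gcrossings_double dPQ dPQ').
rewrite (U _ _ dXY) (U _ _ dYX) -leNgt le_eqVlt.
suff : gheight Y.1 Y.2 != gheight X.1 X.2 by move=> /negbTE ->.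
apply/eqP => E; case: dXY => cX cY XY EXY; apply: XY.
have E3 : pt gnext gspace (nd X) (off X) = pt gnext gspace (nd Y) (off Y).
  rewrite /pt /gspace; move: EXY E; rewrite /gheight /gcurve /polycurve -!/(nd _) -!/(off _) /seg.
  by move=> h1 h2; congr (_, _).
have /andP[x0 x1] := off01 X; have /andP[y0 y1] := off01 Y.
have [||[N O]|[_ h _]|[_ _ h]] := emb _ _ E3; rewrite ?x0 ?y0 ?ltW //; last 2 first.
- by rewrite h ltxx in x1.
- by rewrite h ltxx in y1.
exact: param_eq.
Qed.

Definition grid_diagram : link_diagram R n :=
  LinkDiagram gcurve_closed gcurve_polygonal gcrossings_finite gcrossings_double
    gcrossings_transverse gupper_crossing.

Lemma grid_diagram_of L : ambient_isotopic (polygon_trace gnext gspace) L ->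
  diagram_of grid_diagram L.
Proof.
move=> iso; exists gheight; split; first exact: gheight_closed.
  move=> X Y dXY /asboolP[Y' [dXY' h]].
  by rewrite (gcrossings_double dXY dXY').
have -> // : trace (fun i r => (gcurve i r, gheight i r)) = polygon_trace gnext gspace.
apply/seteqP; split=> [_ [i [r <-]]|_ [[e a] /= /andP[a0 a1] <-]].
  exists (nd (i, r), off (i, r)) => //=; have /andP[p0 p1] := off01 (i, r).
  by rewrite p0 ltW.
have key e' b : 0 <= b < 1 -> trace (fun i r => (gcurve i r, gheight i r)) (pt gnext gspace e' b).
  by move=> /param_ex-/(_ e')[[i r] [_ <- <-]]; exists i, r.
move: a1; rewrite le_eqVlt => /orP[/eqP->|a1]; last by apply: key; rewrite a0.
have -> : pt gnext gspace e 1 = pt gnext gspace (gnext e) 0 by exact: seg1.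
by apply: key; rewrite lexx ltr01.
Qed.

Lemma trace_gcurve : trace gcurve = T.
Proof.
apply/seteqP; split=> [_ [i [r <-]]|p].
  rewrite (gcurveE (i, r)); have /andP[p0 /ltW p1] := off01 (i, r).
  case: (nd (i, r)) => [k []]; rewrite ?segH ?segV; exists k; apply/orP; [right|left].
    by rewrite /onH /= eqxx affine_btw // p0.
  by rewrite /onV /= eqxx affine_btw // p0.
have key e b : 0 <= b < 1 -> trace gcurve (seg gnext gcorner e b).
  by move=> /param_ex-/(_ e)[[i r] [_ <- <-]]; exists i, r.
have key1 e b : 0 <= b <= 1 -> trace gcurve (seg gnext gcorner e b).
  move=> /andP[b0]; rewrite le_eqVlt => /orP[/eqP->|b1]; last by apply: key; rewrite b0.
  by rewrite seg1; apply: key; rewrite lexx ltr01.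
case: p => p1 p2 [k /orP[] /andP[/= /eqP -> /btw_affine[b hb ->]]].
  by rewrite -segV; exact: key1.
by rewrite -segH; exact: key1.
Qed.

Local Notation Fc := (comp_of T).
Local Notation rad := (rad x z).
Local Notation quad := (quad s t x z).
Local Notation adherent := (adherent s t x z).
Local Notation noncross := (noncross s t x z).

Lemma gcurve_shift i r (q : int) : gcurve i (r + q%:~R) = gcurve i r /\
  nd (i, r + q%:~R) = nd (i, r) /\ off (i, r + q%:~R) = off (i, r).
Proof.
have H r' (m : nat) : nd (i, r' + m%:R) = nd (i, r') /\ off (i, r' + m%:R) = off (i, r').
  elim: m => [|m [IH1 IH2]]; first by rewrite addr0.
  rewrite -natr1 addrA /nd /off /=; have [-> ->] := node_shift gnextK gprevK (e0 i) (r' + m%:R).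
  by split.
suff [N O] : nd (i, r + q%:~R) = nd (i, r) /\ off (i, r + q%:~R) = off (i, r).
  by rewrite N O (gcurveE (i, _)) (gcurveE (i, r)) N O.
case: q => m; first exact: H.
by have [<- <-] := H (r + (Negz m)%:~R) m.+1; rewrite NegzE mulrNz subrK.
Qed.

Definition frac (r : R) := r - (Num.floor r)%:~R.

Lemma frac01 r : 0 <= frac r < 1.
Proof. by have := floor_itv r; rewrite /frac intrD => /andP[h1 h2]; apply/andP; split; lra. Qed.

Lemma gcurve_frac i r : gcurve i (frac r) = gcurve i r /\
  nd (i, frac r) = nd (i, r) /\ off (i, frac r) = off (i, r).
Proof. by have := gcurve_shift i r (- Num.floor r); rewrite /frac mulrNz. Qed.

Lemma trace_param i r : T (gcurve i r).
Proof. by rewrite -trace_gcurve; exists i, r. Qed.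

Lemma noncross_inj i j r r' : ~ crossing gcurve (gcurve i r) -> gcurve i r = gcurve j r' ->
  i = j /\ frac r = frac r'.
Proof.
move=> nc E; have [E1 _] := gcurve_frac i r; have [E2 _] := gcurve_frac j r'.
have [[-> ->] //|ne] := pselect ((i, frac r) = (j, frac r')).
exfalso; apply: nc; exists (i, frac r), (j, frac r'); split => //; split => //; try exact: frac01.
by rewrite /= E1 E2.
Qed.

Lemma noncrossP i r : ~ crossing gcurve (gcurve i r) -> noncross (gcurve i r).
Proof. by move=> nc k l E; apply/negP => c; apply: nc; apply/crossingP; exists k, l. Qed.

(* A visit [(k, l, b)] is the passage through the crossing of the vertical side
   [k] and the horizontal side [l], along the latter when [b] is true. *)
Local Notation visit := (W * W * bool)%type.
Implicit Types v : visit.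
Definition visit_node v := if v.2 then (v.1.2, true) else (v.1.1, false).
Definition visit_point v := (x v.1.1, z v.1.2).
Definition valid v := cross v.1.1 v.1.2.

Lemma visit_ex : exists f : visit -> 'I_n * R, forall v, valid v ->
  [/\ @circles R n (f v), nd (f v) = visit_node v & gcurve (f v).1 (f v).2 = visit_point v].
Proof.
suff /choice[f Hf] : forall v, exists X, valid v ->
    [/\ @circles R n X, nd X = visit_node v & gcurve X.1 X.2 = visit_point v] by exists f.
move=> [[k l] b]; have [c|nc] := boolP (valid (k, l, b)); last first.
  by have [X _] := @param_ex (k, true) 0 (introT andP (conj (lexx 0) ltr01)); exists X.
have [X [Y [[cX cY _ _] NX NY EX EY]]] := @cross_param k l c.
by exists (if b then Y else X) => _; case: b c.
Qed.

Definition vparam := projT1 (cid visit_ex).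
Lemma vparamP v : valid v -> [/\ @circles R n (vparam v), nd (vparam v) = visit_node v &
  gcurve (vparam v).1 (vparam v).2 = visit_point v].
Proof. by rewrite /vparam; case: cid => f /= h; exact: h. Qed.

Lemma vparam_inj v v' : valid v -> valid v' -> vparam v = vparam v' -> v = v'.
Proof.
move=> /vparamP[_ N E] /vparamP[_ N' E'] VV.
move: N' E'; rewrite -VV N E; case: v v' {N E VV} => [[k l] b] [[k' l'] b'].
rewrite /visit_node /visit_point /= => + [/xI -> /zI ->].
by case: b b' => [] [].
Qed.

Lemma visit_of i r : crossing gcurve (gcurve i r) -> exists v, [/\ valid v,
  vparam v = (i, frac r), nd (i, r) = visit_node v, gcurve i r = visit_point v & 0 < off (i, r) < 1].
Proof.
have [E1 [E2 E3]] := gcurve_frac i r; rewrite -E1 -E2 -E3 => /crossingP[k [l [c E]]].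
pose X := (i, frac r); have cX : @circles R n X := frac01 r.
have [b N] : exists b, nd X = visit_node (k, l, b).
  have [P [Q [dPQ NP NQ EP EQ]]] := cross_param c.
  have [XP|XP] := pselect (X = P); first by exists false; rewrite XP.
  have dPX : double_pair gcurve P X by case: dPQ => cP cQ _ _; split => //; [exact: nesym|rewrite EP E].
  by exists true; rewrite -(gcrossings_double dPQ dPX).
have V : valid (k, l, b) by [].
have [cv Nv Ev] := vparamP V.
exists (k, l, b).
have VX : vparam (k, l, b) = X.
  apply: contrapT => ne; have d : double_pair gcurve (vparam (k, l, b)) X by split => //; rewrite Ev E.
  have [k' [l' [_ _ _ _]]] := double_pairP d; rewrite N Nv.
  by case: (b) => -[] [] //= [->] [].
split => //; apply/andP.
have [P [Q [dPQ NP NQ EP EQ]]] := cross_param c.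
have [k' [l' [_ h1 h2 _ _]]] := double_pairP dPQ.
have : X = P \/ X = Q.
  have [XP|XP] := pselect (X = P); first by left.
  have dPX : double_pair gcurve P X by case: dPQ => cP cQ _ _; split => //; [exact: nesym|rewrite EP E].
  by right; rewrite (gcrossings_double dPQ dPX).
by rewrite -/X => -[->|->]; exact/andP.
Qed.

(** Parameters of successive crossings on one component, that is the two ends of an edge of the
    diagram. *)
Definition consec i a b := [/\ a < b, crossing gcurve (gcurve i a), crossing gcurve (gcurve i b)
  & forall r, a < r < b -> ~ crossing gcurve (gcurve i r)].

Lemma consec_shift i a b (q : int) : consec i (a + q%:~R) (b + q%:~R) -> consec i a b.
Proof.
have E r : gcurve i (r + q%:~R) = gcurve i r by case: (gcurve_shift i r q).
move=> [h1 h2 h3 h4]; rewrite !E in h2 h3; split => //; first by move: h1; rewrite ltrD2r.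
by move=> r hr; rewrite -E; apply: h4; rewrite !ltrD2r.
Qed.

Lemma seq_min (C : seq R) : C != [::] -> exists2 b, b \in C & forall c, c \in C -> b <= c.
Proof.
elim: C => // c [|c' C] IH _; first by exists c; rewrite ?inE // => c'; rewrite inE => /eqP ->.
have [//|b bC hb] := IH; have [cb|cb] := leP c b.
  exists c; first by rewrite inE eqxx.
  by move=> d; rewrite inE => /orP[/eqP->//|/hb]; exact: le_trans.
exists b; first by rewrite inE bC orbT.
by move=> d; rewrite inE => /orP[/eqP->|/hb//]; exact: ltW.
Qed.

(** All crossing parameters in [-1, 2): enough periods to find the neighbours on both sides of a
    parameter in [0, 1). *)
Definition cand i : seq R := [seq (vparam v).2 + q |
  v <- [seq v <- enum {: visit} | valid v && ((vparam v).1 == i)], q <- [:: -1; 0; 1]].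

Lemma candP i r : r \in cand i -> crossing gcurve (gcurve i r).
Proof.
move=> /allpairsP[[v q] /= []]; rewrite mem_filter => /andP[/andP[c /eqP <-] _] hq ->.
have [_ _ E] := vparamP c.
have [q' ->] : exists q' : int, q = q'%:~R.
  by move: hq; rewrite !inE => /or3P[] /eqP ->; [exists (-1); rewrite mulrNz|exists 0|exists 1].
have [-> _] := gcurve_shift (vparam v).1 (vparam v).2 q'; rewrite E; apply/crossingP.
by exists v.1.1, v.1.2.
Qed.

Lemma cand_mem i r : -1 <= r < 2 -> crossing gcurve (gcurve i r) -> r \in cand i.
Proof.
move=> /andP[r1 r2] /visit_of[v [c E _ _ _]]; apply/allpairsP.
exists (v, (Num.floor r)%:~R) => /=; split.
- by rewrite mem_filter c E eqxx mem_enum.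
- have : -1 <= Num.floor r < 2 by rewrite floor_ge_int floor_lt_int mulrNz r1.
  by case: (Num.floor r) => [[|[|m]]|[|m]] //= _; rewrite !inE ?eqxx ?orbT // mulrNz eqxx.
- by rewrite E /frac subrK.
Qed.

(** By periodicity [a + 1] is again a crossing parameter, so the finite list of later candidates is
    not empty; its least element is the next crossing. *)
Lemma next_ex i a : 0 <= a < 1 -> crossing gcurve (gcurve i a) -> exists b, consec i a b.
Proof.
move=> /andP[a0 a1] ca; pose C := [seq r <- cand i | a < r].
have C1 : a + 1 \in C.
  rewrite mem_filter ltrDl ltr01 cand_mem //; first by apply/andP; split; lra.
  by have [-> _] := gcurve_shift i a 1.
have [|b] := @seq_min C; first by apply/eqP => E; rewrite E in C1.
rewrite mem_filter => /andP[ab bc] hb; exists b; split => //; first exact: candP.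
move=> r /andP[ar rb] cr; have : r \in C.
  by rewrite mem_filter ar cand_mem //; have := hb _ C1; move=> h; apply/andP; split; lra.
by move=> /hb; rewrite leNgt rb.
Qed.

Lemma prev_ex i b : 0 <= b < 1 -> crossing gcurve (gcurve i b) -> exists a, consec i a b.
Proof.
move=> /andP[b0 b1] cb; pose C := [seq - r | r <- cand i & r < b].
have C1 : - (b - 1) \in C.
  apply/map_f; rewrite mem_filter cand_mem ?ltrBlDr ?ltrDl ?ltr01 //; first by apply/andP; split; lra.
  by have := gcurve_shift i b (-1); rewrite mulrNz => -[-> _].
have [|a'] := @seq_min C; first by apply/eqP => E; rewrite E in C1.
move=> /mapP[a]; rewrite mem_filter => /andP[ab ac] -> ha; exists a; split => //; first exact: candP.
move=> r /andP[ar rb] cr; have : - r \in C.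
  by apply/map_f; rewrite mem_filter rb cand_mem //; have := ha _ C1; move=> h; apply/andP; split; lra.
by move=> /ha; rewrite lerN2 leNgt ar.
Qed.

(** By [adherent_near] the faces touching the curve are locally constant between two crossings;
    [segment_constant] concludes. *)
Lemma adherent_consec i a b (u v : R) F : consec i a b -> a < u -> u <= v -> v < b ->
  adherent (gcurve i u) F <-> adherent (gcurve i v) F.
Proof.
move=> [_ _ _ nc] au uv vb.
have loc r : u <= r <= v -> exists2 e, 0 < e & forall r', u <= r' <= v -> `|r - r'| < e ->
    adherent (gcurve i r) F <-> adherent (gcurve i r') F.
  move=> /andP[ur rv]; have ncr : ~ crossing gcurve (gcurve i r) by apply: nc; apply/andP; split; lra.
  have [cont _] := gcurve_closed i.
  have /nbhs_ballP[e ep He] := cont r _ (nbhsx_ballx _ _ (rad_gt0 x z (gcurve i r))).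
  exists e => // r' _ rr'; have /ball_prodE[h1 h2] := He r' rr'.
  apply: iff_sym; exact: (adherent_near sK tK xI zI sn F (trace_param i r) (noncrossP ncr) (trace_param i r') h1 h2).
split; first exact: segment_constant uv loc.
move=> Av; apply: contrapT => nAu; move: Av.
apply: (@segment_constant _ u v (fun r => ~ adherent (gcurve i r) F)) => // r /loc[e ep He].
by exists e => // r' h1 h2; have := He r' h1 h2; tauto.
Qed.

(* The faces at both sides of the strand leaving ([d] true) or entering a crossing. *)
Definition strand_faces v (d : bool) F :=
  if v.2 then exists e, F = quad (visit_point v) ((x v.1.2 < x (s v.1.2)) == d) e
  else exists e, F = quad (visit_point v) e ((z (t v.1.1) < z v.1.1) == d).

Lemma strand_adherent v d F : strand_faces v d F -> adherent (visit_point v) F.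
Proof. by rewrite /strand_faces; case: v.2 => -[e ->]; [exists ((x v.1.2 < x (s v.1.2)) == d), e|exists e, ((z (t v.1.1) < z v.1.1) == d)]. Qed.

Lemma small_step (m o D r h : R) : 0 < m -> 0 < o < 1 -> 0 < r -> 0 < h ->
  exists e, [/\ 0 < e < h, m * e < o, m * e < 1 - o & m * e * `|D| < r].
Proof.
move=> m0 /andP[p0 p1] r0 h0; have D0 : 0 < m * `|D| + 1 by rewrite ltr_wpDl // mulr_ge0 // ltW.
pose f (i : 'I_4) := nth 0 [:: h; o / m; (1 - o) / m; r / (m * `|D| + 1)] i.
have [|e ep He] := @fin_lower R _ f.
  by move=> [[|[|[|[|i]]]] hi] //; rewrite /f /= ?divr_gt0 ?subr_gt0.
exists e; split.
- by rewrite ep; have := He (inord 0); rewrite /f inordK.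
- by have := He (inord 1); rewrite /f inordK //= ltr_pdivlMr // mulrC.
- by have := He (inord 2); rewrite /f inordK //= ltr_pdivlMr // mulrC.
- have := He (inord 3); rewrite /f inordK //= ltr_pdivlMr // mulrDr mulr1 => h1.
  by rewrite (mulrC m e) -mulrA; lra.
Qed.

(** Shortly after or before a crossing the curve runs along a wall of it, beside which there are
    only two of the four quadrants. *)
Lemma strand_near i a v d h : valid v -> nd (i, a) = visit_node v ->
  gcurve i a = visit_point v -> 0 < off (i, a) < 1 -> 0 < h ->
  exists2 e, 0 < e < h & forall F, adherent (gcurve i (sh d a e)) F <-> strand_faces v d F.
Proof.
move=> c N P ho h0; set m : R := (order gnext (e0 i))%:R.
have m0 : 0 < m by rewrite ltr0n order_gt0.
set q := Num.floor (m * a); have ofE : off (i, a) = m * a - q%:~R by [].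
have Q r : q%:~R <= m * r <= q%:~R + 1 -> gcurve i r = seg gnext gcorner (visit_node v) (m * r - q%:~R).
  by move=> hr; rewrite /gcurve (polycurve_seg gprevK _ hr) -N.
have mr e : m * sh d a e - q%:~R = sh d (off (i, a)) (m * e).
  by rewrite ofE /sh; case: (d); ring.
move: P; rewrite (gcurveE (i, a)) N; set w := off (i, a) in ho ofE mr *.
have r0 := rad_gt0 x z (visit_point v); have /andP[w0 w1] := ho.
have shm e : 0 < e -> m * e < w -> m * e < 1 - w -> q%:~R <= m * sh d a e <= q%:~R + 1.
  move=> ep h1 h2; have me := mulr_gt0 m0 ep.
  have := mr e; rewrite /sh; case: (d) => E; apply/andP; split; lra.
case: v c N Q r0 => [[k l] b]; rewrite /visit_node /visit_point /strand_faces /=.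
case: b => c N Q r0.
  rewrite segH => -[Ex].
  have [e [he h1 h2 h3]] := small_step (x (s l) - x l) m0 ho r0 h0.
  have /andP[ep _] := he; have me := mulr_gt0 m0 ep.
  exists e => // F; rewrite (Q _ (shm e ep h1 h2)) mr segH.
  set y := (1 - sh d w (m * e)) * x l + sh d w (m * e) * x (s l).
  have yE : y = x k + (if d then m * e else - (m * e)) * (x (s l) - x l).
    by rewrite /y -Ex /sh; case: (d); ring.
  have [ry ny] : in_ray ((x l < x (s l)) == d) (x k) (rad (x k, z l)) y /\
      y != sh ((x l < x (s l)) == d) (x k) (rad (x k, z l)).
    have := xs l; rewrite neq_lt yE /in_ray /sh => /orP[] hx; rewrite ?hx ?(lt_gtF hx).
      have hd : 0 < x (s l) - x l by lra.
      rewrite gtr0_norm // in h3; have := mulr_gt0 me hd.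
      by case: (d) => /= h4; (split; [apply/andP; split; lra|rewrite neq_lt; apply/orP; (left; lra) || (right; lra)]).
    have hd : 0 < x l - x (s l) by lra.
    rewrite distrC gtr0_norm // in h3; have := mulr_gt0 me hd.
    by case: (d) => /= h4; (split; [apply/andP; split; lra|rewrite neq_lt; apply/orP; (left; lra) || (right; lra)]).
  have QQ d' e' := @quad_on_H _ _ s t x z (x k, z l) _ _ d' e' ry ny.
  split=> [[d' [e' ->]]|[e' ->]]; first by exists e'; rewrite -(QQ d').
  by exists true, e'; rewrite -(QQ true).
rewrite segV => -[Ez].
have [e [he h1 h2 h3]] := small_step (z k - z (t k)) m0 ho r0 h0.
have /andP[ep _] := he; have me := mulr_gt0 m0 ep.
exists e => // F; rewrite (Q _ (shm e ep h1 h2)) mr segV.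
set y := (1 - sh d w (m * e)) * z (t k) + sh d w (m * e) * z k.
have yE : y = z l + (if d then m * e else - (m * e)) * (z k - z (t k)).
  by rewrite /y -Ez /sh; case: (d); ring.
have [ry ny] : in_ray ((z (t k) < z k) == d) (z l) (rad (x k, z l)) y /\
    y != sh ((z (t k) < z k) == d) (z l) (rad (x k, z l)).
  have := zt k; rewrite neq_lt yE /in_ray /sh => /orP[] hx; rewrite ?hx ?(lt_gtF hx).
    have hd : 0 < z k - z (t k) by lra.
    rewrite gtr0_norm // in h3; have := mulr_gt0 me hd.
    by case: (d) => /= h4; (split; [apply/andP; split; lra|rewrite neq_lt; apply/orP; (left; lra) || (right; lra)]).
  have hd : 0 < z (t k) - z k by lra.
  rewrite distrC gtr0_norm // in h3; have := mulr_gt0 me hd.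
  by case: (d) => /= h4; (split; [apply/andP; split; lra|rewrite neq_lt; apply/orP; (left; lra) || (right; lra)]).
have QQ d' e' := @quad_on_V _ _ s t x z (x k, z l) _ _ d' e' ry ny.
split=> [[d' [e' ->]]|[e' ->]]; first by exists d'; rewrite -(QQ _ e').
by exists e', true; rewrite -(QQ _ true).
Qed.

Definition arc i (a b : R) := gcurve i @` [set r | a <= r <= b].

Lemma boundary_adherent p q : T p -> ~ T q -> boundary (Fc q) p <-> adherent p (Fc q).
Proof.
move=> Tp nTq; rewrite -(closure_adherent Tp nTq); split=> [[]//|cl]; split => //.
by move=> /interior_subset /connected_component_sub.
Qed.

(** If one interior point of an edge touches the face then the whole edge does, so the condition can
    be tested just after its start or just before its end. *)
Lemma arc_faces i a b v v' q : consec i a b -> ~ T q ->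
  valid v -> nd (i, a) = visit_node v -> gcurve i a = visit_point v -> 0 < off (i, a) < 1 ->
  valid v' -> nd (i, b) = visit_node v' -> gcurve i b = visit_point v' -> 0 < off (i, b) < 1 ->
  (arc i a b `<=` boundary (Fc q) <-> strand_faces v true (Fc q)) /\
  (arc i a b `<=` boundary (Fc q) <-> strand_faces v' false (Fc q)).
Proof.
move=> cs nTq c N P ho c' N' P' ho'; have [ab _ _ _] := cs.
have h0 : 0 < (b - a) / 2 by rewrite divr_gt0 // subr_gt0.
have [e /andP[e_0 e_1] He] := @strand_near i a v true _ c N P ho h0.
have [f /andP[f_0 f_1] Hf] := @strand_near i b v' false _ c' N' P' ho' h0.
rewrite /sh in He Hf.
have step : strand_faces v true (Fc q) <-> strand_faces v' false (Fc q).
  by rewrite -He -Hf; apply: (adherent_consec _ cs); lra.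
have fwd : arc i a b `<=` boundary (Fc q) -> strand_faces v true (Fc q).
  move=> sub; apply/He/(boundary_adherent (trace_param _ _) nTq)/sub.
  by exists (a + e) => //=; apply/andP; split; lra.
have bwd : strand_faces v true (Fc q) -> arc i a b `<=` boundary (Fc q).
  move=> G _ [r /andP[ar rb] <-]; apply/(boundary_adherent (trace_param _ _) nTq).
  move: ar rb; rewrite !le_eqVlt => /orP[/eqP <- _|ar /orP[/eqP ->|rb]].
  - by rewrite P; exact: strand_adherent G.
  - by rewrite P'; apply: strand_adherent (proj1 step G).
  - have [re|re] := leP (a + e) r.
      by apply/(adherent_consec _ cs _ re rb); [lra|exact/He].
    by apply/(adherent_consec _ cs ar (ltW re)); [lra|exact/He].
by split; split => // G; [apply/step/fwd|apply/bwd/step].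
Qed.

Lemma consec_next i a b b' : consec i a b -> consec i a b' -> b = b'.
Proof.
move=> [h1 _ h2 h3] [h4 _ h5 h6]; apply: contrapT => /eqP; rewrite neq_lt => /orP[] h.
  by apply: (h6 b) => //; rewrite h1.
by apply: (h3 b') => //; rewrite h4.
Qed.

Lemma consec_prev i a a' b : consec i a b -> consec i a' b -> a = a'.
Proof.
move=> [h1 h2 _ h3] [h4 h5 _ h6]; apply: contrapT => /eqP; rewrite neq_lt => /orP[] h.
  by apply: (h3 a') => //; rewrite h4 h.
by apply: (h6 a) => //; rewrite h1 h.
Qed.

Lemma arc_shift i a b (q : int) : arc i (a + q%:~R) (b + q%:~R) = arc i a b.
Proof.
have E r : gcurve i (r + q%:~R) = gcurve i r by case: (gcurve_shift i r q).
apply/seteqP; split=> [_ [r hr <-]|_ [r hr <-]]; last first.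
  by exists (r + q%:~R) => //=; move: hr; rewrite /= !lerD2r.
exists (r - q%:~R); first by move: hr; rewrite /= lerBrDr lerBlDr.
by rewrite -[in RHS](subrK q%:~R r) E.
Qed.

(** The middle of the first arc is not a crossing, so its parameter is unique up to integers. The
    ends are then determined as the neighbouring crossings. *)
Lemma arc_inj i a b i' a' b' : consec i a b -> consec i' a' b' -> arc i a b = arc i' a' b' ->
  i = i' /\ exists q : int, a' = a + q%:~R /\ b' = b + q%:~R.
Proof.
move=> cs cs' E; have [ab ca cb nc] := cs; have [ab' ca' cb' nc'] := cs'.
have : arc i a b (gcurve i ((a + b) / 2)) by exists ((a + b) / 2) => //=; apply/andP; split; lra.
have ncu : ~ crossing gcurve (gcurve i ((a + b) / 2)) by apply: nc; apply/andP; split; lra.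
move: ncu; set u := (a + b) / 2 => ncu; rewrite E => -[u' /andP[au ub] E'].
have [ii fr] := noncross_inj ncu (esym E'); subst i'; split => //.
have {au ub} /andP[au ub] : a' < u' < b'.
  by rewrite !lt_neqAle au ub !andbT; apply/andP; split; apply/eqP => h; apply: ncu; rewrite -E' -?h // h.
pose q : int := Num.floor u' - Num.floor u; exists q.
have uu : u' = u + q%:~R by rewrite /q intrB; move: fr; rewrite /frac; lra.
have Eq r : gcurve i (r + q%:~R) = gcurve i r by case: (gcurve_shift i r q).
have aa : a' = a + q%:~R.
  apply: contrapT => /eqP; rewrite neq_lt => /orP[] h.
    by apply: (nc' (a + q%:~R)); [apply/andP; split; rewrite // /u in uu *; lra|rewrite Eq].
  apply: (nc (a' - q%:~R)); first by apply/andP; split; rewrite /u in uu *; lra.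
  by rewrite -Eq subrK.
split => //; apply: (consec_next cs'); rewrite aa; split; rewrite ?Eq // ?ltrD2r //.
by move=> r hr; rewrite -[r](subrK q%:~R) Eq; apply: nc; rewrite ltrBlDr ltrBrDr.
Qed.

Lemma int01 (a : R) (q : int) : 0 <= a < 1 -> 0 <= a + q%:~R < 1 -> q = 0.
Proof.
move=> /andP[h1 h2] /andP[h3 h4].
have h5 : -1 < q by rewrite -(ltr_int R) mulrNz mulr1z; lra.
have h6 : q < 1 by rewrite -(ltr_int R) mulr1z; lra.
by move: h5 h6; clear; case: q => [[|?]|[|?]].
Qed.

Lemma exists_next : exists f : visit -> R, forall v, valid v -> consec (vparam v).1 (vparam v).2 (f v).
Proof.
suff /choice[f Hf] : forall v, exists b, valid v -> consec (vparam v).1 (vparam v).2 b by exists f.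
move=> v; have [c|nc] := boolP (valid v); last by exists 0.
have [cc _ E] := vparamP c.
have [|b] := @next_ex (vparam v).1 (vparam v).2 cc; last by exists b.
by rewrite E; apply/crossingP; exists v.1.1, v.1.2.
Qed.

Lemma exists_prev : exists f : visit -> R, forall v, valid v -> consec (vparam v).1 (f v) (vparam v).2.
Proof.
suff /choice[f Hf] : forall v, exists b, valid v -> consec (vparam v).1 b (vparam v).2 by exists f.
move=> v; have [c|nc] := boolP (valid v); last by exists 0.
have [cc _ E] := vparamP c.
have [|b] := @prev_ex (vparam v).1 (vparam v).2 cc; last by exists b.
by rewrite E; apply/crossingP; exists v.1.1, v.1.2.
Qed.

Definition strand_set (d : bool) F := [set v : visit | valid v && `[< strand_faces v d F >]]%SET.

Lemma card_image_finset (I : finType) (T' : Type) (f : I -> T') (A : {set I}) :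
  {in A &, injective f} -> (f @` [set i | i \in A]%classic #= `I_#|A|)%card.
Proof.
move=> fI; have [A0|[i0 i0A]] := set_0Vmem A.
  rewrite A0 cards0 II0 card_eq0; apply/eqP/seteqP.
  by split => // y [i]; rewrite /= inE.
pose g k := f (nth i0 (enum A) k).
have -> : f @` [set i | i \in A]%classic = g @` `I_#|A|.
  apply/seteqP; split=> [_ [i /= iA <-]|_ [k /= kA <-]].
    exists (index i (enum A)); first by rewrite /= cardE index_mem mem_enum.
    by rewrite /g nth_index // mem_enum.
  by exists (nth i0 (enum A) k) => //=; rewrite -mem_enum mem_nth // -cardE.
have M j : (j < #|A|)%N -> nth i0 (enum A) j \in A.
  by move=> hj; rewrite -mem_enum mem_nth // -cardE.
apply: inj_card_eq => k k'; rewrite !inE /= => hk hk' /fI.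
by move=> /(_ (M _ hk) (M _ hk'))/eqP; rewrite nth_uniq -?cardE ?enum_uniq // => /eqP.
Qed.

Local Notation D := grid_diagram.

(** Every edge begins with exactly one strand leaving a crossing, and borders the face exactly when
    this strand does. *)
Lemma sides_out q : ~ T q -> (sides D (Fc q) #= `I_#|strand_set true (Fc q)|)%card.
Proof.
move=> nTq; have [f Hf] := exists_next.
have -> : sides D (Fc q) = (fun v => arc (vparam v).1 (vparam v).2 (f v)) @`
    [set v | v \in strand_set true (Fc q)]%classic.
  apply/seteqP; split=> [e [[i [a [b [ab [ca cb] nc E]]]] sub]|_ [v + <-]].
    have cs : consec i a b by [].
    have [v [c V N P ho]] := visit_of ca; have [v' [c' V' N' P' ho']] := visit_of cb.
    have [H _] := arc_faces cs nTq c N P ho c' N' P' ho'.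
    have EA : e = arc i a b := E.
    exists v.
      by rewrite /= inE c; apply/asboolP/H; rewrite -EA.
    have sE r : r = frac a + (r - frac a) by rewrite addrC subrK.
    have cs2 : consec i (frac a) (b - (Num.floor a)%:~R).
      by apply: (@consec_shift _ _ _ (Num.floor a)); rewrite /frac !subrK.
    have := Hf v c; rewrite V /= => cs3; rewrite (consec_next cs3 cs2) EA.
    by rewrite -(arc_shift _ _ _ (Num.floor a)) /frac !subrK.
  rewrite /= inE => /andP[c /asboolP G]; have cs := Hf v c; have [h1 h2 h3 h4] := cs.
  have [v1 [c1 V1 N1 P1 ho1]] := visit_of h2; have [v' [c' V' N' P' ho']] := visit_of h3.
  have [cc N P] := vparamP c.
  have [H _] := arc_faces cs nTq c N P ho1 c' N' P' ho'.
  split; last exact/H.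
  by exists (vparam v).1, (vparam v).2, (f v).
apply: card_image_finset => v v'; rewrite !inE => /andP[c _] /andP[c' _].
move=> /(arc_inj (Hf v c) (Hf v' c'))[E1 [p [E2 _]]].
have [cc _ _] := vparamP c; have [cc' _ _] := vparamP c'.
have p0 : p = 0 by apply: (int01 cc); rewrite -E2.
apply: vparam_inj => //; rewrite p0 addr0 in E2.
by case: (vparam v) (vparam v') E1 E2 => ? ? [? ?] /= -> ->.
Qed.

Lemma sides_in q : ~ T q -> (sides D (Fc q) #= `I_#|strand_set false (Fc q)|)%card.
Proof.
move=> nTq; have [f Hf] := exists_prev.
have -> : sides D (Fc q) = (fun v => arc (vparam v).1 (f v) (vparam v).2) @`
    [set v | v \in strand_set false (Fc q)]%classic.
  apply/seteqP; split=> [e [[i [a [b [ab [ca cb] nc E]]]] sub]|_ [v + <-]].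
    have cs : consec i a b by [].
    have [v [c V N P ho]] := visit_of ca; have [v' [c' V' N' P' ho']] := visit_of cb.
    have [_ H] := arc_faces cs nTq c N P ho c' N' P' ho'.
    have EA : e = arc i a b := E.
    exists v'.
      by rewrite /= inE c'; apply/asboolP/H; rewrite -EA.
    have cs2 : consec i (a - (Num.floor b)%:~R) (frac b).
      by apply: (@consec_shift _ _ _ (Num.floor b)); rewrite /frac !subrK.
    have := Hf v' c'; rewrite V' /= => cs3; rewrite (consec_prev cs3 cs2) EA.
    by rewrite -(arc_shift _ _ _ (Num.floor b)) /frac !subrK.
  rewrite /= inE => /andP[c /asboolP G]; have cs := Hf v c; have [h1 h2 h3 h4] := cs.
  have [v1 [c1 V1 N1 P1 ho1]] := visit_of h3; have [v' [c' V' N' P' ho']] := visit_of h2.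
  have [cc N P] := vparamP c.
  have [_ H] := arc_faces cs nTq c' N' P' ho' c N P ho1.
  split; last exact/H.
  by exists (vparam v).1, (f v), (vparam v).2.
apply: card_image_finset => v v'; rewrite !inE => /andP[c _] /andP[c' _].
move=> /(arc_inj (Hf v c) (Hf v' c'))[E1 [p [_ E2]]].
have [cc _ _] := vparamP c; have [cc' _ _] := vparamP c'.
have p0 : p = 0 by apply: (int01 cc); rewrite -E2.
apply: vparam_inj => //; rewrite p0 addr0 in E2.
by case: (vparam v) (vparam v') E1 E2 => ? ? [? ?] /= -> ->.
Qed.

Lemma strand_setE d F : #|strand_set d F| =
  (\sum_(k : W) \sum_(l | cross k l) \sum_(b : bool) `[< strand_faces (k, l, b) d F >])%N.
Proof.
rewrite pair_big_dep /= pair_big_dep /= /strand_set cardsE -sum1_card.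
transitivity (\sum_(v : visit | valid v && `[< strand_faces v d F >]) 1)%N; first exact: eq_bigl.
rewrite big_mkcondr /=; apply: eq_big => [[[k l] b]|[[k l] b] _] /=; last by case: `[< _ >].
by rewrite /valid /= ?andbT.
Qed.

Lemma asbool_or (P Q : Prop) : ~ (P /\ Q) -> (`[< P \/ Q >] = `[< P >] + `[< Q >] :> nat)%N.
Proof.
move=> nPQ; have [p|np] := pselect P.
  have -> : `[< Q >] = false by apply/asboolPn => q; apply: nPQ.
  by rewrite (asboolT p) (asboolT (or_introl p)).
rewrite (asboolF np); congr nat_of_bool; apply/asbool_equiv_eq.
by split=> [[]|]//; right.
Qed.

(** Each quadrant of a crossing lies between two of its four strands. The two quadrants beside a
    strand are in different faces by [wallV_quad] and [wallH_quad], so no strand has [F] on both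
    sides. *)
Lemma strand_sum F : (#|strand_set true F| + #|strand_set false F| = 2 * nquads s t x z F)%N.
Proof.
rewrite !strand_setE /nquads -big_split big_distrr; apply: eq_bigr => k _ /=.
rewrite -big_split big_distrr; apply: eq_bigr => l /andP[c1 c2] /=.
rewrite !big_bool /= /strand_faces /= /visit_point /=; set p := (x k, z l).
have wV e : quad p true e <> quad p false e.
  by apply: (wallV_quad sK xI); exact: (@sbtw_wallV _ _ s t x z k).
have wH d : quad p d true <> quad p d false.
  by apply: (wallH_quad sK zI); exact: (@sbtw_wallH _ _ s t x z l).
have EV e : (`[< exists d, F = quad p d e >] = `[< quad p true e = F >] + `[< quad p false e = F >] :> nat)%N.
  rewrite -asbool_or; last by case=> h1 h2; apply: (wV e); rewrite h1 h2.
  congr nat_of_bool; apply/asbool_equiv_eq; split; last by case=> <-; [exists true|exists false].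
  by case=> -[] ->; [left|right].
have EH d : (`[< exists e, F = quad p d e >] = `[< quad p d true = F >] + `[< quad p d false = F >] :> nat)%N.
  rewrite -asbool_or; last by case=> h1 h2; apply: (wH d); rewrite h1 h2.
  congr nat_of_bool; apply/asbool_equiv_eq; split; last by case=> <-; [exists true|exists false].
  by case=> -[] ->; [left|right].
rewrite !EV !EH; case: (x l < x (s l)); case: (z (t k) < z k) => /=; ring.
Qed.

(** Leaving strands and entering strands both count the sides, so the number of sides is half of the
    sum in [strand_sum]. *)
Lemma sides_card q : ~ T q -> (sides D (Fc q) #= `I_(nquads s t x z (Fc q)))%card.
Proof.
move=> nTq; have S1 := sides_out nTq; have S2 := sides_in nTq.
have E : #|strand_set true (Fc q)| = #|strand_set false (Fc q)|.
  by apply/card_eq_II; apply: card_eq_trans S2; rewrite card_eq_sym.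
have := strand_sum (Fc q); rewrite -E addnn -mul2n => /eqP; rewrite eqn_mul2l /= => /eqP <-.
exact: S1.
Qed.

Lemma gon_nquads m q : ~ T q -> gon D m (Fc q) <-> m = nquads s t x z (Fc q).
Proof.
move=> nTq; have S := sides_card nTq; split=> [[_ h]|->].
  by apply/card_eq_II; apply: card_eq_trans S; rewrite card_eq_sym.
by split => //; exists q; rewrite /= trace_gcurve.
Qed.

Lemma odd_sided_grid : odd_sided_faces D =
  [set F | exists2 q, ~ T q & F = Fc q /\ odd (nquads s t x z (Fc q))].
Proof.
apply/seteqP; split=> [F [m om [[q + FE] h]]|_ [q nTq [-> om]]].
  rewrite /= trace_gcurve => nTq; exists q => //.
  have FE' : F = Fc q by rewrite FE /= trace_gcurve.
  rewrite FE' in h *; split => //.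
  have -> // : nquads s t x z (Fc q) = m.
  by apply/esym/(gon_nquads m nTq); split => //; exists q; rewrite /= trace_gcurve.
by exists (nquads s t x z (Fc q)) => //; apply/gon_nquads.
Qed.

End diagram.

(** * Sliding the ends of the tokens *)

(** Will be applied to the distances of the two ends of a moving edge to a fixed line which the edge
    does not pass. *)
Lemma convex_zero (R : realFieldType) (b P Q : R) : 0 <= b -> 0 < 1 - b -> 0 <= P -> 0 <= Q ->
  (0 < Q \/ (0 < P /\ b = 0)) -> (1 - b) * P + b * Q = 0 -> b = 0 /\ (0 < P -> False).
Proof.
move=> b0 b1' P0 Q0 H0 hPQ; have h1 := mulr_ge0 (ltW b1') P0; have h2 := mulr_ge0 b0 Q0.
have E1 : (1 - b) * P = 0 by lra.
have E2 : b * Q = 0 by lra.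
move/eqP: E1; rewrite mulf_eq0 (gt_eqF b1') /= => /eqP P00.
move/eqP: E2; rewrite mulf_eq0 => /orP[/eqP ->|/eqP Q00]; first by split => //; lra.
by case: H0; lra.
Qed.

Section config.
Variables (R : realType) (N T : nat) (e nb : nat -> nat) (s t : 'I_N -> 'I_N).
Hypotheses (T0 : (0 < T)%N) (e_0 : e 0 = 0%N) (e_T : e T = N).
Hypothesis e_S : forall i, (i < T)%N -> (e i + 14 <= e i.+1)%N.
Hypothesis nb_lt : forall i, (i < T)%N -> (nb i < T)%N.
Hypothesis nb_inj : forall i i', (i < T)%N -> (i' < T)%N -> nb i = nb i' -> i = i'.
Hypothesis nb_next : forall i, (i < T)%N -> nb i = i.+1 \/
  (nb i <= i)%N /\ forall i', (i < i' < T)%N -> (i < nb i')%N.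
Hypotheses (sK : cancel s t) (tK : cancel t s).
Hypothesis s_end : forall (k : 'I_N) i, (i < T)%N -> k.+1 = e i.+1 -> s k = e (nb i) :> nat.
Hypothesis s_next : forall (k : 'I_N), (forall i, (i < T)%N -> k.+1 <> e i.+1) -> s k = k.+1 :> nat.

Lemma e_le i j : (i <= j)%N -> (j <= T)%N -> (e i <= e j)%N.
Proof.
elim: j => [|j IH]; first by rewrite leqn0 => /eqP ->.
rewrite leq_eqVlt => /orP[/eqP->//|ij] jT.
have := IH ij (ltnW jT); have := e_S jT; lia.
Qed.

(** The block [i] consists of the numbers from [e i] to [e i.+1 - 1]; its last edge is a token,
    after which the link goes on at the block [nb i]. The hypothesis [nb_next] says that components
    occupy successive ranges of blocks: the link goes on at the next block, or goes back at the end
    of a component. *)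
Definition blk (k : nat) := find (fun i => k < e i.+1)%N (iota 0 T).

Lemma blkP k : (k < N)%N -> [/\ (blk k < T)%N, (e (blk k) <= k)%N & (k < e (blk k).+1)%N].
Proof.
move=> kN; have H : has (fun i => k < e i.+1)%N (iota 0 T).
  apply/hasP; exists T.-1; first by rewrite mem_iota; lia.
  by rewrite prednK // e_T.
have bT : (blk k < T)%N by rewrite /blk -[ltnRHS](size_iota 0) -has_find.
have kb : (k < e (blk k).+1)%N by have := nth_find 0%N H; rewrite -/(blk k) nth_iota.
split => //; case E : (blk k) => [|i]; first by rewrite e_0.
have iT : (i < T)%N by lia.
have : (i < blk k)%N by rewrite E.
by move=> /(before_find 0%N); rewrite nth_iota // add0n => /negbT; rewrite -leqNgt.
Qed.

Lemma blk_uniq k i : (i < T)%N -> (e i <= k)%N -> (k < e i.+1)%N -> blk k = i.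
Proof.
move=> iT h1 h2; have kN : (k < N)%N by rewrite (leq_trans h2) // -e_T e_le.
have [b1 b2 b3] := blkP kN.
have [h|h|//] := ltngtP (blk k) i.
  by have := e_le h (ltnW iT); lia.
by have := e_le h (ltnW b1); lia.
Qed.

(* Position of [k] in its block, from the start and from the end. *)
Definition apos k := (k - e (blk k))%N.
Definition bpos k := (e (blk k).+1 - 1 - k)%N.

Variant position (k : nat) : nat -> nat -> nat -> Prop :=
  Position i of (i < T)%N & (e i <= k)%N & (k < e i.+1)%N & (e i + 14 <= e i.+1)%N :
    position k i (k - e i)%N (e i.+1 - 1 - k)%N.

Lemma positionP k : (k < N)%N -> position k (blk k) (apos k) (bpos k).
Proof. by move=> /blkP[h1 h2 h3]; rewrite /apos /bpos; constructor => //; exact: e_S. Qed.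

Lemma pos_out i a : (i < T)%N -> (a < 14)%N ->
  [/\ (e i + a < N)%N, blk (e i + a) = i & apos (e i + a) = a].
Proof.
move=> iT a7; have h := e_S iT; have h' := e_le iT (leqnn T).
have b : blk (e i + a) = i by apply: blk_uniq => //; lia.
by rewrite /apos b e_T in h' *; split => //; lia.
Qed.

Lemma pos_in i b : (i < T)%N -> (b < 14)%N ->
  [/\ (e i.+1 - 1 - b < N)%N, blk (e i.+1 - 1 - b) = i & bpos (e i.+1 - 1 - b) = b].
Proof.
move=> iT a7; have h := e_S iT; have h' := e_le iT (leqnn T).
have E : blk (e i.+1 - 1 - b) = i by apply: blk_uniq => //; lia.
by rewrite /bpos E e_T in h' *; split => //; lia.
Qed.

Lemma s_inner (k : 'I_N) : bpos k != 0%N -> s k = k.+1 :> nat.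
Proof.
move=> bk; apply: s_next => i iT E; move: bk; case: (positionP (ltn_ord k)) => i' i'T h1 h2 h3.
have [h|h|h] := ltngtP i i'.
- by have := e_le h (ltnW i'T); lia.
- by have := e_le h (ltnW iT); have := e_S iT; lia.
- by rewrite h in E; lia.
Qed.

Lemma s_last (k : 'I_N) : bpos k = 0%N -> s k = e (nb (blk k)) :> nat.
Proof.
move=> bk; have [h1 h2 h3] := blkP (ltn_ord k); apply: s_end => //.
by move: bk; rewrite /bpos; lia.
Qed.

Lemma t_inner (k : 'I_N) : apos k != 0%N -> t k = k.-1 :> nat.
Proof.
move=> ak; have [bk|bk] := eqVneq (bpos (t k)) 0%N.
  have := s_last bk; rewrite tK => E; move: ak; rewrite E.
  have := nb_lt (let: And3 h _ _ := blkP (ltn_ord (t k)) in h) => h.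
  by have [] := pos_out h (isT : (0 < 14)%N); rewrite addn0 => _ _ ->.
by have := s_inner bk; rewrite tK => ->.
Qed.

Lemma t_first (k : 'I_N) : apos k = 0%N -> bpos (t k) = 0%N.
Proof.
move=> ak; apply/eqP; apply: contraTT isT => bk; have := s_inner bk; rewrite tK => E.
move: ak bk; rewrite E /apos; case: (positionP (ltn_ord (t k))) => i iT h1 h2 h3.
move=> E1 E2; have b : blk (t k).+1 = i by apply: blk_uniq => //; lia.
by rewrite b in E1; lia.
Qed.

Lemma s_neq (k : 'I_N) : s k != k.
Proof.
apply/eqP => E; have [bk|bk] := eqVneq (bpos k) 0%N; last by have := s_inner bk; rewrite E; lia.
have := s_last bk; rewrite E => Ek.
have [h _ _] := blkP (ltn_ord k); have nl := nb_lt h.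
have [_ b _] := pos_out nl (isT : (0 < 14)%N); rewrite addn0 -Ek in b.
move: bk; rewrite /bpos b; have := e_S nl; lia.
Qed.

(* [K] labels: [2 i] at the start and [2 i + 1] at the end of the block [i].
   A moved vertex or edge of the label [j] is given with the rank of its new
   coordinate among those of its label. *)
Let K := (2 * T)%N.
Variables g g' : bool.

(** At an ordinary end one vertex slides. At the first start four do, and their ranks 0, 3, 1, 2 in
    link order make the additional turn; at the last end the ranks, read backwards, are the
    complementary 3, 0, 2, 1. *)
Definition mvx (k : nat) : option (nat * nat) :=
  let i := blk k in let a := apos k in let b := bpos k in
  if a == 2%N then Some (2 * i, 0)%N
  else if (i == 0%N) && (a == 3%N) then Some (0, 3)%N
  else if (i == 0%N) && (a == 4%N) then Some (0, 1)%N
  else if (i == 0%N) && (a == 5%N) then Some (0, 2)%N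
  else if b == 2%N then Some (2 * i + 1, if i.+1 == T then 3 else 0)%N
  else if (i.+1 == T) && (b == 3%N) then Some (2 * i + 1, 0)%N
  else if (i.+1 == T) && (b == 4%N) then Some (2 * i + 1, 2)%N
  else if (i.+1 == T) && (b == 5%N) then Some (2 * i + 1, 1)%N
  else None.

(** Rank 4 is the bottom edge of a bend. The flags [g] and [g'] exchange the ranks 2 and 3 of two
    parallel edges, which decides whether the odd face has one or three sides. *)
Definition mvz (k : nat) : option (nat * nat) :=
  let i := blk k in let a := apos k in let b := bpos k in
  if a == 1%N then Some (2 * i, 4)%N
  else if (i == 0%N) && (a == 2%N) then Some (0, if g then 2 else 3)%N
  else if (i == 0%N) && (a == 3%N) then Some (0, 1)%N
  else if (i == 0%N) && (a == 4%N) then Some (0, if g then 3 else 2)%N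
  else if b == 2%N then Some (2 * i + 1, 4)%N
  else if (i.+1 == T) && (b == 3%N) then Some (2 * i + 1, if g' then 2 else 3)%N
  else if (i.+1 == T) && (b == 4%N) then Some (2 * i + 1, 1)%N
  else if (i.+1 == T) && (b == 5%N) then Some (2 * i + 1, if g' then 3 else 2)%N
  else None.

(** Inverse tables of [mvx] and [mvz]: the position having a given rank, counted from the start of a
    block ([ax], [az]) or from its end ([bx], [bz]), where [l] tells whether the block is the last
    one. *)
Definition ax r := nth 0%N [:: 2; 4; 5; 3]%N r.
Definition bx (l : bool) r := if l then nth 0%N [:: 3; 5; 4; 2]%N r else 2%N.
Definition az r := nth 0%N (if g then [:: 0; 3; 2; 4; 1]%N else [:: 0; 3; 4; 2; 1]%N) r.
Definition bz (l : bool) r :=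
  if l then nth 0%N (if g' then [:: 0; 4; 3; 5; 2]%N else [:: 0; 4; 5; 3; 2]%N) r else 2%N.

Lemma az_le r : (az r <= 4)%N.
Proof. by rewrite /az; case: g; case: r => [|[|[|[|[|[|]]]]]]. Qed.

Lemma bz_le l r : (bz l r <= 5)%N.
Proof. by rewrite /bz; case: l => //; case: g'; case: r => [|[|[|[|[|[|]]]]]]. Qed.

Lemma ax_le r : (ax r <= 5)%N.
Proof. by rewrite /ax; case: r => [|[|[|[|[|[|]]]]]]. Qed.

Lemma bx_le l r : (bx l r <= 5)%N.
Proof. by rewrite /bx; case: l => //; case: r => [|[|[|[|[|[|]]]]]]. Qed.

Lemma mvx_spec k j r : mvx k = Some (j, r) -> (r < 4)%N /\
  (j = 2 * blk k /\ apos k = ax r \/ j = 2 * blk k + 1 /\ bpos k = bx ((blk k).+1 == T) r)%N.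
Proof.
rewrite /mvx; move: (blk k) (apos k) (bpos k) => i a b.
do 8?[case: ifP => [h|_]]; move=> // [<- <-]; rewrite /ax /bx /=.
- by split => //; left; split; lia.
- by split => //; left; split; lia.
- by split => //; left; split; lia.
- by split => //; left; split; lia.
- by move/eqP: h => ->; case: (i.+1 == T); split => //; right.
- by split => //; right; split => //; move: h => /andP[-> /eqP ->].
- by split => //; right; split => //; move: h => /andP[-> /eqP ->].
- by split => //; right; split => //; move: h => /andP[-> /eqP ->].
Qed.

Lemma mvz_spec k j r : mvz k = Some (j, r) -> (0 < r < 5)%N /\
  (j = 2 * blk k /\ apos k = az r \/ j = 2 * blk k + 1 /\ bpos k = bz ((blk k).+1 == T) r)%N.
Proof.
rewrite /mvz; move: (blk k) (apos k) (bpos k) => i a b.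
do 8?[case: ifP => [h|_]]; move=> // [<- <-]; rewrite /az /bz /=.
- by split => //; left; split => //; move/eqP: h => ->; case: (g).
- by move: h => /andP[/eqP-> /eqP->]; case: (g); split => //; left.
- by move: h => /andP[/eqP-> /eqP->]; case: (g); split => //; left.
- by move: h => /andP[/eqP-> /eqP->]; case: (g); split => //; left.
- by move/eqP: h => ->; case: (i.+1 == T); split => //; right; case: (g').
- by split; [case: (g')|right; split => //; move: h => /andP[-> /eqP ->]; case: (g')].
- by split => //; right; split => //; move: h => /andP[-> /eqP ->]; case: (g').
- by split; [case: (g')|right; split => //; move: h => /andP[-> /eqP ->]; case: (g')].
Qed.

Lemma apos_inj k k' : (k < N)%N -> (k' < N)%N -> blk k = blk k' -> apos k = apos k' -> k = k'.
Proof.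
move=> kN kN' E; have [_ h _] := blkP kN; have [_ h' _] := blkP kN'.
by rewrite /apos E in h *; lia.
Qed.

Lemma bpos_inj k k' : (k < N)%N -> (k' < N)%N -> blk k = blk k' -> bpos k = bpos k' -> k = k'.
Proof.
move=> kN kN' E; have [_ _ h] := blkP kN; have [_ _ h'] := blkP kN'.
by rewrite /bpos E in h *; lia.
Qed.

Lemma mvx_inj k k' p : (k < N)%N -> (k' < N)%N -> mvx k = Some p -> mvx k' = Some p -> k = k'.
Proof.
case: p => j r kN kN' /mvx_spec[_ H] /mvx_spec[_ H'].
case: H H' => -[E A] [] [E' A']; try lia; have B : blk k = blk k' by lia.
  by apply: apos_inj; rewrite // A A'.
by apply: bpos_inj; rewrite // A A' B.
Qed.

Lemma mvz_inj k k' p : (k < N)%N -> (k' < N)%N -> mvz k = Some p -> mvz k' = Some p -> k = k'.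
Proof.
case: p => j r kN kN' /mvz_spec[_ H] /mvz_spec[_ H'].
case: H H' => -[E A] [] [E' A']; try lia; have B : blk k = blk k' by lia.
  by apply: apos_inj; rewrite // A A'.
by apply: bpos_inj; rewrite // A A' B.
Qed.

Variables (xs : 'I_N -> R) (M : R).
Hypotheses (xs_inj : injective xs) (xs_M : forall k, xs k < M).
Definition special (k : nat) := (apos k < 7)%N || (bpos k < 7)%N.
Hypothesis xs_special : forall k l : 'I_N, special k -> special l -> (k < l)%N -> xs k < xs l.

(* The labels [j < c] have been moved. *)
Definition xmove (c : nat) (k : 'I_N) : R :=
  if mvx k is Some (j, r) then if (j < c)%N then M + (8 * (K - j) + r)%:R else xs k else xs k.

(** Tokens have positive levels, increasing with their number; other edges decrease along the link.
    A slid edge goes below all of these. The spacing 8 of the labels exceeds every rank, and earlier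
    labels go farther, so the bends are nested. *)
Definition zmove (c : nat) (k : nat) : int :=
  if bpos k == 0%N then k.+1%:Z else
  if mvz k is Some (j, r) then if (j < c)%N then - (N + 8 * (K - j) + r)%:Z else - k%:Z
  else - k%:Z.

Definition zmoveR c (k : 'I_N) : R := (zmove c k)%:~R.

Lemma mvx_lt k j r : (k < N)%N -> mvx k = Some (j, r) -> (j < K)%N /\ (r < 4)%N.
Proof. by move=> /blkP[h _ _] /mvx_spec[h1 h2]; split => //; rewrite /K; lia. Qed.

Lemma mvz_lt k j r : (k < N)%N -> mvz k = Some (j, r) -> (j < K)%N /\ (0 < r < 5)%N.
Proof. by move=> /blkP[h _ _] /mvz_spec[h1 h2]; split => //; rewrite /K; lia. Qed.

Lemma xmove_inj c : injective (xmove c).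
Proof.
have big (k : 'I_N) m : xs k != M + m%:R.
  by rewrite lt_eqF // (lt_le_trans (xs_M k)) // lerDl.
move=> k l; rewrite /xmove.
case Ek : (mvx k) => [[j r]|]; case El : (mvx l) => [[j' r']|]; last exact: xs_inj.
- have [h1 h2] := mvx_lt (ltn_ord k) Ek; have [h1' h2'] := mvx_lt (ltn_ord l) El.
  case: ifP => hj; case: ifP => hj'; last exact: xs_inj.
  + move=> /addrI /eqP; rewrite eqr_nat => /eqP h.
    have [E1 E2] : j = j' /\ r = r' by lia.
    apply/val_inj; rewrite -E1 -E2 in El; exact: (mvx_inj (ltn_ord k) (ltn_ord l) Ek El).
  + by move=> /esym /eqP; rewrite (negbTE (big _ _)).
  + by move=> /eqP; rewrite (negbTE (big _ _)).
- by case: ifP => hj; [move=> /esym /eqP; rewrite (negbTE (big _ _))|exact: xs_inj].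
- by case: ifP => hj; [move=> /eqP; rewrite (negbTE (big _ _))|exact: xs_inj].
Qed.

Variant zmove_case c k : int -> Prop :=
  | ZToken of bpos k = 0%N : zmove_case c k k.+1%:Z
  | ZMoved j r of mvz k = Some (j, r) & (j < c)%N & (j < K)%N & (0 < r < 5)%N & bpos k != 0%N :
      zmove_case c k (- (N + 8 * (K - j) + r)%:Z)
  | ZStay of (forall j r, mvz k = Some (j, r) -> (c <= j)%N) & bpos k != 0%N :
      zmove_case c k (- k%:Z).

Lemma zmoveP c k : (k < N)%N -> zmove_case c k (zmove c k).
Proof.
move=> kN; rewrite /zmove; case: eqP => [E|/eqP b0]; first exact: ZToken.
case E : (mvz k) => [[j r]|]; last by apply: ZStay => // j r; rewrite E.
case: ifP => jc; last by apply: ZStay => // j' r'; rewrite E => -[<- _]; rewrite leqNgt jc.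
by have [h1 h2] := mvz_lt kN E; exact: ZMoved E jc h1 h2 b0.
Qed.

Lemma zmove_inj c k l : (k < N)%N -> (l < N)%N -> zmove c k = zmove c l -> k = l.
Proof.
move=> kN lN; case: (zmoveP c kN) => [h1|j r h1 h2 h3 h4 h5|h1 h2];
  case: (zmoveP c lN) => [h1'|j' r' h1' h2' h3' h4' h5'|h1' h2']; try lia.
move=> h; have [E1 E2] : j = j' /\ r = r' by lia.
by rewrite -E1 -E2 in h1'; exact: (mvz_inj kN lN h1 h1').
Qed.

Lemma zmoveR_inj c : injective (zmoveR c).
Proof. by move=> k l /intr_inj h; apply/val_inj; exact: (zmove_inj (ltn_ord k) (ltn_ord l) h). Qed.

Lemma mvx_out i a : (i < T)%N -> (a < 7)%N -> mvx (e i + a) =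
  if a == 2%N then Some (2 * i, 0)%N
  else if (i == 0%N) && (a == 3%N) then Some (0, 3)%N
  else if (i == 0%N) && (a == 4%N) then Some (0, 1)%N
  else if (i == 0%N) && (a == 5%N) then Some (0, 2)%N else None.
Proof.
move=> iT a7; have [h1 h2 h3] := pos_out iT (leq_trans a7 (isT : (7 <= 14)%N)).
have hb : (6 < bpos (e i + a))%N by rewrite /bpos h2; have := e_S iT; lia.
rewrite /mvx h2 h3; do 4?[case: ifP => // _].
by case: (bpos _) hb => [|[|[|[|[|[|b]]]]]] //; rewrite !andbF.
Qed.

Lemma mvz_out i a : (i < T)%N -> (a < 7)%N -> mvz (e i + a) =
  if a == 1%N then Some (2 * i, 4)%N
  else if (i == 0%N) && (a == 2%N) then Some (0, if g then 2 else 3)%N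
  else if (i == 0%N) && (a == 3%N) then Some (0, 1)%N
  else if (i == 0%N) && (a == 4%N) then Some (0, if g then 3 else 2)%N else None.
Proof.
move=> iT a7; have [h1 h2 h3] := pos_out iT (leq_trans a7 (isT : (7 <= 14)%N)).
have hb : (6 < bpos (e i + a))%N by rewrite /bpos h2; have := e_S iT; lia.
rewrite /mvz h2 h3; do 4?[case: ifP => // _].
by case: (bpos _) hb => [|[|[|[|[|[|b]]]]]] //; rewrite !andbF.
Qed.

Lemma mvx_in i b : (i < T)%N -> (b < 7)%N -> mvx (e i.+1 - 1 - b) =
  if b == 2%N then Some (2 * i + 1, if i.+1 == T then 3 else 0)%N
  else if (i.+1 == T) && (b == 3%N) then Some (2 * i + 1, 0)%N
  else if (i.+1 == T) && (b == 4%N) then Some (2 * i + 1, 2)%N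
  else if (i.+1 == T) && (b == 5%N) then Some (2 * i + 1, 1)%N else None.
Proof.
move=> iT a7; have [h1 h2 h3] := pos_in iT (leq_trans a7 (isT : (7 <= 14)%N)).
have ha : (6 < apos (e i.+1 - 1 - b))%N by rewrite /apos h2; have := e_S iT; lia.
rewrite /mvx h2 h3; case: (apos _) ha => [|[|[|[|[|[|a]]]]]] //.
by rewrite !andbF.
Qed.

Lemma mvz_in i b : (i < T)%N -> (b < 7)%N -> mvz (e i.+1 - 1 - b) =
  if b == 2%N then Some (2 * i + 1, 4)%N
  else if (i.+1 == T) && (b == 3%N) then Some (2 * i + 1, if g' then 2 else 3)%N
  else if (i.+1 == T) && (b == 4%N) then Some (2 * i + 1, 1)%N
  else if (i.+1 == T) && (b == 5%N) then Some (2 * i + 1, if g' then 3 else 2)%N else None.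
Proof.
move=> iT a7; have [h1 h2 h3] := pos_in iT (leq_trans a7 (isT : (7 <= 14)%N)).
have ha : (6 < apos (e i.+1 - 1 - b))%N by rewrite /apos h2; have := e_S iT; lia.
rewrite /mvz h2 h3; case: (apos _) ha => [|[|[|[|[|[|a]]]]]] //.
by rewrite !andbF.
Qed.

Lemma zmove_out c i a : (i < T)%N -> (a < 7)%N -> zmove c (e i + a) =
  if mvz (e i + a) is Some (j, r) then
    if (j < c)%N then - (N + 8 * (K - j) + r)%:Z else - (e i + a)%:Z else - (e i + a)%:Z.
Proof.
move=> iT a7; have [h1 h2 h3] := pos_out iT (leq_trans a7 (isT : (7 <= 14)%N)).
rewrite /zmove; case: eqP => // hb; exfalso; move: hb; rewrite /bpos h2; have := e_S iT; lia.
Qed.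

Lemma zmove_in c i b : (i < T)%N -> (0 < b < 7)%N -> zmove c (e i.+1 - 1 - b) =
  if mvz (e i.+1 - 1 - b) is Some (j, r) then
    if (j < c)%N then - (N + 8 * (K - j) + r)%:Z else - (e i.+1 - 1 - b)%:Z else - (e i.+1 - 1 - b)%:Z.
Proof.
move=> iT /andP[b0 b7]; have [h1 h2 h3] := pos_in iT (leq_trans b7 (isT : (7 <= 14)%N)).
by rewrite /zmove h3; case: (b) b0.
Qed.

(* Moved vertices by their rank, the others being all to their left. *)
Definition code c (k : nat) : nat :=
  if mvx k is Some (j, r) then if (j < c)%N then (8 * (K - j) + r).+1 else 0 else 0.

Lemma xmove_code c (k l : 'I_N) : (0 < code c l)%N -> xmove c k < xmove c l -> (code c k < code c l)%N.
Proof.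
rewrite /code /xmove.
case: (mvx l) => [[j r]|//]; case: ifP => // _ _.
case: (mvx k) => [[j' r']|//]; case: ifP => // _.
by rewrite ltrD2l ltr_nat ltnS.
Qed.

Lemma xmove_stay c (k : 'I_N) : code c k = 0%N -> xmove c k = xs k.
Proof. by rewrite /code /xmove; case: (mvx k) => [[j r]|//]; case: ifP. Qed.

Lemma xmove_big c (k l : 'I_N) : code c k = 0%N -> (0 < code c l)%N -> xmove c k < xmove c l.
Proof.
move=> /xmove_stay ->; rewrite /code /xmove; case: (mvx l) => [[j r]|//]; case: ifP => // _ _.
by rewrite (lt_le_trans (xs_M k)) // lerDl.
Qed.

Local Notation cross c := (cross s t (xmove c) (zmoveR c)).

Lemma cross_code c k l : cross c k l -> (0 < code c k)%N ->
  (code c l < code c k < code c (s l))%N \/ (code c (s l) < code c k < code c l)%N.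
Proof.
move=> /andP[_]; rewrite /sbtw => + k0.
have P m : xmove c k < xmove c m -> (0 < code c m)%N.
  by move=> h; case: posnP => // E; have := lt_trans h (xmove_big E k0); rewrite ltxx.
move=> /orP[] /andP[h1 h2]; [left|right]; apply/andP; split.
- exact: xmove_code h1.
- exact: xmove_code (P _ h2) h2.
- exact: xmove_code h1.
- exact: xmove_code (P _ h2) h2.
Qed.

Lemma cross_int c k l : cross c k l ->
  (zmove c (t k) < zmove c l < zmove c k) \/ (zmove c k < zmove c l < zmove c (t k)).
Proof. by move=> /andP[+ _]; rewrite /sbtw /zmoveR !ltr_int => /orP. Qed.

(** Successive undisturbed edges are on successive integers, which leaves no room for a third level
    in between. *)
Lemma cross_level c k l : cross c k l -> [\/ apos k = 0%N, bpos k = 0%N,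
  zmove c k.-1 <> - k.-1%:Z | zmove c k <> - k%:Z].
Proof.
move=> /cross_int; have [a0|a0] := eqVneq (apos k) 0%N; first by constructor 1.
have [b0|b0] := eqVneq (bpos k) 0%N; first by constructor 2.
rewrite (t_inner a0); have [->|h] := eqVneq (zmove c k.-1) (- k.-1%:Z); last by constructor 3; apply/eqP.
have [->|h] := eqVneq (zmove c k) (- k%:Z); last by constructor 4; apply/eqP.
have : (0 < k)%N by move: a0; rewrite /apos; lia.
lia.
Qed.

Lemma cross_special c k l : cross c k l -> special k.
Proof.
have kN := ltn_ord k; rewrite /special => /cross_level[->|->|h|h]; rewrite ?orbT //.
- have [a0|a0] := eqVneq (apos k) 0%N; first by rewrite a0.
  have kN' : (k.-1 < N)%N by lia.
  have [i iT [h1 h2 h3]] : exists2 i, (i < T)%N & [/\ (e i < k)%N, (k < e i.+1)%N & (e i + 14 <= e i.+1)%N].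
    move: a0; rewrite /apos; case: (positionP kN) => i iT h1 h2 h3 a0; exists i => //; split => //; lia.
  have B : blk k = i by apply: blk_uniq => //; lia.
  have B' : blk k.-1 = i by apply: blk_uniq => //; lia.
  move: h; case: (zmoveP c kN') => [|j r + _ _ _ _|//].
    by rewrite /bpos B'; lia.
  move=> /mvz_spec[h [[_ E]|[_ E]]] _; move: E; rewrite /apos /bpos B B'.
    by have := az_le r; lia.
  by have := bz_le (i.+1 == T) r; lia.
move: h; case: (zmoveP c kN) => [E|j r + _ _ _ _|//]; first by rewrite E orbT.
move=> /mvz_spec[h [[_ ->]|[_ ->]]] _; first by have := az_le r; lia.
by have := bz_le ((blk k).+1 == T) r; lia.
Qed.

Lemma free_column c (k : 'I_N) : apos k != 0%N -> bpos k != 0%N ->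
  zmove c k.-1 = - k.-1%:Z -> zmove c k = - k%:Z -> forall l, ~~ cross c k l.
Proof.
move=> a0 b0 h1 h2 l; apply/negP => /cross_level[/eqP|/eqP|//|//].
  by rewrite (negbTE a0).
by rewrite (negbTE b0).
Qed.

(** A crossing column would be special as well, and special columns which stay are sorted by number:
    none is strictly between [l] and [l.+1]. A slid column lies to the right of both ends. *)
Lemma moved_free_row c (l : 'I_N) : bpos l != 0%N -> special l -> special l.+1 -> code c l = 0%N ->
  code c l.+1 = 0%N -> forall k, ~~ cross c k l.
Proof.
move=> b0 sl sl' c0 c0' k; apply/negP => ck; have sk := cross_special ck.
have sE := s_inner b0; rewrite -sE in sl' c0'.
have [E|k0] := posnP (code c k); last first.
  by have := cross_code ck k0; rewrite c0 c0'; lia.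
move: ck => /andP[_]; rewrite /sbtw !xmove_stay // => /orP[] /andP[h1 h2].
  have lk : (l < k)%N.
    rewrite ltnNge; apply/negP; rewrite leq_eqVlt => /orP[/eqP/val_inj h|h].
      by rewrite h ltxx in h1.
    by have := lt_trans h1 (xs_special sk sl h); rewrite ltxx.
  have kl : (k < s l)%N.
    rewrite ltnNge; apply/negP; rewrite leq_eqVlt => /orP[/eqP/val_inj h|h].
      by rewrite h ltxx in h2.
    by have := lt_trans h2 (xs_special sl' sk h); rewrite ltxx.
  by rewrite sE in kl; lia.
have : xs l < xs (s l) by apply: xs_special => //; rewrite sE.
by have := lt_trans h1 h2; move=> a b; have := lt_trans a b; rewrite ltxx.
Qed.

(** Only a column at an end of a later token reaches above this one. By [nb_next] the ends of the
    row have successive numbers, or the row goes back over earlier numbers while the columns of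
    later tokens have greater ones. *)
Lemma free_token_row c (l : 'I_N) : bpos l = 0%N -> forall k, ~~ cross c k l.
Proof.
move=> b0 k; apply/negP => ck; have sk := cross_special ck.
have [i iT El] : exists2 i, (i < T)%N & l.+1 = e i.+1.
  have [h1 h2 h3] := blkP (ltn_ord l); exists (blk l) => //; move: b0; rewrite /bpos; lia.
have Bl : blk l = i by apply: blk_uniq => //; have := e_S iT; lia.
have sl := s_last b0; rewrite Bl in sl; have nT := nb_lt iT.
have [h1 h2 h3] := pos_out nT (isT : (0 < 14)%N); rewrite addn0 -sl in h1 h2 h3.
have cl : code c l = 0%N.
  have := mvx_in iT (isT : (0 < 7)%N); rewrite subn0 -El subn1 /= !andbF /code => ->.
  by [].
have csl : code c (s l) = 0%N.
  by have := mvx_out nT (isT : (0 < 7)%N); rewrite addn0 -sl /= !andbF /code => ->.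
have sps : special (s l) by rewrite /special h3.
have spl : special l by rewrite /special b0 orbT.
have zl : zmove c l = l.+1 by rewrite /zmove b0.
have tok m : (m < N)%N -> (zmove c l < zmove c m) -> exists i', [/\ (i < i')%N, (i' < T)%N & m.+1 = e i'.+1].
  rewrite zl => mN; case: (zmoveP c mN) => [bm|j r _ _ _ _ _|_ _]; last 2 first.
  - by lia.
  - by lia.
  move=> lm; have [h4 h5 h6] := blkP mN; exists (blk m).
  have E : m.+1 = e (blk m).+1 by move: bm; rewrite /bpos; lia.
  split => //; rewrite ltnNge; apply/negP => h7.
  by have := e_le (i := (blk m).+1) (j := i.+1) h7 iT; lia.
have bet : sbtw (xs l) (xs (s l)) (xmove c k) by move: ck => /andP[_]; rewrite (xmove_stay cl) (xmove_stay csl).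
have ck0 : code c k = 0%N.
  by case: (posnP (code c k)) => // k0; have := cross_code ck k0; rewrite cl csl; lia.
rewrite (xmove_stay ck0) in bet.
have mono (u v : 'I_N) : special u -> special v -> (xs u < xs v) = (u < v)%N.
  move=> su sv; apply/idP/idP => [h|]; last exact: xs_special.
  rewrite ltnNge; apply/negP; rewrite leq_eqVlt => /orP[/eqP/val_inj E|h'].
    by rewrite E ltxx in h.
  by have := lt_trans h (xs_special sv su h'); rewrite ltxx.
move: bet; rewrite /sbtw !mono // => bet.
(* An end of the column [k] is on the row of a later token [i']: so [k] is the start of this token
   or the vertex where it ends. *)
have [i' [ii' i'T Ek]] : exists i', [/\ (i < i')%N, (i' < T)%N & (k = (e i'.+1 - 1)%N :> nat) \/ (k = e (nb i') :> nat)].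
  case: (cross_int ck) => /andP[h4 h5]; last first.
    have [i' [h6 h7 h8]] := tok _ (ltn_ord (t k)) h5; exists i'; split => //; right.
    have bt : bpos (t k) = 0%N.
      have B : blk (t k) = i' by apply: blk_uniq => //; have := e_S h7; lia.
      by rewrite /bpos B; lia.
    have := s_last bt; rewrite tK => ->.
    have -> // : blk (t k) = i' by apply: blk_uniq => //; have := e_S h7; lia.
  have [i' [h6 h7 h8]] := tok _ (ltn_ord k) h5; exists i'; split => //; left; lia.
have l_k := e_le (i := i.+1) (j := i') ii' (ltnW i'T).
have e_i' := e_S i'T.
case: (nb_next iT) => [E|[E H]].
  by rewrite E -El in sl; case: Ek => Ek; [lia|]; case/orP: bet => /andP[]; rewrite ?sl; lia.
have Enb := H i'; rewrite ii' i'T in Enb; have {}Enb := Enb isT.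
have l_nb := e_le (i := i.+1) (j := nb i') Enb (ltnW (nb_lt i'T)).
have nb_l := e_le (i := nb i) (j := i) E (ltnW iT).
have e_i := e_S iT.
by case: Ek => Ek; case/orP: bet => /andP[]; rewrite ?sl; lia.
Qed.

(** The far end of an edge is the near end of the following one, so it is enough to compare
    half-open edges. *)
Lemma embedded_half (W : finType) (f f' : W -> W) (v : W -> space3 R) : cancel f f' ->
  (forall j k a b, 0 <= a < 1 -> 0 <= b < 1 -> pt f v j a = pt f v k b -> j = k /\ a = b) ->
  embedded f v.
Proof.
move=> fK H.
have p1 j : pt f v j 1 = pt f v (f j) 0 by rewrite /pt subrr scale0r add0r scale1r subr0 scale1r scale0r addr0.
move=> j k a b ha hb; have h0 : 0 <= (0 : R) < 1 by apply/andP; split; lra.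
have lt1 (r : R) : 0 <= r <= 1 -> r != 1 -> 0 <= r < 1.
  by move=> /andP[-> r1] h; rewrite lt_neqAle h.
have [->|a1'] := eqVneq a 1; have [->|b1'] := eqVneq b 1.
- by rewrite !p1 => /(H _ _ _ _ h0 h0)[/(can_inj fK) -> _]; constructor 1.
- by rewrite p1 => /(H _ _ _ _ h0 (lt1 _ hb b1'))[<- <-]; constructor 2.
- by rewrite p1 => /(H _ _ _ _ (lt1 _ ha a1') h0)[-> ->]; constructor 3.
- by move=> /(H _ _ _ _ (lt1 _ ha a1') (lt1 _ hb b1'))[-> ->]; constructor 1.
Qed.

Lemma embedded_lt (W : finType) (f : W -> W) (v : W -> space3 R) : (forall k, f k != k) ->
  embedded f v -> forall j k a b, 0 <= a < 1 -> 0 <= b < 1 -> pt f v j a = pt f v k b -> j = k /\ a = b.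
Proof.
move=> fn H j k a b ha hb E; have le1 (r : R) : 0 <= r < 1 -> 0 <= r <= 1.
  by move=> /andP[-> /ltW].
case: (H j k a b (le1 _ ha) (le1 _ hb) E) => [//|[_ h _]|[_ _ h]].
  by move: ha; rewrite h ltxx andbF.
by move: hb; rewrite h ltxx andbF.
Qed.

Lemma gnext_neq (v : 'I_N * bool) : gnext s v != v.
Proof. by case: v => k []; rewrite /gnext /= -pair_eqE /= ?andbF. Qed.

(** Projected edges meet only at crossings, so the depths matter only at the ends of sides that
    cross each other. *)
Lemma embedded_dep (x z : 'I_N -> R) (dep dep' : 'I_N * bool -> R) : injective x -> injective z ->
  embedded (gnext s) (gspace t x z dep) ->
  (forall k l, Grid.cross s t x z k l -> [/\ dep' (k, false) = dep (k, false),
    dep' (k, true) = dep (k, true), dep' (l, true) = dep (l, true) &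
    dep' (s l, false) = dep (s l, false)]) ->
  embedded (gnext s) (gspace t x z dep').
Proof.
move=> xI zI H E; apply: (embedded_half (gnextK sK)) => j k a b ha hb jk.
case: (seg_cases sK tK xI zI s_neq ha hb (congr1 fst jk)) => // -[k' [l' [kl _ _ _ h]]].
have [E1 E2 E3 E4] := E _ _ kl; apply: (embedded_lt gnext_neq H ha hb).
by case: h jk => -[-> ->]; rewrite /pt /gspace /= E1 E2 E3 E4.
Qed.

(** These lengths delimit the corners to be lifted before sliding: all moved corners and their
    neighbours along the link, by [moved_main], [moved_next] and [moved_prev]. The first start and
    the last end are longer because of the additional turn. *)
Definition outlen i := (3 + 3 * (i == 0))%N.
Definition inlen i := (3 + 3 * (i.+1 == T))%N.
Definition main (v : 'I_N * bool) : bool :=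
  ((0 < apos v.1) && (apos v.1 + v.2 <= outlen (blk v.1)) ||
   (0 < bpos v.1) && (bpos v.1 + ~~ v.2 <= inlen (blk v.1)))%N.
Definition noderank (v : 'I_N * bool) : nat := (2 * v.1 + v.2)%N.
Definition noderow (v : 'I_N * bool) : nat := row t v.1 v.2.

Lemma pos_sum k : (k < N)%N -> (13 <= apos k + bpos k)%N.
Proof. by case/positionP => i iT h1 h2 h3; lia. Qed.

Lemma pos_succ k : (k < N)%N -> bpos k != 0%N ->
  [/\ blk k.+1 = blk k, apos k.+1 = (apos k).+1 & bpos k = (bpos k.+1).+1].
Proof.
move=> /blkP[h1 h2 h3] b0; have b : blk k.+1 = blk k.
  by apply: blk_uniq => //; move: b0; rewrite /bpos; lia.
by rewrite /apos /bpos b in b0 *; split => //; lia.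
Qed.

Lemma pos_pred k : (k < N)%N -> apos k != 0%N ->
  [/\ blk k.-1 = blk k, apos k = (apos k.-1).+1 & bpos k.-1 = (bpos k).+1].
Proof.
move=> /blkP[h1 h2 h3] b0; have b : blk k.-1 = blk k.
  by apply: blk_uniq => //; move: b0; rewrite /apos; lia.
by rewrite /apos /bpos b in b0 *; split => //; lia.
Qed.

Lemma mvx_some k : mvx k != None -> ([|| apos k == 2, (blk k == 0) && (2 < apos k < 6),
  bpos k == 2 | ((blk k).+1 == T) && (2 < bpos k < 6)])%N.
Proof.
rewrite /mvx; move: (blk k) (apos k) (bpos k) => i a b.
do 8?[case: ifP => [h _|_]] => //; lia.
Qed.

Lemma mvz_some k : mvz k != None -> ([|| apos k == 1, (blk k == 0) && (1 < apos k < 5),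
  bpos k == 2 | ((blk k).+1 == T) && (2 < bpos k < 6)])%N.
Proof.
rewrite /mvz; move: (blk k) (apos k) (bpos k) => i a b.
do 8?[case: ifP => [h _|_]] => //; lia.
Qed.

Lemma gnext_true (k : 'I_N) : gnext s (k, true) = (s k, false). Proof. by []. Qed.
Lemma gnext_false (k : 'I_N) : gnext s (k, false) = (k, true). Proof. by []. Qed.

Definition moved (v : 'I_N * bool) := (mvx v.1 != None) || (mvz (noderow v) != None).

Lemma moved_main v : moved v -> main v.
Proof.
case: v => k b; have kN := ltn_ord k; have ps := pos_sum kN.
rewrite /moved /main /outlen /inlen /noderow /= => /orP[/mvx_some|]; first by case: b; lia.
case: b => /= [/mvz_some|]; first by lia.
have [a0|a0] := eqVneq (apos k) 0%N.
  have b0 := t_first a0; have := pos_sum (ltn_ord (t k)).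
  by move=> ? /mvz_some; lia.
rewrite (t_inner a0); have [B h2 h3] := pos_pred kN a0 => /mvz_some; rewrite ?B; lia.
Qed.

Lemma moved_next v : moved v -> main (gnext s v).
Proof.
case: v => k b; have kN := ltn_ord k; have ps := pos_sum kN.
rewrite /moved /main /outlen /inlen /noderow.
case: b => /=.
  move=> h; have b0 : bpos k != 0%N.
    by case/orP: h => [/mvx_some|/mvz_some]; lia.
  rewrite (s_inner b0); have [-> h2 h3] := pos_succ kN b0.
  by case/orP: h => [/mvx_some|/mvz_some]; lia.
case/orP => [/mvx_some|]; first by lia.
have [a0|a0] := eqVneq (apos k) 0%N.
  have b0 := t_first a0; have := pos_sum (ltn_ord (t k)).
  by move=> ? /mvz_some; lia.
rewrite (t_inner a0); have [B h2 h3] := pos_pred kN a0 => /mvz_some; rewrite ?B; lia.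
Qed.

Lemma moved_prev v : moved (gnext s v) -> main v.
Proof.
case: v => k b; have kN := ltn_ord k; have ps := pos_sum kN.
rewrite /moved /main /outlen /inlen /noderow; case: b => /=; last first.
  by case/orP => [/mvx_some|/mvz_some]; lia.
rewrite sK; have [b0|b0] := eqVneq (bpos k) 0%N.
  have := s_last b0; have [h _ _] := blkP kN; have nT := nb_lt h => E.
  have [_ h2 h3] := pos_out nT (isT : (0 < 14)%N); rewrite addn0 -E in h2 h3.
  by have := pos_sum (ltn_ord (s k)) => ? /orP[/mvx_some|/mvz_some]; lia.
rewrite (s_inner b0); have [B h2 h3] := pos_succ kN b0.
by case/orP => [/mvx_some|/mvz_some]; rewrite ?B; lia.
Qed.

Lemma main_inner v : main v -> [/\ apos v.1 != 0%N, bpos v.1 != 0%N & special v.1].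
Proof. by have := pos_sum (ltn_ord v.1); rewrite /main /special /outlen /inlen; split; lia. Qed.

Lemma main_row v : main v -> noderow v = (noderank v).-1./2 /\ bpos (noderow v) != 0%N.
Proof.
move=> /main_inner[a0 b0 _]; case: v a0 b0 => k [] /= a0 b0; rewrite /noderow /noderank /=.
  by split => //; lia.
rewrite (t_inner a0); have [_ _ ->] := pos_pred (ltn_ord k) a0; split => //.
by move: a0; rewrite /apos; lia.
Qed.

Lemma noderank_inj : injective noderank.
Proof.
move=> [k b] [l c]; rewrite /noderank /= => h.
have bc : b = c by move: h; case: b; case: c; lia.
by congr (_, _) => //; apply/val_inj => /=; rewrite bc in h; lia.
Qed.

Lemma main_next v : main v -> noderank (gnext s v) = (noderank v).+1.
Proof.
by move=> /main_inner[_ b0 _]; case: v b0 => k [] /= b0; rewrite /noderank /= ?(s_inner b0); lia.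
Qed.

Lemma zmove_le c k : (k < N)%N -> bpos k != 0%N -> zmove c k <= - k%:Z.
Proof. by move=> kN; case: (zmoveP c kN) => [->|j r _ _ _ _ _|_ _] //; lia. Qed.

Lemma xmove_ge c k : xs k <= xmove c k.
Proof.
rewrite /xmove; case: (mvx k) => [[j r]|//]; case: ifP => // _.
by rewrite (le_trans (ltW (xs_M k))) // lerDl.
Qed.

Lemma xmove0 k : xmove 0 k = xs k.
Proof. by rewrite /xmove; case: (mvx k) => [[j r]|]. Qed.

Lemma xmove_none c (k : 'I_N) : mvx k = None -> xmove c k = xs k.
Proof. by rewrite /xmove => ->. Qed.

Lemma zmove_none c k : mvz k = None -> zmove c k = zmove 0 k.
Proof. by rewrite /zmove => ->. Qed.

Lemma zmove_0 k : bpos k != 0%N -> zmove 0 k = - k%:Z.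
Proof. by rewrite /zmove => /negbTE ->; case: (mvz k) => [[j r]|]. Qed.

(** Lifted corners go above all others, in unit steps decreasing along the link. Edges between
    lifted corners are then disjoint by their depths alone, whatever their projections do during the
    slide. *)
Definition bumped (dep : 'I_N * bool -> R) (v : 'I_N * bool) : R :=
  if main v then 1 + \sum_w `|dep w| + (2 * N)%:R - (noderank v)%:R else dep v.

(** Before the slide the sides at lifted corners are free, by [free_column], [moved_free_row] and
    [free_token_row]; so their depths can be changed at will. *)
Lemma cross0_nonmain k l : cross 0 k l ->
  [/\ ~~ main (k, false), ~~ main (k, true), ~~ main (l, true) & ~~ main (s l, false)].
Proof.
move=> kl; have kN := ltn_ord k; have lN := ltn_ord l.
have col b : ~~ main (k, b).
  apply/negP => /main_inner /= [a0 b0 _]; have [_ _ h] := pos_pred kN a0.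
  have kN' : (k.-1 < N)%N by lia.
  have := kl; apply/negP; apply: free_column => //; apply: zmove_0 => //.
  by rewrite h.
have row : ~~ (main (l, true) || main (s l, false)).
  have := kl; apply: contraL => h.
  have [b0|b0] := eqVneq (bpos l) 0%N; first exact: free_token_row.
  have [B h2 h3] := pos_succ lN b0; have ps := pos_sum lN.
  have [sl sl'] : special l /\ special l.+1.
    move: h; rewrite /main /= (s_inner b0) /special B h2 h3 /outlen /inlen.
    have : (blk l).+1 == T \/ (blk l).+1 != T by case: eqP; auto.
    by split; lia.
  have code0 m : code 0 m = 0%N by rewrite /code; case: (mvx m) => [[j r]|].
  exact: moved_free_row.
by move: row; rewrite negb_or => /andP[-> ->]; split.
Qed.

Lemma bump_isotopic dep : embedded (gnext s) (gspace t (xmove 0) (zmoveR 0) dep) ->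
  ambient_isotopic (polygon_trace (gnext s) (gspace t (xmove 0) (zmoveR 0) dep))
    (polygon_trace (gnext s) (gspace t (xmove 0) (zmoveR 0) (bumped dep))).
Proof.
move=> emb; apply: polygon_isotopy => u hu.
have -> : line_homotopy (gspace t (xmove 0) (zmoveR 0) dep) (gspace t (xmove 0) (zmoveR 0) (bumped dep)) u
   = gspace t (xmove 0) (zmoveR 0) (fun v => (1 - u) * dep v + u * bumped dep v).
  by apply/funext => v; rewrite /line_homotopy; apply: sp_eq; rewrite /= /GRing.scale /=; ring.
apply: (embedded_dep (@xmove_inj _) (@zmoveR_inj _) emb) => k l /cross0_nonmain[h1 h2 h3 h4].
by rewrite /bumped (negbTE h1) (negbTE h2) (negbTE h3) (negbTE h4); split; ring.
Qed.

Lemma noderank_bound (v : 'I_N * bool) : (2 * v.1 <= noderank v <= 2 * v.1 + 1)%N.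
Proof. by rewrite /noderank; case: v.2; lia. Qed.

Section slide.
Variables (dep : 'I_N * bool -> R) (u : R).
Hypothesis hu : 0 <= u <= 1.
Let D : R := 1 + \sum_w `|dep w| + (2 * N)%:R.
Let V := line_homotopy (gspace t (xmove 0) (zmoveR 0) (bumped dep))
                       (gspace t (xmove K) (zmoveR K) (bumped dep)) u.
Let X v : R := (V v).1.1.
Let Z v : R := (V v).1.2.
Let H v : R := (V v).2.

Let HE v : H v = bumped dep v.
Proof. by rewrite /H /V /line_homotopy /= /GRing.scale /=; ring. Qed.

Let XE v : X v = (1 - u) * xs v.1 + u * xmove K v.1.
Proof. by rewrite /X /V /line_homotopy /= /GRing.scale /= xmove0. Qed.

Let ZE v : Z v = (1 - u) * (zmove 0 (noderow v))%:~R + u * (zmove K (noderow v))%:~R.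
Proof. by rewrite /Z /V /line_homotopy /= /GRing.scale /=. Qed.

Let X_ge v : xs v.1 <= X v.
Proof. by rewrite XE; have := xmove_ge K v.1; have := hu => /andP[u0 u1] h; have := ler_wpM2l u0 h; lra. Qed.

Let Z_le v : main v -> Z v <= - (noderow v)%:R.
Proof.
move=> /main_row[_ b0]; rewrite ZE.
have vN : (noderow v < N)%N by exact: ltn_ord.
have := zmove_le K vN b0; rewrite (zmove_0 b0) -(ler_int R) mulrNz => h.
by have := hu => /andP[u0 u1]; have := ler_wpM2l u0 h; rewrite -pmulrn; lra.
Qed.

Let static v : ~~ moved v -> X v = xs v.1 /\ Z v = (zmove 0 (noderow v))%:~R.
Proof.
rewrite negb_or !negbK => /andP[/eqP h1 /eqP h2]; rewrite XE ZE.
by rewrite xmove_none // [zmove K _]zmove_none //; split; ring.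
Qed.

Let H_main v : main v -> H v = D - (noderank v)%:R.
Proof. by rewrite HE /bumped => ->. Qed.

Let rank_lt v : (noderank v < 2 * N)%N.
Proof. by have := ltn_ord v.1; rewrite /noderank; case: v.2; lia. Qed.

Let H_low v : ~~ main v -> H v < D - (2 * N)%:R.
Proof.
rewrite HE /bumped => /negbTE ->; rewrite /D (bigD1 v) //=.
have h := ler_norm (dep v); have : 0 <= \sum_(i | i != v) `|dep i| by apply: sumr_ge0.
by lra.
Qed.

Lemma H_low_rank v w : ~~ main v -> H v < D - (noderank w)%:R.
Proof.
move=> /H_low h; apply: lt_le_trans h _; rewrite lerD2l lerN2 ler_nat ltnW //.
Qed.

Let ptE v a : [/\ (pt (gnext s) V v a).1.1 = (1 - a) * X v + a * X (gnext s v),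
  (pt (gnext s) V v a).1.2 = (1 - a) * Z v + a * Z (gnext s v) &
  (pt (gnext s) V v a).2 = (1 - a) * H v + a * H (gnext s v)].
Proof. by []. Qed.

Lemma main_depth v a : main v -> main (gnext s v) ->
  (1 - a) * H v + a * H (gnext s v) = D - (noderank v)%:R - a.
Proof. by move=> h1 h2; rewrite !H_main // main_next // -natr1; ring. Qed.

(** Lifted edges with smaller numbers are higher than the ramp. The ramp keeps still while the
    others move only to the right and down, so those with greater numbers stay strictly beyond the
    line of the ramp, except at the corner where the ramp ends. *)
Lemma up_ramp v a w b : ~~ main v -> main (gnext s v) -> main w -> main (gnext s w) ->
  0 <= a < 1 -> 0 <= b < 1 -> pt (gnext s) V v a <> pt (gnext s) V w b.
Proof.
move=> nv mv mw mw' /andP[a0 a1] /andP[b0 b1] E.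
have [EX EZ EH] := ptE v a; rewrite E in EX EZ EH.
have [FX FZ FH] := ptE w b; rewrite FX in EX; rewrite FZ in EZ; rewrite FH in EH.
rewrite (main_depth _ mw mw') (H_main mv) in EH.
have Lv w' := H_low_rank w' nv.
have a1' : 0 < 1 - a by lra.
have deep : (1 - a) * H v + a * (D - (noderank (gnext s v))%:R) < D - (noderank (gnext s v))%:R.
  by have := Lv (gnext s v); rewrite -(ltr_pM2l a1'); lra.
have [h|h] := ltnP (noderank w) (noderank (gnext s v)).
  have : (noderank w).+1%:R <= (noderank (gnext s v))%:R :> R by rewrite ler_nat.
  by rewrite -natr1; lra.
have sv : ~~ moved v by apply: contra nv; exact: moved_main.
have sv' : ~~ moved (gnext s v) by apply: contra nv; exact: moved_prev.
have [Xv Zv] := static sv; have [Xv' Zv'] := static sv'.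
have rw' : noderank (gnext s w) = (noderank w).+1 := main_next mw.
have [a00 b00 spv] := main_inner mv.
have b1' : 0 < 1 - b by lra.
have pos (P Q : R) : 0 <= P -> 0 <= Q -> (0 < Q \/ (0 < P /\ b = 0)) -> (1 - b) * P + b * Q = 0 ->
   b = 0 /\ (0 < P -> False).
  exact: (convex_zero b0 b1').
(* The only contact which the projection allows is at the upper end of the ramp, and there the
   depths differ because [a < 1]. *)
have rank_eq : noderank w = noderank (gnext s v) -> b = 0 -> False.
  by move=> h' b00'; rewrite b00' h' in EH; lra.
case: v nv mv E EX EZ EH Lv deep h sv sv' Xv Zv Xv' Zv' spv a00 b00 rank_eq => k [] nv mv E EX EZ EH Lv deep h sv sv' Xv Zv Xv' Zv' spv a00 b00 rank_eq; last first.
  have rkt : noderank (k, true) = (2 * k + 1)%N by [].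
  rewrite Xv Xv' /= in EX; have [_ _ spw] := main_inner mw; have [_ _ spw'] := main_inner mw'.
  have kw' : (k < (gnext s w).1)%N.
    by have := noderank_bound (gnext s w); rewrite rw'; move: h; rewrite gnext_false rkt; case: (gnext s w) => l c /=; clear; lia.
  have Pw' : xs k < X (gnext s w) by apply: lt_le_trans (X_ge _); exact: xs_special.
  have [h'|h'] : noderank w = noderank (k, true) \/ (k < w.1)%N.
    by have := noderank_bound w; move: h; rewrite gnext_false rkt; clear; lia.
    have wk : w = (k, true) := noderank_inj h'.
    have [||||b00' _] := pos (X w - xs k) (X (gnext s w) - xs k).
    - by have := X_ge w; rewrite wk /=; lra.
    - by lra.
    - by left; lra.
    - by lra.
    exact: rank_eq.
  have Pw : xs k < X w by apply: lt_le_trans (X_ge _); exact: xs_special.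
  by have [||||_ ff] := pos (X w - xs k) (X (gnext s w) - xs k); [by rewrite subr_ge0 ltW|by rewrite subr_ge0 ltW|by left; rewrite subr_gt0|by lra|by apply: ff; rewrite subr_gt0].
have bk : bpos k != 0%N.
  apply/eqP => b0'; have := s_last b0'; have [h' _ _] := blkP (ltn_ord k); have nT := nb_lt h' => E'.
  have [_ h2 h3] := pos_out nT (isT : (0 < 14)%N); rewrite addn0 -E' in h2 h3.
  by move: a00; rewrite gnext_true /= h3.
have rowk : noderow (gnext s (k, true)) = k by rewrite /noderow /= sK.
rewrite Zv Zv' rowk /noderow /= (zmove_0 bk) mulrNz -pmulrn in EZ.
have rk : noderank (gnext s (k, true)) = (2 * k + 2)%N by rewrite gnext_true /noderank /= s_inner //; clear; lia.
have [rw bw] := main_row mw; have [rw2 bw2] := main_row mw'.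
have kw' : (k < noderow (gnext s w))%N by rewrite rw2 rw'; move: h; rewrite rk; clear; lia.
have Pw' : Z (gnext s w) < - k%:R.
  by apply: le_lt_trans (Z_le mw') _; rewrite ltrN2 ltr_nat.
have [h'|h'] : noderank w = noderank (gnext s (k, true)) \/ (k < noderow w)%N.
  by rewrite rw; move: h; rewrite rk; clear; lia.
  have wk : w = gnext s (k, true) := noderank_inj h'.
  have Zw := Z_le mw; rewrite {2}wk rowk in Zw.
  have [||||b00' _] := pos (- k%:R - Z w) (- k%:R - Z (gnext s w)).
  - by rewrite subr_ge0.
  - by rewrite subr_ge0 ltW.
  - by left; rewrite subr_gt0.
  - by lra.
  exact: rank_eq.
have Pw : Z w < - k%:R by apply: le_lt_trans (Z_le mw) _; rewrite ltrN2 ltr_nat.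
by have [||||_ ff] := pos (- k%:R - Z w) (- k%:R - Z (gnext s w)); [by rewrite subr_ge0 ltW|by rewrite subr_ge0 ltW|by left; rewrite subr_gt0|by lra|by apply: ff; rewrite subr_gt0].
Qed.

(** Lifted edges with smaller numbers are higher than the ramp. Those with greater numbers are on
    rows strictly below its lowest point, and slide only further down. *)
Lemma down_ramp v a w b : main v -> ~~ main (gnext s v) -> main w -> main (gnext s w) ->
  0 <= a < 1 -> 0 <= b < 1 -> pt (gnext s) V v a <> pt (gnext s) V w b.
Proof.
move=> mv nv mw mw' /andP[a0 a1] /andP[b0 b1] E.
have [EX EZ EH] := ptE v a; rewrite E in EX EZ EH.
have [FX FZ FH] := ptE w b; rewrite FX in EX; rewrite FZ in EZ; rewrite FH in EH.
rewrite (main_depth _ mw mw') (H_main mv) in EH.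
have Lv := ler_wpM2l a0 (ltW (H_low_rank v nv)).
have [h|h|h] := ltngtP (noderank w) (noderank v).
- have : (noderank w).+1%:R <= (noderank v)%:R :> R by rewrite ler_nat.
  by rewrite -natr1; lra.
- have sv : ~~ moved v by apply: contra nv; exact: moved_next.
  have sv' : ~~ moved (gnext s v).
    by apply: contra nv; exact: moved_main.
  have [_ Zv] := static sv; have [_ Zv'] := static sv'.
  have [rv bv] := main_row mv; have [rw bw] := main_row mw; have [rw2 bw2] := main_row mw'.
  have rw' : noderank (gnext s w) = (noderank w).+1 := main_next mw.
  have [a00 b00 spv] := main_inner mv.
  have w1 : w != gnext s v by apply: contra nv => /eqP <-.
  (* The row of [w] is strictly below the lowest row of the ramp. This holds because [w] is neither
     the end of the ramp nor, for a vertical ramp, the corner after it, which is not lifted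
     either. *)
  have {w1 h} h : ((noderank v).-1./2 + 1 + ~~ v.2 <= (noderank w).-1./2)%N.
    have w2 : noderank w <> noderank (gnext s v) by move=> /noderank_inj/eqP; exact/negP.
    have w3 : v.2 = false -> w <> (s v.1, false).
      move=> v2 wE; move: mw nv; rewrite wE /main {wE}.
      case: v v2 mv {rv bv Zv sv w1 w2 h Lv EH EX EZ E Zv' sv' spv rw bw} a00 b00 => k [] //= _ mv a00 b00.
      rewrite (s_inner b00); have [B h2 h3] := pos_succ (ltn_ord k) b00; have := pos_sum (ltn_ord k).
      by move: mv; rewrite /main B h2 h3 /outlen /inlen /=; lia.
    have w4 : v.2 = false -> noderank w <> noderank (s v.1, false).
      by move=> v2 /noderank_inj; exact: w3.
    case: (v) h w2 w4 {rv bv Zv sv w1 w3 Lv EH EX EZ E Zv' sv' spv rw bw nv} mv a00 b00 => k [] h w2 w4 mv a00 b00.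
      have rk : noderank (gnext s (k, true)) = (2 * k + 2)%N by rewrite gnext_true /noderank /= s_inner //; clear; lia.
      have rk' : noderank (k, true) = (2 * k + 1)%N by [].
      by move: h w2; rewrite rk rk' /=; move: (noderank w) => n; clear; lia.
    have rk : noderank (s k, false) = (2 * k + 2)%N by rewrite /noderank /= s_inner //; clear; lia.
    have rk' : noderank (k, true) = (2 * k + 1)%N by [].
    have rk0 : noderank (k, false) = (2 * k + 0)%N by [].
    have k0 : (0 < k)%N by move: a00; rewrite /apos /=; clear; lia.
    by have := w4 erefl; move: h w2 k0; rewrite gnext_false rk rk' rk0 /=; move: (noderank w) => n; clear; lia.
  have low : - (noderow v + ~~ v.2)%:R <= (1 - a) * Z v + a * Z (gnext s v).
    have nn (n : nat) : (zmove 0 n)%:~R = - n%:R :> R \/ bpos n = 0%N.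
      by have [->|/zmove_0 ->] := eqVneq (bpos n) 0%N; [right|left; rewrite mulrNz -pmulrn].
    have ev : Z v = - (noderow v)%:R by rewrite Zv; case: (nn (noderow v)) => // h'; rewrite h' in bv.
    have ev' : Z (gnext s v) = - (noderow v + ~~ v.2)%:R.
      rewrite Zv'; case: (v) {Lv h} a00 b00 rv bv => k [] /= a00 b00 rv bv.
        rewrite gnext_true addn0 /noderow /= sK.
        by case: (nn k) => // h'; rewrite h' in b00.
      rewrite gnext_false /noderow /= (t_inner a00) addn1 prednK; last by move: a00; rewrite /apos /=; clear; lia.
      by case: (nn k) => // h'; rewrite h' in b00.
    have : - (noderow v + ~~ v.2)%:R <= - (noderow v)%:R :> R by rewrite lerN2 ler_nat leq_addr.
    rewrite ev ev'; move: (noderow v + ~~ v.2)%:R (noderow v)%:R => q p h'.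
    by have a1' : 0 <= 1 - a by [lra]; have := ler_wpM2l a1' h'; lra.
  have hi w' : main w' -> (noderank w <= noderank w')%N -> Z w' < - (noderow v + ~~ v.2)%:R.
    move=> m' h'; apply: le_lt_trans (Z_le m') _; rewrite ltrN2 ltr_nat.
    by have [-> _] := main_row m'; rewrite rv; move: h h'; clear; lia.
  have h1 := hi _ mw (leqnn _); have h2 : Z (gnext s w) < - (noderow v + ~~ v.2)%:R.
    by apply: hi => //; rewrite rw'.
  have b1' : 0 < 1 - b by lra.
  by move: h1; rewrite -(ltr_pM2l b1'); have := ler_wpM2l b0 (ltW h2); lra.
- by move: nv; rewrite -(noderank_inj h) mw'.
Qed.

End slide.

(** All labels slide at once along straight lines. An edge with an end that is not lifted keeps
    still; it is lower than the lifted edges, or is a ramp and falls under the two preceding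
    lemmas. *)
Lemma slide_isotopic dep : embedded (gnext s) (gspace t (xmove 0) (zmoveR 0) dep) ->
  exists2 dep', embedded (gnext s) (gspace t (xmove K) (zmoveR K) dep') &
    ambient_isotopic (polygon_trace (gnext s) (gspace t (xmove 0) (zmoveR 0) dep))
      (polygon_trace (gnext s) (gspace t (xmove K) (zmoveR K) dep')).
Proof.
move=> emb; have iso := bump_isotopic emb.
have emb1 : embedded (gnext s) (gspace t (xmove 0) (zmoveR 0) (bumped dep)).
  apply: (embedded_dep (@xmove_inj _) (@zmoveR_inj _) emb) => k l /cross0_nonmain[h1 h2 h3 h4].
  by rewrite /bumped (negbTE h1) (negbTE h2) (negbTE h3) (negbTE h4).
pose V u := line_homotopy (gspace t (xmove 0) (zmoveR 0) (bumped dep))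
                       (gspace t (xmove K) (zmoveR K) (bumped dep)) u.
have emb2 u : 0 <= u <= 1 -> embedded (gnext s) (V u).
  move=> hu; apply: (embedded_half (gnextK sK)) => v w a b ha hb vw.
  pose mm v := main v && main (gnext s v).
  have static v' a' : ~~ mm v' -> pt (gnext s) (V u) v' a' = pt (gnext s) (gspace t (xmove 0) (zmoveR 0) (bumped dep)) v' a'.
    have st w' : ~~ moved w' -> V u w' = gspace t (xmove 0) (zmoveR 0) (bumped dep) w'.
      rewrite negb_or !negbK => /andP[/eqP h1 /eqP h2].
      rewrite /V /line_homotopy /gspace /gcorner /corner; apply: sp_eq; rewrite /= /GRing.scale /=.
      - by rewrite !(@xmove_none _ w'.1) //; ring.
      - by rewrite /zmoveR !(@zmove_none _ (row t w'.1 w'.2)) //; ring.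
      - by ring.
    move=> nm; rewrite /pt !st //; apply: contra nm => h; apply/andP; split.
    + exact: moved_prev.
    + exact: moved_main.
    + exact: moved_main.
    + exact: moved_next.
  have ramp v' a' w' b' : ~~ mm v' -> mm w' -> 0 <= a' < 1 -> 0 <= b' < 1 ->
    pt (gnext s) (V u) v' a' <> pt (gnext s) (V u) w' b'.
    move=> + /andP[m1 m2] ha' hb'; rewrite negb_and.
    have [mv|nv] := boolP (main v'); have [mv'|nv'] := boolP (main (gnext s v')) => // _.
    + exact: down_ramp.
    + exact: up_ramp.
    + move=> /(congr1 snd) /=.
      have := @main_depth dep u w' b' m1 m2; have := @H_low_rank dep u hu v' (gnext s w') nv.
      have := @H_low_rank dep u hu (gnext s v') (gnext s w') nv'; rewrite (main_next m1) -natr1 => h1 h2.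
      rewrite -/V => h3; move: ha' hb' => /andP[a0 a1] /andP[b0 b1].
      have a1' : 0 < 1 - a' by lra.
      move: h2; rewrite -(ltr_pM2l a1'); have := ler_wpM2l a0 (ltW h1).
      move: h3; rewrite /V /pt /= /GRing.scale /=; lra.
  have [mv|nv] := boolP (mm v); have [mw|nw] := boolP (mm w).
  + case/andP: mv => mv mv'; case/andP: mw => mw mw'.
    have E := congr1 snd vw; move: E (@main_depth dep u v a mv mv') (@main_depth dep u w b mw mw').
    rewrite /pt /= => -> -> h; have h2 : (noderank v)%:R + a = (noderank w)%:R + b by lra.
    move: ha hb => /andP[a0 a1] /andP[b0 b1].
    have [h3|h3|h3] := ltngtP (noderank v) (noderank w).
    * by move: h3; rewrite -(ler_nat R) -natr1; lra.
    * by move: h3; rewrite -(ler_nat R) -natr1; lra.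
    * by rewrite h3 in h2; split; [exact: noderank_inj|lra].
  + by case: (ramp _ _ _ _ nw mv hb ha).
  + by case: (ramp _ _ _ _ nv mw ha hb).
  + by apply: (embedded_lt gnext_neq emb1 ha hb); rewrite -!static.
exists (bumped dep); last exact: ambient_isotopic_trans iso (polygon_isotopy emb2).
by have := emb2 1; rewrite /V line_homotopy1; apply; rewrite ler01 lexx.
Qed.

(** * The parity sum after the slide *)

Section parity.
Local Notation X := (xmove K).
Local Notation Z := (zmoveR K).
Local Notation cd := (code K).

Lemma N_ge : (14 <= N)%N.
Proof. by have := e_S T0; have := e_le (i := 1) T0 (leqnn T); rewrite e_T; clear; lia. Qed.

Lemma K_ge : (2 <= K)%N. Proof. by rewrite /K; have := T0; clear; lia. Qed.

Lemma e_last : e T.-1.+1 = N. Proof. by rewrite prednK. Qed.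

Lemma first_blk k : (k < 14)%N -> [/\ (k < N)%N, blk k = 0%N & apos k = k].
Proof. by move=> k7; have := pos_out T0 k7; rewrite e_0 add0n. Qed.

Lemma last_blk b : (b < 14)%N -> [/\ (N - 1 - b < N)%N, blk (N - 1 - b) = T.-1 & bpos (N - 1 - b) = b].
Proof. by move=> b7; have := pos_in (i := T.-1) _ b7; rewrite e_last ltn_predL T0; apply. Qed.

Lemma code_some k j r : (k < N)%N -> mvx k = Some (j, r) ->
  [/\ (j < K)%N, (r < 4)%N & cd k = (8 * (K - j) + r).+1].
Proof. by move=> kN E; have [h1 h2] := mvx_lt kN E; rewrite /code E h1. Qed.

(** From left to right the columns 2, 3, 4, 5 stand in the order 2, 4, 5, 3: the first bend comes
    back once before leaving upwards along the column 5. *)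
Lemma first_code k : (k < 7)%N ->
  cd k = nth 0%N [:: 0; 0; 8 * K + 1; 8 * K + 4; 8 * K + 2; 8 * K + 3; 0]%N k.
Proof.
move=> k7; have := mvx_out T0 k7; rewrite e_0 add0n /code => ->.
by have := K_ge; case: k k7 => [|[|[|[|[|[|[|]]]]]]] //= _; rewrite ?subn0; case: ifP => //; rewrite ?mul0n; clear; lia.
Qed.

Lemma first_z k : (0 < k < 6)%N -> zmove K k = - (nth 0%N [:: 0; N + 8 * K + 4;
  N + 8 * K + (if g then 2 else 3); N + 8 * K + 1; N + 8 * K + (if g then 3 else 2); 5]%N k)%:Z.
Proof.
move=> /andP[k0 k6]; have k7 : (k < 7)%N by exact: ltnW.
have := zmove_out K T0 k7; rewrite e_0 add0n => ->.
have := mvz_out T0 k7; rewrite e_0 add0n => ->.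
by have := K_ge; case: k k0 k6 {k7} => [|[|[|[|[|[|[|]]]]]]] //= _ _; rewrite ?subn0; case: ifP => //; rewrite ?mul0n; clear; lia.
Qed.

(** The last bend mirrors the first one: from left to right stand the columns at the distances 3, 5,
    4, 2 from the end. *)
Lemma last_code b : (b < 7)%N -> cd (N - 1 - b) = nth 0%N [:: 0; 0; 12; 9; 11; 10; 0]%N b.
Proof.
move=> b7; have := mvx_in (i := T.-1) _ b7; rewrite e_last ltn_predL T0 prednK // eqxx /= /code => ->//.
have E : (2 * T.-1 + 1 < K)%N by rewrite /K; have := T0; clear; lia.
have E1 : (K - (2 * T.-1 + 1) = 1)%N by rewrite /K; have := T0; clear; lia.
by case: b b7 => [|[|[|[|[|[|[|]]]]]]] //= _; rewrite E E1.
Qed.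

Lemma last_z b : (0 < b < 7)%N -> zmove K (N - 1 - b) = - (nth 0%N [:: 0; N - 2; N + 12;
  N + 8 + (if g' then 2 else 3); N + 9; N + 8 + (if g' then 3 else 2); N - 7]%N b)%:Z.
Proof.
move=> hb; have := zmove_in (i := T.-1) K _ hb; rewrite e_last => -> //; last by rewrite ltn_predL.
have /andP[b0 b7] := hb; have := mvz_in (i := T.-1) _ b7; rewrite e_last ltn_predL T0 prednK // eqxx /= => -> //.
have E : (2 * T.-1 + 1 < K)%N by rewrite /K; have := T0; clear; lia.
have E1 : (K - (2 * T.-1 + 1) = 1)%N by rewrite /K; have := T0; clear; lia.
by case: b b0 b7 {hb} => [|[|[|[|[|[|[|]]]]]]] //= _ _; rewrite ?E ?E1; case: (g') => /=; have := N_ge; clear; lia.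
Qed.

(** A slid column and the slid rows at its two ends belong to the same bend. *)
Lemma mv_label k k' j r j' r' : (k < N)%N -> (k' = k \/ (apos k != 0%N /\ k' = k.-1)) ->
  mvx k = Some (j, r) -> mvz k' = Some (j', r') -> j' = j.
Proof.
move=> kN H /mvx_spec[_ h1] /mvz_spec[_ h2]; have ps := pos_sum kN.
have h3 := ax_le r; have h4 := bx_le ((blk k).+1 == T) r.
have h5 := az_le r'; have h6 := bz_le ((blk k').+1 == T) r'.
case: H h2 h6 => [->|[a0 ->]]; last have [-> q1 q2] := pos_pred kN a0;
  case: h1 => -[-> h1] [[-> h2]|[-> h2]] h6 //; lia.
Qed.

Lemma mvx_order k m j r j' r' : (k < N)%N -> (m < N)%N -> mvx k = Some (j, r) ->
  mvx m = Some (j', r') -> (j' < j)%N -> (m + 3 <= k)%N.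
Proof.
move=> kN mN /mvx_spec[r4 h1] /mvx_spec[r4' h2] jj.
have h3 := ax_le r; have h4 := bx_le ((blk k).+1 == T) r.
have h5 := ax_le r'; have h6 := bx_le ((blk m).+1 == T) r'.
have a2 : (2 <= ax r)%N by rewrite /ax; case: r r4 {h1 h3 h4} => [|[|[|[|]]]].
have b2 : (2 <= bx ((blk m).+1 == T) r')%N by rewrite /bx; case: (_ == T); case: r' r4' {h2 h5 h6} => [|[|[|[|]]]].
have [bb|bb] := leqP (blk k) (blk m); last first.
  have [_ k1 _] := blkP kN; have [m0 m1 m2] := blkP mN; have := e_le bb (ltnW (let: And3 h _ _ := blkP kN in h)).
  case: h1 h2 => -[Ej Ea] [] [Ej' Ea']; move: Ea Ea'; rewrite /apos /bpos.
  - by have := e_S m0; have := ax_le r'; lia.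
  - by lia.
  - by have := e_S m0; have := ax_le r'; lia.
  - have := e_S (let: And3 h _ _ := blkP kN in h); lia.
have {bb} bb : blk m = blk k by case: h1 h2 => -[Ej Ea] [] [Ej' Ea']; lia.
case: h1 h2 => -[Ej Ea] [] [Ej' Ea']; try lia.
by move: Ea Ea'; rewrite /apos /bpos bb; have := e_S (let: And3 h _ _ := blkP kN in h); lia.
Qed.

(** A row crossing the column [k] has an end farther to the right. If that end belonged to an
    earlier bend, the row would be below the whole column when it has slid, and above it when it has
    not. *)
Lemma cross_moved (k l : 'I_N) j r : mvx k = Some (j, r) -> cross K k l -> exists r', (r < r')%N /\
  ((mvx l = Some (j, r') /\ (cd (s l) < cd k)%N) \/ (mvx (s l) = Some (j, r') /\ (cd l < cd k)%N)).
Proof.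
move=> mk kl; have kN := ltn_ord k; have [jK r4 ck] := code_some kN mk.
have bl : bpos l != 0%N by apply/eqP => b0; have := free_token_row K b0 k; rewrite kl.
have sl := s_inner bl; have lN := ltn_ord l; have slN := ltn_ord (s l).
suff key (m : 'I_N) : m = l \/ m = s l -> (cd k < cd m)%N -> exists r', (r < r')%N /\ mvx m = Some (j, r').
  have k0 : (0 < cd k)%N by rewrite ck.
  case: (cross_code kl k0) => /andP[h1 h2].
    have [r' [h3 h4]] := key _ (or_intror erefl) h2; by exists r'; split => //; right; split.
  have [r' [h3 h4]] := key _ (or_introl erefl) h2; by exists r'; split => //; left; split.
move=> ml; case mm : (mvx m) => [[j' r']|]; last by rewrite [X in (_ < X)%N]/code mm.
have [j'K r'4 cm] := code_some (ltn_ord m) mm.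
rewrite cm ck => h; have [jj|jj] := ltnP j' j; last first.
  have E : j' = j by lia.
  by exists r'; rewrite E; split => //; lia.
exfalso; have mk3 := mvx_order kN (ltn_ord m) mk mm jj.
have lk : (l + 2 <= k)%N by case: ml => E; rewrite E ?sl in mk3; lia.
have ak : apos k != 0%N /\ bpos k != 0%N.
  have A : (2 <= ax r <= 5)%N by rewrite /ax; case: (r) r4 => [|[|[|[|]]]].
  have B l' : (2 <= bx l' r <= 5)%N by rewrite /bx; case: l' => //; case: (r) r4 => [|[|[|[|]]]].
  have ps := pos_sum kN; move: mk => /mvx_spec[_ [[_ E]|[_ E]]]; first by split; lia.
  by have := B ((blk k).+1 == T); split; lia.
case: ak => ak bk; have [pb pa pbb] := pos_pred kN ak; have kN1 : (k.-1 < N)%N by lia.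
have zl : (exists j2 r2, mvz l = Some (j2, r2) /\ (j2 < j)%N /\ (r2 < 5)%N /\ zmove K l = - (N + 8 * (K - j2) + r2)%:Z) \/ zmove K l = - l%:Z.
  case: (zmoveP K lN) => [E|j2 r2 h1 h2 h3 h4 h5|]; [by rewrite E in bl| |by right].
  left; exists j2, r2; split => //; suff -> : j2 = j' by split=> //; split => //; lia.
  apply: (mv_label (ltn_ord m) _ mm h1); case: ml => ->; [by left|right].
  by rewrite sl; split => //; have [_ -> _] := pos_succ lN bl.
have zk (k' : nat) : k' = k :> nat \/ k' = k.-1 -> zmove K k' <= - k.-1%:Z /\ (zmove K k' < - N%:Z -> - (N + 8 * (K - j) + 4)%:Z <= zmove K k').
  move=> hk'; have k'N : (k' < N)%N by case: hk' => ->.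
  case: (zmoveP K k'N) => [E|j2 r2 h1 h2 h3 h4 h5|h1 h2].
  - by case: hk' E => ->; rewrite ?pbb //; move/eqP; rewrite (negbTE bk).
  - have -> : j2 = j by apply: (mv_label kN _ mk h1); case: hk' => ->; [left|right].
    by split; lia.
  - by case: hk' => ->; split; lia.
move: (cross_int kl); rewrite (t_inner ak).
have [z1 z2] := zk _ (or_introl erefl); have [z3 z4] := zk _ (or_intror erefl).
case: zl => [[j2 [r2 [_ [z5 [z6 ->]]]]]|->]; clear -z1 z2 z3 z4 z5 z6 lk jK || clear -z1 z3 lk; lia.
Qed.

(** The two columns of each additional turn that may be crossed. By [free_cols] all other columns
    are free if they are at least two positions away from both ends of their block. *)
Definition gadget k := ((blk k == 0) && ((apos k == 4) || (apos k == 5)) ||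
  ((blk k).+1 == T) && ((bpos k == 4) || (bpos k == 5)))%N.

Lemma mvx_first k r : (k < N)%N -> mvx k = Some (0, r)%N -> k = ax r /\ (r < 4)%N.
Proof.
move=> kN /mvx_spec[r4 [[E1 E2]|[E1 E2]]]; last lia.
have b0 : blk k = 0%N by lia.
by rewrite -E2 /apos b0 e_0 subn0.
Qed.

Lemma mvx_last k r : (k < N)%N -> mvx k = Some (K.-1, r)%N -> k = (N - 1 - bx true r)%N /\ (r < 4)%N.
Proof.
move=> kN /mvx_spec[r4 [[E1 E2]|[E1 E2]]].
  by move: E1; rewrite /K; have := T0; lia.
have b0 : blk k = T.-1 by move: E1; rewrite /K; have := T0; lia.
move: E2; rewrite b0 prednK // eqxx => <-.
by rewrite /bpos b0 e_last; split => //; have := blkP kN; lia.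
Qed.

Lemma mvx_gadget k j r : (k < N)%N -> mvx k = Some (j, r) -> (0 < r)%N -> j = 0%N \/ j = K.-1.
Proof.
move=> kN; rewrite /mvx /K; do 8?[case: ifP => [h|_]] => // -[<- <-] //; try by left.
- by case: eqP => // h1 _; right; lia.
- by right; lia.
- by right; lia.
Qed.

Lemma unmoved_cols (k l : 'I_N) : (1 < apos k)%N -> (1 < bpos k)%N -> ~~ gadget k ->
  mvx k = None -> ~~ cross K k l.
Proof.
move=> a1 b1 gk; have kN := ltn_ord k; have lN := ltn_ord l; have slN := ltn_ord (s l).
have a0 : apos k != 0%N by rewrite -lt0n ltnW.
have b0 : bpos k != 0%N by rewrite -lt0n ltnW.
have [pb pa pbb] := pos_pred kN a0; have N14 := N_ge.
move=> mk; apply: free_column => //.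
  have z1 : mvz k.-1 = None; last first.
    by rewrite (zmove_none _ z1) zmove_0 // pbb.
  case E : (mvz k.-1) => [p|//]; have /mvz_some : mvz k.-1 != None by rewrite E.
  move: gk mk; rewrite /gadget /mvx pb pbb => gk mk h; exfalso; move: mk a1 b1 gk h pa; clear.
  by do 8?[case: ifP => [//|?]] => _ a1 b1 gk h pa; lia.
have z1 : mvz k = None; last by rewrite (zmove_none _ z1) zmove_0.
case E : (mvz k) => [p|//]; have /mvz_some : mvz k != None by rewrite E.
move: gk mk; rewrite /gadget /mvx => gk mk h; exfalso; move: mk a1 b1 gk h; clear.
by do 8?[case: ifP => [//|?]] => _ a1 b1 gk h; lia.
Qed.

Lemma first_cols (k l : 'I_N) r : (1 < apos k)%N -> (1 < bpos k)%N -> ~~ gadget k ->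
  mvx k = Some (0%N, r) -> ~~ cross K k l.
Proof.
move=> a1 b1 gk; have kN := ltn_ord k; have lN := ltn_ord l; have slN := ltn_ord (s l).
have a0 : apos k != 0%N by rewrite -lt0n ltnW.
have b0 : bpos k != 0%N by rewrite -lt0n ltnW.
have [pb pa pbb] := pos_pred kN a0; have N14 := N_ge.
move=> mk; apply/negP => kl.
have bl : bpos l != 0%N by apply/eqP => b0'; have := free_token_row K b0' k; rewrite kl.
have sl := s_inner bl.
have [r' [rr H]] := cross_moved mk kl; have [jK r4 ck] := code_some kN mk.
have zint := cross_int kl; have cdc := cross_code kl; rewrite ck in cdc; have {cdc} := cdc isT.
rewrite -ck (t_inner a0) in zint *.
have [k2 _] := mvx_first kN mk.
have k23 : (k = 2 :> nat \/ k = 3 :> nat)%N.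
  have [h1 h2 h3] := first_blk (k := k) ltac:(by rewrite k2 (leq_ltn_trans (ax_le r))).
  move: gk k2; rewrite /gadget /ax h2 h3 /=; move: r r4 {mk ck rr} => [|[|[|[|]]]] //= _; lia.
have l5 : (2 <= l <= 5)%N.
  case: H => -[/mvx_first h _]; have [q1 q2] := h ltac:(done).
    by rewrite q1; move: r' q2 {rr q1 h} => [|[|[|[|]]]].
  by rewrite sl /ax in q1; move: r' q2 q1 rr {h} => [|[|[|[|]]]] //= _; lia.
move=> cdc; move: cdc zint; rewrite sl.
have : l = 2 :> nat \/ l = 3 :> nat \/ l = 4 :> nat \/ l = 5 :> nat by lia.
by case: k23 => ->; case=> [->|[->|[->|->]]]; rewrite !first_code // ?first_z //= => *; lia.
Qed.

Lemma last_cols (k l : 'I_N) r : (1 < apos k)%N -> (1 < bpos k)%N -> ~~ gadget k ->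
  mvx k = Some (K.-1, r) -> ~~ cross K k l.
Proof.
move=> a1 b1 gk; have kN := ltn_ord k; have lN := ltn_ord l; have slN := ltn_ord (s l).
have a0 : apos k != 0%N by rewrite -lt0n ltnW.
have b0 : bpos k != 0%N by rewrite -lt0n ltnW.
have [pb pa pbb] := pos_pred kN a0; have N14 := N_ge.
move=> mk; apply/negP => kl.
have bl : bpos l != 0%N by apply/eqP => b0'; have := free_token_row K b0' k; rewrite kl.
have sl := s_inner bl.
have [r' [rr H]] := cross_moved mk kl; have [jK r4 ck] := code_some kN mk.
have zint := cross_int kl; have cdc := cross_code kl; rewrite ck in cdc; have {cdc} := cdc isT.
rewrite -ck (t_inner a0) in zint *.
have [k2 _] := mvx_last kN mk.
have bE : bpos k = bx true r by rewrite k2; have [_ _ ->] := last_blk (b := bx true r) ltac:(by rewrite (leq_ltn_trans (bx_le _ _))).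
have k23 : bpos k = 2%N \/ bpos k = 3%N.
  have [h1 h2 h3] := last_blk (b := bpos k) ltac:(by rewrite bE (leq_ltn_trans (bx_le _ _))).
  rewrite -bE in k2; have B : blk k = T.-1 by rewrite k2.
  move: gk; rewrite /gadget B prednK // eqxx /= bE /bx.
  by move: r r4 {mk ck rr bE k2 h1 h2 h3} => [|[|[|[|]]]] //= _; lia.
rewrite -bE in k2.
have [bb [hb lE]] : exists bb, (2 <= bb <= 6)%N /\ l = (N - 1 - bb)%N :> nat.
  case: H => -[/mvx_last h _]; have [q1 q2] := h ltac:(done).
    by exists (bx true r'); split => //; move: r' q2 {rr q1 h} => [|[|[|[|]]]].
  exists (bx true r').+1; split; first by move: r' q2 {rr q1 h} => [|[|[|[|]]]].
  by move: q1; rewrite sl; lia.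
have slE : l.+1 = (N - 1 - bb.-1)%N by lia.
have kpE : k.-1 = (N - 1 - (bpos k).+1)%N by lia.
have : bb = 2 \/ bb = 3 \/ bb = 4 \/ bb = 5 \/ bb = 6 by lia.
move=> hbb cdc; move: hbb cdc zint; rewrite sl slE lE; move: k23 k2 kpE; move: (bpos k) => q k23 k2 kpE.
rewrite kpE k2; case: k23 => -> [->|[->|[->|[->|->]]]]; rewrite !last_code // ?last_z //=; case: (g') => /=; clear; lia.
Qed.

Lemma crossed_label (k l : 'I_N) j r : mvx k = Some (j, r) -> cross K k l -> j = 0%N \/ j = K.-1.
Proof.
move=> mk kl; have [r' [rr H]] := cross_moved mk kl.
have r0 : (0 < r')%N := leq_ltn_trans (leq0n r) rr.
by case: H => -[h _]; exact: (mvx_gadget (ltn_ord _) h r0).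
Qed.

(** A column that stays is between consecutive levels. A slid one is crossed only by rows with an
    end of greater rank in the same bend, so only the two long bends are left to be examined. *)
Lemma free_cols (k : 'I_N) : (1 < apos k)%N -> (1 < bpos k)%N -> ~~ gadget k ->
  forall l, ~~ cross K k l.
Proof.
move=> a1 b1 gk l; case mk : (mvx k) => [[j r]|]; last exact: unmoved_cols.
apply/negP => kl; have kl' := kl; move: kl; apply/negP; case: (crossed_label mk kl') => jE; rewrite jE in mk.
  exact: (first_cols l a1 b1 gk mk).
exact: (last_cols l a1 b1 gk mk).
Qed.

Lemma mvx_none k : (mvx k == None) = ~~ [|| apos k == 2, (blk k == 0) && (2 < apos k < 6),
  bpos k == 2 | ((blk k).+1 == T) && (2 < bpos k < 6)]%N.
Proof.
apply/idP/idP => [/eqP|]; rewrite /mvx; move: (blk k) (apos k) (bpos k) => i a b.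
  by do 8?[case: ifP => [//|?]]; lia.
by do 8?[case: ifP => [?|_]] => //; lia.
Qed.

Lemma code_pos k : (k < N)%N -> (0 < cd k)%N = (mvx k != None).
Proof.
move=> kN; rewrite /code; case E : (mvx k) => [[j r]|//].
by have [-> _] := mvx_lt kN E.
Qed.

Lemma N_gt0 : (0 < N)%N. Proof. exact: leq_trans N_ge. Qed.
(** Total conversion to ordinals, meaningful for [k < N] only. *)
Definition ko k : 'I_N := insubd (Ordinal N_gt0) k.
Lemma koE k : (k < N)%N -> ko k = k :> nat.
Proof. by move=> kN; rewrite /ko val_insubd kN. Qed.
Lemma ko_ord (k : 'I_N) : ko k = k. Proof. by apply/val_inj; rewrite /= koE. Qed.
Lemma ko_s k : (k.+1 < N)%N -> bpos k != 0%N -> s (ko k) = ko k.+1.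
Proof. by move=> kN b0; have kN' := ltnW kN; apply/val_inj; rewrite /= s_inner !koE. Qed.
Lemma ko_t k : (k.+1 < N)%N -> bpos k != 0%N -> t (ko k.+1) = ko k.
Proof. by move=> kN b0; rewrite -ko_s // sK. Qed.

Lemma XposE (k : 'I_N) : (0 < cd k)%N -> X k = M + (cd k).-1%:R.
Proof.
rewrite code_pos // /xmove; case E : (mvx k) => [[j r]|//] _.
by have [h _ ->] := code_some (ltn_ord k) E; rewrite h.
Qed.

Lemma XsE (k : 'I_N) : cd k = 0%N -> X k < M.
Proof. by move=> /xmove_stay ->. Qed.

Lemma X_lt (k l : 'I_N) : (0 < cd k)%N -> (X k < X l) = (cd k < cd l)%N /\ (X l < X k) = (cd l < cd k)%N.
Proof.
move=> k0; rewrite (XposE k0); have [l0|l0] := posnP (cd l); last first.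
  by rewrite (XposE l0) !ltrD2l !ltr_nat; split; move: k0 l0; clear; lia.
have := XsE l0; rewrite l0 k0 => h; split; last by rewrite (lt_le_trans h) // lerDl.
by apply/negbTE; rewrite -leNgt (le_trans (ltW h)) // lerDl.
Qed.

Lemma nbtw_pos (l m : 'I_N) c : (0 < cd l)%N -> (0 < cd m)%N -> c < M -> ~~ btw (X l) (X m) c.
Proof.
move=> /XposE -> /XposE -> cM; rewrite /btw negb_or !negb_and -!ltNge.
by rewrite !(lt_le_trans cM) ?lerDl // orbT.
Qed.

Lemma nbtw_neg (l m : 'I_N) c : cd l = 0%N -> cd m = 0%N -> M <= c -> ~~ btw (X l) (X m) c.
Proof.
move=> /XsE h1 /XsE h2 cM; rewrite /btw negb_or !negb_and -!ltNge.
by rewrite (lt_le_trans h1 cM) (lt_le_trans h2 cM) !orbT.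
Qed.

Definition level (j : nat) : int := - (N + 8 * (K - j) + 4)%:Z.
(** The fixed column leading to the bottom edge of the bend [j], just after a token for even [j] and
    just before one for odd [j]; [bot j] is its lower corner. *)
Definition beta j := (if odd j then e (j./2).+1 - 2 else e (j./2) + 1)%N.
Definition bot j := (ko (beta j), ~~ odd j).

Lemma half_lt j : (j < K)%N -> (j./2 < T)%N.
Proof. by rewrite /K; clear; lia. Qed.

Lemma beta_pos j : (j < K)%N -> (beta j < N)%N /\ if odd j then bpos (beta j) = 1%N /\ blk (beta j) = j./2
  else apos (beta j) = 1%N /\ blk (beta j) = j./2.
Proof.
move=> /half_lt h; rewrite /beta; case: odd.
  by have [] := pos_in h (isT : (1 < 14)%N); rewrite -subnDA.
by have [] := pos_out h (isT : (1 < 14)%N).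
Qed.

Lemma beta_mono j j' : (j < j')%N -> (j' < K)%N -> (beta j < beta j')%N.
Proof.
move=> jj j'K; have h' := half_lt j'K; have h := half_lt (ltn_trans jj j'K).
have p1 := odd_double_half j; have p2 := odd_double_half j'; rewrite /beta.
have := e_S h; have := e_S h'; move=> e1 e2.
have [E|E] := eqVneq (j./2) (j'./2).
  by rewrite E in p1 e2 *; case: (odd j) (odd j') p1 p2 => [] []; lia.
have hh : ((j./2).+1 <= j'./2)%N by lia.
by have := e_le hh (ltnW h'); case: (odd j); case: (odd j'); lia.
Qed.

Lemma bottom j : (j < K)%N -> [/\ nat_of_ord (bot j).1 = beta j, special (beta j), cd (beta j) = 0%N,
  zmove K (row t (bot j).1 (bot j).2) = level j &
  dirH s t X (bot j).1 (bot j).2 /\ dirV t Z (bot j).1 (bot j).2].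
Proof.
move=> jK; have h := half_lt jK; have jE := odd_double_half j; have N14 := N_ge.
have [bN _] := beta_pos jK; have Ek := koE bN; rewrite /dirH /dirV /bot.
have big k m r : (k < N)%N -> mvx k = Some (m, r) -> (0 < cd k)%N.
  by move=> kN E; rewrite code_pos // E.
rewrite /zmoveR ltr_int; move: bN Ek; rewrite /beta; case: (odd j) jE => jE bN Ek /=.
  have [q1 q2 q3] := pos_in h (isT : (1 < 14)%N); have [p1 p2 p3] := pos_in h (isT : (2 < 14)%N).
  have eS := e_S h; have E1 : (e (j./2).+1 - 2 = e (j./2).+1 - 1 - 1)%N by lia.
  have E2 : (e (j./2).+1 - 1 - 1 = (e (j./2).+1 - 1 - 2).+1)%N by lia.
  have tE : t (ko (e (j./2).+1 - 2)) = ko (e (j./2).+1 - 1 - 2).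
    by rewrite E1 E2 ko_t //; [rewrite -E2 -E1|rewrite p3].
  have mx := mvx_in h (isT : (1 < 7)%N); have mx2 := mvx_in h (isT : (2 < 7)%N).
  have c0 : cd (e (j./2).+1 - 2) = 0%N by rewrite E1 /code mx /= !andbF.
  have z2 := zmove_in K h (isT : (0 < 2 < 7)%N); rewrite (mvz_in h (isT : (2 < 7)%N)) /= in z2.
  have jj : (2 * j./2 + 1 = j)%N by rewrite -[RHS]jE -muln2; lia.
  rewrite jj jK in z2 mx2.
  have z1 := zmove_in K h (isT : (0 < 1 < 7)%N); rewrite (mvz_in h (isT : (1 < 7)%N)) /= !andbF in z1.
  rewrite tE !koE // z2 E1 z1; split => //.
  - by rewrite -E1 /special E1 q3 orbT.
  - by rewrite -E1.
  split; last by rewrite -E1 /level; lia.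
  by rewrite -E1; apply: xmove_big; rewrite koE //; apply: big mx2.
have [q1 q2 q3] := pos_out h (isT : (1 < 14)%N); have [p1 p2 p3] := pos_out h (isT : (0 < 14)%N).
have [r1 r2 r3] := pos_out h (isT : (2 < 14)%N).
have eS := e_S h; have ps := pos_sum q1; have ps0 := pos_sum p1; rewrite addn0 in p1 p2 p3 ps0.
have tE : t (ko (e j./2 + 1)) = ko (e j./2) by rewrite addn1 ko_t //; [rewrite -addn1|lia].
have b1 : bpos (e j./2 + 1) != 0%N by move: ps; rewrite q3; clear; lia.
have sE : s (ko (e j./2 + 1)) = ko (e j./2 + 2).
  by rewrite addn1 in b1; rewrite addn2 in r1; rewrite addn1 addn2 ko_s.
have mx := mvx_out h (isT : (1 < 7)%N); have mx2 := mvx_out h (isT : (2 < 7)%N).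
have jj : (2 * j./2 = j)%N by rewrite -[RHS]jE -muln2; lia.
have z1 := zmove_out K h (isT : (1 < 7)%N); rewrite (mvz_out h (isT : (1 < 7)%N)) /= jj jK in z1.
have z0 := zmove_out K h (isT : (0 < 7)%N); rewrite (mvz_out h (isT : (0 < 7)%N)) /= !andbF addn0 in z0.
rewrite /= jj in mx2.
rewrite tE sE !koE // z1 z0; split => //.
- by rewrite /special q3.
- by rewrite /code mx /= !andbF.
split; last by lia.
by apply: xmove_big; rewrite koE //; [rewrite /code mx /= !andbF|apply: big mx2].
Qed.

(** A fixed column gets as low as this only by leading to the bottom of the bend [j] or of an
    earlier, deeper one. *)
Lemma col_touch (k : 'I_N) j : (j < K)%N -> cd k = 0%N -> btw (Z (t k)) (Z k) (level j)%:~R ->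
  (k <= beta j)%N /\ special k.
Proof.
move=> jK c0 B; have kN := ltn_ord k; have N14 := N_ge.
have /negbT : (0 < cd k)%N = false by rewrite c0.
rewrite code_pos // negbK mvx_none => mk.
have [l [hl zl]] : exists l : nat, (l = k :> nat \/ l = t k :> nat) /\ zmove K l <= level j.
  move: B; rewrite /btw /zmoveR !ler_int => /orP[] /andP[h1 h2].
    by exists (t k); split; [right|].
  by exists k; split; [left|].
have lN : (l < N)%N by case: hl => ->.
move: zl; case: (zmoveP K lN) => [|j' r' mz j1 j2 r5 b0|_ _]; rewrite /level; try lia.
move=> zl; have jj : (j' <= j)%N by lia.
suff [E sk] : k = beta j' :> nat /\ special k.
  split => //; rewrite E; move: jj; rewrite leq_eqVlt => /orP[/eqP ->//|jj].
  by rewrite ltnW // beta_mono.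
have mz0 : mvz l != None by rewrite mz.
have tb := mvz_some mz0; rewrite /special.
have [kb k1 k2] := blkP kN; have ps := pos_sum kN.
have ap : apos k = 1%N -> j' = (2 * blk k)%N -> k = beta j' :> nat.
  move=> a1 ->; rewrite /beta mul2n odd_double doubleK; move: a1 k1 k2; rewrite /apos; clear; lia.
have bp : bpos k = 1%N -> j' = (2 * blk k + 1)%N -> k = beta j' :> nat.
  move=> a1 ->; rewrite /beta mul2n addn1 /= odd_double /= uphalf_double; move: a1 k1 k2; rewrite /bpos; clear; lia.
have [_ sp] := mvz_spec mz.
have [E|[a0 E]] : l = k :> nat \/ (apos k != 0%N /\ l = k.-1).
- case: hl => E; first by left.
  have [a0|a0] := eqVneq (apos k) 0%N; last by right; rewrite E t_inner.
  by have := t_first a0; rewrite -E => E'; rewrite E' in b0.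
- have a1 : apos k = 1%N by move: tb mk; rewrite E; lia.
  split; last by rewrite a1.
  by apply: ap => //; case: sp => -[-> q]; rewrite E // in q *; have := bz_le ((blk k).+1 == T) r'; lia.
- have [pb pa pbb] := pos_pred kN a0.
  have b1 : bpos k = 1%N by move: tb mk; rewrite E pb pbb; lia.
  split; last by rewrite b1 orbT.
  apply: bp => //; case: sp => -[-> q]; rewrite E pb // in q *; have := az_le r'; lia.
Qed.

(** Strictly between two successive bottoms there are only rows of ranks 1 to 3, inside an
    additional turn, and both their ends have slid. *)
Lemma row_touch (l : 'I_N) j : (j.+1 < K)%N -> (level j)%:~R < Z l < (level j.+1)%:~R ->
  (0 < cd l)%N /\ (0 < cd (s l))%N.
Proof.
move=> jK; rewrite /zmoveR !ltr_int; have lN := ltn_ord l; have ps := pos_sum lN.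
case: (zmoveP K lN) => [_|j' r' mz j1 j2 r5 b0|_ _]; rewrite /level; try lia.
move=> h; have {}h : j' = j /\ (r' < 4)%N by lia.
have mz0 : mvz l != None by rewrite mz.
rewrite !code_pos // !mvx_none (s_inner b0); have [pb pa pbb] := pos_succ lN b0.
have a1 : apos l <> 1%N by move=> a1; move: mz h; rewrite /mvz a1 /= => -[_ <-] [].
have b2 : bpos l <> 2%N.
  move=> b2; move: mz h; rewrite /mvz b2 /=.
  do 4?[case: ifP => [q|_]; first by move: q ps; rewrite b2; clear; lia].
  by move=> [_ <-] [].
rewrite pb pa; by have := mvz_some mz0; lia.
Qed.

Local Notation T' := (grid_trace s t X Z).
Local Notation cin := (cin s t X Z).
Local Notation cout := (cout s t X Z).
Local Notation quad := (quad s t X Z).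
Let XI := @xmove_inj K.
Let ZI := @zmoveR_inj K.
Let qc := quad_corner tK XI ZI s_neq.

Lemma bot_corner j : (j < K)%N -> corner t X Z (bot j).1 (bot j).2 = (X (bot j).1, (level j)%:~R).
Proof. by move=> jK; have [_ _ _ h _] := bottom jK; rewrite /corner /zmoveR h. Qed.

Lemma bot_cin j : (j < K)%N -> cin (bot j).1 (bot j).2 = quad (X (bot j).1, (level j)%:~R) true true.
Proof. by move=> jK; rewrite -bot_corner // qc; have [_ _ _ _ [-> ->]] := bottom jK. Qed.

Lemma bot_cout j d e' : (j < K)%N -> ~~ (d && e') ->
  cout (bot j).1 (bot j).2 = quad (X (bot j).1, (level j)%:~R) d e'.
Proof.
move=> jK; rewrite -bot_corner // qc; have [_ _ _ _ [-> ->]] := bottom jK.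
by case: d; case: e'.
Qed.

Lemma bot_X j : (j < K)%N -> [/\ X (bot j).1 = xs (bot j).1, X (bot j).1 < M & special (bot j).1].
Proof.
by move=> jK; have [E1 h1 h2 _ _] := bottom jK; rewrite -E1 in h1 h2; split; [exact: xmove_stay|exact: XsE|].
Qed.

Lemma bot_right j (k : 'I_N) : (j < K)%N -> X (bot j).1 < X k -> cd k = 0%N ->
  ~~ btw (Z (t k)) (Z k) (level j)%:~R.
Proof.
move=> jK + c0; have [x1 m1 s1] := bot_X jK; have [E1 _ _ _ _] := bottom jK.
move=> k1; apply/negP => B; have [kb sk] := col_touch jK c0 B.
move: k1; rewrite x1 xmove_stay // ltNge => /negP; apply.
move: kb; rewrite -E1 leq_eqVlt => /orP[/eqP/val_inj -> //|kb].
by apply/ltW/xs_special.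
Qed.

(** Walk above the bottom of the bend [j] to the column of the next bend, then up to the lower left
    of its bottom corner. Fixed columns on the way do not reach this level, and rows between the two
    bottoms are far to the right. *)
Lemma chain j : (j.+1 < K)%N -> cin (bot j).1 (bot j).2 = cout (bot j.+1).1 (bot j.+1).2.
Proof.
move=> jK; have jK' := ltnW jK.
have [E1 _ _ _ _] := bottom jK'; have [E2 _ _ _ _] := bottom jK.
have [x1 m1 s1] := bot_X jK'; have [x2 m2 s2] := bot_X jK.
have lt : X (bot j).1 < X (bot j.+1).1.
  by rewrite x1 x2; apply: xs_special => //; rewrite E1 E2; exact: beta_mono.
rewrite bot_cin // (@bot_cout _ false false) // (quad_hor _ _ lt); last first.
  move=> k /andP[k1 k2]; apply: bot_right => //.
  by have [//|c0] := posnP (cd k); have := lt_trans k2 m2; rewrite (XposE c0) ltNge lerDl ler0n.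
apply: quad_ver; first by rewrite ltr_int /level; move: jK; clear; lia.
by move=> l /(row_touch jK)[h1 h2]; exact: nbtw_pos.
Qed.

Lemma sbtw_code (k l m : 'I_N) : (0 < cd k)%N ->
  sbtw (X l) (X m) (X k) = ((cd l < cd k < cd m) || (cd m < cd k < cd l))%N.
Proof.
by move=> k0; have [h1 h2] := X_lt l k0; have [h3 h4] := X_lt m k0; rewrite /sbtw h1 h2 h3 h4.
Qed.

Lemma top_code (k : 'I_N) : (8 * K < cd k)%N -> (2 <= k <= 5)%N.
Proof.
move=> h; have k0 : (0 < cd k)%N by apply: leq_ltn_trans h.
move: k0 h; rewrite code_pos //; case E : (mvx k) => [[j r]|//] _.
have [jK r4 ->] := code_some (ltn_ord k) E => h.
have j0 : j = 0%N by lia.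
rewrite j0 in E; have [-> _] := mvx_first (ltn_ord k) E.
by rewrite /ax; case: r r4 {E h} => [|[|[|[|]]]].
Qed.

Lemma low_code (k : 'I_N) : (0 < cd k <= 12)%N -> exists2 b, (2 <= b <= 5)%N & k = (N - 1 - b)%N :> nat.
Proof.
move=> /andP[]; rewrite code_pos //; case E : (mvx k) => [[j r]|//] _.
have [jK r4 ->] := code_some (ltn_ord k) E => h.
have j0 : j = K.-1 by lia.
rewrite j0 in E; have [-> _] := mvx_last (ltn_ord k) E; exists (bx true r) => //.
by rewrite /bx; case: r r4 {E h} => [|[|[|[|]]]].
Qed.

Lemma code_ge (k : 'I_N) : (0 < cd k)%N -> (9 <= cd k)%N.
Proof.
rewrite code_pos //; case E : (mvx k) => [[j r]|//] _.
by have [jK r4 ->] := code_some (ltn_ord k) E; lia.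
Qed.

Lemma first_pos k : (k < 7)%N -> bpos k != 0%N.
Proof. by move=> k7; have [h1 h2 h3] := first_blk (k := k) (leq_trans k7 (isT : (7 <= 14)%N)); have := pos_sum h1; lia. Qed.

Lemma first_s k : (k < 7)%N -> [/\ ko k = k :> nat, s (ko k) = ko k.+1 & t (ko k.+1) = ko k].
Proof.
move=> k7; have N14 := N_ge; have b := first_pos k7; split; first by rewrite koE //; lia.
  by rewrite ko_s //; lia.
by rewrite ko_t //; lia.
Qed.

Lemma last_s b : (b < 7)%N -> [/\ ko (N - 1 - b) = (N - 1 - b)%N :> nat,
  s (ko (N - 1 - b.+1)) = ko (N - 1 - b) & t (ko (N - 1 - b)) = ko (N - 1 - b.+1)].
Proof.
move=> b7; have N14 := N_ge; have [_ _ h] := last_blk (b := b.+1) (leq_trans b7 (isT : (7 <= 13)%N)).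
have E : (N - 1 - b = (N - 1 - b.+1).+1)%N by lia.
split; first by rewrite koE //; lia.
  by rewrite ko_s -?E ?h //; lia.
by rewrite E ko_t -?E ?h //; lia.
Qed.

Lemma first_Z k : (0 < k < 6)%N -> Z (ko k) = - (nth 0%N [:: 0; N + 8 * K + 4;
  N + 8 * K + (if g then 2 else 3); N + 8 * K + 1; N + 8 * K + (if g then 3 else 2); 5]%N k)%:R.
Proof.
move=> hk; have [E _ _] := first_s (k := k) ltac:(by case/andP: hk => _ h; exact: ltnW).
by rewrite /zmoveR E first_z // mulrNz -pmulrn.
Qed.

Lemma last_Z b : (0 < b < 7)%N -> Z (ko (N - 1 - b)) = - (nth 0%N [:: 0; N - 2; N + 12;
  N + 8 + (if g' then 2 else 3); N + 9; N + 8 + (if g' then 3 else 2); N - 7]%N b)%:R.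
Proof.
move=> hk; have [E _ _] := last_s (b := b) ltac:(by case/andP: hk).
by rewrite /zmoveR E last_z // mulrNz -pmulrn.
Qed.

Lemma first_cd k : (k < 7)%N ->
  cd (ko k) = nth 0%N [:: 0; 0; 8 * K + 1; 8 * K + 4; 8 * K + 2; 8 * K + 3; 0]%N k.
Proof. by move=> k7; have [-> _ _] := first_s k7; exact: first_code. Qed.

Lemma last_cd b : (b < 7)%N -> cd (ko (N - 1 - b)) = nth 0%N [:: 0; 0; 12; 9; 11; 10; 0]%N b.
Proof. by move=> k7; have [-> _ _] := last_s k7; exact: last_code. Qed.

Lemma z_low l : - (N + 8 * K + 4)%:R <= Z l.
Proof.
have -> : - (N + 8 * K + 4)%:R = (- (N + 8 * K + 4)%:Z)%:~R :> R by rewrite mulrNz -pmulrn.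
rewrite /zmoveR ler_int; have lN := ltn_ord l; case: (zmoveP K lN) => [_|j r _ _ _ h _|_ _]; lia.
Qed.

Lemma level_R j : (level j)%:~R = - (N + 8 * (K - j) + 4)%:R :> R.
Proof. by rewrite /level mulrNz -pmulrn. Qed.

Let bE (b b' : bool) : ~~ (b && b') -> b && b' = false. Proof. by move/negbTE. Qed.

Lemma p1_corner d e' : quad (X (ko 5), Z (ko 5)) d e' =
  if ~~ d && ~~ e' then cin (ko 5) true else cout (ko 5) true.
Proof.
have [E5 s5 _] := first_s (isT : (5 < 7)%N); have [_ _ t5] := first_s (isT : (4 < 7)%N).
have := qc (ko 5) true d e'; rewrite /corner /= => ->; rewrite /dirH /dirV /= s5 t5 !first_Z //=.
have [_ ->] : (X (ko 5) < X (ko 6)) = false /\ (X (ko 5) < X (ko 6)) = false.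
  by have [-> _] := X_lt (k := ko 5) (ko 6) ltac:(by rewrite first_cd //=; lia); rewrite !first_cd //.
have -> : (- 5 < - (N + 8 * K + (if g then 3 else 2))%:R :> R) = false.
  by rewrite ltrN2 ltr_nat; have := N_ge; case: (g) => /=; clear; lia.
by case: d; case: e'.
Qed.

Lemma p4_corner d e' : quad (X (ko 4), Z (ko 3)) d e' =
  if d && ~~ e' then cin (ko 4) false else cout (ko 4) false.
Proof.
have [_ _ t4] := first_s (isT : (3 < 7)%N).
have := qc (ko 4) false d e'; rewrite /corner /= t4 => ->; rewrite /dirH /dirV /= t4 !first_Z //=.
have -> : X (ko 4) < X (ko 3).
  by have [-> _] := X_lt (k := ko 4) (ko 3) ltac:(by rewrite first_cd //=; lia); rewrite !first_cd //=; lia.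
have -> : (- (N + 8 * K + 1)%:R < - (N + 8 * K + (if g then 3 else 2))%:R :> R) = false.
  by rewrite ltrN2 ltr_nat; case: (g) => /=; clear; lia.
by case: d; case: e'.
Qed.

Lemma q1_corner d e' : quad (X (ko (N - 1 - 5)), Z (ko (N - 1 - 6))) d e' =
  if ~~ d && ~~ e' then cin (ko (N - 1 - 5)) false else cout (ko (N - 1 - 5)) false.
Proof.
have [_ _ t5] := last_s (isT : (5 < 7)%N).
have := qc (ko (N - 1 - 5)) false d e'; rewrite /corner /= t5 => ->; rewrite /dirH /dirV /= t5 !last_Z //=.
have -> : (X (ko (N - 1 - 5)) < X (ko (N - 1 - 6))) = false.
  by have [-> _] := X_lt (k := ko (N - 1 - 5)) (ko (N - 1 - 6)) ltac:(by rewrite last_cd); rewrite !last_cd.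
have -> : (- (N - 7)%:R < - (N + 8 + (if g' then 3 else 2))%:R :> R) = false.
  by rewrite ltrN2 ltr_nat; case: (g') => /=; clear; lia.
by case: d; case: e'.
Qed.

Lemma q4_corner d e' : quad (X (ko (N - 1 - 4)), Z (ko (N - 1 - 4))) d e' =
  if ~~ d && ~~ e' then cin (ko (N - 1 - 4)) true else cout (ko (N - 1 - 4)) true.
Proof.
have [_ _ t4] := last_s (isT : (4 < 7)%N); have [_ s4 _] := last_s (isT : (3 < 7)%N).
have := qc (ko (N - 1 - 4)) true d e'; rewrite /corner /= => ->; rewrite /dirH /dirV /= t4 s4 !last_Z //=.
have -> : (X (ko (N - 1 - 4)) < X (ko (N - 1 - 3))) = false.
  by have [-> _] := X_lt (k := ko (N - 1 - 4)) (ko (N - 1 - 3)) ltac:(by rewrite last_cd); rewrite !last_cd.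
have -> : (- (N + 9)%:R < - (N + 8 + (if g' then 3 else 2))%:R :> R) = false.
  by rewrite ltrN2 ltr_nat; case: (g') => /=; clear; lia.
by case: d; case: e'.
Qed.

Lemma code_lt_X (k : 'I_N) c m : M <= c -> c = M + m%:R -> (c < X k -> (m.+1 < cd k)%N) /\ (X k < c -> (cd k < m.+1)%N).
Proof.
move=> Mc cE; have [k0|k0] := posnP (cd k).
  by rewrite k0; split => // h; have := lt_trans h (XsE k0); rewrite ltNge Mc.
by rewrite (XposE k0) cE !ltrD2l !ltr_nat; split; move: k0; clear; lia.
Qed.

(** Both corners touch the outer face: a path runs below the whole diagram, then up on its right
    side, and back to the corner on the level of the row 5, which the column 3 does not reach. *)
Lemma first_label : cout (ko 5) true = cout (bot 0).1 (bot 0).2.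
Proof.
have K0 : (0 < K)%N by apply: leq_trans K_ge.
have N14 := N_ge.
rewrite (@bot_cout 0 true false) // level_R subn0.
have [x1 m1 s1] := bot_X K0.
pose B : R := - (N + 8 * K + 5)%:R; pose c : R := M + (8 * K + 4)%:R.
have Bl : B < - (N + 8 * K + 4)%:R by rewrite ltrN2 ltr_nat; clear; lia.
have Mc : M <= c by rewrite lerDl.
rewrite -(quad_ver _ _ Bl) => [|l /andP[_ h]]; last by have := z_low l; rewrite leNgt h.
have xc : X (bot 0).1 < c by apply: lt_le_trans m1 Mc.
rewrite (quad_hor _ _ xc) => [|k _]; last first.
  apply/negP; rewrite /btw => /orP[] /andP[h _].
    by have := le_trans (z_low (t k)) h; rewrite leNgt Bl.
  by have := le_trans (z_low k) h; rewrite leNgt Bl.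
have B5 : B < Z (ko 5) by rewrite first_Z //= ltrN2 ltr_nat; move: N14; clear; lia.
rewrite (quad_ver _ _ B5) => [|l _]; last first.
  have cX (k : 'I_N) : X k < c.
    rewrite ltNge; apply/negP => h; have := (code_lt_X (c := c - 1) (m := 8 * K + 3) k _ _).1.
    rewrite /c; have -> : (8 * K + 4 = (8 * K + 3).+1)%N by clear; lia.
    rewrite -natr1 addrA addrK lerDl ler0n => /(_ isT erefl) h'.
    have {}h' : (8 * K + 4 < cd k)%N.
      by have := h'; rewrite -addnS; apply; apply: lt_le_trans h; rewrite /c ltrD2l ltr_nat; clear; lia.
    have k5 := top_code (k := k) ltac:(by apply: leq_ltn_trans h'; rewrite leq_addr).
    move: h'; have -> : k = ko k by rewrite ko_ord.
    rewrite first_cd; last by move: k5; clear; lia.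
    by case: (nat_of_ord k) k5 => [|[|[|[|[|[|]]]]]] //= _; clear; lia.
  by rewrite /btw negb_or !negb_and -!ltNge !cX !orbT.
have := p1_corner true false; rewrite /= => <-.
have x5 : X (ko 5) < c.
  by rewrite XposE first_cd //= ?addn3 //; rewrite ltrD2l ltr_nat; clear; lia.
apply: quad_hor => // k /andP[h _].
have {}h : (8 * K + 3 < cd k)%N.
  by move: h; have [-> _] := X_lt (k := ko 5) k ltac:(by rewrite first_cd //= addn3); rewrite first_cd.
have k5 := top_code (k := k) ltac:(by apply: leq_ltn_trans h; rewrite leq_addr).
have kE : k = ko k by rewrite ko_ord.
have k3 : k = 3 :> nat.
  move: h; rewrite kE first_cd; last by move: k5; clear; lia.
  by rewrite -kE; case: (nat_of_ord k) k5 => [|[|[|[|[|[|]]]]]] //= _; clear; lia.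
rewrite kE k3; have [_ _ ->] := first_s (isT : (2 < 7)%N).
rewrite !first_Z // /btw negb_or !negb_and -!ltNge !ltrN2 !ltr_nat /=.
by case: (g) => /=; apply/andP; split; apply/orP; move: N14; clear; lia.
Qed.

Lemma top_row (l : 'I_N) : (8 * K < cd l)%N \/ (8 * K < cd (s l))%N -> (1 <= l <= 5)%N /\ l = ko l.
Proof.
case=> /top_code h; first by split; [move: h; clear; lia|rewrite ko_ord].
rewrite ko_ord; split => //; have [m mE] : exists m, nat_of_ord (s l) = m.+1 by exists (s l).-1; move: h; clear; lia.
have m7 : (m < 7)%N by move: h; rewrite mE; clear; lia.
have [k1 _ k2] := first_s m7; have : l = t (ko m.+1) by rewrite -mE ko_ord sK.
by rewrite k2 => ->; rewrite k1; move: h; rewrite mE; clear; lia.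
Qed.

(** Both corners touch the strip between the columns 4 and 5 above the row 3, and no row strictly
    between the rows 3 and 5 extends so far to the right. *)
Lemma second_label : cin (ko 5) true = cout (ko 4) false.
Proof.
have N14 := N_ge; have := p1_corner false false; rewrite /= => <-; have := p4_corner true true; rewrite /= => <-.
have Z35 : Z (ko 3) < Z (ko 5) by rewrite !first_Z //= ltrN2 ltr_nat; move: N14; clear; lia.
have c5 : (0 < cd (ko 5))%N by rewrite first_cd //= addn3.
rewrite -(quad_ver _ _ Z35) => [|l /andP[z1 z2]].
  apply/esym/quad_hor; first by have [-> _] := X_lt (k := ko 4) (ko 5) ltac:(by rewrite first_cd //= addn2); rewrite !first_cd //=; clear; lia.
  move=> k /andP[]; have [-> _] := X_lt (k := ko 4) k ltac:(by rewrite first_cd //= addn2).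
  have [_ ->] := X_lt k c5; rewrite !first_cd //=; clear; lia.
apply/negP => B.
have [l5 lE] : (1 <= l <= 5)%N /\ l = ko l.
  apply: top_row; move: B; rewrite /btw.
  have [h1 h2] := X_lt l c5; have [h3 h4] := X_lt (s l) c5; rewrite !leNgt h1 h2 h3 h4 first_cd //=; clear; lia.
move: z1 z2; rewrite lE; have : [\/ l = 1 :> nat, l = 2 :> nat, l = 3 :> nat | l = 4 :> nat] \/ l = 5 :> nat.
  by move: l5; case: (nat_of_ord l) => [|[|[|[|[|[|]]]]]] // _; [left; constructor 1|left; constructor 2|left; constructor 3|left; constructor 4|right].
by case=> [[]|] ->; rewrite !first_Z //= !ltrN2 !ltr_nat; case: (g) => /=; move: N14; clear; lia.
Qed.

Lemma mvz_none k : ~~ [|| apos k == 1, (blk k == 0) && (1 < apos k < 5),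
  bpos k == 2 | ((blk k).+1 == T) && (2 < bpos k < 6)]%N -> mvz k = None.
Proof. by move=> h; case E : (mvz k) => [p|//]; have /mvz_some : mvz k != None; [rewrite E|rewrite (negbTE h)]. Qed.

(** A bend is attached to the fixed part by its bottom and by one undisturbed row. Among the latter,
    the row [N - 7] at which the last bend begins has the greatest number. *)
Lemma jump_row (l : 'I_N) : (0 < cd l)%N != (0 < cd (s l))%N ->
  (exists2 j, (j < K)%N & zmove K l = level j) \/ zmove K l = - l%:Z /\ (l <= N - 7)%N.
Proof.
have lN := ltn_ord l; have ps := pos_sum lN; have [iT k1 k2] := blkP lN; rewrite !code_pos // !mvx_none !negbK.
have jK q : (q < 2)%N -> (2 * blk l + q < K)%N by move: iT; rewrite /K; clear; lia.
have [b0|b0] := eqVneq (bpos l) 0%N.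
  have := s_last b0; have nT := nb_lt iT => E; have [_ h2 h3] := pos_out nT (isT : (0 < 14)%N).
  have := pos_sum (ltn_ord (s l)); rewrite addn0 -E in h2 h3; rewrite h3 b0; move: ps; rewrite b0; clear; lia.
rewrite (s_inner b0); have [pb pa pbb] := pos_succ lN b0; rewrite pb pa => h.
have zE j : mvz l = Some (j, 4)%N -> (j < K)%N -> zmove K l = level j.
  by move=> mz jK'; rewrite /zmove (negbTE b0) mz jK'.
have [a1|a1] := eqVneq (apos l) 1%N.
  by left; exists (2 * blk l + 0)%N; [exact: jK|apply: zE; [rewrite /mvz a1 addn0|exact: jK]].
have [b2|b2] := eqVneq (bpos l) 2%N.
  left; exists (2 * blk l + 1)%N; first exact: jK.
  apply: zE; last exact: jK.
  rewrite /mvz b2 (negbTE a1) /=; do 3?[case: ifP => [q|_]; first by move: q ps; rewrite b2; clear; lia].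
  by [].
right; split.
  rewrite (zmove_none _ (mvz_none _)) ?zmove_0 //; move: h a1 b2 ps pbb; clear; lia.
have eS := e_S iT; have eN := e_le (i := (blk l).+1) (j := T) iT (leqnn T); rewrite e_T in eN.
move: h; rewrite /apos /bpos in a1 b2 ps pbb *.
have [last|nlast] := eqVneq (blk l).+1 T.
  rewrite last e_T in k2 eS pbb b2 ps b0 *; move: a1 b2 ps pbb k1 k2 eS; clear; lia.
have iT1 : ((blk l).+1 < T)%N by rewrite ltn_neqAle nlast.
have eS1 := e_S iT1; have eN1 := e_le (i := (blk l).+2) (j := T) iT1 (leqnn T); rewrite e_T in eN1.
move: k1 k2 eS eS1 eN1; clear; lia.
Qed.

Lemma nbtw_pos8 (l m : 'I_N) c : (0 < cd l)%N -> (0 < cd m)%N -> c < M + 8 -> ~~ btw (X l) (X m) c.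
Proof.
move=> l0 m0 cM; have big (k : 'I_N) : (0 < cd k)%N -> c < X k.
  move=> k0; apply: lt_le_trans cM _; rewrite XposE // lerD2l.
  by rewrite ler_nat; move: (code_ge k0); clear; lia.
by rewrite /btw negb_or !negb_and -!ltNge !big // orbT.
Qed.

(** The path follows the bottom of the last bend, goes up between the fixed and the slid columns,
    and then right along the undisturbed row to the corner where the turn begins. *)
Lemma last_label : cin (ko (N - 1 - 5)) false = cin (bot K.-1).1 (bot K.-1).2.
Proof.
have N14 := N_ge; have K2 := K_ge; have K0 : (K.-1 < K)%N by move: K2; clear; lia.
have [x1 m1 s1] := bot_X K0.
(* Fixed columns are left of [M] and slid ones start at [M + 8], so the vertical line [c] separates
   them. *)
pose c : R := M + 15 / 2; have cM : M < c by rewrite /c; lra.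
have cM8 : c < M + 8 by rewrite /c; lra.
have c9 : c < X (ko (N - 1 - 5)) by rewrite XposE last_cd //= /c; lra.
have := q1_corner false false; rewrite /= => <-; rewrite bot_cin //.
have big (k : 'I_N) : X k < c -> cd k = 0%N.
  move=> kc; have [//|k0] := posnP (cd k); have := lt_trans kc cM8.
  by rewrite (XposE k0) ltrD2l ltr_nat; have := code_ge k0; clear; lia.
have xc : X (bot K.-1).1 < c by exact: lt_trans m1 cM.
rewrite (quad_hor _ _ xc) => [|k /andP[k1 /big c0]]; last exact: bot_right.
have E1 : (K - K.-1 = 1)%N by move: K2; clear; lia.
have lev : (level K.-1)%:~R < Z (ko (N - 1 - 6)).
  by rewrite level_R last_Z //= ltrN2 ltr_nat E1; clear; lia.
rewrite (quad_ver _ _ lev) => [|l /andP[z1 z2]]; last first.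
  have [l0|l0] := posnP (cd l); have [sl0|sl0] := posnP (cd (s l)).
  - by apply: nbtw_neg => //; exact: ltW.
  - exfalso; have J := @jump_row l; rewrite l0 sl0 in J; have {}J := J isT; rewrite last_Z //= /zmoveR in z2; rewrite /zmoveR in z1.
    case: J => [[j jK E]|[E lN]].
      by move: z1; rewrite E ltr_int /level; move: K2 jK; clear; lia.
    by move: z2; rewrite E mulrNz -pmulrn ltrN2 ltr_nat; move: lN; clear; lia.
  - exfalso; have J := @jump_row l; rewrite l0 sl0 in J; have {}J := J isT; rewrite last_Z //= /zmoveR in z2; rewrite /zmoveR in z1.
    case: J => [[j jK E]|[E lN]].
      by move: z1; rewrite E ltr_int /level; move: K2 jK; clear; lia.
    by move: z2; rewrite E mulrNz -pmulrn ltrN2 ltr_nat; move: lN; clear; lia.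
  - exact: nbtw_pos8.
have -> : quad (c, Z (ko (N - 1 - 6))) false false = quad (c, Z (ko (N - 1 - 6))) true false.
  apply: quad_off_V => k /=; apply/eqP => E; have : X k < M + 8 by rewrite E.
  have [k0|k0] := posnP (cd k); first by have := XsE k0; rewrite E ltNge (ltW cM).
  by rewrite (XposE k0) ltrD2l ltr_nat; have := code_ge k0; clear; lia.
apply/esym/quad_hor => // k /andP[k1 k2].
have k0 : (0 < cd k)%N.
  by rewrite lt0n; apply/eqP => /XsE h; have := lt_trans k1 h; rewrite ltNge (ltW cM).
have ck : (cd k < 10)%N.
  by move: k2; have [_ ->] := X_lt (k := ko (N - 1 - 5)) k ltac:(by rewrite last_cd); rewrite last_cd.
have [|b hb kE] := low_code (k := k); first by rewrite k0 ltnW // (leq_trans ck).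
have ck9 := code_ge k0.
have kE' : k = ko (N - 1 - b) by rewrite -kE ko_ord.
have b3 : b = 3%N.
  move: ck ck9; rewrite kE' last_cd; last by move: hb; clear; lia.
  by case: b hb {kE kE'} => [|[|[|[|[|[|]]]]]].
rewrite kE' b3; have [_ _ ->] := last_s (isT : (3 < 7)%N); rewrite !last_Z //=.
rewrite /btw negb_or !negb_and -!ltNge !ltrN2 !ltr_nat.
by case: (g') => /=; move: N14; clear; lia.
Qed.

(** Both corners touch the strip between the columns at the distances 5 and 4 from the end, above
    the row at the distance 4. *)
Lemma last_label' : cout (ko (N - 1 - 5)) false = cout (ko (N - 1 - 4)) true.
Proof.
have N14 := N_ge; have K2 := K_ge.
have := q1_corner true false; rewrite /= => <-; have := q4_corner false true; rewrite /= => <-.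
have Z46 : Z (ko (N - 1 - 4)) < Z (ko (N - 1 - 6)) by rewrite !last_Z //= ltrN2 ltr_nat; clear; lia.
have c5 : (0 < cd (ko (N - 1 - 5)))%N by rewrite last_cd.
have c4 : (0 < cd (ko (N - 1 - 4)))%N by rewrite last_cd.
rewrite -(quad_ver _ _ Z46) => [|l].
  apply: quad_hor; first by have [-> _] := X_lt (ko (N - 1 - 4)) c5; rewrite !last_cd.
  by move=> k /andP[]; have [-> _] := X_lt k c5; have [_ ->] := X_lt k c4; rewrite !last_cd //=; clear; lia.
rewrite !last_Z //= /zmoveR; have lN := ltn_ord l.
have -> : - (N + 9)%:R = (- (N + 9)%:Z)%:~R :> R by rewrite mulrNz -pmulrn.
have -> : - (N - 7)%:R = (- (N - 7)%:Z)%:~R :> R by rewrite mulrNz -pmulrn.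
rewrite !ltr_int; case: (zmoveP K lN) => [_|j r _ _ jK r5 _|mz b0].
- by clear; lia.
- by move: jK r5; clear; lia.
move=> h; have {h} l7 : (N - 7 < l)%N by move: h; clear; lia.
have [b b6 lE] : exists2 b, (b < 6)%N & l = (N - 1 - b)%N :> nat by exists (N - 1 - l)%N; move: l7 lN; clear; lia.
have [q1 q2 q3] := last_blk (b := b) (leq_trans b6 (isT : (6 <= 14)%N)).
have b1 : b = 1%N.
  have /negP : ~ (mvz l != None).
    by case E : (mvz l) => [[j r]|//] _; have := mz _ _ E; have [jK _] := mvz_lt lN E; rewrite leqNgt jK.
  rewrite negbK => /eqP E; move: E b0; rewrite lE /mvz q2 q3 prednK // eqxx /=.
  case: b b6 {lE q1 q2 q3} => [|[|[|[|[|[|]]]]]] //= _; do 4?[case: ifP => //].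
rewrite b1 in lE; have lo : l = ko (N - 1 - 1) by rewrite -lE ko_ord.
have [_ sl _] := last_s (isT : (0 < 7)%N).
by apply: nbtw_neg; rewrite ?lo ?sl ?last_cd // XposE // last_cd //= lerDl ler0n.
Qed.

Lemma big7 (f : nat -> bool) c : \big[addb/false]_(c <= k < c + 7) f k =
  f c (+) (f (c + 1) (+) (f (c + 2) (+) (f (c + 3) (+) (f (c + 4) (+) (f (c + 5) (+) f (c + 6))))))%N.
Proof.
rewrite -{1}[c]add0n big_addn addKn big_mkord !big_ord_recl big_ord0 /= /bump /= !add1n.
by rewrite add0n addbF !(addnC c).
Qed.

Lemma addb_cancel1 x a b : (x (+) a) (+) (b (+) x) = a (+) b.
Proof. by case: x a b => [] [] []. Qed.

Lemma addb_cancel2 x a b : (a (+) x) (+) (x (+) b) = a (+) b.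
Proof. by case: x a b => [] [] []. Qed.

Lemma addb_cancel3 a b p q r v : (a (+) b) (+) (((p (+) q) (+) (q (+) a)) (+) ((b (+) r) (+) (v (+) r))) = p (+) v.
Proof. by case: a b p q r v => [] [] [] [] [] []. Qed.

Lemma big_add4 (f1 f2 f3 f4 : nat -> bool) m :
  \big[addb/false]_(0 <= i < m) ((f1 i (+) f2 i) (+) (f3 i (+) f4 i)) =
  (\big[addb/false]_(0 <= i < m) f1 i (+) \big[addb/false]_(0 <= i < m) f2 i) (+)
  (\big[addb/false]_(0 <= i < m) f3 i (+) \big[addb/false]_(0 <= i < m) f4 i).
Proof. by rewrite !big_split. Qed.

Lemma big_blocks (f : nat -> bool) m : (m <= T)%N ->
  \big[addb/false]_(0 <= k < e m) f k = \big[addb/false]_(0 <= i < m) \big[addb/false]_(e i <= k < e i.+1) f k.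
Proof.
elim: m => [_|m IH mT]; first by rewrite e_0 !big_geq.
rewrite big_nat_recr //= -IH ?(ltnW mT) // -big_cat_nat //=.
by have := e_S mT; clear; lia.
Qed.

Section sum.
Variable F : set (R * R).
Local Notation om := (omega s t X Z).
Let A k := om (ko k) true F.
Let C k := om (ko k) false F.
Let f k := A k (+) C k.

Let f_free k : (k < N)%N -> (1 < apos k)%N -> (1 < bpos k)%N -> ~~ gadget k -> f k = false.
Proof.
move=> kN a1 b1 gk; have kE := koE kN.
have := free_cols (k := ko k); rewrite kE => /(_ a1 b1 gk) h.
by rewrite /f /A /C (free_col sK tK XI ZI s_neq F h) addbb.
Qed.

Let row_free k : (k < N)%N -> bpos k != 0%N -> special k -> special k.+1 -> cd k = 0%N -> cd k.+1 = 0%N ->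
  A k = C k.+1.
Proof.
move=> kN b0 s0 s1 c0 c1; have kE := koE kN.
have h := @moved_free_row K (ko k); rewrite kE in h; have {}h := h b0 s0 s1 c0 c1.
rewrite /A /C (free_row sK tK XI ZI s_neq F h); congr (om _ _ _).
by apply/val_inj; rewrite /= s_inner kE // koE //; have := pos_succ kN b0; move: b0; rewrite /bpos => b0; have [h1 h2 h3] := blkP kN; have := e_le (i := (blk k).+1) (j := T) h1 (leqnn T); rewrite e_T; move: b0 h3; clear; lia.
Qed.

(** Free columns contribute nothing, and a free row gives equal contributions at its two ends. There
    remain the corners at the tokens, the two bottom corners and, in the first and the last block,
    the additional turn. *)
Let block i : (i < T)%N -> \big[addb/false]_(e i <= k < e i.+1) f k =
  (C (e i) (+) A (e i.+1 - 1)) (+) (A (e i + 1) (+) C (e i.+1 - 2))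
  (+) (((i == 0%N) && (f 4 (+) f 5)) (+) ((i == T.-1) && (f (N - 1 - 5) (+) f (N - 1 - 4)))).
Proof.
move=> iT; have eS := e_S iT; have eN := e_le (i := i.+1) (j := T) iT (leqnn T); rewrite e_T in eN.
have N14 := N_ge.
rewrite (big_cat_nat (n := e i + 7)) /=; [|clear -eS; lia|clear -eS; lia].
rewrite [X in _ (+) X](big_cat_nat (n := e i.+1 - 7)) /=; [|clear -eS; lia|clear -eS; lia].
rewrite [X in _ (+) (X (+) _)]big_nat [X in _ (+) (X (+) _)]big1 => [|k /andP[k1 k2]]; last first.
  have kN : (k < N)%N by clear -k2 eN; lia.
  have B : blk k = i by apply: blk_uniq => //; [clear -k1; lia|clear -k2 eS; lia].
  by apply: f_free => //; rewrite /gadget /apos /bpos B; clear -k1 k2 eS; lia.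
have E7 : (e i.+1 = e i.+1 - 7 + 7)%N by clear -eS; lia.
have L7 := big7 f (e i.+1 - 7); rewrite -E7 in L7; rewrite big7 L7 addFb {L7}.
have po a : (a < 14)%N -> [/\ (e i + a < N)%N, blk (e i + a) = i & apos (e i + a) = a] by exact: pos_out.
have pin b : (b < 14)%N -> [/\ (e i.+1 - 1 - b < N)%N, blk (e i.+1 - 1 - b) = i & bpos (e i.+1 - 1 - b) = b] by exact: pos_in.
have fo a : (1 < a < 7)%N -> ~~ ((i == 0) && ((a == 4) || (a == 5)))%N -> f (e i + a) = false.
  move=> ha ng; have [h1 h2 h3] := po a (leq_trans (proj2 (andP ha)) (isT : (7 <= 14)%N)).
  have ps := pos_sum h1; rewrite h3 in ps; apply: f_free => //; rewrite /gadget ?h2 ?h3; clear -ha ng ps; lia.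
have fi b : (1 < b < 7)%N -> ~~ ((i.+1 == T) && ((b == 4) || (b == 5)))%N -> f (e i.+1 - 1 - b) = false.
  move=> ha ng; have [h1 h2 h3] := pin b (leq_trans (proj2 (andP ha)) (isT : (7 <= 14)%N)).
  have ps := pos_sum h1; rewrite h3 in ps; apply: f_free => //; rewrite /gadget ?h2 ?h3; clear -ha ng ps; lia.
have st : A (e i) = C (e i + 1).
  have [h1 h2 h3] := po 0%N isT; rewrite addn0 in h1 h2 h3; have ps := pos_sum h1; rewrite addn1.
  have [h4 h5 h6] := po 1%N isT; rewrite addn1 in h4 h5 h6.
  have m0 := mvx_out iT (isT : (0 < 7)%N); have m1 := mvx_out iT (isT : (1 < 7)%N).
  rewrite addn0 /= !andbF in m0; rewrite addn1 /= !andbF in m1.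
  apply: row_free => //; rewrite ?/special ?h3 ?h6 ?/code ?m0 ?m1 //.
  by rewrite h3 in ps; clear -ps; lia.
have fin : A (e i.+1 - 2) = C (e i.+1 - 1).
  have [h1 h2 h3] := pin 1%N isT; have [h4 h5 h6] := pin 0%N isT; rewrite subn0 in h4 h5 h6.
  have E1 : (e i.+1 - 2 = e i.+1 - 1 - 1)%N by clear -eS; lia.
  have E2 : (e i.+1 - 1 = (e i.+1 - 1 - 1).+1)%N by clear -eS; lia.
  have m0 := mvx_in iT (isT : (0 < 7)%N); have m1 := mvx_in iT (isT : (1 < 7)%N).
  rewrite subn0 /= !andbF in m0; rewrite /= !andbF in m1.
  rewrite E1 [in RHS]E2; apply: row_free => //; rewrite -?E2 ?/special ?h3 ?h6 ?orbT ?/code ?m0 ?m1 //.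
have Eb b : (b < 7)%N -> (e i.+1 - 7 + b = e i.+1 - 1 - (6 - b))%N by clear -eS; lia.
have Eb0 : (e i.+1 - 7 = e i.+1 - 1 - 6)%N by clear; lia.
rewrite !Eb // Eb0 !subSS !subn0.
rewrite (fo 2%N) // ?(fo 3%N) // ?(fo 6%N) //; try by rewrite /= ?andbF.
rewrite (fi 2%N) // ?(fi 3%N) // ?(fi 6%N) //; try by rewrite /= ?andbF.
have fE : f (e i.+1 - 1 - 1) (+) f (e i.+1 - 1) = C (e i.+1 - 2) (+) A (e i.+1 - 1).
  by rewrite -subnDA /f fin; case: (C _) (C _) (A _) => [] [] [].
have o45 : f (e i + 4) (+) f (e i + 5) = (i == 0)%N && (f 4 (+) f 5).
  have [->|i0] := eqVneq i 0%N; first by rewrite e_0.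
  by rewrite (fo 4%N) ?(fo 5%N) // (negbTE i0).
have i45 : f (e i.+1 - 1 - 5) (+) f (e i.+1 - 1 - 4) = (i == T.-1)%N && (f (N - 1 - 5) (+) f (N - 1 - 4)).
  have [->|i0] := eqVneq i T.-1; first by rewrite prednK // e_T.
  have i1 : (i.+1 == T) = false by apply/negbTE; clear -i0 iT; lia.
  by rewrite (fi 4%N) ?(fi 5%N) // i1.
rewrite -o45 -i45.
move: fE.
have e1 : f (e i) (+) f (e i + 1) = C (e i) (+) A (e i + 1).
  by rewrite /f st; case: (C (e i)) (C (e i + 1)) (A (e i + 1)) => [] [] [].
move: e1; move: (f (e i)) (f (e i + 1)) (C (e i)) (A (e i + 1)) => a1 a2 a3 a4 e1.
move: (f (e i.+1 - 1 - 1)) (f (e i.+1 - 1)) (C (e i.+1 - 2)) (A (e i.+1 - 1)) => b1 b2 b3 b4 e2.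
move: (f (e i + 4)) (f (e i + 5)) (f (e i.+1 - 1 - 5)) (f (e i.+1 - 1 - 4)) => c1 c2 c3 c4.
move: e1 e2; case: a1; case: a2; case: a3; case: a4 => //= _; case: b1; case: b2; case: b3; case: b4 => //= _;
  case: c1; case: c2; case: c3; case: c4 => //.
Qed.

(** The row of a token is free, so both its ends contribute alike; as [nb] is a permutation of the
    blocks, each end of a block is matched with the start where the link goes on. *)
Lemma tokens_cancel : \big[addb/false]_(0 <= i < T) (C (e i) (+) A (e i.+1 - 1)) = false.
Proof.
rewrite big_split /= !big_mkord.
have nbT (i : 'I_T) : (nb i < T)%N by exact: nb_lt.
pose h (i : 'I_T) : 'I_T := Ordinal (nbT i).
have hI : injective h.
  by move=> i j /(congr1 val) /= E; apply/val_inj; exact: nb_inj E.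
rewrite (reindex_inj hI) /= -big_split big1 // => i _ /=.
have iT := ltn_ord i; have [h1 h2 h3] := pos_in iT (isT : (0 < 14)%N); rewrite subn0 in h1 h2 h3.
suff -> : A (e i.+1 - 1) = C (e (nb i)) by rewrite addbb.
have kE := koE h1; have fr := @free_token_row K (ko (e i.+1 - 1)); rewrite kE in fr.
rewrite /A /C (free_row sK tK XI ZI s_neq F (fr h3)); congr (om _ _ _).
have := s_last (k := ko (e i.+1 - 1)); rewrite kE => /(_ h3); rewrite h2 => E.
by apply/val_inj; rewrite /= E koE // -E.
Qed.

(** By [chain] the inner face of each bend cancels with the outer face of the next one, which leaves
    the outer face of the first bend and the inner face of the last. *)
Lemma bottoms_sum m : (m < T)%N -> \big[addb/false]_(0 <= i < m.+1) (A (e i + 1) (+) C (e i.+1 - 2)) =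
  `[< cout (bot 0).1 (bot 0).2 = F >] (+) `[< cin (bot (2 * m + 1)).1 (bot (2 * m + 1)).2 = F >].
Proof.
have b0 i : bot (2 * i) = (ko (e i + 1), true) by rewrite /bot /beta mul2n odd_double doubleK.
have b1 i : bot (2 * i + 1) = (ko (e i.+1 - 2), false).
  by rewrite /bot /beta mul2n addn1 /= odd_double /= uphalf_double.
have o i : (i < T)%N -> A (e i + 1) (+) C (e i.+1 - 2) =
    `[< cout (bot (2 * i)).1 (bot (2 * i)).2 = F >] (+) `[< cin (bot (2 * i + 1)).1 (bot (2 * i + 1)).2 = F >].
  move=> iT; have := @chain (2 * i); have -> : ((2 * i).+1 = 2 * i + 1)%N by rewrite addn1.
  move=> /(_ ltac:(move: iT; rewrite /K; clear; lia)).
  rewrite /A /C /omega b0 b1 /= => ->.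
    exact: addb_cancel1.
elim: m => [T0'|m IH mT]; first by rewrite big_nat1 o.
rewrite big_nat_recr //= IH ?(ltnW mT) // o //.
have := @chain (2 * m + 1); have -> : ((2 * m + 1).+1 = 2 * m.+1)%N by clear; lia.
move=> /(_ ltac:(move: mT; rewrite /K; clear; lia)) ->.
exact: addb_cancel2.
Qed.

(** By the four label lemmas, the two faces left by the bottoms and the strips between the columns
    of the turns each occur twice. Only the face inside each additional turn survives. *)
Lemma omega_sum : \big[addb/false]_(k : 'I_N) (om k true F (+) om k false F) =
  `[< cin (ko 4) false = F >] (+) `[< cin (ko (N - 1 - 4)) true = F >].
Proof.
have N14 := N_ge; have K2 := K_ge.
have -> : \big[addb/false]_(k : 'I_N) (om k true F (+) om k false F) = \big[addb/false]_(0 <= k < N) f k.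
  by rewrite big_mkord; apply: eq_bigr => k _; rewrite /f /A /C ko_ord.
rewrite -{1}e_T big_blocks // (eq_big_nat _ _ (F2 := fun i => (C (e i) (+) A (e i.+1 - 1)) (+)
  (A (e i + 1) (+) C (e i.+1 - 2))
  (+) (((i == 0%N) && (f 4 (+) f 5)) (+) ((i == T.-1) && (f (N - 1 - 5) (+) f (N - 1 - 4)))))); last first.
  by move=> i /andP[_ iT]; exact: block.
rewrite (big_add4 (fun i => C (e i) (+) A (e i.+1 - 1)) (fun i => A (e i + 1) (+) C (e i.+1 - 2))
  (fun i => (i == 0%N) && (f 4 (+) f 5)) (fun i => (i == T.-1) && (f (N - 1 - 5) (+) f (N - 1 - 4)))).
rewrite tokens_cancel addFb.
have pick j c : (j < T)%N -> \big[addb/false]_(0 <= i < T) ((i == j) && c) = c.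
  move=> jT; rewrite big_mkord (bigD1 (Ordinal jT)) //= eqxx big1 ?addbF // => i /negbTE.
  by rewrite -val_eqE /= => ->.
rewrite !pick //; last by rewrite ltn_predL.
have -> : \big[addb/false]_(0 <= i < T) (A (e i + 1) (+) C (e i.+1 - 2)) =
  `[< cout (bot 0).1 (bot 0).2 = F >] (+) `[< cin (bot K.-1).1 (bot K.-1).2 = F >].
  have E : (2 * T.-1 + 1 = K.-1)%N by rewrite /K; have := T0; clear; lia.
  by rewrite -{1}(prednK T0) bottoms_sum ?ltn_predL // E.
have f45 : f 4 (+) f 5 = C 4 (+) A 5.
  have [E4 s4 _] := first_s (isT : (4 < 7)%N).
  have c4 : (0 < cd (ko 4))%N by rewrite first_cd //= addn2.
  have fr k : ~~ cross K k (ko 4).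
    apply/negP => kl; have := kl => /andP[_]; rewrite s4.
    have [h1 h2] := X_lt k c4; have c5 : (0 < cd (ko 5))%N by rewrite first_cd //= addn3.
    by have [h3 h4] := X_lt k c5; rewrite /sbtw h1 h2 h3 h4 !first_cd //=; clear; lia.
  have E : C 5 = A 4 by rewrite /A /C (free_row sK tK XI ZI s_neq F fr) s4.
  by rewrite /f E; case: (A 4) (C 4) (A 5) => [] [] [].
have l45 : f (N - 1 - 5) (+) f (N - 1 - 4) = C (N - 1 - 5) (+) A (N - 1 - 4).
  have [_ s5 _] := last_s (isT : (4 < 7)%N).
  have c5 : (0 < cd (ko (N - 1 - 5)))%N by rewrite last_cd.
  have fr k : ~~ cross K k (ko (N - 1 - 5)).
    apply/negP => kl; have := kl => /andP[_]; rewrite s5.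
    have [h1 h2] := X_lt k c5; have c4 : (0 < cd (ko (N - 1 - 4)))%N by rewrite last_cd.
    by have [h3 h4] := X_lt k c4; rewrite /sbtw h1 h2 h3 h4 !last_cd //=; clear; lia.
  have E : C (N - 1 - 4) = A (N - 1 - 5) by rewrite /A /C (free_row sK tK XI ZI s_neq F fr) s5.
  by rewrite /f E; case: (A _) (C _) (A _) => [] [] [].
rewrite f45 l45 /A /C /omega first_label second_label last_label last_label'.
exact: addb_cancel3.
Qed.

End sum.

Lemma odd_nquads_final F : odd (nquads s t X Z F) =
  `[< cin (ko 4) false = F >] (+) `[< cin (ko (N - 1 - 4)) true = F >].
Proof. by rewrite (odd_nquads sK tK XI ZI s_neq) omega_sum. Qed.

Lemma no_x_between (k1 k2 : 'I_N) : (0 < cd k1)%N -> (cd k2 = (cd k1).+1)%N ->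
  forall k, ~~ (X k1 < X k < X k2).
Proof.
move=> c1 c12 k; have c2 : (0 < cd k2)%N by rewrite c12.
have [-> _] := X_lt k c1; have [_ ->] := X_lt k c2; rewrite c12; clear; lia.
Qed.

Lemma no_z_between (l1 l2 : 'I_N) : zmove K l2 = zmove K l1 + 1 -> forall l, ~~ (Z l1 < Z l < Z l2).
Proof. by move=> E l; rewrite /zmoveR !ltr_int E; clear; lia. Qed.

Lemma crossE (k l : 'I_N) : (0 < cd k)%N -> cross K k l =
  ((zmove K (t k) < zmove K l < zmove K k) || (zmove K k < zmove K l < zmove K (t k))) &&
  ((cd l < cd k < cd (s l)) || (cd (s l) < cd k < cd l))%N.
Proof. by move=> k0; rewrite /Grid.cross sbtw_code // /sbtw /zmoveR !ltr_int. Qed.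

Section rectangle.
Variables k1 k2 l1 l2 : 'I_N.
Hypotheses (c1 : (0 < cd k1)%N) (c12 : cd k2 = (cd k1).+1) (z12 : zmove K l2 = zmove K l1 + 1).
Hypothesis V1 : (zmove K (t k1) <= zmove K l1 /\ zmove K l2 <= zmove K k1) \/
  (zmove K k1 <= zmove K l1 /\ zmove K l2 <= zmove K (t k1)).
Hypothesis V2 : (zmove K (t k2) <= zmove K l1 /\ zmove K l2 <= zmove K k2) \/
  (zmove K k2 <= zmove K l1 /\ zmove K l2 <= zmove K (t k2)).
Hypothesis H1 : (cd l1 <= cd k1 < cd (s l1))%N \/ (cd (s l1) <= cd k1 < cd l1)%N.
Hypothesis H2 : (cd l2 <= cd k1 < cd (s l2))%N \/ (cd (s l2) <= cd k1 < cd l2)%N.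

Let wall_V (k : 'I_N) v : (zmove K (t k) <= zmove K l1 /\ zmove K l2 <= zmove K k) \/
  (zmove K k <= zmove K l1 /\ zmove K l2 <= zmove K (t k)) -> Z l1 <= v <= Z l2 -> T' (X k, v).
Proof.
move=> h /andP[v1 v2]; apply: (@onV_trace _ _ _ _ _ _ k) => //; rewrite /btw; apply/orP.
case: h => -[]; rewrite -!(ler_int R) => h1 h2; [left|right]; apply/andP; split.
- exact: le_trans h1 v1.
- exact: le_trans v2 h2.
- exact: le_trans h1 v1.
- exact: le_trans v2 h2.
Qed.

Let wall_H (l : 'I_N) u : (cd l <= cd k1 < cd (s l))%N \/ (cd (s l) <= cd k1 < cd l)%N ->
  X k1 <= u <= X k2 -> T' (u, Z l).
Proof.
have c2 : (0 < cd k2)%N by rewrite c12.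
have le1 (m : 'I_N) : (cd m <= cd k1)%N -> X m <= X k1.
  by move=> h; have [h' _] := X_lt m c1; rewrite leNgt h' -leqNgt.
have le2 (m : 'I_N) : (cd k1 < cd m)%N -> X k2 <= X m.
  by move=> h; have [_ h'] := X_lt m c2; rewrite leNgt h' c12 -leqNgt.
move=> h /andP[v1 v2]; apply: (@onH_trace _ _ _ _ _ _ l) => //; rewrite /btw; apply/orP.
case: h => /andP[/le1 h1 /le2 h2]; [left|right]; apply/andP; split.
- exact: le_trans h1 v1.
- exact: le_trans v2 h2.
- exact: le_trans h1 v1.
- exact: le_trans v2 h2.
Qed.

(** Restates the facts on rectangular faces in terms of codes and integer levels, so that their
    hypotheses become arithmetic. *)
Lemma rectangle d e' : let k := if d then k1 else k2 in let l := if e' then l1 else l2 in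
  quad (X k, Z l) d e' = cell X Z k1 k2 l1 l2 /\
  nquads s t X Z (cell X Z k1 k2 l1 l2) =
  (cross K k1 l1 + cross K k1 l2 + (cross K k2 l1 + cross K k2 l2))%N.
Proof.
have x12 : X k1 < X k2 by have [-> _] := X_lt k2 c1; rewrite c12.
have z12' : Z l1 < Z l2 by rewrite /zmoveR ltr_int z12; clear; lia.
have nox := no_x_between c1 c12; have noz := no_z_between z12.
have wV v : Z l1 <= v <= Z l2 -> T' (X k1, v) /\ T' (X k2, v) by move=> h; split; exact: wall_V.
have wH u : X k1 <= u <= X k2 -> T' (u, Z l1) /\ T' (u, Z l2) by move=> h; split; exact: wall_H.
split; last exact: (nquads_cell XI ZI x12 z12' nox noz wV wH).
exact/(quad_cell XI ZI x12 z12' nox noz wV wH).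
Qed.

End rectangle.

Lemma quad_face p d e' : exists2 q, ~ T' q & quad p d e' = comp_of T' q.
Proof. by eexists; last reflexivity; exact: quad_point_free. Qed.

(** The face lies between the columns 4 and 5, below the row 3, which only the column 5 crosses. It
    is closed from below by the row 2, crossed by both columns, or by the row 4, which joins them
    without a crossing; whence 3 or 1. *)
Lemma first_face : exists l1, let F := cell X Z (ko 4) (ko 5) l1 (ko 3) in
  cin (ko 4) false = F /\ nquads s t X Z F = if g then 3%N else 1%N.
Proof.
have N14 := N_ge; have K2 := K_ge.
have [k2 s2 t3] := first_s (isT : (2 < 7)%N); have [k3 s3 t4] := first_s (isT : (3 < 7)%N).
have [k4 s4 t5] := first_s (isT : (4 < 7)%N); have [k5 _ _] := first_s (isT : (5 < 7)%N).
have c4 : (0 < cd (ko 4))%N by rewrite first_cd //= addn2.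
have c5 : (0 < cd (ko 5))%N by rewrite first_cd //= addn3.
have c45 : cd (ko 5) = (cd (ko 4)).+1 by rewrite !first_cd //= addnS.
have cE := first_cd; have zE n : (0 < n < 6)%N -> zmove K (ko n) = - (nth 0%N [:: 0; N + 8 * K + 4;
  N + 8 * K + (if g then 2 else 3); N + 8 * K + 1; N + 8 * K + (if g then 3 else 2); 5]%N n)%:Z.
  by move=> hn; rewrite koE ?first_z //; move: hn N14; clear; lia.
have cs := p4_corner true false; rewrite /= in cs.
exists (ko (if g then 2 else 4)%N).
have [|||||||r1 r2] := @rectangle (ko 4) (ko 5) (ko (if g then 2 else 4)%N) (ko 3) _ _ _ _ _ _ _ true false => //.
- by case: (g) zE => zE; rewrite !zE //=; clear; lia.
- by case: (g) zE => zE; rewrite t4 !zE //=; right; clear; lia.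
- by case: (g) zE => zE; rewrite t5 !zE //=; left; move: N14; clear; lia.
- by case: (g) => /=; rewrite ?s2 ?s4 !cE //=; clear; lia.
- by rewrite s3 !cE //=; clear; lia.
move: r1 r2; rewrite /= cs => -> ->; split => //; rewrite !crossE // t4 t5 s3.
case: (g) zE => zE; rewrite ?s2 ?s4 !zE //= !cE //=.
  have L : forall a b c d : bool, a -> ~~ b -> c -> d -> (a + b + (c + d) = 3)%N by move=> [] [] [] [].
  by apply: L; move: N14 K2; clear; lia.
have L : forall a b c d : bool, ~~ a -> ~~ b -> ~~ c -> d -> (a + b + (c + d) = 1)%N by move=> [] [] [] [].
  by apply: L; move: N14 K2; clear; lia.
Qed.

Lemma last_face : exists l1, let F := cell X Z (ko (N - 1 - 5)) (ko (N - 1 - 4)) l1 (ko (N - 1 - 4)) in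
  cin (ko (N - 1 - 4)) true = F /\ nquads s t X Z F = if g' then 3%N else 1%N.
Proof.
have N14 := N_ge.
have [k2 s3 t2] := last_s (isT : (2 < 7)%N); have [k3 s4 t3] := last_s (isT : (3 < 7)%N).
have [k4 s5 t4] := last_s (isT : (4 < 7)%N); have [k5 s6 t5] := last_s (isT : (5 < 7)%N).
have c5 : (0 < cd (ko (N - 1 - 5)))%N by rewrite last_cd.
have c4 : (0 < cd (ko (N - 1 - 4)))%N by rewrite last_cd.
have c45 : cd (ko (N - 1 - 4)) = (cd (ko (N - 1 - 5))).+1 by rewrite !last_cd.
have cE := last_cd; have zE n : (0 < n < 7)%N -> zmove K (ko (N - 1 - n)) = - (nth 0%N [:: 0; N - 2; N + 12;
  N + 8 + (if g' then 2 else 3); N + 9; N + 8 + (if g' then 3 else 2); N - 7]%N n)%:Z.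
  by move=> hn; rewrite koE ?last_z //; move: hn N14; clear; lia.
have cs := q4_corner false false; rewrite /= in cs.
exists (ko (N - 1 - (if g' then 3 else 5)))%N.
have [|||||||r1 r2] := @rectangle (ko (N - 1 - 5)) (ko (N - 1 - 4)) (ko (N - 1 - (if g' then 3 else 5)))%N (ko (N - 1 - 4)) _ _ _ _ _ _ _ false false => //.
- by case: (g') zE => zE; rewrite !zE //=; clear; lia.
- by case: (g') zE => zE; rewrite t5 !zE //=; right; move: N14; clear; lia.
- by case: (g') zE => zE; rewrite t4 !zE //=; left; clear; lia.
- by case: (g') => /=; rewrite ?s3 ?s5 !cE //=; clear; lia.
- by rewrite s4 !cE //=; clear; lia.
move: r1 r2; rewrite /= cs => -> ->; split => //; rewrite !crossE // t4 t5 s4.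
case: (g') zE => zE; rewrite ?s3 ?s5 !zE //= !cE //=.
  have L : forall a b c d : bool, a -> b -> c -> ~~ d -> (a + b + (c + d) = 3)%N by move=> [] [] [] [].
  by apply: L; move: N14; clear; lia.
have L : forall a b c d : bool, ~~ a -> b -> ~~ c -> ~~ d -> (a + b + (c + d) = 1)%N by move=> [] [] [] [].
  by apply: L; move: N14; clear; lia.
Qed.

Lemma two_odd_faces : exists F G : set (R * R), [/\ F <> G,
  (exists2 q, ~ T' q & F = comp_of T' q) /\ (exists2 q, ~ T' q & G = comp_of T' q),
  nquads s t X Z F = (if g then 3%N else 1%N) /\ nquads s t X Z G = (if g' then 3%N else 1%N) &
  forall H, odd (nquads s t X Z H) = `[< F = H >] (+) `[< G = H >]].
Proof.
have [l1 [E1 n1]] := first_face; have [l2 [E2 n2]] := last_face.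
exists (cin (ko 4) false), (cin (ko (N - 1 - 4)) true); split.
(* The first bend is entirely to the right of the last one, so the two rectangles have no common
   point. *)
- have N14 := N_ge; have K2 := K_ge; rewrite E1 E2 => E.
  have [q nq Eq] := quad_face (corner t X Z (ko 4) false) (dirH s t X (ko 4) false) (dirV t Z (ko 4) false).
  have Fq : cell X Z (ko 4) (ko 5) l1 (ko 3) q.
    by rewrite -E1 /Strand.cin Eq; apply: connected_component_refl.
  have Gq := Fq; rewrite E in Gq; move: Fq Gq => [/andP[h1 _] _] [/andP[_ h2] _].
  have := lt_trans h1 h2; have [-> _] := X_lt (k := ko 4) (ko (N - 1 - 4)) ltac:(by rewrite first_cd //= addn2).
  by rewrite first_cd // last_cd //=; move: K2; clear; lia.
- by split; exact: quad_face.
- by rewrite E1 E2.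
- exact: odd_nquads_final.
Qed.

End parity.
End config.

(** * Lifting the projection of a polygon to prescribed heights *)

Section lift.
Variables (R : realType) (W : finType) (s t : W -> W) (w : W -> space3 R) (l : W -> R) (k0 : R).
Hypotheses (sK : cancel s t) (tK : cancel t s) (lI : injective l) (sn : forall k, s k != k) (k01 : 0 < k0 < 1).

(** For a point ((x, z), y) the shadow is (x, y), and [height] is the coordinate z which the levels
    [l] are going to replace. *)
Definition shadow k u : R * R := ((pt s w k u).1.1, (pt s w k u).2).
Definition height k u : R := (pt s w k u).1.2.
Definition above j a k b := l k < l j /\ height k b < height j a.

(** Crossings stay beyond the fraction [k0] of both edges, because at the beginning of an edge the
    height will pass from one level to the next. *)
Definition tame_crossings := forall j k a b, 0 <= a < 1 -> 0 <= b < 1 -> shadow j a = shadow k b ->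
  (j = k /\ a = b) \/ [/\ k0 < a, k0 < b & above j a k b \/ above k b j a].
Hypothesis gen : tame_crossings.

(** Each edge is broken at the fraction [c]: the height runs from [h0 k] to [h1 k] on the first
    part, and then to [h0 (s k)]. *)
Definition bent (c : R) (h0 h1 : W -> R) (v : W * bool) : space3 R :=
  if v.2 then (((shadow v.1 c).1, h1 v.1), (shadow v.1 c).2) else (((shadow v.1 0).1, h0 v.1), (shadow v.1 0).2).

(** Crossings of the shadow are on second parts, whose heights are the affine expressions compared
    in the hypothesis. Points of one edge are told apart by the shadow, and by the height on a first
    part with [c = 0]. *)
Lemma bent_embedded c h0 h1 : 0 <= c <= k0 -> (0 < c \/ forall k, h0 k != h1 k) ->
  (forall j k a b, k0 < a < 1 -> k0 < b < 1 -> above j a k b ->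
     h1 k + (b - c) / (1 - c) * (h0 (s k) - h1 k) < h1 j + (a - c) / (1 - c) * (h0 (s j) - h1 j)) ->
  embedded (gnext s) (bent c h0 h1).
Proof.
have k01' := k01; move=> /andP[c0 ck] hc hh; have c1 : c < 1 by move/andP: k01' => [_ h]; lra.
have c1' : 1 - c != 0 by rewrite subr_eq0 gt_eqF.
pose u (v : W * bool) a : R := if v.2 then c + (1 - c) * a else c * a.
pose H (v : W * bool) a : R := if v.2 then (1 - a) * h1 v.1 + a * h0 (s v.1) else (1 - a) * h0 v.1 + a * h1 v.1.
have ptE v a : pt (gnext s) (bent c h0 h1) v a = (((shadow v.1 (u v a)).1, H v a), (shadow v.1 (u v a)).2).
  by case: v => k []; apply: sp_eq; rewrite /u /H /shadow /pt /bent /= /GRing.scale /=; ring.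
have u01 v a : 0 <= a < 1 -> 0 <= u v a < 1.
  move=> /andP[a0 a1]; rewrite /u; case: v.2; apply/andP; split; try nra.
apply: (embedded_half (gnextK sK)) => v v' a a' ha ha'; rewrite !ptE => -[E1 EH E2].
have E : shadow v.1 (u v a) = shadow v'.1 (u v' a') by apply/eqP; rewrite -pair_eqE /= /pair_eq E1 E2 !eqxx.
have [[Ev Eu]|[ka ka' ab]] := gen (u01 v a ha) (u01 v' a' ha') E.
  case: v v' Ev Eu EH {E1 E2 E} => k p [k' p'] /= <-; rewrite /u /H /=.
  move: ha ha' => /andP[a0 a1] /andP[a0' a1'].
  have hk := fun h : forall k, h0 k != h1 k => h k.
  case: p; case: p' => Eu EH.
  - split => //; have : (1 - c) * (a - a') = 0 by lra.
    by move/eqP; rewrite mulf_eq0 (negbTE c1') subr_eq0 => /eqP.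
  - exfalso; case: hc => [hc|/(_ k)/eqP hc]; first by nra.
    have e1 : c = 0 by nra.
    have e2 : a = 0 by move: Eu; rewrite e1; lra.
    apply: hc; move: EH; rewrite e2 => EH; have : (1 - a') * (h0 k - h1 k) = 0 by lra.
    by move/eqP; rewrite mulf_eq0 !subr_eq0 => /orP[/eqP ?|/eqP //]; exfalso; lra.
  - exfalso; case: hc => [hc|/(_ k)/eqP hc]; first by nra.
    have e1 : c = 0 by nra.
    have e2 : a' = 0 by move: Eu; rewrite e1; lra.
    apply: hc; move: EH; rewrite e2 => EH; have : (1 - a) * (h0 k - h1 k) = 0 by lra.
    by move/eqP; rewrite mulf_eq0 !subr_eq0 => /orP[/eqP ?|/eqP //]; exfalso; lra.
  - split => //; case: hc => [hc|/(_ k) hc].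
      have : c * (a - a') = 0 by lra.
      by move/eqP; rewrite mulf_eq0 (gt_eqF hc) subr_eq0 => /eqP.
    have : (a - a') * (h0 k - h1 k) = 0 by lra.
    by move/eqP; rewrite mulf_eq0 !subr_eq0 (negbTE hc) orbF => /eqP.
exfalso.
have upper v'' a'' : 0 <= a'' < 1 -> k0 < u v'' a'' ->
    H v'' a'' = h1 v''.1 + (u v'' a'' - c) / (1 - c) * (h0 (s v''.1) - h1 v''.1).
  rewrite /u /H => /andP[? ?]; case: v''.2 => h; last by exfalso; nra.
  by field.
have /andP[_ ua] := u01 v a ha; have /andP[_ ua'] := u01 v' a' ha'.
move: EH; rewrite (upper _ _ ha ka) (upper _ _ ha' ka') => EH.
by case: ab => /hh; rewrite ?ka ?ka' ?ua ?ua' EH ltxx => /(_ isT isT).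
Qed.

Lemma bent_homotopy c c' h0 h1 h0' h1' r : line_homotopy (bent c h0 h1) (bent c' h0' h1') r =
  bent ((1 - r) * c + r * c') (fun k => (1 - r) * h0 k + r * h0' k) (fun k => (1 - r) * h1 k + r * h1' k).
Proof.
apply/funext => -[k []]; rewrite /line_homotopy /bent /shadow /pt /=; apply: sp_eq;
  rewrite /= /GRing.scale /=; ring.
Qed.

Lemma bent_trace : polygon_trace (gnext s) (bent k0 (fun k => height k 0) (fun k => height k k0)) =
  polygon_trace s w.
Proof.
have k01' := k01; have /andP[k00 k01''] := k01'.
have ptE v a : pt (gnext s) (bent k0 (fun k => height k 0) (fun k => height k k0)) v a =
    pt s w v.1 (if v.2 then k0 + (1 - k0) * a else k0 * a).
  by case: v => k []; apply: sp_eq; rewrite /bent /height /shadow /pt /= /GRing.scale /=; ring.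
apply/seteqP; split => [_ [[v a] /andP[/= a0 a1] <-]|_ [[k a] /andP[/= a0 a1] <-]].
  rewrite ptE; exists (v.1, if v.2 then k0 + (1 - k0) * a else k0 * a) => //=.
  by case: v.2; apply/andP; split; nra.
have [ak|ak] := leP a k0.
  exists ((k, false), a / k0) => /=; first by rewrite divr_ge0 ?ler_pdivrMr ?mul1r // ltW.
  by rewrite ptE /= mulrCA divff ?mulr1 // gt_eqF.
have k1 : 0 < 1 - k0 by lra.
exists ((k, true), (a - k0) / (1 - k0)) => /=.
  by rewrite divr_ge0 ?ler_pdivrMr ?mul1r //; lra.
by rewrite ptE /=; congr pt; field; rewrite subr_eq0 gt_eqF.
Qed.

(** First, with the break kept at [k0], the heights move to the levels, which makes all second parts
    horizontal. Then the break goes to 0, which makes all first parts vertical. The levels order the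
    strands of a crossing as the heights do, so nothing collides. *)
Lemma lift_isotopic :
  let v := gspace t (fun k => (w k).1.1) l (fun p => (w p.1).2) in
  embedded (gnext s) v /\ ambient_isotopic (polygon_trace s w) (polygon_trace (gnext s) v).
Proof.
have k01' := k01; have /andP[k00 k01''] := k01'; move=> v.
have tn k : t k != k by apply/eqP => E; have := sn k; rewrite -{1}E tK eqxx.
have vE : v = bent 0 (fun k => l (t k)) l.
  by apply/funext => -[k []]; rewrite /v /bent /shadow /pt /gspace /gcorner /corner; apply: sp_eq;
    rewrite /= /GRing.scale /=; ring.
have level c : 0 <= c <= k0 -> embedded (gnext s) (bent c (fun k => l (t k)) l).
  move=> hc; apply: bent_embedded => //; first by right => k; rewrite (inj_eq lI).
  by move=> j k a b _ _ [h _]; rewrite !sK !subrr !mulr0 !addr0.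
split; first by rewrite vE; apply: level; rewrite lexx ltW.
apply: (@ambient_isotopic_trans _ _ (polygon_trace (gnext s) (bent k0 (fun k => l (t k)) l))).
  rewrite -bent_trace; apply: polygon_isotopy => r /andP[r0 r1]; rewrite bent_homotopy.
  have -> : (1 - r) * k0 + r * k0 = k0 by ring.
  apply: bent_embedded; first by rewrite lexx ltW.
    by left.
  move=> j k a b /andP[ka a1] /andP[kb b1] [h1 h2].
  (* Since [l (t (s i)) = l i], the second part has at every point the same convex combination of
     old height and level. *)
  have hE i x : (1 - r) * height i k0 + r * l i + (x - k0) / (1 - k0) *
     ((1 - r) * height (s i) 0 + r * l (t (s i)) - ((1 - r) * height i k0 + r * l i)) =
     (1 - r) * height i x + r * l i.
    have k1 : 1 - k0 != 0 by rewrite subr_eq0 gt_eqF.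
    by rewrite sK /height /pt /= /GRing.scale /=; field.
  rewrite !hE; have [->|rn] := eqVneq r 0; first by lra.
  have {}r0 : 0 < r by rewrite lt_neqAle eq_sym rn.
  have r1' : 0 <= 1 - r by rewrite subr_ge0.
  have h3 : r * l k < r * l j by rewrite ltr_pM2l.
  by move: h3 (ler_wpM2l r1' (ltW h2)) => {h1 h2}; lra.
rewrite vE; apply: polygon_isotopy => r /andP[r0 r1]; rewrite bent_homotopy.
have E h : (fun k => (1 - r) * h k + r * h k) = h :> (W -> R) by apply/funext => k; ring.
by rewrite !E; apply: level; apply/andP; split; nra.
Qed.

End lift.

(** * Shearing by a piecewise linear function of the depth *)

Section interpolation.
Variable R : realType.

Definition affine_off (ys : seq R) (f : R -> R) := forall p q a : R, 0 <= a <= 1 ->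
  (forall y, y \in ys -> ~~ sbtw p q y) -> f ((1 - a) * p + a * q) = (1 - a) * f p + a * f q.

(** The list decreases, so a new point [y0] is to the right of all others; a multiple of the
    positive part of [x - y1] corrects the value there without affecting the other points. *)
Lemma interpolation_sorted (ys : seq R) (v : R -> R) : sorted >%R ys ->
  exists f : R -> R, [/\ continuous f, {in ys, f =1 v} & affine_off ys f].
Proof.
elim: ys => [_|y0 [|y1 ys] IH].
- by exists (fun=> 0); split => [x|//|p q a _ _]; [exact: cvg_cst|ring].
- exists (fun=> v y0); split => [x|x|p q a _ _]; [exact: cvg_cst|by rewrite inE => /eqP ->|ring].
move=> /= /andP[y10 so]; have [f [fc fv fa]] := IH so.
pose c := (v y0 - f y0) / (y0 - y1).
pose f' x := f x + c * Num.max 0 (x - y1).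
exists f'; split.
- move=> x; apply: cvgD; first exact: fc.
  apply: cvgM; first exact: cvg_cst.
  apply: (@continuous_max _ _ (fun=> 0) (fun x => x - y1)); first exact: cvg_cst.
  by apply: cvgB; [exact: cvg_id|exact: cvg_cst].
- have le1 y : y \in y1 :: ys -> y <= y1.
    rewrite inE => /orP[/eqP ->//|yin].
    have := order_path_min (rev_trans lt_trans) so => /allP /(_ _ yin) /ltW //.
  move=> y; rewrite inE => /orP[/eqP ->|yin]; rewrite /f'.
    rewrite max_r; last by rewrite subr_ge0 ltW.
    by rewrite /c divfK ?subr_eq0 ?gt_eqF //; ring.
  by rewrite max_l ?subr_le0 ?le1 // mulr0 addr0 fv.
- move=> p q a a01 no; rewrite /f' fa //; last by move=> y yin; apply: no; rewrite inE yin orbT.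
  have y1no := no y1 ltac:(by rewrite !inE eqxx orbT).
  suff -> : Num.max 0 ((1 - a) * p + a * q - y1) = (1 - a) * Num.max 0 (p - y1) + a * Num.max 0 (q - y1) by ring.
  have /andP[a0 a1] := a01.
  have [[hp hq]|[hp hq]] : (p <= y1 /\ q <= y1) \/ (y1 <= p /\ y1 <= q).
    move: y1no; rewrite /sbtw negb_or !negb_and -!leNgt => /andP[/orP[] h1 /orP[] h2].
    - by right.
    - by have [?|?] := leP q y1; [left|right]; split; lra.
    - by have [?|?] := leP p y1; [left|right]; split; lra.
    - by left.
  - have a1' : 0 <= 1 - a by lra.
    have := ler_wpM2l a0 hq; have := ler_wpM2l a1' hp => h1 h2.
    by rewrite !max_l ?mulr0 ?addr0 // subr_le0 //; lra.
  - have a1' : 0 <= 1 - a by lra.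
    have := ler_wpM2l a0 hq; have := ler_wpM2l a1' hp => h1 h2.
    by rewrite !max_r ?subr_ge0 //; [ring|lra].
Qed.

Lemma interpolation (ys : seq R) (v : R -> R) :
  exists f : R -> R, [/\ continuous f, {in ys, f =1 v} & affine_off ys f].
Proof.
have so : sorted >%R (rev (sort <=%R (undup ys))).
  by rewrite rev_sorted sort_lt_sorted undup_uniq.
have [f [fc fv fa]] := interpolation_sorted v so; exists f; split => //.
  by move=> y yin; apply: fv; rewrite mem_rev mem_sort mem_undup.
by move=> p q a a01 no; apply: fa => // y; rewrite mem_rev mem_sort mem_undup; exact: no.
Qed.

End interpolation.

Lemma avoid_near0 (R : realType) (bad : seq R) (d : R) : 0 < d -> exists2 c, 0 < c < d & c \notin bad.
Proof.
move=> d0; suff [c /andP[c0 cd] h] : exists2 c, 0 < c <= d & forall b, b \in bad -> ~~ (0 < b < c).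
  exists (c / 2); first by apply/andP; split; lra.
  by apply/negP => /h /negP; apply; apply/andP; split; lra.
elim: bad => [|b bad [c /andP[c0 cd] h]]; first by exists d => //; rewrite d0 lexx.
have [b0|b0] := leP b 0.
  exists c; first by rewrite c0.
  by move=> y; rewrite inE => /orP[/eqP ->|/h //]; rewrite ltNge b0.
exists (Num.min b c); first by rewrite lt_min b0 c0 ge_min cd orbT.
move=> y; rewrite inE => /orP[/eqP ->|/h]; rewrite lt_min ?ltxx ?andbF //.
by apply: contra => /andP[-> /andP[_ ->]].
Qed.

Section connect.
Variables (W : finType) (s : W -> W).

Lemma gnext_connect k k' b : fconnect s k k' -> fconnect (gnext s) (k, false) (k', b).
Proof.
have sub : fconnect s k k' -> fconnect (gnext s) (k, false) (k', false).
  move=> /iter_findex <-; elim: (findex s k k') => //= m IH.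
  apply: connect_trans IH _; apply: (@connect_trans _ _ (iter m s k, true)); exact: fconnect1.
move=> /sub; case: b => // h; apply: connect_trans h _; exact: fconnect1.
Qed.

Lemma gnext_disconnect k k' b : fconnect (gnext s) (k, false) (k', b) -> fconnect s k k'.
Proof.
move=> /iter_findex E; have : fconnect s k (k', b).1; last by [].
rewrite -E; elim: (findex _ _ _) => [|m]; first exact: connect0.
rewrite iterS; case: (iter m _ _) => j []; rewrite /gnext //= => h.
by apply: connect_trans h _; exact: fconnect1.
Qed.

End connect.

Section token_polygon.
Variables (R : realType) (N T : nat) (e nb : nat -> nat) (s t : 'I_N -> 'I_N).
Hypotheses (T0 : (0 < T)%N) (e_0 : e 0 = 0%N) (e_T : e T = N).
Hypothesis e_S : forall i, (i < T)%N -> (e i + 14 <= e i.+1)%N.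
Hypothesis nb_lt : forall i, (i < T)%N -> (nb i < T)%N.
Hypothesis nb_inj : forall i i', (i < T)%N -> (i' < T)%N -> nb i = nb i' -> i = i'.
Hypothesis nb_next : forall i, (i < T)%N -> nb i = i.+1 \/
  (nb i <= i)%N /\ forall i', (i < i' < T)%N -> (i < nb i')%N.
Hypotheses (sK : cancel s t) (tK : cancel t s).
Hypothesis s_end : forall (k : 'I_N) i, (i < T)%N -> k.+1 = e i.+1 -> s k = e (nb i) :> nat.
Hypothesis s_next : forall (k : 'I_N), (forall i, (i < T)%N -> k.+1 <> e i.+1) -> s k = k.+1 :> nat.
Variables (n : nat) (e0 : 'I_n -> 'I_N).
Hypothesis e0_surj : forall k, exists i, fconnect s (e0 i) k.
Hypothesis e0_inj : forall i j, fconnect s (e0 i) (e0 j) -> i = j.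

Variables (w : 'I_N -> space3 R) (k0 : R) (ys : seq R).
Hypothesis k01 : 0 < k0 < 1.
(* The edge [k] is a token when it ends its block, that is when [bpos T e k] is 0. *)
Definition token_level (k : 'I_N) : R := if bpos T e k == 0%N then k.+1%:R else - k%:R.
Hypothesis gen : tame_crossings s w token_level k0.
Hypothesis ys_off : forall k y, y \in ys -> ~~ sbtw (w k).2 (w (s k)).2 y.
Hypothesis ys_special : forall k : 'I_N, special T e k -> (w k).2 \in ys.
Hypothesis special_inj : forall k l : 'I_N, special T e k -> special T e l -> (w k).2 = (w l).2 -> k = l.

Let sn := s_neq T0 e_0 e_T e_S nb_lt s_end s_next.

Lemma token_levelE g g' : zmoveR R T e g g' 0 = token_level.
Proof.
apply/funext => k; rewrite /zmoveR /token_level; case: eqP => [b0|/eqP b0].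
  by rewrite /zmove b0 eqxx -pmulrn.
by rewrite zmove_0 // mulrNz -pmulrn.
Qed.

Lemma w_inj k l : (w k).1.1 = (w l).1.1 -> (w k).2 = (w l).2 -> k = l.
Proof.
move=> E1 E2; have h0 : 0 <= (0 : R) < 1 by apply/andP; split; lra.
have [|[->//]|[h _ _]] := gen (j := k) (k := l) h0 h0.
  by rewrite /shadow /pt /= /GRing.scale /= E1 E2; congr (_, _); ring.
by have /andP[h1 _] := k01; have := lt_trans h1 h; rewrite ltxx.
Qed.

(** Special vertices have distinct depths, so a function of the depth can give them any abscissas.
    It bends only at depths in [ys], which no edge passes in its interior, so edges stay straight. A
    small linear term separates the remaining abscissas. *)
Lemma shear_exists : exists f : R -> R, [/\ continuous f,
  forall k a, 0 <= a <= 1 -> f ((1 - a) * (w k).2 + a * (w (s k)).2) = (1 - a) * f (w k).2 + a * f (w (s k)).2,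
  injective (fun k => (w k).1.1 + f (w k).2) &
  forall k l : 'I_N, special T e k -> special T e l -> (k < l)%N ->
    (w k).1.1 + f (w k).2 < (w l).1.1 + f (w l).2].
Proof.
pose v y := if [pick k : 'I_N | special T e k && ((w k).2 == y)] is Some k then k%:R - (w k).1.1 else 0.
have [f [fc fv fa]] := interpolation ys v.
have fs (k : 'I_N) : special T e k -> (w k).1.1 + f (w k).2 = k%:R.
  move=> sk; rewrite fv ?ys_special // /v; case: pickP => [l /andP[sl /eqP E]|/(_ k)]; last by rewrite sk eqxx.
  by rewrite (special_inj sl sk E); ring.
pose Y : R := 1 + \sum_k `|(w k).2|.
have Yk k : `|(w k).2| < Y.
  by rewrite /Y (bigD1 k) //= addrCA ltrDl ltr_wpDr // sumr_ge0.
have Y0 : 0 < Y by rewrite ltr_wpDr // sumr_ge0.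
pose x1 k := (w k).1.1 + f (w k).2.
pose bad := [seq (x1 p.2 - x1 p.1) / ((w p.1).2 - (w p.2).2) | p : 'I_N * 'I_N].
(* Depths differ by less than [2 * Y], so this term stays below the unit gaps between special
   vertices; [bad] lists the slopes for which two abscissas coincide. *)
have [c /andP[c0 cY] cb] : exists2 c, 0 < c < (2 * Y)^-1 & c \notin bad.
  by apply: avoid_near0; rewrite invr_gt0 mulr_gt0.
exists (fun y => f y + c * y); split.
- move=> y; apply: cvgD; first exact: fc.
  by apply: cvgM; [exact: cvg_cst|exact: cvg_id].
- by move=> k a ha; rewrite fa //; [ring|move=> y; exact: ys_off].
- move=> k l /= E; have [E2|N2] := eqVneq (w k).2 (w l).2.
    by apply: w_inj => //; move: E; rewrite E2 => /addIr.
  exfalso; move/negP: cb; apply; apply/mapP; exists (k, l); first by rewrite mem_enum.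
  have N2' : (w k).2 - (w l).2 != 0 by rewrite subr_eq0.
  rewrite /x1 /=; apply: (mulIf N2'); rewrite divfK //; lra.
- move=> k l sk sl kl; rewrite !addrA !fs //.
  have h : k%:R + 1 <= l%:R :> R by rewrite natr1 ler_nat.
  have := Yk k; have := Yk l; rewrite !ltr_norml => /andP[l1 l2] /andP[k1 k2].
  have cY' : c * (2 * Y) < 1 by rewrite -ltr_pdivlMr ?mulr_gt0 // mul1r.
  have := ltr_pM2l c0; move=> M; have := M (w k).2 Y; have := M (- Y) (w l).2.
  rewrite k2 l1 => m1 m2; move: m1 m2; move=> /idP m1 /idP m2; lra.
Qed.

Lemma token_diagram g g' : exists D : link_diagram R n, diagram_of D (polygon_trace s w) /\
  exists F G : set (plane R), [/\ F <> G, odd_sided_faces D = [set F; G],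
    gon D (if g then 3 else 1)%N F & gon D (if g' then 3 else 1)%N G].
Proof.
have [f [fc fa fI fs]] := shear_exists.
pose sh (p : space3 R) : space3 R := ((f p.2, 0), 0).
pose w' k := w k + sh (w k).
have sh_iso : ambient_isotopic (polygon_trace s w) (polygon_trace s w').
  have -> : polygon_trace s w' = [set p + sh p | p in polygon_trace s w].
    have E k a : 0 <= a <= 1 -> pt s w' k a = pt s w k a + sh (pt s w k a).
      move=> ha; apply: sp_eq; rewrite /w' /sh /pt /= /GRing.scale /=; [|ring|ring].
      by rewrite fa //; ring.
    apply/seteqP; split => [_ [[k a] /= ha <-]|_ [_ [[k a] /= ha <-] <-]].
      by exists (pt s w k a); [exists (k, a)|rewrite E].
    by exists (k, a) => //=; rewrite E.
  apply: shear_isotopic.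
    have c0 : continuous (fun _ : space3 R => 0 : R) by move=> p; exact: cvg_cst.
    have c1 : continuous (fun p : space3 R => f p.2).
      by move=> p; apply: continuous_comp; [exact: snd_continuous|exact: fc].
    exact: (continuous_pair (continuous_pair c1 c0) c0).
  by move=> r p; rewrite /sh /=; congr ((f _, _), _); rewrite /= /GRing.scale /= mulr0 addr0.
have w'E k : (w' k).1.1 = (w k).1.1 + f (w k).2 by [].
pose xs k := (w' k).1.1.
have xsI : injective xs by exact: fI.
pose M := 1 + \sum_k `|xs k|.
have xsM k : xs k < M.
  by apply: le_lt_trans (ler_norm _) _; rewrite /M (bigD1 k) //= addrCA ltrDl ltr_wpDr // sumr_ge0.
have xs_sp (k l : 'I_N) : special T e k -> special T e l -> (k < l)%N -> xs k < xs l by exact: fs.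
have lI : injective token_level.
  by rewrite -(token_levelE g g'); exact: zmoveR_inj.
have gen' : tame_crossings s w' token_level k0.
  have E k a : 0 <= a < 1 -> shadow s w' k a = ((shadow s w k a).1 + f (shadow s w k a).2, (shadow s w k a).2).
    move=> /andP[a0 a1]; rewrite /shadow /w' /pt /= /GRing.scale /=; congr (_, _); last by ring.
    by rewrite fa ?a0 ?ltW //; ring.
  have Eh k a : height s w' k a = height s w k a.
    by rewrite /height /w' /pt /= /GRing.scale /=; ring.
  move=> j k a b ha hb; rewrite !E // => -[E1 E2].
  have [|h|h] := @gen j k a b ha hb; [|by left|by right; rewrite /above !Eh].
  by apply/eqP; rewrite -pair_eqE /= /pair_eq E2 eqxx andbT; move: E1; rewrite E2 => /addIr ->.
have [emb iso] := lift_isotopic sK tK lI sn k01 gen'.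
have gE : gspace t (fun k => (w' k).1.1) token_level (fun p => (w' p.1).2) =
   gspace t (xmove T e xs M 0) (zmoveR R T e g g' 0) (fun p => (w' p.1).2).
  by rewrite token_levelE; congr gspace; apply/funext => k; rewrite xmove0.
rewrite gE in emb iso.
have [dep emb' iso'] := slide_isotopic T0 e_0 e_T e_S nb_lt nb_next sK tK s_end s_next xsI xsM xs_sp emb.
have e0_surj' p : exists i, fconnect (gnext s) (e0 i, false) p.
  by case: p => k b; have [i hi] := e0_surj k; exists i; exact: gnext_connect.
have e0_inj' i j : fconnect (gnext s) (e0 i, false) (e0 j, false) -> i = j.
  by move=> /gnext_disconnect /e0_inj.
pose XI := xmove_inj T0 e_0 e_T xsI xsM (c := (2 * T)%N).
pose ZI := @zmoveR_inj R _ _ _ T0 e_0 e_T g g' (2 * T)%N.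
exists (grid_diagram sK tK XI ZI sn e0_surj' e0_inj' emb'); split.
  apply: grid_diagram_of; apply: ambient_isotopic_sym.
  exact: ambient_isotopic_trans sh_iso (ambient_isotopic_trans iso iso').
have [F [G [FG [[p np Fp] [q nq Gq]] [nF nG] od]]] :=
  two_odd_faces T0 e_0 e_T e_S nb_lt nb_inj nb_next sK tK s_end s_next g g' xsI xsM xs_sp.
exists F, G; split => //.
- rewrite odd_sided_grid; apply/seteqP; split => H.
    move=> [r nr [-> /=]]; rewrite od.
    by case: asboolP => [<- _|_]; [left|case: asboolP => [<- _|//]; right].
  move=> [->|->]; [exists p => //|exists q => //]; split => //.
    by rewrite -Fp od asboolT // asboolF // => E; exact: FG.
  by rewrite -Gq od asboolF // asboolT.
- by rewrite Fp; apply/(gon_nquads sK tK XI ZI sn e0_surj' e0_inj' emb' _ np); rewrite -Fp nF.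
- by rewrite Gq; apply/(gon_nquads sK tK XI ZI sn e0_surj' e0_inj' emb' _ nq); rewrite -Gq nG.
Qed.

End token_polygon.

(** * Cutting a polygon at its overcrossings *)

Lemma seq_small (R : realType) (T : eqType) (s : seq T) (P : T -> R -> Prop) :
  (forall z, z \in s -> exists2 r, 0 < r & forall d, 0 < d <= r -> P z d) ->
  exists2 r, 0 < r & forall z, z \in s -> forall d, 0 < d <= r -> P z d.
Proof.
elim: s => [|z s IH] H; first by exists 1.
have [r r0 hr] := IH (fun y ys => H y ltac:(by rewrite inE ys orbT)).
have [r' r'0 hr'] := H z (mem_head _ _).
exists (Num.min r r'); first by rewrite lt_min r0.
move=> y; rewrite inE => /orP[/eqP ->|ys] d; rewrite le_min => /and3P[d0 d1 d2].
  by apply: hr'; rewrite d0.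
by apply: hr; rewrite ?d0.
Qed.

Section counting.
Variables (R : realType) (S : seq R).
Hypothesis so : sorted <%R S.

(** For an element of [S] this is its index; counting gives it a meaning for every real. *)
Definition below x := count (fun u => u < x) S.

Let Su : uniq S. Proof. exact: lt_sorted_uniq so. Qed.

Lemma nth_below x : x \in S -> (below x < size S)%N /\ nth 0 S (below x) = x.
Proof.
move=> xS; suff E : below x = index x S by rewrite E index_mem nth_index.
move: so xS; rewrite /below; elim: S => //= y s IH ys; rewrite inE eq_sym.
have ys' := order_path_min lt_trans ys.
case: eqVneq => [<-|yx] /= xs; first by rewrite ltxx add0n -[RHS](count_pred0 s); apply: eq_in_count => u /(allP ys') /= h; rewrite ltNge (ltW h).
by rewrite (allP ys' _ xs) IH // (path_sorted ys).
Qed.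

Lemma below_nth k : (k < size S)%N -> below (nth 0 S k) = k.
Proof.
move=> kS; have [h1 h2] := nth_below (mem_nth 0 kS).
by apply/eqP; rewrite -(nth_uniq 0 h1 kS Su) h2.
Qed.

Lemma below_lt x y : x \in S -> x < y -> (below x < below y)%N.
Proof.
move=> xS xy; rewrite /below -addn1 (_ : 1%N = count (pred1 x) S); last by rewrite count_uniq_mem // xS.
rewrite -count_predUI addnC [X in (X + _)%N](_ : _ = 0%N); last first.
  by rewrite -[RHS](count_pred0 S); apply: eq_count => u /=; case: eqP => [->|]; rewrite ?ltxx ?andbF.
by apply: sub_count => u /= /orP[h|/eqP ->//]; exact: lt_trans xy.
Qed.

Lemma below_next x y : x \in S -> x < y -> (forall u, u \in S -> ~~ (x < u < y)) ->
  below y = (below x).+1.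
Proof.
move=> xS xy no; apply/eqP; rewrite eqn_leq below_lt // andbT.
rewrite /below -addn1 (_ : 1%N = count (pred1 x) S); last by rewrite count_uniq_mem // xS.
rewrite -count_predUI; apply: leq_trans (leq_addr _ _).
rewrite -!size_filter; apply: uniq_leq_size; first exact: filter_uniq.
move=> u; rewrite !mem_filter /= => /andP[uy uS]; rewrite uS andbT.
by have := no u uS; rewrite uy andbT -leNgt le_eqVlt orbC.
Qed.

Lemma nth_lt j k : (j < size S)%N -> (k < size S)%N -> (nth 0 S j < nth 0 S k) = (j < k)%N.
Proof.
move=> jS kS; apply/idP/idP => [h|].
  by have := below_lt (mem_nth 0 jS) h; rewrite !below_nth.
by move=> jk; exact: (sorted_ltn_nth lt_trans 0 so).
Qed.

End counting.

(* The component [c] is run through by [F c], and the whole link by the parameter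
   [U] which is in [c m, (c + 1) m) on the component [c]. As vertices are at
   the parameters [k + th], the base points [c m] are not vertices. The list [tk]
   contains the overcrossings and [ver] the depths of the vertices. *)
Section generic.
Variables (R : realType) (n m : nat) (F : nat -> R -> space3 R) (th : R) (tk ver : seq R).
Hypotheses (n0 : (0 < n)%N) (m0 : (0 < m)%N).
Local Notation L := (m%:R : R).
Hypothesis per : forall c U, F c (U + L) = F c U.
Hypothesis aff : forall c (k : int) a, 0 <= a <= 1 ->
  F c (k%:~R + th + a) = (1 - a) *: F c (k%:~R + th) + a *: F c (k%:~R + th + 1).
Hypothesis verP : forall c (k : int), (c < n)%N -> (F c (k%:~R + th)).2 \in ver.
Hypothesis slopeP : forall c (k : int), (c < n)%N -> (F c (k%:~R + th)).2 != (F c (k%:~R + th + 1)).2.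

Definition comp (U : R) : nat := Num.truncn (U / L).
Definition G (U : R) : space3 R := F (comp U) U.
Definition inside U := 0 <= U < n%:R * L.
Definition Y U := (G U).2.
Hypothesis Ginj : forall U U', inside U -> inside U' -> G U = G U' -> U = U'.
Hypothesis tk_inside : forall U, U \in tk -> inside U.
Hypothesis tkP : forall U U', inside U -> inside U' -> U' != U ->
  (G U').1.1 = (G U).1.1 -> (G U').2 = (G U).2 -> (G U').1.2 < (G U).1.2 -> U \in tk.
Definition bases := [seq c%:R * L | c <- iota 0 n].
Definition centers := tk ++ bases.
Hypothesis tk_bases : forall U, U \in tk -> U \notin bases.
Hypothesis centers_inj : forall z z', z \in centers -> z' \in centers -> Y z = Y z' -> z = z'.
Hypothesis centers_ver : forall z, z \in centers -> Y z \notin ver.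

Lemma L0 : 0 < L. Proof. by rewrite ltr0n. Qed.
Lemma L1 : 1 <= L. Proof. by rewrite ler1n. Qed.

Lemma compE c U : c%:R * L <= U < c.+1%:R * L -> comp U = c.
Proof.
move=> /andP[h1 h2]; apply/eqP; rewrite /comp truncn_eq; last by rewrite divr_ge0 ?(le_trans _ h1) ?mulr_ge0.
by rewrite ler_pdivlMr ?L0 // ltr_pdivrMr ?L0 // h1.
Qed.

Lemma compP U : inside U -> [/\ (comp U < n)%N, (comp U)%:R * L <= U & U < (comp U).+1%:R * L].
Proof.
move=> /andP[U0 Un]; have h : 0 <= U / L by rewrite divr_ge0.
have /andP[h1 h2] := truncn_itv h; rewrite -/(comp U) ler_pdivlMr ?L0 // in h1; rewrite -/(comp U) ltr_pdivrMr ?L0 // in h2.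
split => //; rewrite -(ltr_nat R); have := le_lt_trans h1 Un; rewrite ltr_pM2r //; exact: L0.
Qed.

Lemma base_in c : (c < n)%N -> c%:R * L \in centers.
Proof. by move=> cn; rewrite mem_cat; apply/orP; right; apply/mapP; exists c; rewrite // mem_iota add0n. Qed.

Lemma centers_inside z : z \in centers -> inside z.
Proof.
rewrite mem_cat => /orP[/tk_inside //|/mapP[c]]; rewrite mem_iota add0n => /andP[_ cn] ->.
by rewrite /inside mulr_ge0 //= ltr_pM2r ?L0 // ltr_nat.
Qed.

Lemma perN c U k : F c (U + k%:R * L) = F c U.
Proof.
elim: k => [|k IH]; first by rewrite mul0r addr0.
by rewrite -natr1 mulrDl mul1r addrA per.
Qed.

Definition left_break (U : R) : int := Num.floor (U - th).
Lemma left_breakP U : (left_break U)%:~R + th <= U < (left_break U)%:~R + th + 1.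
Proof.
have := floor_itv (U - th); rewrite -/(left_break U) intrD => /andP[h1 h2].
by apply/andP; split; lra.
Qed.

Definition slope c U := (F c ((left_break U)%:~R + th + 1)).2 - (F c ((left_break U)%:~R + th)).2.

Lemma affE c U V : (left_break U)%:~R + th <= V <= (left_break U)%:~R + th + 1 ->
  F c V = F c U + (V - U) *: (F c ((left_break U)%:~R + th + 1) - F c ((left_break U)%:~R + th)).
Proof.
move=> /andP[h1 h2]; have /andP[h3 h4] := left_breakP U; set B := (left_break U)%:~R + th in h1 h2 h3 h4 *.
have -> : F c V = F c (B + (V - B)) by congr F; ring.
rewrite (@aff c (left_break U) (V - B)) -/B; last by apply/andP; split; lra.
have -> : F c U = F c (B + (U - B)) by congr F; ring.
rewrite (@aff c (left_break U) (U - B)) -/B; last by apply/andP; split; lra.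
by apply: sp_eq; rewrite /= /GRing.scale /=; ring.
Qed.

Lemma affine_between c U V a : U <= V -> 0 <= a <= 1 ->
  (forall k : int, ~~ (U < k%:~R + th < V)) ->
  F c ((1 - a) * U + a * V) = (1 - a) *: F c U + a *: F c V.
Proof.
move=> UV /andP[a0 a1] no; have /andP[h1 h2] := left_breakP U.
have h3 : V <= (left_break U)%:~R + th + 1.
  have := no (left_break U + 1); rewrite intrD negb_and -!leNgt => /orP[]; lra.
have W1 : U <= (1 - a) * U + a * V by have := ler_wpM2l a0 UV; lra.
have W2 : (1 - a) * U + a * V <= V.
  by have a1' : 0 <= 1 - a by [lra]; have := ler_wpM2l a1' UV; lra.
rewrite [LHS](affE c (U := U)); last by apply/andP; split; lra.
rewrite [in RHS](affE c (U := U) (V := V)); last by apply/andP; split; lra.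
by apply: sp_eq; rewrite /= /GRing.scale /=; ring.
Qed.

(** No vertex has the depth of a center, so a center is interior to a linear piece, on which the
    depth is affine and, by [slopeP], not constant. *)
Lemma center_affine z : z \in centers -> slope (comp z) z != 0 /\ exists2 r, 0 < r & forall d, 0 < d <= r ->
  forall h, `|h| <= d -> (F (comp z) (z + h)).2 = Y z + slope (comp z) z * h.
Proof.
move=> zc; have [cn c1 c2] := compP (centers_inside zc).
split; first by rewrite subr_eq0 eq_sym slopeP.
have /andP[h1 h2] := left_breakP z; set B := (left_break z)%:~R + th in h1 h2.
have h3 : B < z.
  rewrite lt_neqAle h1 andbT; apply/negP => /eqP E.
  by have := verP (left_break z) cn; rewrite -/B E; apply/negP; exact: centers_ver.
have zB : 0 < z - B by rewrite subr_gt0.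
have Bz : 0 < B + 1 - z by rewrite subr_gt0.
exists (Num.min (z - B) (B + 1 - z)); first by rewrite lt_min zB.
move=> d /andP[d0]; rewrite le_min => /andP[d1 d2] h; rewrite ler_norml => /andP[h4 h5].
rewrite (affE (comp z) (U := z)) -/B; last by apply/andP; split; lra.
by rewrite /Y /G /slope /= /GRing.scale /= -/B; ring.
Qed.

Definition total_slope : R := 1 + \sum_(z <- centers) `|slope (comp z) z|.
Lemma slope_total z : z \in centers -> `|slope (comp z) z| <= total_slope.
Proof.
move=> zc; rewrite /total_slope (big_rem z) //= addrCA lerDl addr_ge0 // sumr_ge0 //.
Qed.
Lemma total_slope_gt0 : 0 < total_slope.
Proof. by rewrite ltr_wpDr // sumr_ge0. Qed.

(** Marks are at most 7 [eps] away from their center, so their depths differ from its depth by at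
    most 7 times [total_slope * eps]. The factor 32 keeps the marks of different centers and the
    vertices apart with room to spare. *)
Lemma eps_exists : exists2 eps, 0 < eps & [/\ 32 * eps < 1,
  forall z h, z \in centers -> `|h| <= 16 * eps -> (F (comp z) (z + h)).2 = Y z + slope (comp z) z * h,
  forall z v, z \in centers -> v \in ver -> 32 * total_slope * eps < `|Y z - v| &
  forall z z', z \in centers -> z' \in centers -> z != z' -> 32 * total_slope * eps < `|Y z - Y z'|].
Proof.
have T0 := total_slope_gt0.
have half (q : R) : 0 < q -> exists2 r, 0 < r & forall d, 0 < d <= r -> 32 * total_slope * d < q.
  move=> q0; have T32 : 0 < 32 * total_slope by lra.
  exists (q / (32 * total_slope) / 2); first by rewrite !divr_gt0.
  move=> d /andP[d0 d1]; rewrite mulrC -ltr_pdivlMr //; apply: le_lt_trans d1 _.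
  by rewrite ltr_pdivrMr // ltr_pMr ?divr_gt0 //; lra.
have [r1 r10 R1] := seq_small (fun z zc => (center_affine zc).2).
have [r2 r20 R2] : exists2 r, 0 < r & forall z, z \in centers -> forall d, 0 < d <= r -> forall v, v \in ver ->
   32 * total_slope * d < `|Y z - v|.
  apply: seq_small => z zc.
  have [r r0 h] : exists2 r, 0 < r & forall v, v \in ver -> forall d, 0 < d <= r -> 32 * total_slope * d < `|Y z - v|.
    apply: seq_small => v vv; apply: half; rewrite normr_gt0 subr_eq0.
    by apply: contraNneq (centers_ver zc) => ->.
  by exists r => // d hd v vv; exact: h.
have [r3 r30 R3] : exists2 r, 0 < r & forall z, z \in centers -> forall d, 0 < d <= r -> forall z', z' \in centers ->
   z != z' -> 32 * total_slope * d < `|Y z - Y z'|.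
  apply: seq_small => z zc.
  have [r r0 h] : exists2 r, 0 < r & forall z', z' \in centers -> forall d, 0 < d <= r -> z != z' -> 32 * total_slope * d < `|Y z - Y z'|.
    apply: seq_small => z' zc'; have [->|zz] := eqVneq z z'; first by exists 1.
    have [|r r0 h] := half `|Y z - Y z'|; last by exists r => // d hd _; exact: h.
    by rewrite normr_gt0 subr_eq0; apply: contraNneq zz => /centers_inj ->.
  by exists r => // d hd z' zc'; exact: h.
pose eps := Num.min (Num.min (r1 / 16) (1 / 64)) (Num.min r2 r3).
have e0 : 0 < eps by rewrite !lt_min r20 r30 !divr_gt0.
have e1 : eps <= r1 / 16 by rewrite /eps !ge_min lexx.
have e2 : eps <= 1 / 64 by rewrite /eps !ge_min lexx orbT.
have e3 : eps <= r2 by rewrite /eps !ge_min lexx !orbT.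
have e4 : eps <= r3 by rewrite /eps !ge_min lexx !orbT.
exists eps => //; split.
- by lra.
- by move=> z h zc hh; apply: (R1 z zc (16 * eps)) => //; apply/andP; split; lra.
- by move=> z v zc vv; apply: R2 => //; rewrite e0.
- by move=> z z' zc zc' zz; apply: R3 => //; rewrite e0.
Qed.

Variable eps : R.
Hypothesis eps0 : 0 < eps.
Hypothesis eps32 : 32 * eps < 1.
Hypothesis near_center : forall z h, z \in centers -> `|h| <= 16 * eps ->
  (F (comp z) (z + h)).2 = Y z + slope (comp z) z * h.
Hypothesis far_ver : forall z v, z \in centers -> v \in ver -> 32 * total_slope * eps < `|Y z - v|.
Hypothesis far_center : forall z z', z \in centers -> z' \in centers -> z != z' ->
  32 * total_slope * eps < `|Y z - Y z'|.

(* The link is cut wherever its depth is in [ys], so that no edge meets these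
   depths in its interior, and an edge meets the depth of a center only within
   the token around this center. *)
Definition offs : seq R := [seq j%:R | j <- iota 1 7] ++ [seq - j%:R | j <- iota 1 7].
Definition ys := ver ++ [seq Y p.1 + slope (comp p.1) p.1 * (p.2 * eps) | p <- [seq (z, q) | z <- centers, q <- offs]].

Lemma offsP q : q \in offs <-> exists2 j, (1 <= j <= 7)%N & q = j%:R \/ q = - j%:R.
Proof.
rewrite mem_cat; split.
  by move=> /orP[] /mapP[j]; rewrite mem_iota => hj ->; exists j => //; [left|right].
move=> [j hj [|] ->]; apply/orP; [left|right]; apply/mapP; exists j => //; rewrite mem_iota; move: hj; clear; lia.
Qed.

Lemma offs_bound q : q \in offs -> 1 <= `|q| <= 7.
Proof.
by move=> /offsP[j /andP[j1 j7] [|] ->]; rewrite ?normrN normr_nat ler1n j1 ler_nat.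
Qed.

Lemma ysP l : l \in ys -> l \in ver \/ exists z q, [/\ z \in centers, q \in offs & l = Y z + slope (comp z) z * (q * eps)].
Proof.
rewrite mem_cat => /orP[|/mapP[[z q] /allpairsP[[z' q'] /= [h1 h2 [-> ->]]] ->]]; [by left|right].
by exists z', q'.
Qed.

Lemma ys_mark z q : z \in centers -> q \in offs -> Y z + slope (comp z) z * (q * eps) \in ys.
Proof.
move=> zc qo; rewrite mem_cat; apply/orP; right; apply/mapP; exists (z, q) => //.
by apply/allpairsP; exists (z, q).
Qed.

Lemma slope_neq0 z : z \in centers -> slope (comp z) z != 0.
Proof. by move=> /center_affine[]. Qed.

Lemma mark_norm z q b : z \in centers -> `|q| <= b -> `|slope (comp z) z * (q * eps)| <= b * total_slope * eps.
Proof.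
move=> zc qb; rewrite !normrM (gtr0_norm eps0) mulrA ler_pM2r // mulrC.
by apply: ler_pM => //; exact: slope_total.
Qed.

(** Vertices, and the marks of other centers, are too far away in depth by the choice of [eps]. *)
Lemma ys_near z l : z \in centers -> l \in ys -> `|l - Y z| <= 16 * total_slope * eps ->
  exists2 q, q \in offs & l = Y z + slope (comp z) z * (q * eps).
Proof.
move=> zc ly h; have te : 0 < total_slope * eps by rewrite mulr_gt0 // total_slope_gt0.
case: (ysP ly) => [lv|[z' [q [zc' qo E]]]].
  have := far_ver zc lv; rewrite distrC => h'; exfalso; lra.
have [zz|zz] := eqVneq z z'; first by exists q; rewrite // zz.
exfalso; have := far_center zc zc' zz; have /andP[_ q7] := offs_bound qo.
have := mark_norm zc' q7; rewrite E in h.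
set M := slope (comp z') z' * (q * eps) in h *.
have -> : Y z - Y z' = M - (Y z' + M - Y z) by ring.
by have := ler_normB M (Y z' + M - Y z); lra.
Qed.

Lemma center_ys z : z \in centers -> Y z \notin ys.
Proof.
move=> zc; apply/negP => h; have [|q qo E] := ys_near zc h.
  by rewrite subrr normr0 !mulr_ge0 ?ltW // total_slope_gt0.
have /andP[q1 _] := offs_bound qo.
have : slope (comp z) z * (q * eps) = 0 by lra.
move/eqP; rewrite !mulf_eq0 (negbTE (slope_neq0 zc)) (gt_eqF eps0) orbF /= => /eqP q0.
by move: q1; rewrite q0 normr0; lra.
Qed.

Lemma mark_inj z z' q q' : z \in centers -> z' \in centers -> q \in offs -> q' \in offs ->
  Y z + slope (comp z) z * (q * eps) = Y z' + slope (comp z') z' * (q' * eps) -> z = z' /\ q = q'.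
Proof.
move=> zc zc' qo qo' E; have te : 0 < total_slope * eps by rewrite mulr_gt0 // total_slope_gt0.
have /andP[_ q7] := offs_bound qo; have /andP[_ q7'] := offs_bound qo'.
have [zz|zz] := eqVneq z z'; last first.
  exfalso; have := far_center zc zc' zz; have := mark_norm zc q7; have := mark_norm zc' q7'.
  have -> : Y z - Y z' = slope (comp z') z' * (q' * eps) - slope (comp z) z * (q * eps) by lra.
  by have := ler_normB (slope (comp z') z' * (q' * eps)) (slope (comp z) z * (q * eps)); lra.
split => //; rewrite -zz in E; move: E => /addrI /(mulfI (slope_neq0 zc)) /(mulIf _) -> //.
by rewrite gt_eqF.
Qed.

(** The depth is affine and not constant on each linear piece, so every piece meets every level at
    most once; this finite list contains all points at which to cut. *)
Definition candidates := [seq (let B := ((Num.floor (- th) + p.1.2%:Z)%:~R + th) in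
   B + (p.2 - (F p.1.1 B).2) / ((F p.1.1 (B + 1)).2 - (F p.1.1 B).2)) |
   p <- [seq (ck, l) | ck <- [seq (c, k) | c <- iota 0 n, k <- iota 0 (n * m + 2)], l <- ys]].
Definition cuts := sort <=%R (undup [seq U <- candidates | (0 <= U < n%:R * L) && (Y U \in ys)]).

Lemma cuts_sorted : sorted <%R cuts.
Proof. by rewrite /cuts sort_lt_sorted undup_uniq. Qed.

Lemma cutsP U : (U \in cuts) = (0 <= U < n%:R * L) && (Y U \in ys).
Proof.
rewrite mem_sort mem_undup mem_filter; apply: andb_idr => /andP[UI Uy].
have [cn c1 c2] := compP UI; have /andP[U0 Un] := UI.
have /andP[b1 b2] := left_breakP U; set k := left_break U in b1 b2.
have /andP[f1 f2] := floor_itv (- th).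
have k0 : Num.floor (- th) <= k by rewrite -ltzD1 -(ltr_int R) intrD; lra.
have kn : k - Num.floor (- th) < (n * m + 2)%:Z.
  rewrite -(ltr_int R) intrD mulrNz; have : (n * m + 2)%:Z%:~R = n%:R * L + 2 :> R by rewrite -pmulrn natrD natrM.
  by move=> ->; rewrite intrD in f2; lra.
have kE : k = Num.floor (- th) + `|k - Num.floor (- th)|%N%:Z by rewrite gez0_abs ?subr_ge0 //; ring.
apply/mapP; exists ((comp U, `|k - Num.floor (- th)|%N), Y U).
  apply/allpairsP; exists ((comp U, `|k - Num.floor (- th)|%N), Y U); split => //.
  apply/allpairsP; exists (comp U, `|k - Num.floor (- th)|%N); split => //=; rewrite mem_iota ?add0n //=.
  by move: kn k0; clear; lia.
rewrite /= -kE; set B := k%:~R + th in b1 b2 *.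
have s0 : (F (comp U) (B + 1)).2 - (F (comp U) B).2 != 0.
  by rewrite subr_eq0 eq_sym; exact: slopeP.
have E : Y U = (F (comp U) B).2 + (U - B) * ((F (comp U) (B + 1)).2 - (F (comp U) B).2).
  rewrite /Y /G {1}(_ : F (comp U) U = F (comp U) (B + (U - B))); last by congr F; ring.
  rewrite (@aff (comp U) k (U - B)) -/B; last by apply/andP; split; lra.
  by rewrite /= /GRing.scale /=; ring.
by apply: (mulIf s0); rewrite mulrDl divfK // E; ring.
Qed.

Lemma cut_inside U : U \in cuts -> inside U. Proof. by rewrite cutsP => /andP[]. Qed.
Lemma cut_ys U : U \in cuts -> Y U \in ys. Proof. by rewrite cutsP => /andP[]. Qed.

(** Besides the overcrossings, the end of each component is a token; this is the additional token
    which every component receives. *)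
Definition tokens := sort <=%R (undup (tk ++ [seq c%:R * L | c <- iota 1 n])).
(** The block [i] lies between [tp i] and [tp i.+1], with [tp 0 = 0]. *)
Definition tp i := nth 0 (0 :: tokens) i.
Local Notation T := (size tokens).

Lemma tokensP U : (U \in tokens) = (U \in tk) || (U \in [seq c%:R * L | c <- iota 1 n]).
Proof. by rewrite mem_sort mem_undup mem_cat. Qed.

Lemma token_base c : (0 < c <= n)%N -> c%:R * L \in tokens.
Proof. by move=> hc; rewrite tokensP; apply/orP; right; apply/mapP; exists c => //; rewrite mem_iota; move: hc; clear; lia. Qed.

Lemma token_range U : U \in tokens -> 0 < U <= n%:R * L.
Proof.
rewrite tokensP => /orP[Ut|/mapP[c]]; last first.
  rewrite mem_iota => hc ->; have c0 : 0 < c%:R :> R by rewrite ltr0n; move: hc; clear; lia.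
  by rewrite (mulr_gt0 c0 L0) ler_pM2r ?L0 // ler_nat; move: hc; clear; lia.
have /andP[h1 h2] := tk_inside Ut; rewrite (ltW h2) andbT lt_neqAle h1 andbT.
apply: contraNneq (tk_bases Ut) => <-; apply/mapP; exists 0%N; first by rewrite mem_iota.
by rewrite mul0r.
Qed.

Lemma tp_sorted : sorted <%R (0 :: tokens).
Proof.
rewrite /= path_sortedE; last exact: lt_trans.
rewrite sort_lt_sorted undup_uniq andbT; apply/allP => U /token_range /andP[].
by [].
Qed.

Lemma tp_lt i j : (i <= T)%N -> (j <= T)%N -> (tp i < tp j) = (i < j)%N.
Proof. by move=> iT jT; rewrite /tp nth_lt //; exact: tp_sorted. Qed.

Lemma tp_index U : U \in 0 :: tokens -> (below (0%R :: tokens) U <= T)%N /\ tp (below (0%R :: tokens) U) = U.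
Proof. by move=> /(nth_below tp_sorted)[h1 h2]. Qed.

Lemma tp_0 : tp 0 = 0. Proof. by []. Qed.
Lemma tp_S i : (i < T)%N -> tp i.+1 \in tokens. Proof. by move=> iT; rewrite /tp /= mem_nth. Qed.

Lemma T_gt0 : (0 < T)%N.
Proof. by have := token_base (c := n) ltac:(by rewrite n0 leqnn); case: tokens. Qed.

Lemma tp_T : tp T = n%:R * L.
Proof.
have h : n%:R * L \in 0 :: tokens by rewrite inE token_base ?orbT // n0 leqnn.
have [i1 i2] := tp_index h; move: i1; rewrite leq_eqVlt => /orP[/eqP <- //|i1].
have := tp_lt (ltnW i1) (leqnn T); rewrite i1 i2.
have := tp_S (i := T.-1) ltac:(by rewrite prednK ?T_gt0); rewrite prednK ?T_gt0 // => /token_range /andP[_].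
by rewrite leNgt => /negbTE ->.
Qed.

Definition bc i := comp (tp i).

Lemma tp_center i : (i < T)%N -> tp i \in centers.
Proof.
move=> iT; have lt : tp i < n%:R * L by rewrite -tp_T tp_lt // ltnW.
case: i iT lt => [_ _|i iT lt]; first by rewrite tp_0 -(mul0r L); exact: (@base_in 0%N).
have := tp_S (ltnW iT); rewrite tokensP mem_cat => /orP[->//|/mapP[c]]; rewrite mem_iota => hc E.
apply/orP; right; apply/mapP; exists c; rewrite // mem_iota add0n /=; move: lt; rewrite E ltr_pM2r ?L0 // ltr_nat.
by [].
Qed.

Lemma tp_block i : (i < T)%N -> [/\ (bc i < n)%N, (bc i)%:R * L <= tp i, tp i < tp i.+1 & tp i.+1 <= (bc i).+1%:R * L].
Proof.
move=> iT; have [h1 h2 h3] := compP (centers_inside (tp_center iT)).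
split => //; first by rewrite tp_lt ?ltnS // ltnW.
have hb : (bc i).+1%:R * L \in 0 :: tokens by rewrite inE token_base ?orbT.
have [j1 j2] := tp_index hb; rewrite -/(bc i) -j2 (tp_lt (ltnW iT) j1) in h3.
by rewrite -j2 leNgt tp_lt // -leqNgt.
Qed.

Lemma comp_between i U : (i < T)%N -> tp i <= U < tp i.+1 -> inside U /\ comp U = bc i.
Proof.
move=> iT /andP[h1 h2]; have [c1 c2 c3 c4] := tp_block iT.
have cE : comp U = bc i by apply: compE; rewrite (le_trans c2) //= (lt_le_trans h2).
split => //; rewrite /inside (le_trans _ (le_trans c2 h1)) ?mulr_ge0 //=.
by apply: lt_le_trans h2 (le_trans c4 _); rewrite ler_pM2r ?L0 // ler_nat.
Qed.

Definition at_end i := tp i.+1 == (bc i).+1%:R * L.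
(** The center at which the block [i] ends. At the end of a component it is the base point of this
    component, the same point of the link one period earlier. *)
Definition zl i := if at_end i then (bc i)%:R * L else tp i.+1.

Lemma zlP i : (i < T)%N -> [/\ zl i \in centers, comp (zl i) = bc i &
  forall h, F (bc i) (tp i.+1 + h) = F (bc i) (zl i + h)].
Proof.
move=> iT; have [c1 c2 c3 c4] := tp_block iT; rewrite /zl.
case E : (at_end i); last first.
  have lt : tp i.+1 < (bc i).+1%:R * L by rewrite lt_neqAle c4 andbT -/(at_end i) E.
  split => //; last by apply: compE; rewrite lt (le_trans c2 (ltW c3)).
  have := tp_S iT; rewrite tokensP mem_cat => /orP[->//|/mapP[c]]; rewrite mem_iota => hc E'.
  apply/orP; right; apply/mapP; exists c; rewrite // mem_iota add0n /=.
  have := lt_le_trans lt (_ : _ <= n%:R * L); rewrite E' ltr_pM2r ?L0 // ltr_nat; apply.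
  by rewrite ler_pM2r ?L0 // ler_nat.
split; first exact: base_in.
  by apply: compE; rewrite lexx ltr_pM2r ?L0 // ltr_nat ltnSn.
by move=> h; rewrite (eqP E) -[in RHS]per; congr F; rewrite -natr1; ring.
Qed.

Lemma near_left i h : (i < T)%N -> `|h| <= 16 * eps ->
  (F (bc i) (tp i.+1 + h)).2 = Y (zl i) + slope (bc i) (zl i) * h.
Proof. by move=> iT hh; have [z1 z2 ->] := zlP iT; rewrite -z2 near_center. Qed.

Lemma near_right i h : (i < T)%N -> `|h| <= 16 * eps ->
  (F (bc i) (tp i + h)).2 = Y (tp i) + slope (bc i) (tp i) * h.
Proof. by move=> iT hh; rewrite near_center // tp_center. Qed.

(** Over a shorter distance the depth could not change as much as it does between two distinct
    centers. *)
Lemma token_spacing i : (i < T)%N -> 16 * eps < tp i.+1 - tp i.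
Proof.
move=> iT; rewrite ltNge; apply/negP => h; have [c1 c2 c3 c4] := tp_block iT; have [z1 z2 z3] := zlP iT.
have h0 : 0 <= tp i.+1 - tp i by rewrite subr_ge0 ltW.
have te : 0 < total_slope * eps by rewrite mulr_gt0 // total_slope_gt0.
(* If the two centers were the same, the block would be a whole component, of length at least 1. *)
have ne : tp i != zl i.
  rewrite /zl; case E : (at_end i); last by rewrite lt_eqF.
  apply/eqP => E'; move: h; rewrite (eqP E) E' -natr1 => h; have := L1; have := eps32; lra.
have := near_right (h := tp i.+1 - tp i) iT; rewrite ger0_norm // => /(_ h).
have := near_left (h := 0) iT; rewrite normr0 mulr0 !addr0 => /(_ ltac:(by rewrite mulr_ge0 // ltW)).
have -> : tp i + (tp i.+1 - tp i) = tp i.+1 by ring.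
move=> -> E; have := far_center (tp_center iT) z1 ne; rewrite E.
rewrite [X in `|X|](_ : _ = - (slope (bc i) (tp i) * (tp i.+1 - tp i))); last by ring.
rewrite normrN normrM (ger0_norm h0).
have := ler_pM (normr_ge0 _) h0 (slope_total (tp_center iT)) h; rewrite -/(bc i).
by lra.
Qed.

(** Near its center the depth is affine with nonzero slope, so it takes the levels in [ys] at the
    seven marks only. *)
Lemma cut_right i U : (i < T)%N -> U \in cuts -> tp i <= U <= tp i + 8 * eps ->
  exists2 j, (1 <= j <= 7)%N & U = tp i + j%:R * eps.
Proof.
move=> iT Uc /andP[U1 U2]; have g := token_spacing iT; have e0' := eps0.
have [UI cU] : inside U /\ comp U = bc i by apply: comp_between => //; rewrite U1 /=; lra.
have YE : Y U = Y (tp i) + slope (bc i) (tp i) * (U - tp i).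
  rewrite -near_right ?ger0_norm //; try lra.
  by rewrite /Y /G cU; congr (_ .2); congr F; ring.
have [|q qo] := ys_near (tp_center iT) (cut_ys Uc).
  rewrite YE [X in `|X|](_ : _ = slope (bc i) (tp i) * (U - tp i)); last by ring.
  rewrite normrM [`|U - _|]ger0_norm; last lra.
  have U3 : 0 <= U - tp i by lra.
  have U4 : U - tp i <= 8 * eps by lra.
  have := ler_pM (normr_ge0 _) U3 (slope_total (tp_center iT)) U4; rewrite -/(bc i).
  have te : 0 < total_slope * eps by rewrite mulr_gt0 // total_slope_gt0.
  by lra.
rewrite YE => /addrI /(mulfI (slope_neq0 (tp_center iT))) E.
case/offsP: qo => j hj [|] qE; first by exists j => //; rewrite -qE -E; ring.
exfalso; move: E; rewrite qE => E; have : 1 <= j%:R :> R by rewrite ler1n; move: hj; clear; lia.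
by move=> j1; have : 0 < j%:R * eps by [rewrite mulr_gt0 //; lra]; lra.
Qed.

Lemma cut_left i U : (i < T)%N -> U \in cuts -> tp i.+1 - 8 * eps <= U < tp i.+1 ->
  exists2 j, (1 <= j <= 7)%N & U = tp i.+1 - j%:R * eps.
Proof.
move=> iT Uc /andP[U1 U2]; have g := token_spacing iT; have e0' := eps0; have [z1 z2 z3] := zlP iT.
have [UI cU] : inside U /\ comp U = bc i by apply: comp_between => //; rewrite U2 andbT; lra.
have YE : Y U = Y (zl i) + slope (bc i) (zl i) * (U - tp i.+1).
  rewrite -near_left ?ler0_norm //; try lra.
  by rewrite /Y /G cU; congr (_ .2); congr F; ring.
have [|q qo] := ys_near z1 (cut_ys Uc).
  rewrite YE [X in `|X|](_ : _ = slope (bc i) (zl i) * (U - tp i.+1)); last by ring.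
  rewrite normrM [`|U - _|]ler0_norm; last lra.
  have U3 : 0 <= - (U - tp i.+1) by lra.
  have U4 : - (U - tp i.+1) <= 8 * eps by lra.
  have := ler_pM (normr_ge0 _) U3 (slope_total z1) U4; rewrite z2.
  have te : 0 < total_slope * eps by rewrite mulr_gt0 // total_slope_gt0.
  by lra.
rewrite YE -z2 => /addrI /(mulfI (slope_neq0 z1)) E.
case/offsP: qo => j hj [|] qE; last by exists j => //; rewrite -mulNr -qE -E; ring.
exfalso; move: E; rewrite qE => E; have : 1 <= j%:R :> R by rewrite ler1n; move: hj; clear; lia.
by move=> j1; have : 0 < j%:R * eps by [rewrite mulr_gt0 //; lra]; lra.
Qed.

Lemma mark_le (j : nat) : (1 <= j <= 7)%N -> eps <= j%:R * eps <= 7 * eps.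
Proof.
move=> /andP[j1 j7]; rewrite !ler_pM2r // ler_nat j7 andbT -[leLHS]mul1r ler_pM2r // ler1n //.
Qed.

Lemma mark_right i j : (i < T)%N -> (1 <= j <= 7)%N -> tp i + j%:R * eps \in cuts.
Proof.
move=> iT hj; have g := token_spacing iT; have /andP[m1 m2] := mark_le hj; have e0' := eps0.
have [UI cU] := @comp_between i (tp i + j%:R * eps) iT ltac:(by apply/andP; split; lra).
rewrite cutsP -/(inside _) UI /= /Y /G cU near_right //; last by rewrite ger0_norm; lra.
by apply: ys_mark; [exact: tp_center|apply/offsP; exists j => //; left].
Qed.

Lemma mark_left i j : (i < T)%N -> (1 <= j <= 7)%N -> tp i.+1 - j%:R * eps \in cuts.
Proof.
move=> iT hj; have g := token_spacing iT; have /andP[m1 m2] := mark_le hj; have e0' := eps0.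
have [z1 z2 z3] := zlP iT.
have [UI cU] := @comp_between i (tp i.+1 - j%:R * eps) iT ltac:(by apply/andP; split; lra).
rewrite cutsP -/(inside _) UI /= /Y /G cU near_left //; last by rewrite normrN ger0_norm; lra.
by rewrite -z2 -mulNr; apply: ys_mark => //; apply/offsP; exists j => //; right.
Qed.

Local Notation N := (size cuts).
(** The first mark after [tp i] starts the block [i]. *)
Definition ee i := below cuts (tp i + eps).
Definition cut k := nth 0 cuts k.

Lemma token_gap i U : (i < T)%N -> U \in cuts -> ~~ (tp i.+1 - eps < U < tp i.+1 + eps).
Proof.
move=> iT Uc; have e0' := eps0; apply/negP => /andP[U1 U2]; have [h|h] := ltP U (tp i.+1).
  have [|j hj E] := cut_left iT Uc; first by apply/andP; split; lra.
  by have /andP[m1 m2] := mark_le hj; lra.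
have := iT; rewrite leq_eqVlt => /orP[/eqP E|iT'].
  by have /andP[_] := cut_inside Uc; rewrite -tp_T -E => h'; lra.
have [|j hj E] := cut_right iT' Uc; first by apply/andP; split; lra.
by have /andP[m1 m2] := mark_le hj; lra.
Qed.

Lemma ee_out i a : (i < T)%N -> (a < 7)%N -> below cuts (tp i + a.+1%:R * eps) = (ee i + a)%N.
Proof.
move=> iT; have e0' := eps0; elim: a => [|a IH] a7; first by rewrite mul1r addn0.
rewrite addnS -IH ?(ltnW a7) //; apply: (below_next cuts_sorted).
- by apply: mark_right => //; rewrite /= (ltnW a7).
- by rewrite ltrD2l ltr_pM2r // ltr_nat.
- move=> U Uc; apply/negP => /andP[U1 U2].
  have /andP[m1 m2] := @mark_le a.+1 ltac:(by rewrite /= ltnW).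
  have /andP[m3 m4] := @mark_le a.+2 a7.
  have [|j hj E] := cut_right iT Uc; first by apply/andP; split; lra.
  move: U1 U2; rewrite E !ltrD2l !ltr_pM2r // !ltr_nat; clear; lia.
Qed.

Lemma ee_in i b : (i < T)%N -> (b < 7)%N -> (below cuts (tp i.+1 - b.+1%:R * eps)%R + b.+1)%N = ee i.+1.
Proof.
move=> iT; have e0' := eps0; elim: b => [|b IH] b7.
  rewrite addn1; apply/esym/(below_next cuts_sorted); first exact: mark_left.
    by lra.
  by move=> U Uc; rewrite mul1r; exact: token_gap.
rewrite -IH ?(ltnW b7) // addnS -addSn; congr addn; apply/esym/(below_next cuts_sorted).
- by apply: mark_left => //; rewrite /= b7.
- by rewrite ltrD2l ltrN2 ltr_pM2r // ltr_nat.
- move=> U Uc; apply/negP => /andP[U1 U2].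
  have /andP[m1 m2] := @mark_le b.+1 ltac:(by rewrite /= ltnW).
  have /andP[m3 m4] := @mark_le b.+2 b7.
  have [|j hj E] := cut_left iT Uc; first by apply/andP; split; lra.
  move: U1 U2; rewrite E !ltrD2l !ltrN2 !ltr_pM2r // !ltr_nat; clear; lia.
Qed.

(** The seven marks after a center and the seven marks before the next one are distinct cuts. *)
Lemma ee_S i : (i < T)%N -> (ee i + 14 <= ee i.+1)%N.
Proof.
move=> iT; rewrite -(ee_in (b := 6) iT) //; have g := token_spacing iT; have e0' := eps0.
have : (below cuts (tp i + 7%:R * eps)%R < below cuts (tp i.+1 - 7%:R * eps)%R)%N.
  by apply: (below_lt cuts_sorted); [exact: mark_right|lra].
by rewrite ee_out //; clear; lia.
Qed.

Lemma ee_0 : ee 0 = 0%N.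
Proof.
apply/eqP; rewrite -leqn0 leqNgt -has_count; apply/negP => /hasP[U Uc]; rewrite tp_0 add0r => Ue.
have /andP[U0 _] := cut_inside Uc; have e0' := eps0.
have [|j hj E] := cut_right T_gt0 Uc; first by rewrite tp_0; apply/andP; split; lra.
by have /andP[m1 m2] := mark_le hj; move: E; rewrite tp_0; lra.
Qed.

Lemma ee_T : ee T = N.
Proof.
apply/eqP; rewrite -all_count; apply/allP => U Uc; have /andP[_ h] := cut_inside Uc.
by rewrite tp_T; have := eps0; lra.
Qed.

Let ee_le i j : (i <= j)%N -> (j <= T)%N -> (ee i <= ee j)%N.
Proof. exact: (e_le T_gt0 ee_0 ee_T ee_S). Qed.
Local Notation blk := (blk T ee).
Let ee_blkP := blkP T_gt0 ee_0 ee_T.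

Lemma cut_out i a : (i < T)%N -> (a < 7)%N -> cut (ee i + a) = tp i + a.+1%:R * eps.
Proof.
by move=> iT a7; rewrite /cut -ee_out //; have [_ ->] := nth_below cuts_sorted (@mark_right i a.+1 iT a7).
Qed.

Lemma cut_in i b : (i < T)%N -> (b < 7)%N -> cut (ee i.+1 - 1 - b) = tp i.+1 - b.+1%:R * eps.
Proof.
move=> iT b7; have [_ <-] := nth_below cuts_sorted (@mark_left i b.+1 iT b7).
by rewrite /cut -(ee_in iT b7); congr nth; clear; lia.
Qed.

Lemma cut_lt j k : (j < N)%N -> (k < N)%N -> (cut j < cut k) = (j < k)%N.
Proof. exact: (nth_lt cuts_sorted). Qed.

Lemma cut_le j k : (j <= k)%N -> (k < N)%N -> cut j <= cut k.
Proof.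
rewrite leq_eqVlt => /orP[/eqP ->//|jk] kN; apply: ltW; rewrite cut_lt //; exact: ltn_trans kN.
Qed.

Lemma cut_block k : (k < N)%N -> tp (blk k) + eps <= cut k <= tp (blk k).+1 - eps.
Proof.
move=> kN; have [iT h1 h2] := ee_blkP kN; have eS := ee_S iT; have eN := ee_le iT (leqnn T); rewrite ee_T in eN.
have := @cut_out (blk k) 0 iT isT; have := @cut_in (blk k) 0 iT isT; rewrite addn0 !mul1r subn0 => <- <-.
by rewrite !cut_le //; move: h2 eN eS; clear; lia.
Qed.

Lemma cut_comp k : (k < N)%N -> inside (cut k) /\ comp (cut k) = bc (blk k).
Proof.
move=> kN; have [iT h1 h2] := ee_blkP kN; have /andP[c1 c2] := cut_block kN; have e0' := eps0.
by apply: comp_between => //; apply/andP; split; lra.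
Qed.

(** At the end of a component the link goes on at the block which starts at the base point of this
    component. *)
Definition nb i := if at_end i then below (0 :: tokens) ((bc i)%:R * L) else i.+1.

Lemma base_below c : (c < n)%N -> (below (0%R :: tokens) (c%:R * L)%R <= T)%N /\
  tp (below (0%R :: tokens) (c%:R * L)) = c%:R * L.
Proof.
move=> cn; apply: tp_index; case: c cn => [_|c cn]; first by rewrite mul0r inE eqxx.
by rewrite inE token_base ?orbT //= ltnW.
Qed.

Lemma tp_nb i : (i < T)%N -> (nb i < T)%N /\ tp (nb i) = zl i.
Proof.
move=> iT; have [c1 c2 c3 c4] := tp_block iT; have [z1 z2 _] := zlP iT.
suff [h1 h2] : (nb i <= T)%N /\ tp (nb i) = zl i.
  split => //; rewrite ltn_neqAle h1 andbT; apply/eqP => E; move: h2; rewrite E tp_T => h2.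
  by have /andP[_] := centers_inside z1; rewrite -h2 ltxx.
rewrite /nb /zl; case: (at_end i); last by split.
exact: base_below.
Qed.

Lemma nb_lt i : (i < T)%N -> (nb i < T)%N. Proof. by move=> /tp_nb[]. Qed.

Lemma at_end_last i : (i < T)%N -> ~~ at_end i -> (i.+1 < T)%N /\ bc i.+1 = bc i.
Proof.
move=> iT ne; have [c1 c2 c3 c4] := tp_block iT; have [z1 z2 _] := zlP iT.
have [h1 h2] := tp_nb iT; move: h1 h2; rewrite /nb /zl (negbTE ne) => h1 _; split => //.
by move: z2; rewrite /zl (negbTE ne).
Qed.

Lemma zl_inj i i' : (i < T)%N -> (i' < T)%N -> zl i = zl i' -> i = i'.
Proof.
have aux j : (j < T)%N -> (bc j)%:R * L < zl j \/ at_end j /\ zl j = (bc j)%:R * L.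
  move=> jT; have [c1 c2 c3 c4] := tp_block jT; rewrite /zl; case: (at_end j); first by right.
  by left; apply: le_lt_trans c3.
move=> iT i'T E; have [_ z2 _] := zlP iT; have [_ z2' _] := zlP i'T.
have cc : bc i = bc i' by rewrite -z2 -z2' E.
have tpI : tp i.+1 = tp i'.+1 -> i = i'.
  move=> E'; have [h|h|//] := ltngtP i i'; exfalso.
    by have := tp_lt (i := i.+1) (j := i'.+1) iT i'T; rewrite E' ltxx ltnS h.
  by have := tp_lt (i := i'.+1) (j := i.+1) i'T iT; rewrite E' ltxx ltnS h.
case: (aux _ iT) (aux _ i'T) => [h|[h1 h2]] [h'|[h1' h2']].
- apply: tpI; move: E h h'; rewrite /zl; case: (at_end i); case: (at_end i'); rewrite ?cc ?ltxx //.
- by move: h; rewrite E h2' cc ltxx.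
- by move: h'; rewrite -E h2 cc ltxx.
- by apply: tpI; rewrite (eqP h1) (eqP h1') cc.
Qed.

Lemma nb_inj i i' : (i < T)%N -> (i' < T)%N -> nb i = nb i' -> i = i'.
Proof.
move=> iT i'T E; apply: zl_inj => //.
by have [_ <-] := tp_nb iT; have [_ <-] := tp_nb i'T; rewrite E.
Qed.

(** Components occupy successive parameter intervals, so a block ending a component returns to its
    start, and no later block returns to before the end of this component. *)
Lemma nb_next i : (i < T)%N -> nb i = i.+1 \/
  (nb i <= i)%N /\ forall i', (i < i' < T)%N -> (i < nb i')%N.
Proof.
move=> iT; rewrite {1 2}/nb; case E : (at_end i); last by left.
right; have [c1 c2 c3 c4] := tp_block iT; have [b1 b2] := base_below c1; split.
  by rewrite -ltnS -tp_lt // b2; apply: le_lt_trans c3.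
move=> i' /andP[ii' i'T]; rewrite /nb; case E' : (at_end i'); last by apply: ltn_trans ii' _.
have [c1' c2' c3' c4'] := tp_block i'T; have [b1' b2'] := base_below c1'.
rewrite ltnNge -ltnS -tp_lt // b2' -leNgt (eqP E).
have : tp i.+1 < tp i'.+1 by rewrite tp_lt // ltnS.
rewrite (eqP E) (eqP E') ltr_pM2r ?L0 // ltr_nat ltnS => cc.
by rewrite ler_pM2r ?L0 // ler_nat.
Qed.

Definition snat k := if k.+1 == ee (blk k).+1 then ee (nb (blk k)) else k.+1.

Lemma ee_blk i : (i < T)%N -> (ee i < N)%N /\ blk (ee i) = i.
Proof.
by move=> iT; have := pos_out T_gt0 ee_0 ee_T ee_S iT (isT : (0 < 14)%N); rewrite addn0 => -[].
Qed.

Lemma snat_lt k : (k < N)%N -> (snat k < N)%N.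
Proof.
move=> kN; have [iT h1 h2] := ee_blkP kN; rewrite /snat; case: eqP => [E|ne].
  by have [] := ee_blk (nb_lt iT).
have eN := ee_le iT (leqnn T); rewrite ee_T in eN; apply: leq_trans eN.
by rewrite ltn_neqAle h2 andbT; apply/eqP.
Qed.

Definition sn (k : 'I_N) : 'I_N := Ordinal (snat_lt (ltn_ord k)).

Lemma snat_blk k : (k < N)%N -> blk (snat k) = if k.+1 == ee (blk k).+1 then nb (blk k) else blk k.
Proof.
move=> kN; have [iT h1 h2] := ee_blkP kN; rewrite /snat; case: eqP => [E|ne].
  by have [] := ee_blk (nb_lt iT).
apply: (blk_uniq T_gt0 ee_0 ee_T ee_S) => //; first exact: leqW.
by rewrite ltn_neqAle h2 andbT; apply/eqP.
Qed.

Lemma sn_inj : injective sn.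
Proof.
move=> k l /(congr1 val) /= E; apply/val_inj => /=; have kN := ltn_ord k; have lN := ltn_ord l.
have bb := congr1 blk E; rewrite !snat_blk // in bb.
have [iT h1 h2] := ee_blkP kN; have [iT' h1' h2'] := ee_blkP lN.
move: E bb; rewrite /snat; case: eqP => [E1|_]; case: eqP => [E2|_].
- by move=> _ /(nb_inj iT iT') E; move: E1; rewrite E -E2 => -[].
- by move=> E bb; move: E h1'; rewrite bb => ->; rewrite ltnn.
- by move=> E bb; move: E h1; rewrite bb => <-; rewrite ltnn.
- by move=> [].
Qed.

Definition sp_prev := invF sn_inj.
Lemma snK : cancel sn sp_prev. Proof. exact: invF_f. Qed.
Lemma sp_prevK : cancel sp_prev sn. Proof. exact: f_invF. Qed.

Lemma sn_end (k : 'I_N) i : (i < T)%N -> k.+1 = ee i.+1 -> sn k = ee (nb i) :> nat.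
Proof.
move=> iT E; have B : blk k = i by apply: (blk_uniq T_gt0 ee_0 ee_T ee_S) => //; rewrite -?E // -ltnS E; have := ee_S iT; clear; lia.
by rewrite /= /snat B E eqxx.
Qed.

Lemma sn_next (k : 'I_N) : (forall i, (i < T)%N -> k.+1 <> ee i.+1) -> sn k = k.+1 :> nat.
Proof. by move=> h; have [iT _ _] := ee_blkP (ltn_ord k); rewrite /= /snat; case: eqP => // /(h _ iT). Qed.

Definition w (k : 'I_N) := G (cut k).
(** The end of the edge [k]. For a token it is measured from the center, because at the end of a
    component it lies beyond the parameters of this component. *)
Definition vv k := if k.+1 == ee (blk k).+1 then tp (blk k).+1 + eps else cut k.+1.

Lemma next_same k : (k < N)%N -> k.+1 <> ee (blk k).+1 -> (k.+1 < N)%N /\ blk k.+1 = blk k.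
Proof.
move=> kN ne; have := snat_lt kN; have := snat_blk kN; rewrite /snat; case: eqP => [E|_]; first by case: ne.
by split.
Qed.

Lemma cut_end k : (k < N)%N -> k.+1 = ee (blk k).+1 -> cut k = tp (blk k).+1 - eps.
Proof.
move=> kN E; have [iT _ _] := ee_blkP kN; have := @cut_in (blk k) 0 iT isT.
by rewrite -E subn1 subn0 /= mul1r.
Qed.

Lemma edge_range k : (k < N)%N -> cut k < vv k /\ vv k <= tp (blk k).+1 + eps.
Proof.
move=> kN; have e0' := eps0; rewrite /vv; case: eqP => [E|ne]; first by rewrite cut_end //; split; lra.
have [kN' B] := next_same kN ne; rewrite cut_lt // ltnSn; split => //.
by have := cut_block kN'; rewrite B => /andP[_]; lra.
Qed.

Lemma vv_cut k l : (k < l)%N -> (l < N)%N -> vv k <= cut l.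
Proof.
move=> kl lN; have kN := ltn_trans kl lN; rewrite /vv; case: eqP => [E|ne]; last exact: cut_le.
have [iT h1 h2] := ee_blkP kN; have iT' : ((blk k).+1 < T)%N.
  by rewrite ltn_neqAle iT andbT; apply/eqP => E'; move: kl lN; rewrite -ltnS E E' ee_T; clear; lia.
have := @cut_out (blk k).+1 0 iT' isT; rewrite addn0 mul1r => <-.
by apply: cut_le => //; rewrite -E.
Qed.

(** Before the center at the end of the block, such a depth would make [r] a cut between two
    consecutive ones. After it, the depth is affine and the first mark is only reached at the end of
    the edge. *)
Lemma edge_free k r : (k < N)%N -> cut k < r < vv k -> (F (bc (blk k)) r).2 \notin ys.
Proof.
move=> kN /andP[r1 r2]; have [iT h1 h2] := ee_blkP kN; have /andP[b1 b2] := cut_block kN; have e0' := eps0.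
have [er1 er2] := edge_range kN; apply/negP => ry; have [h|h] := ltP r (tp (blk k).+1).
  have [rI rc] := @comp_between (blk k) r iT ltac:(by apply/andP; split; lra).
  have rC : r \in cuts by rewrite cutsP -/(inside r) rI /= /Y /G rc.
  have [j1 j2] := nth_below cuts_sorted rC; rewrite -/(cut _) in j2.
  move: r2; rewrite /vv; case: eqP => [E|ne] r2.
    by have := token_gap iT rC; rewrite -cut_end // r1; move: r2 => ->.
  have [kN' _] := next_same kN ne.
  by move: r1 r2; rewrite -j2 !cut_lt //; clear; lia.
move: r2; rewrite /vv; case: eqP => [E|ne] r2; last first.
  have [kN' B] := next_same kN ne; have := cut_block kN'; rewrite B => /andP[_ h3]; lra.
have [z1 z2 _] := zlP iT.
have hh : `|r - tp (blk k).+1| <= 16 * eps by rewrite ger0_norm; lra.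
have := near_left iT hh; rewrite [tp _ + _](_ : _ = r); last by ring.
move=> rE; have [|q qo] := ys_near z1 ry.
  rewrite rE [X in `|X|](_ : _ = slope (bc (blk k)) (zl (blk k)) * (r - tp (blk k).+1)); last by ring.
  have U3 : 0 <= r - tp (blk k).+1 by lra.
  have U4 : r - tp (blk k).+1 <= eps by lra.
  have := ler_pM (normr_ge0 _) U3 (slope_total z1) U4; rewrite z2 normrM (ger0_norm U3).
  by have te : 0 < total_slope * eps by [rewrite mulr_gt0 // total_slope_gt0]; lra.
rewrite rE -z2 => /addrI /(mulfI (slope_neq0 z1)) E'.
have /andP[q1 _] := offs_bound qo.
have : `|q| * eps < eps by rewrite -[X in _ * X](gtr0_norm eps0) -normrM -E' ger0_norm; lra.
by rewrite -[ltRHS]mul1r ltr_pM2r // ltNge q1.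
Qed.

Lemma w_F (k : 'I_N) : w k = F (bc (blk k)) (cut k).
Proof. by have [_ <-] := cut_comp (ltn_ord k). Qed.

Lemma edge_end (k : 'I_N) : F (bc (blk k)) (vv k) = w (sn k).
Proof.
have kN := ltn_ord k; have [iT h1 h2] := ee_blkP kN; rewrite w_F /= snat_blk // /vv /snat; case: eqP => [E|//].
have [n1 n2] := tp_nb iT; have [z1 z2 ->] := zlP iT.
have := @cut_out (nb (blk k)) 0 n1 isT; rewrite addn0 mul1r n2 => ->.
by rewrite [bc (nb _)]/bc n2 z2.
Qed.

Definition Q k a := (1 - a) * cut k + a * vv k.

Lemma edge_pt (k : 'I_N) a : 0 <= a <= 1 -> pt sn w k a = F (bc (blk k)) (Q k a).
Proof.
move=> ha; have kN := ltn_ord k; have [er1 er2] := edge_range kN.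
rewrite /pt w_F -edge_end affine_between //; first exact: ltW.
move=> k'; apply/negP => /(edge_free kN)/negP; apply.
by rewrite mem_cat verP //; have [iT _ _] := ee_blkP kN; have [] := tp_block iT.
Qed.

Lemma edge_off (k : 'I_N) y : y \in ys -> ~~ sbtw (w k).2 (w (sn k)).2 y.
Proof.
move=> yy; apply/negP => h; have [a ha E] := btw_affine (sbtwW h).
move: h yy; rewrite E => /affine_sbtw /andP[a0 a1]; apply/negP.
have -> : (1 - a) * (w k).2 + a * (w (sn k)).2 = (pt sn w k a).2 by [].
rewrite edge_pt //; have kN := ltn_ord k; have [er1 _] := edge_range kN; apply: edge_free => //.
have d0 : 0 < vv k - cut k by rewrite subr_gt0.
have a1' : 0 < 1 - a by lra.
have := mulr_gt0 a0 d0; have := mulr_gt0 a1' d0; rewrite /Q => ? ?; apply/andP; split; lra.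
Qed.

Lemma special_cut k : (k < N)%N -> special T ee k -> exists z q, [/\ z \in centers, q \in offs,
  Y (cut k) = Y z + slope (comp z) z * (q * eps) &
  (0 < q /\ cut k = z + q * eps) \/ (q < 0 /\ exists2 i, (i < T)%N & z = zl i /\ cut k = tp i.+1 + q * eps)].
Proof.
move=> kN; have [iT h1 h2] := ee_blkP kN; have e0' := eps0; have [_ cc] := cut_comp kN.
have eN := ee_le iT (leqnn T); rewrite ee_T in eN; have g := token_spacing iT.
rewrite /special /apos /bpos => /orP[] hk.
  have kE : k = (ee (blk k) + (k - ee (blk k)))%N by rewrite subnKC.
  set a := (k - _)%N in hk kE; have cE := cut_out iT hk; rewrite -kE in cE.
  have /andP[m1 m2] := @mark_le a.+1 hk.
  exists (tp (blk k)), a.+1%:R; split; first exact: tp_center.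
  - by apply/offsP; exists a.+1 => //; left.
  - by rewrite /Y /G cc cE near_right // ger0_norm; lra.
  - by left; rewrite ltr0n.
have kE : k = (ee (blk k).+1 - 1 - (ee (blk k).+1 - 1 - k))%N by move: h2; clear; lia.
set b := (ee (blk k).+1 - 1 - k)%N in hk kE; have cE := cut_in iT hk; rewrite -kE in cE.
have /andP[m1 m2] := @mark_le b.+1 hk; have [z1 z2 _] := zlP iT.
exists (zl (blk k)), (- b.+1%:R); split => //.
- by apply/offsP; exists b.+1 => //; right.
- have hb : `|- (b.+1%:R * eps)| <= 16 * eps by rewrite normrN ger0_norm; lra.
  by rewrite {1}/Y /G cc cE (near_left iT hb) z2 mulNr.
- by right; rewrite oppr_lt0 ltr0n; split => //; exists (blk k); rewrite // cE mulNr.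
Qed.

Lemma special_inj (k l : 'I_N) : special T ee k -> special T ee l -> (w k).2 = (w l).2 -> k = l.
Proof.
move=> /(special_cut (ltn_ord k))[z [q [z1 q1 Y1 H1]]] /(special_cut (ltn_ord l))[z' [q' [z2 q2 Y2 H2]]] E.
suff : cut k = cut l by move/eqP; rewrite nth_uniq ?(lt_sorted_uniq cuts_sorted) // => /eqP /val_inj.
have [E1 E2] : z = z' /\ q = q' by apply: mark_inj => //; rewrite -Y1 -Y2.
rewrite -E1 -E2 in H2; case: H1 H2 => [[p1 ->]|[p1 [i iT [zi ->]]]] [[p2 ->]|[p2 [i' i'T [zi' ->]]]] //.
- by have := lt_trans p1 p2; rewrite ltxx.
- by have := lt_trans p1 p2; rewrite ltxx.
- by have -> : i = i' by apply: zl_inj; rewrite // -zi -zi'.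
Qed.

(** The parameter of a point of the edge [k], brought back by one period if the edge has run past
    the end of its component. *)
Definition red k a := if Q k a < (bc (blk k)).+1%:R * L then Q k a else Q k a - L.

Lemma Q_range k a : (k < N)%N -> 0 <= a < 1 -> cut k <= Q k a < vv k.
Proof.
move=> kN /andP[a0 a1]; have [er _] := edge_range kN; have d0 : 0 < vv k - cut k by rewrite subr_gt0.
have a1' : 0 < 1 - a by lra.
have := mulr_ge0 a0 (ltW d0); have := mulr_gt0 a1' d0; rewrite /Q => ? ?; apply/andP; split; lra.
Qed.

Lemma redP (k : 'I_N) a : 0 <= a < 1 -> [/\ inside (red k a), G (red k a) = pt sn w k a,
  comp (red k a) = bc (blk k) & (red k a = Q k a /\ (bc (blk k))%:R * L + eps <= red k a) \/
  [/\ at_end (blk k), k.+1 = ee (blk k).+1 , red k a = Q k a - L & red k a < (bc (blk k))%:R * L + eps]].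
Proof.
move=> ha; have kN := ltn_ord k; have [iT h1 h2] := ee_blkP kN; have /andP[q1 q2] := Q_range kN ha.
have [c1 c2 c3 c4] := tp_block iT; have /andP[b1 b2] := cut_block kN; have e0' := eps0; have e32 := eps32.
have [er1 er2] := edge_range kN; have LL := L1.
have ha' : 0 <= a <= 1 by case/andP: ha => -> /ltW.
have ins U : (bc (blk k))%:R * L <= U < (bc (blk k)).+1%:R * L -> inside U /\ comp U = bc (blk k).
  move=> hU; split; last exact: compE.
  case/andP: hU => u1 u2; rewrite /inside (le_trans _ u1) ?mulr_ge0 //=.
  by apply: lt_le_trans u2 _; rewrite ler_pM2r ?L0 // ler_nat.
rewrite edge_pt // /red; case: ltP => hQ.
  have [i1 i2] := ins (Q k a) ltac:(by rewrite hQ andbT; lra).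
  by rewrite {1}/G i2; split => //; left; split => //; lra.
have E : k.+1 = ee (blk k).+1.
  apply/eqP/negPn/negP => /eqP ne; move: q2 er2; rewrite /vv; case: eqP => // _ q2 er2.
  by have [kN' B] := next_same kN ne; have := cut_block kN'; rewrite B => /andP[_]; lra.
have ae : at_end (blk k).
  apply/negPn/negP => ne; have [iT' bE] := at_end_last iT ne.
  by have [_ _ _ c4'] := tp_block iT'; have := token_spacing iT'; rewrite bE in c4'; lra.
have tE := eqP ae; rewrite tE in er2; move: hQ q2 er2; rewrite -natr1 => hQ q2 er2.
have [i1 i2] := ins (Q k a - L) ltac:(by rewrite -natr1; apply/andP; split; lra).
rewrite {1}/G i2; split => //; last by right; split => //; lra.
by rewrite -[LHS]per; congr F; ring.
Qed.

Lemma red_inj (k l : 'I_N) a b : 0 <= a < 1 -> 0 <= b < 1 -> red k a = red l b -> k = l /\ a = b.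
Proof.
move=> ha hb E; have kN := ltn_ord k; have lN := ltn_ord l.
have [_ _ c1 H1] := redP k ha; have [_ _ c2 H2] := redP l hb.
have cc : bc (blk k) = bc (blk l) by rewrite -c1 -c2 E.
have fin : k = l -> Q k a = Q l b -> k = l /\ a = b.
  move=> -> EQ; split => //; have [er _] := edge_range lN.
  by apply: affine_inj EQ; rewrite lt_eqF.
case: H1 H2 => [[r1 r2]|[r1 r2 r3 r4]] [[r1' r2']|[r1' r2' r3' r4']].
- rewrite r1 r1' in E; apply: fin => //.
  have /andP[q1 q2] := Q_range kN ha; have /andP[q1' q2'] := Q_range lN hb.
  apply/val_inj => /=; have [h|h|//] := ltngtP k l.
    by have := vv_cut h lN; rewrite leNgt => /negP []; apply: le_lt_trans q1' _; rewrite -E.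
  by have := vv_cut h kN; rewrite leNgt => /negP []; apply: le_lt_trans q1 _; rewrite E.
- by move: r4'; rewrite -E ltNge -cc r2.
- by move: r4; rewrite E ltNge cc r2'.
- have [iT _ _] := ee_blkP kN; have [iT' _ _] := ee_blkP lN.
  have bb : blk k = blk l.
    by apply: zl_inj => //; rewrite /zl r1 r1' cc.
  apply: fin; last by move: E; rewrite r3 r3' => /addIr.
  by apply/val_inj => /=; move: r2 r2'; rewrite bb => <- [].
Qed.

Lemma token_edge (k : 'I_N) a : 0 <= a < 1 -> red k a \in tk -> exists i, [/\ (i < T)%N, ~~ at_end i,
  red k a = tp i.+1 & k.+1 = ee i.+1].
Proof.
move=> ha Ut; have kN := ltn_ord k; have e0' := eps0.
have Uin : red k a \in tokens by rewrite tokensP Ut.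
have [j1 j2] := tp_index (U := red k a) ltac:(by rewrite inE Uin orbT).
move: j1 j2; case: (below _ _) => [|i] iT tE.
  by have /andP[] := token_range Uin; rewrite -tE tp_0 ltxx.
have [c1 c2 c3 c4] := tp_block iT; have [iR _ cR H] := redP k ha; have /andP[q1 q2] := Q_range kN ha.
have ne : ~~ at_end i.
  apply/negP => /eqP ae; have := tk_bases Ut; have := tk_inside Ut; rewrite -tE ae /inside => /andP[_].
  rewrite ltr_pM2r ?L0 // ltr_nat => cn /mapP; apply; exists (bc i).+1 => //.
  by rewrite mem_iota.
exists i; split => //; have [iT' bE] := at_end_last iT ne.
have [c1' c2' c3' c4'] := tp_block iT'.
have rc : comp (red k a) = bc i by rewrite -tE -/(bc i.+1).
case: H => [[r1 r2]|[_ _ _ r4]]; last first.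
  exfalso; move: r4; rewrite -cR rc -tE => r4; have := token_spacing iT; lra.
have QE : Q k a = tp i.+1 by rewrite -r1 tE.
rewrite QE in q1 q2; have := token_gap iT (mem_nth 0 kN); rewrite -/(cut k) => tg.
have {tg} ck : cut k <= tp i.+1 - eps.
  by rewrite leNgt; apply/negP => h; move: tg; rewrite h /=; lra.
have ci := @cut_in i 0 iT isT; rewrite subn0 mul1r in ci.
have [e1 e2] := ee_blk iT'; have eS := ee_S iT.
have eN : (ee i.+1 - 1 < N)%N by move: e1; clear; lia.
apply/eqP; rewrite -ci in ck; rewrite eqn_leq; apply/andP; split.
  have : (k <= ee i.+1 - 1)%N by rewrite leqNgt -cut_lt // -leNgt.
  by move: eS; clear; lia.
rewrite leqNgt; apply/negP => h; have h' : (k < ee i.+1 - 1)%N by move: h; clear; lia.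
by have := vv_cut h' eN; rewrite ci; lra.
Qed.

(** Along a token the depth stays close to that of its own center, so it equals the depth of a
    center only for this center, and only there. *)
Lemma end_edge (k : 'I_N) a i : (i < T)%N -> ~~ at_end i -> k.+1 = ee (blk k).+1 -> 0 <= a < 1 ->
  Y (red k a) = Y (tp i.+1) -> red k a = tp i.+1.
Proof.
move=> iT ne E ha EY; have kN := ltn_ord k; have [kT h1 h2] := ee_blkP kN; have /andP[q1 q2] := Q_range kN ha.
have [iR GE cR H] := redP k ha; have e0' := eps0; have [z1 z2 z3] := zlP iT; have [z1' z2' z3'] := zlP kT.
have zi : zl i = tp i.+1 by rewrite /zl (negbTE ne).
have hh : `|Q k a - tp (blk k).+1| <= eps.
  by rewrite cut_end // in q1; rewrite /vv E eqxx in q2; rewrite ler_norml; apply/andP; split; lra.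
have ha' : 0 <= a <= 1 by case/andP: ha => -> /ltW.
have := near_left kT (le_trans hh (_ : eps <= 16 * eps)); rewrite [tp _ + _](_ : _ = Q k a); last by ring.
move=> /(_ ltac:(lra)); have -> : F (bc (blk k)) (Q k a) = G (red k a) by rewrite GE edge_pt.
rewrite -/(Y _) EY -zi => EY'.
have zz : zl i = zl (blk k).
  apply/eqP/negPn/negP => nz; have := far_center z1 z1' nz; rewrite EY'.
  rewrite [X in `|X|](_ : _ = slope (bc (blk k)) (zl (blk k)) * (Q k a - tp (blk k).+1)); last by ring.
  rewrite normrM; have := ler_pM (normr_ge0 _) (normr_ge0 _) (slope_total z1') hh; rewrite z2'.
  by have te : 0 < total_slope * eps by [rewrite mulr_gt0 // total_slope_gt0]; lra.
have ik := zl_inj iT kT zz; have : slope (bc (blk k)) (zl (blk k)) * (Q k a - tp (blk k).+1) = 0.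
  by move: EY'; rewrite zz; lra.
move/eqP; rewrite -z2' mulf_eq0 (negbTE (slope_neq0 z1')) /= subr_eq0 -ik => /eqP QE.
have [iT' bE] := at_end_last iT ne; have [c1 c2 c3 c4] := tp_block iT'; rewrite bE in c4.
by rewrite /red -ik QE (lt_le_trans c3 c4).
Qed.

(** Edges start at depths in [ys], a finite set avoiding the depths of the centers. The depth
    changes at bounded speed along an edge, so it takes some time to reach a center. *)
Lemma crossing_const : exists2 k0, 0 < k0 < 1 & forall (k : 'I_N) a z, 0 <= a < 1 -> z \in centers ->
  (pt sn w k a).2 = Y z -> k0 < a.
Proof.
have [d d0 hd] : exists2 d, 0 < d & forall z, z \in centers -> forall d', 0 < d' <= d -> forall l, l \in ys -> d' <= `|Y z - l|.
  apply: seq_small => z zc.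
  have [r r0 h] : exists2 r, 0 < r & forall l, l \in ys -> forall d', 0 < d' <= r -> d' <= `|Y z - l|.
    apply: seq_small => l ly; exists `|Y z - l|; last by move=> d' /andP[].
    by rewrite normr_gt0 subr_eq0; apply: contraNneq (center_ys zc) => ->.
  by exists r => // d' hd' l ly; exact: h.
pose D : R := 1 + \sum_k `|(w k).2| + \sum_k `|(w k).2|.
have wD k : `|(w k).2| <= \sum_k `|(w k).2| by rewrite (bigD1 k) //= lerDl sumr_ge0.
have D0 : 0 < D by rewrite /D -addrA ltr_wpDr // addr_ge0 // sumr_ge0.
exists (Num.min (d / (2 * D)) (1 / 2)).
  apply/andP; split; first by rewrite lt_min divr_gt0 ?mulr_gt0 //=; lra.
  by rewrite gt_min; apply/orP; right; lra.
move=> k a z /andP[a0 a1] zc E; rewrite gt_min; apply/orP; left.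
have h := hd z zc d ltac:(by rewrite d0 lexx) _ (cut_ys (mem_nth 0 (ltn_ord k))).
have : `|Y z - (w k).2| <= a * D.
  have -> : Y z - (w k).2 = a * ((w (sn k)).2 - (w k).2) by rewrite -E /pt /= /GRing.scale /=; ring.
  rewrite normrM (ger0_norm a0) ler_wpM2l //.
  by have := ler_normB (w (sn k)).2 (w k).2; have := wD k; have := wD (sn k); rewrite /D; lra.
have -> : (w k).2 = Y (nth 0 cuts k) by [].
move=> h'; rewrite ltr_pdivrMr ?mulr_gt0 //; have : d <= a * D by exact: le_trans h h'.
by lra.
Qed.

(** The upper strand of a crossing is on a token, at its center, and by [end_edge] the lower one is
    not on a token. Tokens have positive levels and the other edges do not, so levels agree with
    heights at every crossing. *)
Lemma crossings_tame : exists2 k0, 0 < k0 < 1 & tame_crossings sn w (@token_level R _ T ee) k0.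
Proof.
have [k0 k01 hk0] := crossing_const; exists k0 => // j k a b ha hb E.
have kN := ltn_ord k; have jN := ltn_ord j.
have [iR GR _ _] := redP j ha; have [iR' GR' _ _] := redP k hb.
have [U|U] := eqVneq (red j a) (red k b); first by left; exact: red_inj.
right; move: E => [E1 E2].
have EX : (G (red j a)).1.1 = (G (red k b)).1.1 by rewrite GR GR'.
have EY : (G (red j a)).2 = (G (red k b)).2 by rewrite GR GR'.
have hne : (G (red j a)).1.2 != (G (red k b)).1.2.
  by apply: contraNneq U => h; apply/eqP/Ginj => //; exact: sp_eq.
have token i (l : 'I_N) : (i < T)%N -> l.+1 = ee i.+1 -> bpos T ee l = 0%N /\ l.+1 = ee (blk l).+1.
  move=> iT lE; have B : blk l = i.
    by apply: (blk_uniq T_gt0 ee_0 ee_T ee_S) => //; [rewrite -ltnS lE; have := ee_S iT; clear; lia|rewrite -lE].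
  by rewrite /bpos B -lE; split => //; clear; lia.
have key (j' k' : 'I_N) a' b' : 0 <= a' < 1 -> 0 <= b' < 1 -> red j' a' != red k' b' ->
   (G (red j' a')).1.1 = (G (red k' b')).1.1 -> Y (red j' a') = Y (red k' b') ->
   (G (red k' b')).1.2 < (G (red j' a')).1.2 -> [/\ k0 < a', k0 < b' & above sn w (@token_level R _ T ee) j' a' k' b'].
  move=> ha' hb' U' EX' EY' hlt.
  have [iRj GRj _ _] := redP j' ha'; have [iRk GRk _ _] := redP k' hb'.
  have Ut : red j' a' \in tk by apply: tkP hlt => //; rewrite eq_sym.
  have Uc : red j' a' \in centers by rewrite mem_cat Ut.
  have [i [iT ne UE jE]] := token_edge ha' Ut; have [bj _] := token i j' iT jE.
  split.
  - by apply: (hk0 j' a' _ ha' Uc); rewrite -GRj.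
  - by apply: (hk0 k' b' _ hb' Uc); rewrite -GRk EY'.
  split; last by rewrite /height -GRj -GRk.
  have bk : bpos T ee k' != 0%N.
    apply/eqP => bk; have [kT h1 h2] := ee_blkP (ltn_ord k').
    have kE : k'.+1 = ee (blk k').+1 by move: bk h2; rewrite /bpos; clear; lia.
    by move: U'; rewrite UE (end_edge iT ne kE hb') ?eqxx // -UE EY'.
  by rewrite /token_level bj eqxx (negbTE bk) (le_lt_trans (y := 0)) ?oppr_le0 ?ltr0n.
move: hne; rewrite neq_lt => /orP[] hlt; last first.
  by have [h1 h2 h3] := key j k a b ha hb U EX EY hlt; split => //; left.
by have [h1 h2 h3] := key k j b a hb ha ltac:(by rewrite eq_sym) (esym EX) (esym EY) hlt; split => //; right.
Qed.

Lemma first_lt (c : 'I_n) : (ee (below (0%R :: tokens) (c%:R * L)%R) < N)%N.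
Proof.
have [b1 b2] := base_below (ltn_ord c); apply: (ee_blk _).1.
rewrite ltn_neqAle b1 andbT; apply/eqP => E; move: b2; rewrite E tp_T => /(mulIf (lt0r_neq0 L0)) /eqP.
by rewrite eqr_nat gtn_eqF // ltn_ord.
Qed.
Definition e0 (c : 'I_n) : 'I_N := Ordinal (first_lt c).

Lemma comp_sn (k : 'I_N) : bc (blk (sn k)) = bc (blk k).
Proof.
have kN := ltn_ord k; have [iT _ _] := ee_blkP kN; rewrite /= snat_blk //; case: eqP => // _.
by have [_ h] := tp_nb iT; have [_ z2 _] := zlP iT; rewrite /bc h z2.
Qed.

Lemma e0_comp c : bc (blk (e0 c)) = c.
Proof.
have [b1 b2] := base_below (ltn_ord c).
have iT : (below (0%R :: tokens) (c%:R * L)%R < T)%N.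
  rewrite ltn_neqAle b1 andbT; apply/eqP => E; move: b2; rewrite E tp_T => /(mulIf (lt0r_neq0 L0)) /eqP.
  by rewrite eqr_nat gtn_eqF // ltn_ord.
rewrite /= (ee_blk iT).2 /bc b2; apply: compE; by rewrite lexx ltr_pM2r ?L0 // ltr_nat ltnSn.
Qed.

Lemma e0_inj i j : fconnect sn (e0 i) (e0 j) -> i = j.
Proof.
move=> /iter_findex; move: (findex _ _ _) => q E; apply/val_inj => /=; rewrite -(e0_comp i) -(e0_comp j) -E.
by elim: q {E} => //= q ->; rewrite -comp_sn.
Qed.

(** Induction on the number: a vertex is the successor of the preceding number unless it is the
    first one of a new component. *)
Lemma e0_surj k : exists i, fconnect sn (e0 i) k.
Proof.
suff H q : forall k : 'I_N, k = q :> nat -> exists i, fconnect sn (e0 i) k by exact: (H k).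
elim: q => [|q IH] {}k kE; have kN := ltn_ord k; have [iT h1 h2] := ee_blkP kN.
  exists (Ordinal n0); have -> : k = e0 (Ordinal n0); last exact: connect0.
  apply/val_inj; rewrite [LHS]kE -[RHS]/(ee (below (0%R :: tokens) (0%:R * L)%R)) mul0r (_ : below _ _ = 0%N) ?ee_0 //.
  apply/eqP; rewrite -leqn0 leqNgt -has_count; apply/negP => /hasP[U]; rewrite inE => /orP[/eqP ->|/token_range /andP[U0 _]].
    by rewrite ltxx.
  by rewrite ltNge ltW.
have qN : (q < N)%N by rewrite ltnW // -kE.
have [i hi] := IH (Ordinal qN) erefl.
have step : sn (Ordinal qN) = k -> exists i, fconnect sn (e0 i) k.
  by move=> E; exists i; apply: connect_trans hi _; rewrite -E; exact: fconnect1.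
have [qT q1 q2] := ee_blkP qN.
have [E|ne] := eqVneq q.+1 (ee (blk q).+1); last first.
  by apply: step; apply/val_inj; rewrite /= /snat (negbTE ne) kE.
have kb : blk k = (blk q).+1.
  have iT' : ((blk q).+1 < T)%N.
    by rewrite ltn_neqAle qT andbT; apply/eqP => E'; move: kN; rewrite kE E E' ee_T ltnn.
  by rewrite kE E (ee_blk iT').2.
have [ae|ne] := boolP (at_end (blk q)); last first.
  by apply: step; apply/val_inj; rewrite /= /snat -E eqxx /nb (negbTE ne) -E kE.
have cn : ((bc (blk q)).+1 < n)%N.
  have [c1 _ _ _] := tp_block qT; rewrite ltn_neqAle c1 andbT; apply/eqP => E'.
  have := tp_lt (i := (blk q).+1) (j := T) qT (leqnn T).
  by rewrite (eqP ae) E' tp_T ltxx -kb iT.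
exists (Ordinal cn); have -> : k = e0 (Ordinal cn); last exact: connect0.
apply/val_inj; rewrite -[RHS]/(ee (below (0%R :: tokens) ((bc (blk q)).+1%:R * L)%R)) -(eqP ae) [LHS]kE E; congr ee.
have h0 : tp (blk q).+1 \in 0 :: tokens by rewrite inE tp_S // orbT.
have [b1 b2] := tp_index h0; move: b1 b2; move: (below (0%R :: tokens) _) => q1' b1 b2.
have [h|h|//] := ltngtP (blk q).+1 q1'.
  by move: h; rewrite -tp_lt // b2 ltxx.
by move: h; rewrite -tp_lt // b2 ltxx.
Qed.

Lemma edge_mem (k : 'I_N) U : cut k <= U < vv k -> polygon_trace sn w (F (bc (blk k)) U).
Proof.
move=> /andP[h1 h2]; have d0 : 0 < vv k - cut k by lra.
have ha : 0 <= (U - cut k) / (vv k - cut k) <= 1.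
  have u0 : 0 <= U - cut k by lra.
  by rewrite divr_ge0 ?(ltW d0) //= ler_pdivrMr // mul1r; lra.
exists (k, (U - cut k) / (vv k - cut k)) => //=; rewrite edge_pt //; congr F.
have : (U - cut k) / (vv k - cut k) * (vv k - cut k) = U - cut k by rewrite divfK // gt_eqF.
by rewrite /Q; lra.
Qed.

Lemma trace_cut : polygon_trace sn w = [set G U | U in [set U | inside U]].
Proof.
have LL := L1; have e0' := eps0; have e32 := eps32; apply/seteqP; split => [_ [[k a] /= /andP[a0 a1] <-]|_ [U /= UI <-]].
  have [a1'|a1'] := ltP a 1.
    by have [iR GR _ _] := redP k (introT andP (conj a0 a1')); exists (red k a).
  have -> : a = 1 by apply/le_anti; rewrite a1 a1'.
  rewrite /pt subrr scale0r add0r scale1r.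
  by exists (cut (sn k)) => //; have [] := cut_comp (ltn_ord (sn k)).
have [cn c1 c2] := compP UI; rewrite /G; set c := comp U in cn c1 c2 *.
(* Points before the first mark of their component are on its last edge, one period later. *)
have [h|h] := ltP U (c%:R * L + eps).
  have bI : c.+1%:R * L \in 0 :: tokens by rewrite inE token_base ?orbT.
  have [j1 j2] := tp_index bI; move: j1 j2; case: (below _ _) => [|i] iT tE.
    by move: c2; rewrite -tE tp_0 ltNge (andP UI).1.
  have [b1 b2 b3 b4] := tp_block iT.
  have bE : bc i = c.
    apply/eqP; rewrite eqn_leq; apply/andP; split.
      by rewrite -ltnS -(ltr_nat R) -(ltr_pM2r L0) -tE; exact: le_lt_trans b3.
    by move: b4; rewrite tE ler_pM2r ?L0 // ler_nat.
  have eS := ee_S iT; have eN := ee_le iT (leqnn T); rewrite ee_T in eN.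
  have kN : (ee i.+1 - 1 < N)%N by move: eS eN; clear; lia.
  have kE : (ee i.+1 - 1).+1 = ee i.+1 by move: eS; clear; lia.
  have B : blk (ee i.+1 - 1) = i by apply: (blk_uniq T_gt0 ee_0 ee_T ee_S) => //; move: eS; clear; lia.
  rewrite -per -bE -{1}B; apply: (@edge_mem (Ordinal kN)) => /=.
  by rewrite cut_end ?B // /vv B kE eqxx tE -natr1; apply/andP; split; lra.
have [b1 b2] := base_below cn; set i := below _ _ in b1 b2.
have iT : (i < T)%N.
  rewrite ltn_neqAle b1 andbT; apply/eqP => E; move: b2; rewrite E tp_T => /(mulIf (lt0r_neq0 L0)) /eqP.
  by rewrite eqr_nat gtn_eqF.
have [eN _] := ee_blk iT.
pose P k := [&& (ee i <= k)%N, (k < N)%N & cut k <= U].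
have exP : exists k, P k.
  exists (ee i); rewrite /P leqnn eN /=.
  by have := @cut_out i 0 iT isT; rewrite addn0 mul1r b2 => ->.
have bP k : P k -> (k <= N)%N by move=> /and3P[_ /ltnW].
case: (ex_maxnP exP bP) => k /and3P[k1 kN k2] kmax.
have [iK hk1 hk2] := ee_blkP kN; have [kI kc] := cut_comp kN.
have kc' : comp (cut k) = c.
  apply: compE; rewrite (le_lt_trans k2 c2) andbT; apply: le_trans (cut_le k1 kN).
  by have := @cut_out i 0 iT isT; rewrite addn0 mul1r b2 => ->; lra.
rewrite -kc' kc; apply: (@edge_mem (Ordinal kN)); rewrite /= k2 /= ltNge; apply/negP => vU.
suff : P k.+1 by move/kmax; rewrite ltnn.
rewrite /P (leqW k1) /=; move: vU; rewrite /vv; case: eqP => [E|ne] vU; last first.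
  by have [-> _] := next_same kN ne.
have ne : ~~ at_end (blk k).
  apply/negP => /eqP ae; move: vU c2; rewrite ae -kc kc' => ? ?; lra.
have [iT' _] := at_end_last iK ne; have [eN' _] := ee_blk iT'.
have := @cut_out (blk k).+1 0 iT' isT; rewrite addn0 mul1r => ck.
by rewrite E eN' ck.
Qed.

Lemma cut_diagram g g' : exists D : link_diagram R n, diagram_of D [set G U | U in [set U | inside U]] /\
  exists F G : set (plane R), [/\ F <> G, odd_sided_faces D = [set F; G],
    gon D (if g then 3 else 1)%N F & gon D (if g' then 3 else 1)%N G].
Proof.
have [k0 k01 gen] := crossings_tame; rewrite -trace_cut.
apply: (token_diagram T_gt0 ee_0 ee_T ee_S nb_lt nb_inj nb_next snK sp_prevK sn_end sn_next e0_surj e0_inj k01 gen (ys := ys)).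
- exact: edge_off.
- by move=> k _; apply: cut_ys; exact: mem_nth.
- exact: special_inj.
Qed.
End generic.

Lemma generic_diagram (R : realType) (n m : nat) (F : nat -> R -> space3 R) (th : R) (tk ver : seq R) :
  (0 < n)%N -> (0 < m)%N ->
  (forall c U, F c (U + m%:R) = F c U) ->
  (forall c (k : int) a, 0 <= a <= 1 ->
    F c (k%:~R + th + a) = (1 - a) *: F c (k%:~R + th) + a *: F c (k%:~R + th + 1)) ->
  (forall c (k : int), (c < n)%N -> (F c (k%:~R + th)).2 \in ver) ->
  (forall c (k : int), (c < n)%N -> (F c (k%:~R + th)).2 != (F c (k%:~R + th + 1)).2) ->
  (forall U U', inside n m U -> inside n m U' -> G m F U = G m F U' -> U = U') ->
  (forall U, U \in tk -> inside n m U) ->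
  (forall U U', inside n m U -> inside n m U' -> U' != U ->
    (G m F U').1.1 = (G m F U).1.1 -> (G m F U').2 = (G m F U).2 -> (G m F U').1.2 < (G m F U).1.2 ->
    U \in tk) ->
  (forall U, U \in tk -> U \notin bases R n m) ->
  (forall z z', z \in centers n m tk -> z' \in centers n m tk -> Y m F z = Y m F z' -> z = z') ->
  (forall z, z \in centers n m tk -> Y m F z \notin ver) ->
  forall g g', exists D : link_diagram R n, diagram_of D [set G m F U | U in [set U | inside n m U]] /\
  exists F G : set (plane R), [/\ F <> G, odd_sided_faces D = [set F; G],
    gon D (if g then 3 else 1)%N F & gon D (if g' then 3 else 1)%N G].
Proof.
move=> n0 m0 per aff verP slopeP Ginj tk_inside tkP tk_bases ci cv g g'.
have [eps eps0 [e32 h1 h2 h3]] := eps_exists m0 aff verP slopeP tk_inside ci cv.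
by apply: (cut_diagram n0 m0 per aff verP slopeP Ginj tk_inside tkP tk_bases cv eps0 e32 h1 h2 h3).
Qed.

(** * General position *)

Section thin.
Variable R : realType.

(** Finiteness in the form used to choose parameters: bad values are contained in a list, which can
    be avoided arbitrarily close to any point. *)
Definition thin (P : R -> Prop) := exists B : seq R, forall r, P r -> r \in B.

Lemma thin1 (P : R -> Prop) : (forall r r', P r -> P r' -> r = r') -> thin P.
Proof.
move=> H; have [[r Pr]|no] := pselect (exists r, P r); last by exists [::] => r Pr; case: no; exists r.
by exists [:: r] => r' Pr'; rewrite inE (H _ _ Pr' Pr).
Qed.

Lemma thin_or P Q : thin P -> thin Q -> thin (fun r => P r \/ Q r).
Proof. by move=> [B hB] [C hC]; exists (B ++ C) => r [/hB|/hC] h; rewrite mem_cat h ?orbT. Qed.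

Lemma thin_ex (I : finType) (P : I -> R -> Prop) : (forall i, thin (P i)) -> thin (fun r => exists i, P i r).
Proof.
move=> /choice[B hB]; exists (flatten [seq B i | i <- enum I]) => r [i Pr].
by apply/flattenP; exists (B i); [apply/mapP; exists i => //; rewrite mem_enum|exact: hB].
Qed.

Lemma thin_avoid P x e : thin P -> 0 < e -> exists r, `|r - x| <= e /\ ~ P r.
Proof.
move=> [B hB] e0.
suff [r r1 r2] : exists2 r, `|r - x| <= e & r \notin B.
  by exists r; split => // /hB; rewrite (negbTE r2).
pose f (i : nat) : R := x + e / i.+1%:R.
have fI : injective f.
  move=> i j /addrI /(mulfI (lt0r_neq0 e0)) /invr_inj /eqP; rewrite eqr_nat eqSS => /eqP //.
have : ~~ all (fun r => r \in B) [seq f i | i <- iota 0 (size B).+1].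
  apply/negP => /allP h; have := uniq_leq_size (s1 := [seq f i | i <- iota 0 (size B).+1]) (s2 := B).
  rewrite map_inj_uniq // iota_uniq size_map size_iota ltnn => /(_ isT h).
  by [].
move=> /allPn[r /mapP[i _ ->] fB]; exists (f i) => //.
rewrite /f addrAC subrr add0r ger0_norm ?divr_ge0 ?(ltW e0) // ler_pdivrMr // ler_peMr ?(ltW e0) // ler1n //.
Qed.

End thin.

Section planar.
Variable R : realType.
Implicit Types (p q c d e f : R * R).

Definition orient p q c := (q.1 - p.1) * (c.2 - p.2) - (c.1 - p.1) * (q.2 - p.2).

Lemma orient_swap p q c : orient q p c = - orient p q c.
Proof. by rewrite /orient; ring. Qed.
Lemma orient_rot p q c : orient q c p = orient p q c.
Proof. by rewrite /orient; ring. Qed.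

Lemma orient_line c d p : c.2 != d.2 -> orient c d p = 0 ->
  p.1 = c.1 + (d.1 - c.1) / (d.2 - c.2) * (p.2 - c.2).
Proof.
move=> cd; have cd' : d.2 - c.2 != 0 by rewrite subr_eq0 eq_sym.
rewrite /orient => h; apply: (mulIf cd'); rewrite mulrDl mulrAC divfK //; lra.
Qed.

(** Two lines through two distinct common points would coincide, but [e] is not on the line of [c]
    and [d]. *)
Lemma line_meet c d e f p p' : c.2 != d.2 -> e.2 != f.2 -> orient c d e != 0 ->
  orient c d p = 0 -> orient c d p' = 0 -> orient e f p = 0 -> orient e f p' = 0 -> p = p'.
Proof.
move=> cd ef cde /(orient_line cd) h1 /(orient_line cd) h2 /(orient_line ef) h3 /(orient_line ef) h4.
have cd' : d.2 - c.2 != 0 by rewrite subr_eq0 eq_sym.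
have dE : d.1 - c.1 = (d.1 - c.1) / (d.2 - c.2) * (d.2 - c.2) by rewrite divfK.
set m := (d.1 - c.1) / _ in h1 h2 dE; set k := _ / _ in h3 h4.
have [E|ne] := eqVneq p.2 p'.2.
  by case: p p' E h1 h2 {h3 h4} => [p1 p2] [q1 q2] /= -> -> ->.
have : (m - k) * (p.2 - p'.2) = 0 by lra.
move/eqP; rewrite mulf_eq0 !subr_eq0 (negbTE ne) orbF => /eqP mk.
case/eqP: cde; rewrite /orient dE; rewrite -mk in h3.
have -> : e.1 - c.1 = m * (e.2 - c.2) by lra.
ring.
Qed.

Section position.
Variables (W : finType) (y : W -> R).
Hypothesis yI : injective y.

Definition no_collinear (s : seq W) (x : W -> R) := forall a b c : W, uniq [:: a; b; c] -> all (mem s) [:: a; b; c] ->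
  orient (x a, y a) (x b, y b) (x c, y c) != 0.
Definition no_concurrent (s : seq W) (x : W -> R) := forall a b c d e f : W, uniq [:: a; b; c; d; e; f] ->
  all (mem s) [:: a; b; c; d; e; f] -> forall p,
  orient (x a, y a) (x b, y b) p = 0 -> orient (x c, y c) (x d, y d) p = 0 ->
  orient (x e, y e) (x f, y f) p = 0 -> False.

(* The vertices are placed one after the other, each on its own horizontal line,
   where finitely many positions are forbidden by the preceding vertices. *)
Lemma position_exists x0 eps (s : seq W) : 0 < eps -> uniq s -> exists x,
  [/\ forall k, `|x k - x0 k| <= eps, no_collinear s x & no_concurrent s x].
Proof.
move=> eps0; elim: s => [_|a s IH /= /andP[as' us]].
  exists x0; split; first by move=> k; rewrite subrr normr0 ltW.
    by move=> ? ? ? _ /=.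
  by move=> ? ? ? ? ? ? _ /=.
have [x [xe nc nn]] := IH us.
have y2 (b c : W) : b != c -> y b != y c by move=> bc; rewrite (inj_eq yI).
pose u k := (x k, y k).
(* [bad1] puts the new vertex on a line through two old ones; [bad2] makes its line to an old vertex
   pass through the meeting point of two other lines. *)
pose bad1 (i : W * W) (r : R) := [/\ uniq [:: i.1; i.2], all (mem s) [:: i.1; i.2] & orient (r, y a) (u i.1) (u i.2) = 0].
pose bad2 (i : W * W * W * W * W) (r : R) := let: (b, c, d, e, f) := i in
  [/\ uniq [:: b; c; d; e; f], all (mem s) [:: b; c; d; e; f] &
   exists p, [/\ orient (r, y a) (u b) p = 0, orient (u c) (u d) p = 0 & orient (u e) (u f) p = 0]].
have t1 i : thin (bad1 i).
  case: i => b c; apply: thin1 => r r' [/= h1 _ h2] [_ _ h3].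
  have bc : y b != y c by apply: y2; move: h1; rewrite inE andbT.
  have : (r - r') * (y b - y c) = 0 by move: h2 h3; rewrite /orient /=; lra.
  by move/eqP; rewrite mulf_eq0 !subr_eq0 (negbTE bc) orbF => /eqP.
have t2 i : thin (bad2 i).
  case: i => [[[[b c] d] e] f]; apply: thin1 => r r' [uu /= /and5P[bs cs ds es /andP[fs _]] [p [p1 p2 p3]]] [_ _ [p' [q1 q2 q3]]].
  have ncc (i j k : W) : uniq [:: i; j; k] -> i \in s -> j \in s -> k \in s -> orient (u i) (u j) (u k) != 0.
    by move=> h i1 i2 i3; apply: nc => //=; rewrite i1 i2 i3.
  have [cd ef cde cdb yab] : [/\ y c != y d, y e != y f, orient (u c) (u d) (u e) != 0, orient (u c) (u d) (u b) != 0 & y a != y b].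
    move: uu; rewrite /= !inE !negb_or => /and5P[/and4P[bc bd be bf] /and3P[cd ce cf] /andP[de df] ef _].
    split; [exact: y2|exact: y2|apply: ncc => //|apply: ncc => //|]; rewrite /= ?inE ?negb_or ?cd ?ce ?de ?andbT //=.
      by rewrite eq_sym bc eq_sym bd.
    by apply: y2; apply: contraNneq as' => ->.
  have pp := line_meet (c := u c) (d := u d) (e := u e) (f := u f) cd ef cde p2 q2 p3 q3.
  rewrite -pp in q1; have [E|ne] := eqVneq p.2 (y b).
    (* At the depth of [b] the meeting point would be [b] itself, which is not on the line of [c]
       and [d]. *)
    exfalso; suff : p = u b by move=> E'; move: cdb; rewrite -E' p2 eqxx.
    have : (y b - y a) * (x b - p.1) = 0 by move: p1; rewrite /orient /= E; lra.
    move/eqP; rewrite mulf_eq0 !subr_eq0 eq_sym (negbTE yab) /= => /eqP xE.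
    by rewrite /u xE -E; case: (p).
  have : (r - r') * (p.2 - y b) = 0 by move: p1 q1; rewrite /orient /=; lra.
  by move/eqP; rewrite mulf_eq0 !subr_eq0 (negbTE ne) orbF => /eqP.
have [r [re rn]] := thin_avoid (x0 a) (thin_or (thin_ex t1) (thin_ex t2)) eps0.
pose x' k := if k == a then r else x k.
have xa : x' a = r by rewrite /x' eqxx.
have xs k : k \in s -> x' k = x k by rewrite /x'; case: eqP => // -> h; move: as'; rewrite h.
have key1 (b c : W) : uniq [:: a; b; c] -> b \in s -> c \in s -> orient (x' a, y a) (x' b, y b) (x' c, y c) != 0.
  move=> uu bs cs; apply/eqP => h; apply: rn; left; exists (b, c); split.
  - by move: uu => /andP[].
  - by rewrite /= bs cs.
  - by rewrite -h xa !xs.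
have key2 (b c d e f : W) p : uniq [:: a; b; c; d; e; f] -> all (mem s) [:: b; c; d; e; f] ->
   orient (x' a, y a) (x' b, y b) p = 0 -> orient (x' c, y c) (x' d, y d) p = 0 ->
   orient (x' e, y e) (x' f, y f) p = 0 -> False.
  move=> uu ss; have /= /and5P[bs cs ds es /andP[fs _]] := ss; rewrite xa !xs // => h1 h2 h3.
  apply: rn; right; exists (b, c, d, e, f); split => //; last by exists p.
  by move: uu => /andP[].
exists x'; split.
- by move=> k; rewrite /x'; case: eqP => [->|].
- move=> b c d uu /= /and4P[]; rewrite !inE => bs cs ds _.
  have := uu; rewrite /= !inE !negb_or => /and3P[/andP[bc bd] cd _].
  have [E|bn] := eqVneq b a.
    subst b; rewrite eq_sym (negbTE bc) in cs; rewrite eq_sym (negbTE bd) in ds; exact: key1.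
  have [E|cn] := eqVneq c a.
    subst c; rewrite (negbTE bn) in bs; rewrite eq_sym (negbTE cd) in ds.
    by rewrite -orient_rot; apply: key1 => //; rewrite -(rot_uniq 2).
  have [E|dn] := eqVneq d a.
    subst d; rewrite (negbTE bn) in bs; rewrite (negbTE cn) in cs.
    by rewrite orient_rot; apply: key1 => //; rewrite -(rot_uniq 1).
  rewrite (negbTE bn) /= in bs; rewrite (negbTE cn) /= in cs; rewrite (negbTE dn) /= in ds.
  by rewrite !xs //; apply: nc => //=; rewrite bs cs ds.
move=> b c d e f g uu al p h1 h2 h3.
have [ain|an] := boolP (a \in [:: b; c; d; e; f; g]); last first.
  have ss : all (mem s) [:: b; c; d; e; f; g].
    apply/allP => k hk; have := allP al k hk; rewrite /= inE => /orP[/eqP E|//].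
    by move: an; rewrite -E hk.
  have /= /and5P[s1 s2 s3 s4 /and3P[s5 s6 _]] := ss.
  by apply: (nn b c d e f g uu ss p); rewrite -?xs.
have sw (i j : W) : orient (x' i, y i) (x' j, y j) p = 0 -> orient (x' j, y j) (x' i, y i) p = 0.
  by move=> h; rewrite orient_swap h oppr0.
(* By permuting the six points, every place of the new vertex is reduced to the first one. *)
have fin (b' c' d' e' f' g' : W) : perm_eq [:: b; c; d; e; f; g] [:: b'; c'; d'; e'; f'; g'] -> b' = a ->
   orient (x' b', y b') (x' c', y c') p = 0 -> orient (x' d', y d') (x' e', y e') p = 0 ->
   orient (x' f', y f') (x' g', y g') p = 0 -> False.
  move=> pe E; subst b'; have uu' : uniq [:: a; c'; d'; e'; f'; g'] by rewrite -(perm_uniq pe).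
  apply: key2 => //; apply/allP => k hk.
  have : k \in a :: s by apply: (allP al); rewrite (perm_mem pe) inE hk orbT.
  rewrite /= inE => /orP[/eqP E|//]; move: uu' => /= /andP[]; rewrite -E.
  by rewrite (_ : k \in _ = true).
move: ain; rewrite !inE => /orP[/eqP E|/orP[/eqP E|/orP[/eqP E|/orP[/eqP E|/orP[/eqP E|/eqP E]]]]].
- exact: (fin b c d e f g).
- by apply: (fin c b d e f g) => //; [apply/permP => q /=; ring|exact: sw].
- by apply: (fin d e b c f g) => //; apply/permP => q /=; ring.
- by apply: (fin e d b c f g) => //; [apply/permP => q /=; ring|exact: sw].
- by apply: (fin f g b c d e) => //; apply/permP => q /=; ring.
- by apply: (fin g f b c d e) => //; [apply/permP => q /=; ring|exact: sw].
Qed.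

End position.
End planar.

Section cyclic.
Variables (R : realType) (W : finType) (s : W -> W) (x y z : W -> R).
Hypotheses (yI : injective y) (s3 : forall k, uniq [:: k; s k; s (s k)]) (sI : injective s).
Hypotheses (nc : no_collinear y (enum W) x) (nn : no_concurrent y (enum W) x).
Let u k : R * R := (x k, y k).
Definition plan k (a : R) : R * R := ((1 - a) * x k + a * x (s k), (1 - a) * y k + a * y (s k)).

Let alln (l : seq W) : all (mem (enum W)) l.
Proof. by apply/allP => k _; rewrite /= mem_enum. Qed.

Let ncol a b c : uniq [:: a; b; c] -> orient (u a) (u b) (u c) != 0.
Proof. by move=> h; exact: nc. Qed.

Lemma plan_on k a : orient (u k) (u (s k)) (plan k a) = 0.
Proof. by rewrite /orient /plan /=; ring. Qed.

Lemma plan0 k : plan k 0 = u k.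
Proof. by rewrite /plan /u; congr (_, _); ring. Qed.

Lemma sne k : s k != k.
Proof. by have /= := s3 k; rewrite !inE negb_or eq_sym => /andP[/andP[]]. Qed.

Lemma plan_inj k a b : plan k a = plan k b -> a = b.
Proof.
move=> /(congr1 snd) /=; apply: affine_inj; rewrite (inj_eq yI) eq_sym; exact: sne.
Qed.

(** Three consecutive vertices are not collinear, so adjacent edges share only a vertex, which
    half-open edges count once. *)
Lemma coincide k l a b : 0 <= a < 1 -> 0 <= b < 1 -> plan k a = plan l b -> (k, a) != (l, b) ->
  uniq [:: k; s k; l; s l].
Proof.
move=> ha hb E ne.
have kl : k != l.
  by apply: contraNneq ne => kl; subst l; rewrite (plan_inj E).
have aux k' a' b' : 0 <= a' < 1 -> plan k' a' = plan (s k') b' -> False.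
  move=> /andP[_ a1] E'; have := ncol (s3 k'); apply/negP; rewrite negbK.
  have := plan_on (s k') b'; rewrite -E' /plan /orient /= => h.
  have : (1 - a') * orient (u k') (u (s k')) (u (s (s k'))) = 0 by rewrite /orient /=; lra.
  by move/eqP; rewrite mulf_eq0 subr_eq0 gt_eqF.
rewrite /= !inE !negb_or kl (inj_eq sI) kl /= !andbT -andbA; apply/and4P; split.
- by rewrite eq_sym sne.
- by apply/eqP => h; move: E; rewrite h => /esym E; exact: (aux l b a).
- by apply/eqP => h; move: E; rewrite -h; exact: (aux k a b).
- by rewrite eq_sym sne.
Qed.

Lemma off_vertex k a j : uniq [:: k; s k; j] -> plan k a != u j.
Proof.
by move=> h; apply: contraNneq (ncol h) => <-; rewrite plan_on.
Qed.

(** A vertex is an end of at most one of the two edges; it is not on the line of the other. *)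
Lemma crossing_off k l a b j : 0 <= a < 1 -> 0 <= b < 1 -> plan k a = plan l b -> (k, a) != (l, b) ->
  plan k a != u j.
Proof.
move=> ha hb E ne; have /= := coincide ha hb E ne; rewrite !inE !negb_or => /and4P[/and3P[h1 h2 h3] /andP[h4 h5] h6 _].
have [jk|jk] := boolP (j \in [:: k; s k]); last first.
  by apply: off_vertex; move: jk; rewrite /= !inE !negb_or h1 => /andP[p1 p2]; rewrite eq_sym p1 eq_sym p2.
rewrite E; apply: off_vertex; move: jk; rewrite /= !inE !negb_or h6 => /orP[] /eqP ->.
  by rewrite eq_sym h2 eq_sym h3.
by rewrite eq_sym h4 eq_sym h5.
Qed.

Lemma crossing_unique k l a b a' b' : uniq [:: k; s k; l; s l] ->
  plan k a = plan l b -> plan k a' = plan l b' -> a = a'.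
Proof.
move=> /= uu E E'; have := uu; rewrite !inE !negb_or => /and4P[/and3P[h1 h2 h3] /andP[h4 h5] h6 _].
have nl : orient (u k) (u (s k)) (u l) != 0 by apply: ncol; rewrite /= !inE !negb_or h1 h2 h4.
have y2 i : (u i).2 != (u (s i)).2 by rewrite /= (inj_eq yI) eq_sym sne.
apply/(@plan_inj k)/(line_meet (y2 k) (y2 l) nl) => //; first exact: plan_on.
- exact: plan_on.
- by rewrite E plan_on.
- by rewrite E' plan_on.
Qed.

(** The six ends of three edges which meet pairwise are distinct, so the three lines would
    contradict [nn]. *)
Lemma no_triple j k l a b c : 0 <= a < 1 -> 0 <= b < 1 -> 0 <= c < 1 -> plan j a = plan k b -> plan j a = plan l c ->
  (j, a) != (k, b) -> (j, a) != (l, c) -> (k, b) != (l, c) -> False.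
Proof.
move=> ha hb hc E1 E2 n1 n2 n3; have E3 : plan k b = plan l c by rewrite -E1.
have /= u1 := coincide ha hb E1 n1; have /= u2 := coincide ha hc E2 n2; have /= u3 := coincide hb hc E3 n3.
apply: (@nn j (s j) k (s k) l (s l) _ (alln _) (plan j a)).
- move: u1 u2 u3; rewrite /= !inE !negb_or.
  move=> /and4P[/and3P[-> -> ->] /andP[-> ->] -> _] /and4P[/and3P[_ -> ->] /andP[-> ->] -> _].
  by move=> /and4P[/and3P[_ -> ->] /andP[-> ->] _ _].
- exact: plan_on.
- by rewrite E1 plan_on.
- by rewrite E2 plan_on.
Qed.

(* A feature is a vertex or a crossing, seen in the plane. *)
Definition feature (i : W + W * W) (p : R * R) := match i with
  | inl k => p = u k
  | inr (k, l) => exists a b, [/\ 0 <= a < 1, 0 <= b < 1, (k, a) != (l, b), p = plan k a & p = plan l b]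
  end.

Lemma feature_unique i p q : feature i p -> feature i q -> p = q.
Proof.
case: i => [k -> -> //|[k l] [a [b [ha hb ne -> E]]] [a' [b' [_ _ _ -> E']]]].
by rewrite (crossing_unique (coincide ha hb E ne) E E').
Qed.

(** Each index describes at most one point, and two distinct points get the same depth for at most
    one slope. *)
Lemma shear_exists_features eps : 0 < eps -> exists c, `|c| <= eps /\
  forall i j p q, feature i p -> feature j q -> p.2 + c * p.1 = q.2 + c * q.1 -> p = q.
Proof.
move=> eps0.
pose bad (ij : (W + W * W) * (W + W * W)) (c : R) := exists p q, [/\ feature ij.1 p, feature ij.2 q,
   p != q & p.2 + c * p.1 = q.2 + c * q.1].
have tb ij : thin (bad ij).
  apply: thin1 => c c' [p [q [f1 f2 ne E]]] [p' [q' [f1' f2' _ E']]].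
  rewrite -(feature_unique f1 f1') -(feature_unique f2 f2') in E'.
  have : (c - c') * (p.1 - q.1) = 0 by lra.
  move/eqP; rewrite mulf_eq0 !subr_eq0 => /orP[/eqP //|/eqP h]; case/eqP: ne.
  by move: h E; case: p {E' f1 f1' f2 f2'} => p1 p2; case: q => q1 q2 /= -> /addIr ->.
have [c [ce cn]] := thin_avoid 0 (thin_ex tb) eps0; rewrite subr0 in ce.
exists c; split => // i j p q fp fq E; apply/eqP/negPn/negP => ne.
by apply: cn; exists (i, j), p, q.
Qed.

End cyclic.

(** * Running through polygons whose components have equally many edges *)

Section circular.
Variables (R : realType) (n' m' : nat).
Local Notation n := n'.+1.
Local Notation m := m'.+1.
Local Notation W := ('I_n * 'I_m)%type.

Definition next (k : W) : W := (k.1, ordS k.2).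
Definition corner_at (c : nat) (k : int) : W := (inord c, inord `|(k %% m)%Z|%N).

Lemma next_inj : injective next.
Proof.
move=> [i k] [j l] E; have /= E1 : i = j := congr1 fst E.
by have /(can_inj (@ordSK _)) E2 : ordS k = ordS l := congr1 snd E; rewrite E1 E2.
Qed.

Lemma node_lt (k : int) : (`|(k %% m)%Z| < m)%N.
Proof. by have := ltz_pmod k (isT : 0 < m%:Z); have := modz_ge0 k (isT : m%:Z != 0); clear; lia. Qed.

Lemma node_next c (k : int) : corner_at c (k + 1) = next (corner_at c k).
Proof.
congr (_, _); apply/val_inj; rewrite /= !inordK ?node_lt // -modzDml.
have := modz_ge0 k (isT : m%:Z != 0); case: (k %% m)%Z => // j _.
by rewrite -PoszD modz_nat /= addn1.
Qed.

Lemma node_period c (k : int) : corner_at c (k + m) = corner_at c k.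
Proof. by rewrite /corner_at modzDr. Qed.

Variable w : W -> space3 R.
Variable th : R.

(** The shift [th] puts vertices at the parameters [k + th], so that the base points, at multiples
    of [m], are interior to edges. *)
Definition kap c (U : R) : W := corner_at c (Num.floor (U - th)).
Definition fr (U : R) : R := U - th - (Num.floor (U - th))%:~R.
Definition run c U := pt next w (kap c U) (fr U).

Lemma fr01 U : 0 <= fr U < 1.
Proof. by have /andP[h1 h2] := floor_itv (U - th); rewrite intrD in h2; rewrite /fr; apply/andP; split; lra. Qed.

Lemma kapE c (k : int) a : 0 <= a < 1 -> kap c (k%:~R + th + a) = corner_at c k /\ fr (k%:~R + th + a) = a.
Proof.
move=> /andP[a0 a1]; have E : Num.floor (k%:~R + th + a - th) = k.
  by apply: floor_def; rewrite intrD; apply/andP; split; lra.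
by rewrite /kap /fr E; split => //; ring.
Qed.

Lemma decompose U : exists (k : int) a, 0 <= a < 1 /\ U = k%:~R + th + a.
Proof. by exists (Num.floor (U - th)), (fr U); split; [exact: fr01|rewrite /fr; ring]. Qed.

Lemma run_period c U : run c (U + m%:R) = run c U.
Proof.
have [k [a [ha ->]]] := decompose U; have [e1 e2] := kapE c k ha.
have -> : k%:~R + th + a + m%:R = (k + m)%:~R + th + a :> R by rewrite intrD -pmulrn; ring.
by have [e3 e4] := kapE c (k + m) ha; rewrite /run e1 e2 e3 e4 node_period.
Qed.

Lemma run_node c (k : int) : run c (k%:~R + th) = w (corner_at c k).
Proof.
have [e1 e2] := @kapE c k 0 ltac:(by rewrite lexx ltr01); rewrite addr0 in e1 e2.
by rewrite /run e1 e2 /pt subr0 scale1r scale0r addr0.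
Qed.

Lemma run_next c (k : int) : run c (k%:~R + th + 1) = w (next (corner_at c k)).
Proof.
by rewrite -node_next -run_node intrD; congr run; ring.
Qed.

Lemma run_affine c (k : int) a : 0 <= a <= 1 ->
  run c (k%:~R + th + a) = (1 - a) *: run c (k%:~R + th) + a *: run c (k%:~R + th + 1).
Proof.
move=> /andP[a0]; rewrite le_eqVlt => /orP[/eqP ->|a1].
  by rewrite subrr scale0r add0r scale1r.
have [e1 e2] := @kapE c k a ltac:(by rewrite a0 a1).
by rewrite {1}/run e1 e2 run_node run_next.
Qed.

Lemma par_inj U V : inside n m U -> inside n m V ->
  kap (comp m U) U = kap (comp m V) V -> fr U = fr V -> U = V.
Proof.
move=> hU hV [E1 E2] Ef.
have [u1 u2 u3] := compP (n := n) (isT : (0 < m)%N) hU; have [v1 v2 v3] := compP (n := n) (isT : (0 < m)%N) hV.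
have cc : comp m U = comp m V.
  by have := congr1 val E1; rewrite /= !inordK.
rewrite cc in u2 u3; move: (congr1 val E2); rewrite /= !inordK ?node_lt //.
rewrite /fr in Ef; move: Ef; move: (Num.floor (U - th)) (Num.floor (V - th)) => k l Ef /(congr1 Posz).
rewrite !gez0_abs ?modz_ge0 // => /eqP; rewrite eqz_mod_dvd => /dvdzP[q kl].
have UV : U - V = (q * m)%:~R by rewrite -kl intrB; lra.
suff q0 : q = 0 by move: UV; rewrite q0 mul0r; lra.
rewrite -natr1 in u3 v3; rewrite intrM -pmulrn in UV.
have m0 : 0 < (m%:R : R) by rewrite ltr0n.
have h1 : q%:~R < (1%:~R : R) by rewrite -(ltr_pM2r m0); lra.
have h2 : (-1)%:~R < (q%:~R : R) by rewrite -(ltr_pM2r m0) mulrNz; lra.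
by move: h1 h2; rewrite !ltr_int; clear; lia.
Qed.

Lemma par_surj (k : W) a : 0 < th < 1 -> 0 <= a < 1 -> exists U, [/\ inside n m U, kap (comp m U) U = k & fr U = a].
Proof.
move=> /andP[t0 t1] ha; case: k => i k; have /andP[a0 a1] := ha.
have k0 : 0 <= (k : nat)%:R :> R by [].
have km : (k : nat)%:R + 1 <= m%:R :> R by rewrite natr1 ler_nat.
have m0 : 0 < (m%:R : R) by rewrite ltr0n.
have nE c j : (c < n)%N -> corner_at c (k%:Z + m%:Z * j) = (inord c, k).
  by move=> _; rewrite /corner_at addrC [_%:Z * _]mulrC modzMDl modz_small ?ltz_nat ?ltn_ord // ?lez_nat // inord_val.
have fin V : 0 <= V < m%:R -> (exists j : int, V = (k%:Z + m%:Z * j)%:~R + th + a) ->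
   exists U, [/\ inside n m U, kap (comp m U) U = (i, k) & fr U = a].
  move=> /andP[V0 Vm] [j VE]; exists (i%:R * m%:R + V).
  have iE : i%:R * m%:R <= (i%:R * m%:R + V : R) < i.+1%:R * m%:R by rewrite -natr1; apply/andP; split; lra.
  have cE := compE (isT : (0 < m)%N) iE.
  have VE' : i%:R * m%:R + V = (k%:Z + m%:Z * (j + i%:Z))%:~R + th + a.
    by rewrite VE !(intrD, intrM) -!pmulrn; ring.
  have [e1 e2] := kapE i (k%:Z + m%:Z * (j + i%:Z)) ha.
  split; last by rewrite VE'.
    have /andP[h1 h2] := iE; rewrite /inside (le_trans _ h1) ?mulr_ge0 //=.
    by apply: lt_le_trans h2 _; rewrite ler_pM2r // ler_nat.
  by rewrite cE VE' e1 nE // inord_val.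
have [h|h] := ltP (k%:R + th + a) (m%:R : R).
  apply: (fin (k%:R + th + a)); first by apply/andP; split; lra.
  by exists 0; rewrite mulr0 addr0 -pmulrn.
apply: (fin (k%:R + th + a - m%:R)); first by apply/andP; split; lra.
by exists (-1); rewrite mulrN1 intrB -!pmulrn; ring.
Qed.

Hypothesis th01 : 0 < th < 1.
Hypothesis emb : embedded next w.
Hypothesis yI : injective (fun k => (w k).2).
Hypothesis nn : forall k, next k != k.
Definition over_on k (a : R) l := exists b, [/\ 0 <= b < 1, shadow next w k a = shadow next w l b & height next w l b < height next w k a].
Hypothesis over_vertex : forall k l j a, 0 <= a < 1 -> over_on k a l -> (pt next w k a).2 != (w j).2.
Hypothesis over_unique : forall k l a a', 0 <= a < 1 -> 0 <= a' < 1 -> over_on k a l -> over_on k a' l -> a = a'.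
Hypothesis over_inj : forall k l k' l' a a', 0 <= a < 1 -> 0 <= a' < 1 -> over_on k a l -> over_on k' a' l' ->
  (pt next w k a).2 = (pt next w k' a').2 -> k = k' /\ a = a'.
Hypothesis base_vertex : forall c j, (c < n)%N -> (run c 0).2 != (w j).2.
Hypothesis base_over : forall c k l a, (c < n)%N -> 0 <= a < 1 -> over_on k a l -> (run c 0).2 != (pt next w k a).2.
Hypothesis base_inj : forall c c', (c < n)%N -> (c' < n)%N -> (run c 0).2 = (run c' 0).2 -> c = c'.

Lemma circular_diagram g g' : exists D : link_diagram R n, diagram_of D (polygon_trace next w) /\
  exists F G : set (plane R), [/\ F <> G, odd_sided_faces D = [set F; G],
    gon D (if g then 3 else 1)%N F & gon D (if g' then 3 else 1)%N G].
Proof.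
pose K U := kap (comp m U) U.
have GE U : G m run U = pt next w (K U) (fr U) by [].
have -> : polygon_trace next w = [set G m run U | U in [set U | inside n m U]].
  apply/seteqP; split => [_ [[k a] /= /andP[a0 a1] <-]|_ [U UI <-]]; last first.
    by exists (K U, fr U) => //=; have /andP[-> /ltW] := fr01 U.
  have [a1'|a1'] := ltP a 1.
    have [U [UI E1 E2]] := par_surj k th01 (introT andP (conj a0 a1')).
    by exists U => //; rewrite GE /K E1 E2.
  have -> : a = 1 by apply/le_anti; rewrite a1 a1'.
  have [U [UI E1 E2]] := @par_surj (next k) 0 th01 ltac:(by rewrite lexx ltr01).
  exists U => //; rewrite GE /K E1 E2 /pt subrr [0 *: w k]scale0r add0r scale1r subr0 scale1r scale0r addr0 //.
have Ginj U V : inside n m U -> inside n m V -> G m run U = G m run V -> U = V.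
  move=> UI VI; rewrite !GE => /(embedded_lt nn emb (fr01 U) (fr01 V))[E1 E2]; exact: par_inj.
have [B hB] : thin (fun U => exists kl : W * W, [/\ inside n m U, K U = kl.1 & over_on kl.1 (fr U) kl.2]).
  apply: thin_ex => -[k l]; apply: thin1 => U V [UI UK Uo] [VI VK Vo]; apply: par_inj => //.
    by rewrite -!/(K _) UK VK.
  exact: over_unique (fr01 U) (fr01 V) Uo Vo.
(* The list [B] may contain more than the overcrossings; filtering keeps exactly these. *)
pose tk := [seq U <- B | `[< inside n m U /\ exists l, over_on (K U) (fr U) l >]].
have tkE U : U \in tk -> inside n m U /\ exists l, over_on (K U) (fr U) l.
  by rewrite mem_filter => /andP[/asboolP].
have YE U : Y m run U = (pt next w (K U) (fr U)).2 by [].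
have base c : (c < n)%N -> Y m run (c%:R * m%:R) = (run c 0).2.
  move=> cn; rewrite /Y /G (_ : comp m _ = c); first by rewrite -[X in run c X]add0r (perN run_period).
  by apply: compE => //; rewrite lexx ltr_pM2r ?ltr0n // ltr_nat ltnSn.
have baseP z : z \in bases R n m -> exists2 c, (c < n)%N & z = c%:R * m%:R.
  by move=> /mapP[c]; rewrite mem_iota add0n => /andP[_ cn] ->; exists c.
apply: (@generic_diagram R n m run th tk [seq (w k).2 | k <- enum {: W}] isT isT).
- exact: run_period.
- exact: run_affine.
- by move=> c k cn; rewrite run_node; apply/mapP; exists (corner_at c k); rewrite ?mem_enum.
- by move=> c k cn; rewrite run_node run_next (inj_eq yI) eq_sym.
- exact: Ginj.
- by move=> U /tkE[].
- move=> U V UI VI VU E1 E2 hlt; rewrite mem_filter.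
  have o : over_on (K U) (fr U) (K V) by exists (fr V); split; [exact: fr01|rewrite /shadow -!GE E1 E2|exact: hlt].
  apply/andP; split; first by apply/asboolP; split; [exact: UI|exists (K V); exact: o].
  by apply: hB; exists (K U, K V); split; [exact: UI|reflexivity|exact: o].
- move=> U /tkE[UI [l o]]; apply/negP => /baseP[c cn UE].
  by have := base_over cn (fr01 U) o; rewrite -YE -base // UE eqxx.
- move=> z z'; rewrite !mem_cat => /orP[/tkE[zI [l o]]|/baseP[c cn ->]] /orP[/tkE[zI' [l' o']]|/baseP[c' cn' ->]].
  + by rewrite !YE => /(over_inj (fr01 z) (fr01 z') o o')[E1 E2]; exact: par_inj.
  + by rewrite base // YE => E; have := base_over cn' (fr01 z) o; rewrite E eqxx.
  + by rewrite base // YE => E; have := base_over cn (fr01 z') o'; rewrite E eqxx.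
  + by rewrite !base // => /(base_inj cn cn') ->.
- move=> z; rewrite mem_cat => /orP[/tkE[zI [l o]]|/baseP[c cn ->]]; apply/negP => /mapP[k _].
    by rewrite YE => E; have := over_vertex k (fr01 z) o; rewrite E eqxx.
  by rewrite base // => E; have := base_vertex k cn; rewrite E eqxx.
Qed.

End circular.

(** * Perturbing a polygon into general position *)

Section perturbation.
Variables (R : realType) (n' m' : nat).
Local Notation n := n'.+1.
Local Notation m := m'.+1.
Local Notation W := ('I_n * 'I_m)%type.
Hypothesis m2 : (1 < m')%N.
Local Notation next := (@next n' m').

Lemma next3 (k : W) : uniq [:: k; next k; next (next k)].
Proof.
case: k => i k; rewrite /= !inE !xpair_eqE eqxx /= andbT negb_or -!val_eqE /=.
have := ltn_ord k; rewrite -!andbA; case: (ltngtP k.+1 m) => [h|//|h] _; rewrite ?h ?modnn ?(modn_small h).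
  case: (ltngtP k.+2 m) => [h'|//|h']; rewrite ?h' ?modnn ?(modn_small h') ?eqxx; first by rewrite ltn_eqF // ltn_eqF // ltn_eqF.
    by move: h m2; clear; lia.
  by move: h h' m2; clear; lia.
by rewrite (modn_small (_ : 1 < m)%N) //; move: h m2; clear; lia.
Qed.

Lemma next_neq (k : W) : next k != k.
Proof. by have /= := next3 k; rewrite !inE negb_or eq_sym => /andP[/andP[]]. Qed.

(** Two displaced points coincide only if their displacements differ by the original distance, while
    they differ by at most half of it; so this distance is 0. *)
Lemma small_perturbation_embedded (v : W -> space3 R) : embedded next v -> exists2 e, 0 < e & forall v',
  (forall k, `|v' k - v k| <= e) -> embedded next v' /\ ambient_isotopic (polygon_trace next v) (polygon_trace next v').
Proof.
move=> emb; have [C C0 HC] := displacement_bound_all emb; have [e e0 He] := small_perturbation emb.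
exists (Num.min e (2^-1 / C)); first by rewrite lt_min e0 divr_gt0.
move=> v' hv'; split; last by apply: He => k; apply: le_trans (hv' k) _; rewrite ge_min lexx.
move=> j k a b ha hb E; apply: (emb _ _ _ _ ha hb); apply/eqP; rewrite -subr_eq0 -normr_le0.
have := HC j k (fun k => v' k - v k) (2^-1 / C) (fun k => le_trans (hv' k) _) a b ha hb.
have -> : C * (2^-1 / C) = 2^-1 by field; rewrite gt_eqF.
have -> : pt next (fun k => v' k - v k) j a - pt next (fun k => v' k - v k) k b = - (pt next v j a - pt next v k b).
  have := E; rewrite /pt => E'; rewrite !scalerBr.
  rewrite (_ : _ - _ = ((1 - a) *: v' j + a *: v' (next j)) - ((1 - b) *: v' k + b *: v' (next k)) -
     (((1 - a) *: v j + a *: v (next j)) - ((1 - b) *: v k + b *: v (next k)))); last first.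
    by apply: sp_eq; rewrite /= /GRing.scale /=; ring.
  by rewrite E' subrr sub0r.
rewrite normrN => h; have : `|pt next v j a - pt next v k b| <= 2^-1 * `|pt next v j a - pt next v k b|.
  by apply: h; rewrite ge_min lexx orbT.
lra.
Qed.

(** Adding a multiple of an enumeration separates all values, with finitely many exceptional
    factors. *)
Lemma heights_exist (W' : finType) (y0 : W' -> R) e : 0 < e -> exists2 y, injective y & forall k, `|y k - y0 k| <= e.
Proof.
move=> e0; pose rk (k : W') : R := (enum_rank k)%:R.
have rI : injective rk by move=> k l /eqP; rewrite eqr_nat => /eqP /val_inj /enum_rank_inj.
pose bad (kl : W' * W') (t : R) := kl.1 != kl.2 /\ y0 kl.1 + t * rk kl.1 = y0 kl.2 + t * rk kl.2.
have tb kl : thin (bad kl).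
  apply: thin1 => t t' [ne E] [_ E']; have : (t - t') * (rk kl.1 - rk kl.2) = 0 by lra.
  by move/eqP; rewrite mulf_eq0 !subr_eq0 (inj_eq rI) (negbTE ne) orbF => /eqP.
pose M : R := 1 + \sum_k rk k.
have rkM k : 0 <= rk k <= M.
  rewrite ler0n /= /M (bigD1 k) //= addrCA lerDl addr_ge0 // sumr_ge0 // => i _; exact: ler0n.
have M0 : 0 < M by rewrite /M ltr_wpDr // sumr_ge0 // => i _; exact: ler0n.
have [t [te tn]] := thin_avoid 0 (thin_ex tb) (divr_gt0 e0 M0); rewrite subr0 in te.
exists (fun k => y0 k + t * rk k).
  by move=> k l E; apply/eqP/negPn/negP => ne; apply: tn; exists (k, l).
move=> k; rewrite addrAC subrr add0r normrM; have /andP[r0 rM] := rkM k; rewrite (ger0_norm r0).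
apply: le_trans (ler_pM (normr_ge0 _) r0 te rM) _; rewrite divfK // gt_eqF //.
Qed.

Lemma diagram_of_isotopic (n0 : nat) (D : link_diagram R n0) (L L' : set (space3 R)) :
  ambient_isotopic L L' -> diagram_of D L -> diagram_of D L'.
Proof. by move=> i [h [h1 h2 h3]]; exists h; split => //; exact: ambient_isotopic_trans h3 i. Qed.

(** Distinct depths are needed to place the vertices on their own horizontal lines. Once the
    projection is generic, a shear separates the depths of vertices and crossings, and [th] is left
    to give the base points depths of their own. *)
Lemma polygon_diagram (v : W -> space3 R) g g' : embedded next v ->
  exists D : link_diagram R n, diagram_of D (polygon_trace next v) /\
  exists F G : set (plane R), [/\ F <> G, odd_sided_faces D = [set F; G],
    gon D (if g then 3 else 1)%N F & gon D (if g' then 3 else 1)%N G].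
Proof.
move=> emb; have [eps eps0 Heps] := small_perturbation_embedded emb.
have e2 : 0 < eps / 2 by lra.
have [y yI ye] := heights_exist (fun k => (v k).2) e2.
have [x [xe nc nn]] := position_exists yI (fun k => (v k).1.1) eps0 (enum_uniq {: W}).
pose M : R := 1 + \sum_k `|x k|.
have xM k : `|x k| <= M by rewrite /M (bigD1 k) //= addrCA lerDl addr_ge0 // sumr_ge0.
have M0 : 0 < M by rewrite /M ltr_wpDr // sumr_ge0.
have [c [ce cP]] := shear_exists_features yI next3 (@next_inj n' m') nc (divr_gt0 e2 M0).
pose w (k : W) : space3 R := ((x k, (v k).1.2), y k + c * x k).
have wv k : `|w k - v k| <= eps.
  rewrite prod_norm_le /= xe subrr normr0 (ltW eps0) /=.
  rewrite (_ : _ - _ = (y k - (v k).2) + c * x k); last by ring.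
  have := ler_normD (y k - (v k).2) (c * x k); have := ye k.
  have := ler_pM (normr_ge0 _) (normr_ge0 _) ce (xM k); rewrite divfK ?gt_eqF // -normrM; lra.
have [embw iso] := Heps w wv.
suff [D [D1 D2]] : exists D : link_diagram R n, diagram_of D (polygon_trace next w) /\
  exists F G : set (plane R), [/\ F <> G, odd_sided_faces D = [set F; G],
    gon D (if g then 3 else 1)%N F & gon D (if g' then 3 else 1)%N G].
  by exists D; split => //; apply: diagram_of_isotopic D1; exact: ambient_isotopic_sym.
pose P := plan next x y.
have w1 k a : (pt next w k a).1.1 = (P k a).1 by rewrite /pt /P /plan /= /GRing.scale /=; ring.
have w2 k a : (pt next w k a).2 = (P k a).2 + c * (P k a).1 by rewrite /pt /P /plan /= /GRing.scale /=; ring.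
have shP k l a b : shadow next w k a = shadow next w l b -> P k a = P l b.
  move=> E; have E1 : (P k a).1 = (P l b).1 by rewrite -!w1; exact: (congr1 fst E).
  have E2 : (P k a).2 = (P l b).2.
    by apply: (addIr (c * (P k a).1)); rewrite {2}E1 -!w2; exact: (congr1 snd E).
  by rewrite [LHS]surjective_pairing [RHS]surjective_pairing E1 E2.
have ovne k a l b : height next w l b < height next w k a -> (k, a) != (l, b).
  by move=> h; apply/negP => /eqP [kl ab]; move: h; rewrite kl ab ltxx.
have ov k a l : 0 <= a < 1 -> over_on w k a l -> feature next x y (inr (k, l)) (P k a).
  by move=> ha [b [hb /shP E h]]; exists a, b; split => //; exact: (ovne).
have fv k : feature next x y (inl k) (P k 0) by rewrite /= /P plan0.
have wE k : (w k).2 = (P k 0).2 + c * (P k 0).1 by rewrite /P plan0.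
have ywI : injective (fun k => (w k).2).
  move=> k l; rewrite !wE => /(cP _ _ _ _ (fv k) (fv l)); rewrite /P !plan0 => /(congr1 snd) /=; exact: yI.
have voff k a l j : 0 <= a < 1 -> over_on w k a l -> (pt next w k a).2 != (w j).2.
  move=> ha o; apply/eqP; rewrite w2 wE => /(cP _ _ _ _ (ov _ _ _ ha o) (fv j)).
  case: o => b [hb /shP E /ovne ne]; apply/eqP; rewrite /P plan0; exact: (crossing_off yI next3 (@next_inj n' m') nc _ ha hb E ne).
(* Depth of the base point of the component [i], which lies on the edge from the last vertex back to
   the vertex 0. *)
pose ybase th (i : 'I_n) : R := th * (w (i, ord_max)).2 + (1 - th) * (w (i, ord0)).2.
have neq (i : 'I_n) : (w (i, ord_max)).2 - (w (i, ord0)).2 != 0.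
  rewrite subr_eq0 (inj_eq ywI) xpair_eqE eqxx /= -val_eqE /=; move: m2; clear; lia.
have affI (p q p' q' t t' : R) : q - q' != 0 -> t * p + (1 - t) * q = t * p' + (1 - t) * q' ->
    t' * p + (1 - t') * q = t' * p' + (1 - t') * q' -> t = t'.
  move=> d E E'; have : (t - t') * (q - q') = 0.
    have X : (t * ((p - p') - (q - q')) + (q - q')) = 0 by lra.
    have X' : (t' * ((p - p') - (q - q')) + (q - q')) = 0 by lra.
    have D0 : (t - t') * ((p - p') - (q - q')) = 0 by lra.
    move/eqP: D0; rewrite mulf_eq0 => /orP[/eqP ->|/eqP D0]; first by rewrite mul0r.
    by rewrite D0 mulr0 add0r in X; rewrite X mulr0.
  by move/eqP; rewrite mulf_eq0 (negbTE d) orbF subr_eq0 => /eqP.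
pose bad1 (i : 'I_n * (W + W * W)) th := exists p, feature next x y i.2 p /\ ybase th i.1 = p.2 + c * p.1.
pose bad2 (i : 'I_n * 'I_n) th := i.1 != i.2 /\ ybase th i.1 = ybase th i.2.
have t1 i : thin (bad1 i).
  apply: thin1 => t t' [p [fp E]] [p' [fp' E']].
  rewrite -(feature_unique yI next3 (@next_inj n' m') nc fp fp') in E'.
  have : (t - t') * ((w (i.1, ord_max)).2 - (w (i.1, ord0)).2) = 0 by move: E E'; rewrite /ybase; lra.
  by move/eqP; rewrite mulf_eq0 (negbTE (neq _)) orbF subr_eq0 => /eqP.
have t2 i : thin (bad2 i).
  apply: thin1 => t t' [ne E] [_ E']; apply: affI E E'.
  by rewrite subr_eq0 (inj_eq ywI) xpair_eqE (negbTE ne).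
have q4 : 0 < (4^-1 : R) by rewrite invr_gt0.
have [th [the thn]] := thin_avoid 2^-1 (thin_or (thin_ex t1) (thin_ex t2)) q4.
have th01 : 0 < th < 1 by move: the; rewrite ler_norml => /andP[]; lra.
have runE i : (i < n)%N -> (run w th i 0).2 = ybase th (inord i).
  move=> i_n; have hr : 0 <= 1 - th <= 1 by case/andP: th01 => *; apply/andP; split; lra.
  have := run_affine w th i (-1) hr.
  rewrite (_ : (-1)%:~R + th + (1 - th) = 0); last by rewrite mulrNz; ring.
  have e1 : corner_at n' m' i (-1) = (inord i, ord_max).
    congr (_, _); apply/val_inj; rewrite [LHS]inordK ?node_lt //.
    rewrite -modzDr (_ : -1 + m%:Z = m'%:Z); last by clear; lia.
    by rewrite modz_small // ltz_nat ltnSn andbT.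
  have e2' : corner_at n' m' i 0 = (inord i, ord0).
    by congr (_, _); apply/val_inj; rewrite [LHS]inordK ?node_lt // mod0z.
  move=> ->; rewrite run_node run_next -node_next addNr e1 e2' /ybase.
  by rewrite /= /GRing.scale /=; ring.
have bfeat (i : nat) f p : (i < n)%N -> feature next x y f p -> (run w th i 0).2 != p.2 + c * p.1.
  move=> i_n fp; rewrite runE //; apply/eqP => E; apply: thn; left.
  by exists (inord i, f), p.
apply: (@circular_diagram R n' m' w th) => //.
- exact: next_neq.
- move=> k l j a; exact: voff.
- move=> k l a a' ha ha' [b [hb /shP E /ovne ne]] [b' [_ /shP E' _]].
  exact: (crossing_unique yI next3 nc (coincide yI next3 (@next_inj n' m') nc ha hb E ne) E E').
- move=> k l k' l' a a' ha ha' o o'; rewrite !w2 => /(cP _ _ _ _ (ov _ _ _ ha o) (ov _ _ _ ha' o')) EP.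
  case: o o' => b [hb /shP E h] [b' [hb' /shP E' h']].
  suff /eqP [-> ->] : (k, a) == (k', a') by [].
  apply/negPn/negP => ne.
  have T := no_triple yI next3 (@next_inj n' m') nc nn.
  (* Otherwise three strands would pass through one point of the plane, or each of two strands would
     be above the other. *)
  have [E1|ne1] := eqVneq (k, a) (l', b'); last first.
    by apply: (T k k' l' a a' b' ha ha' hb' EP _ ne ne1 (ovne _ _ _ _ h')); rewrite -/P EP.
  have [E2|ne2] := eqVneq (k', a') (l, b); last first.
    by apply: (T k k' l a a' b ha ha' hb EP E ne (ovne _ _ _ _ h) ne2).
  by case: E1 E2 h h' => -> -> [-> ->] h /(lt_trans h); rewrite ltxx.
- by move=> i j i_n; rewrite wE; exact: bfeat.
- by move=> i k l a i_n ha o; rewrite w2; exact: (bfeat _ _ _ i_n (ov _ _ _ ha o)).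
- move=> i i' i_n i'_n; rewrite !runE // => E; apply/eqP/negPn/negP => ne; apply: thn; right.
  exists (inord i, inord i'); split => //=; apply: contraNneq ne => /(congr1 val); rewrite /= !inordK // => ->.
  by [].
Qed.

End perturbation.

(** * Polygons from tame links *)

Section periodic.
Variables (R : realType) (T : Type) (c : R -> T).
Hypothesis cp : forall r, c (r + 1) = c r.

Lemma periodic_int (k : int) r : c (r + k%:~R) = c r.
Proof.
have N (j : nat) r' : c (r' + j%:R) = c r'.
  by elim: j => [|j IH]; rewrite ?addr0 // -natr1 addrA cp.
case: k => j; first by rewrite -pmulrn.
rewrite -(N j.+1) NegzE mulrNz -pmulrn; congr c; ring.
Qed.

Lemma periodic_fundamental r : exists2 r', 0 <= r' < 1 & c r = c r'.
Proof.
exists (r - (Num.floor r)%:~R).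
  by have := floor_itv r; rewrite intrD => /andP[h1 h2]; apply/andP; split; lra.
by rewrite -[RHS](periodic_int (Num.floor r)) subrK.
Qed.
End periodic.

Section components.
Variables (R : realType) (n n' : nat) (g : 'I_n -> R -> space3 R) (g' : 'I_n' -> R -> space3 R).
Hypotheses (hg : link_parametrization g) (hg' : link_parametrization g').
Hypothesis gg' : trace g = trace g'.

Lemma component_unique i j r r' : g' i r = g' j r' -> i = j.
Proof.
move=> E; have [h1 h2] := hg'.
have [s hs Es] := periodic_fundamental (h1 i).2 r; have [s' hs' Es'] := periodic_fundamental (h1 j).2 r'.
apply/eqP/negPn/negP => ne; apply: (h2 (i, s) (j, s')); split => //=; last by rewrite -Es -Es'.
by case => ij _; move: ne; rewrite ij eqxx.
Qed.

Lemma component_closed j : closed (range (g' j)).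
Proof.
have [h1 _] := hg'; have [gc gp] := h1 j.
have -> : range (g' j) = g' j @` `[0, 1]%classic.
  apply/seteqP; split => [_ [r _ <-]|_ [r _ <-]]; last by exists r.
  have [r' /andP[r0 r1] ->] := periodic_fundamental gp r.
  by exists r' => //; rewrite /= in_itv /= r0 ltW.
apply: compact_closed; first exact: norm_hausdorff.
apply: continuous_compact; last exact: segment_compact.
exact: continuous_subspaceT.
Qed.

Lemma component_meet i r : exists j, range (g' j) (g i r).
Proof.
have : trace g (g i r) by exists i, r.
by rewrite gg' => -[j [r' E]]; exists j; exists r'.
Qed.

(** The components of [g'] are closed, disjoint and finitely many, so the one containing a point is
    locally constant along the curve [g i]. *)
Lemma component_sub i : exists j, range (g i) `<=` range (g' j).
Proof.
have [j hj] := component_meet i 0; exists j; have [h1 _] := hg; have [gc gp] := h1 i.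
suff H r : 0 <= r -> range (g' j) (g i r).
  move=> _ [r _ <-]; have [r' /andP[r0 _] ->] := periodic_fundamental gp r; exact: H.
move=> r0; apply: (@segment_constant R 0 r (fun r => range (g' j) (g i r))) => // q _.
have [j0 hj0] := component_meet i q.
pose D := \bigcup_(k in [set k | k != j0]) range (g' k).
have Dc : closed D by apply: closed_bigcup => [|k _]; [exact: finite_finset|exact: component_closed].
have uniq k k' p : range (g' k) p -> range (g' k') p -> k = k'.
  by move=> [s _ hs] [s' _ E]; apply: (@component_unique k k' s s'); rewrite hs.
have nD : (~` D) (g i q).
  by move=> [k /= /eqP kj hk]; apply: kj; exact: uniq hk hj0.
have : nbhs q (g i @^-1` ~` D).
  by apply: gc; apply: open_nbhs_nbhs; split => //; exact: closed_openC.
move=> /nbhs_ballP[e /= e0 He]; exists e => // q' _ qq'.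
have nD' : ~ D (g i q') by exact: (He q').
have only k : range (g' k) (g i q') -> k = j0.
  by move=> hk; apply: contra_notP nD' => /eqP kj; exists k.
split=> [hq|hq'].
  by have [k hk] := component_meet i q'; rewrite (uniq _ _ _ hq hj0) -(only k hk).
by rewrite (only j hq').
Qed.

End components.

(** Passing to the component containing a given one, and back again, is the identity. *)
Lemma components_le (R : realType) (n n' : nat) (g : 'I_n -> R -> space3 R) (g' : 'I_n' -> R -> space3 R) :
  link_parametrization g -> link_parametrization g' -> trace g = trace g' -> (n <= n')%N.
Proof.
move=> hg hg' E; have /choice[f hf] := component_sub hg hg' E.
have /choice[h hh] := component_sub hg' hg (esym E).
have fI : injective f.
  apply: (can_inj (g := h)) => i.
  have [|r _ /esym] := hh (f i) (g i 0); first by apply: hf; exists 0.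
  by move/(component_unique hg) => <-.
by have := leq_card f fI; rewrite !card_ord.
Qed.

Lemma homeomorphic_parametrization (R : realType) n (g : 'I_n -> R -> space3 R) (f : space3 R -> space3 R) :
  link_parametrization g -> homeomorphism f -> link_parametrization (fun i r => f (g i r)).
Proof.
move=> [h1 h2] [fc [f' [_ fK _]]]; split.
  move=> i; split; last by move=> s; rewrite (h1 i).2.
  by move=> x; apply: continuous_comp; [exact: (h1 i).1|exact: fc].
by move=> x y [c1 c2 c3 /(can_inj fK) c4]; exact: (h2 x y).
Qed.

(** Tameness provides a polygonal link with some number of components, which must be recovered from
    the link as a set of points. *)
Lemma component_count (R : realType) n n' (g : 'I_n' -> R -> space3 R) (L : set (space3 R)) :
  is_link n L -> link_parametrization g -> ambient_isotopic (trace g) L -> n' = n.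
Proof.
move=> [g0 h0 L0] hg [H [_ Hh _ HL]].
have h1 := homeomorphic_parametrization hg (Hh 1 ltac:(by rewrite ler01 lexx)).
have E : trace (fun i r => H (1, g i r)) = trace g0.
  rewrite -L0 -HL; apply/seteqP; split => [_ [i [r <-]]|_ [_ [i [r <-]] <-]].
    by exists (g i r) => //; exists i, r.
  by exists i, r.
by apply/eqP; rewrite eqn_leq (components_le h1 h0 E) (components_le h0 h1 (esym E)).
Qed.

Section pieces.
Variables (R : realType).

Definition pieces (m : nat) (f : R -> space3 R) := forall (k : nat) t, 0 <= t <= 1 ->
  f ((k%:R + t) / m%:R) = (1 - t) *: f (k%:R / m%:R) + t *: f (k.+1%:R / m%:R).

Lemma pieces_mul m q f : (0 < m)%N -> (0 < q)%N -> pieces m f -> pieces (q * m) f.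
Proof.
move=> m0 q0 H k t /andP[t0 t1].
have mR : m%:R != 0 :> R by rewrite pnatr_eq0 -lt0n.
have qR : q%:R != 0 :> R by rewrite pnatr_eq0 -lt0n.
have q0' : 0 < q%:R :> R by rewrite ltr0n.
have kE : k%:R = (k %/ q)%:R * q%:R + (k %% q)%:R :> R by rewrite -natrM -natrD -divn_eq.
have r1 : (k %% q)%:R + 1 <= q%:R :> R by rewrite natr1 ler_nat ltn_mod.
have r0 : 0 <= (k %% q)%:R :> R by [].
have P u : 0 <= u <= 1 -> f ((k%:R + u) / (q * m)%:R) =
   (1 - ((k %% q)%:R + u) / q%:R) *: f ((k %/ q)%:R / m%:R) + (((k %% q)%:R + u) / q%:R) *: f ((k %/ q).+1%:R / m%:R).
  move=> /andP[u0 u1]; rewrite -H; last first.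
    rewrite divr_ge0 ?(ltW q0') ?addr_ge0 //= ler_pdivrMr // mul1r; lra.
  by congr f; rewrite natrM kE; field; rewrite mR qR.
have := P 0 ltac:(by rewrite lexx ler01); have := P 1 ltac:(by rewrite lexx ler01).
rewrite !addr0 natr1 => -> ->; rewrite P ?t0 //.
by apply: sp_eq; rewrite /= /GRing.scale /=; field.
Qed.

(** A common multiple of the numbers of pieces serves all components at once; the factor 3 makes
    three consecutive vertices distinct in the cyclic order. *)
Lemma common_pieces n (g : 'I_n -> R -> space3 R) : (forall i, polygonal (g i)) ->
  exists2 m', (1 < m')%N & forall i, pieces m'.+1 (g i).
Proof.
move=> H; have /choice[m hm] i : exists m, (0 < m)%N /\ pieces m (g i).
  by have [m m0 hm] := H i; exists m.
pose M := (3 * \prod_i m i)%N.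
have M0 : (0 < \prod_i m i)%N by apply: prodn_gt0 => i; case: (hm i).
exists M.-1; first by rewrite /M; move: M0; clear; lia.
have -> : M.-1.+1 = M by rewrite prednK // muln_gt0.
move=> i; have [m0 pm] := hm i.
have -> : M = (3 * \prod_(j | j != i) m j * m i)%N by rewrite /M (bigD1 i) //= mulnA mulnAC.
apply: pieces_mul => //; rewrite muln_gt0 /=; apply: prodn_cond_gt0 => j _; by case: (hm j).
Qed.

Section closed_polygon.
Variables (n' m' : nat) (g : 'I_n'.+1 -> R -> space3 R).
Local Notation m := m'.+1.
Hypotheses (hg : link_parametrization g) (pg : forall i, pieces m (g i)).
Definition corners (k : 'I_n'.+1 * 'I_m) := g k.1 ((k.2 : nat)%:R / m%:R).

Lemma pt_corners k a : 0 <= a <= 1 ->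
  pt (@next n' m') corners k a = g k.1 (((k.2 : nat)%:R + a) / m%:R).
Proof.
move=> ha; rewrite pg // /pt /corners /=; congr (_ + _ *: _).
case: k => i k /=; have := ltn_ord k; rewrite leq_eqVlt => /orP[/eqP E|lt].
  rewrite E modnn mul0r divff ?pnatr_eq0 //.
  by have [_ gp] := hg.1 i; rewrite -[X in _ = g i X]add0r gp.
by rewrite modn_small.
Qed.

Lemma param_inj (k l : 'I_m) (a b : R) : 0 <= a < 1 -> 0 <= b < 1 ->
  ((k : nat)%:R + a) / m%:R = ((l : nat)%:R + b) / m%:R -> k = l /\ a = b.
Proof.
move=> /andP[a0 a1] /andP[b0 b1] /(mulIf (_ : m%:R^-1 != 0)) E.
have {}E : (k : nat)%:R + a = (l : nat)%:R + b by apply: E; rewrite invr_eq0 pnatr_eq0.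
suff kl : k = l by split => //; move: E; rewrite kl => /addrI.
apply/val_inj => /=; have [h|h|//] := ltngtP k l.
  have kl : (k : nat)%:R + 1 <= ((l : nat)%:R : R) by rewrite natr1 ler_nat.
  by exfalso; move: E a1 b0; lra.
have lk : (l : nat)%:R + 1 <= ((k : nat)%:R : R) by rewrite natr1 ler_nat.
by exfalso; move: E a0 b1; lra.
Qed.

Lemma param_in (k : 'I_m) (a : R) : 0 <= a < 1 -> 0 <= ((k : nat)%:R + a) / m%:R < 1.
Proof.
move=> /andP[a0 a1]; rewrite divr_ge0 ?addr_ge0 //= ltr_pdivrMr ?ltr0n // mul1r.
have : (k : nat)%:R + 1 <= m%:R :> R by rewrite natr1 ler_nat ltn_ord.
lra.
Qed.

Lemma corners_embedded : embedded (@next n' m') corners.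
Proof.
pose prev (k : 'I_n'.+1 * 'I_m) := (k.1, ord_pred k.2).
have nK : cancel (@next n' m') prev by move=> [i k]; rewrite /prev /next /= ordSK.
apply: (embedded_half nK) => j k a b ha hb.
have le1 (r : R) : 0 <= r < 1 -> 0 <= r <= 1 by move=> /andP[-> /ltW].
rewrite !pt_corners ?le1 // => E.
have [h|h] := pselect ((j.1, ((j.2 : nat)%:R + a) / m%:R) = (k.1, ((k.2 : nat)%:R + b) / m%:R)).
  have E1 := congr1 fst h; have /= /(param_inj ha hb)[E2 E3] := congr1 snd h.
  by split => //; rewrite [j]surjective_pairing [k]surjective_pairing E2; congr (_, _).
by case: (hg.2 _ _ (And4 (param_in _ ha : circles (_, _)) (param_in _ hb : circles (_, _)) h E)).
Qed.

Lemma corners_trace : polygon_trace (@next n' m') corners = trace g.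
Proof.
apply/seteqP; split => [_ [[k a] /= ha <-]|_ [i [r <-]]].
  by rewrite pt_corners //; exists k.1, (((k.2 : nat)%:R + a) / m%:R).
have [r' /andP[r0 r1] ->] := periodic_fundamental (hg.1 i).2 r.
have m0 : 0 < m%:R :> R by rewrite ltr0n.
have rm : 0 <= r' * m%:R by rewrite mulr_ge0 // ltW.
have /andP[t1 t2] := truncn_itv rm; set q := Num.truncn _ in t1 t2.
have qm : (q < m)%N.
  by rewrite -(ltr_nat R); apply: le_lt_trans t1 _; rewrite -[ltRHS]mul1r ltr_pM2r.
exists ((i, Ordinal qm), r' * m%:R - q%:R) => /=; first by rewrite -natr1 in t2; apply/andP; split; lra.
rewrite pt_corners /=; last by rewrite -natr1 in t2; apply/andP; split; lra.
by congr g; rewrite addrC subrK mulfK // gt_eqF.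
Qed.

End closed_polygon.
End pieces.

Lemma card_pair T (x y : T) : x <> y -> ([set x; y] #= `I_2)%card.
Proof.
move=> xy; pose f (b : bool) := if b then x else y.
have -> : [set x; y] = f @` [set b | b \in [set: bool]%SET].
  by apply/seteqP; split => [_ [->|->]|_ [[] _ <-]]; [exists true|exists false|left|right] => //=; rewrite inE.
rewrite -(_ : #|[set: bool]%SET| = 2%N); last by rewrite cardsT card_bool.
by apply: card_image_finset => -[] [] // _ _ // /esym.
Qed.

Theorem corollary1p6 (R : realType) (n : nat) (hn : (1 <= n)%N)
    (L : set (space3 R)) (hL : is_link n L) (hT : tame L) :
  (exists D : link_diagram R n,
     diagram_of D L /\ (odd_sided_faces D #= `I_2)%card) /\
  (forall a b : nat, a = 1%N \/ a = 3%N -> b = 1%N \/ b = 3%N ->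
     exists D : link_diagram R n, diagram_of D L /\
       exists F G : set (plane R),
         [/\ F <> G, odd_sided_faces D = [set F; G], gon D a F & gon D b G]).
Proof.
have H (a b : nat) : a = 1%N \/ a = 3%N -> b = 1%N \/ b = 3%N ->
     exists D : link_diagram R n, diagram_of D L /\
       exists F G : set (plane R),
         [/\ F <> G, odd_sided_faces D = [set F; G], gon D a F & gon D b G].
  move=> ha hb; have [n1 [g [hg /common_pieces[m' m2 pg] iso]]] := hT.
  have E := component_count hL hg iso; subst n1.
  case: n hn g hg pg iso {hL} => // n' _ g hg pg iso.
  have [D [D1 [F [G [FG od gF gG]]]]] := polygon_diagram m2 (a == 3)%N (b == 3)%N (corners_embedded hg pg).
  rewrite corners_trace // in D1; exists D; split; first exact: diagram_of_isotopic iso D1.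
  exists F, G; split => //.
    by case: ha gF => ->.
  by case: hb gG => ->.
split => //; have [D [D1 [F [G [FG od _ _]]]]] := H 1%N 1%N (or_introl erefl) (or_introl erefl).
by exists D; split => //; rewrite od; exact: card_pair.
Qed.
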